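(* Let $D$ be a bounded domain in $\mathbb R^d$ and let $c:D\to[0,\infty)$ be bounded and Borel measurable. Then there exists a bounded Borel measurable function $\chi:D\to(0,+\infty)$ such that for any open $V\Subset D$ there is a constant $C>0$ for which every non-negative supersolution $u$ of $(-A+c)f=0$ on $D$ satisfies $$\inf_{x\in V}u(x)\ge C\int_Vu\,\chi\,dx.$$
   Context: **Operator.** $Au=Lu+Su$, where $$Lu(x)=\tfrac12\sum_{i,j=1}^d q_{i,j}(x)\partial^2_{x_i,x_j}u(x)+\sum_{i=1}^d b_i(x)\partial_{x_i}u(x),$$ $$Su(x)=\int_{\mathbb R^d}\Big(u(x+y)-u(x)-\sum_{i=1}^d\frac{y_i\partial_{x_i}u(x)}{1+|y|^2}\Big)N(x,dy).$$ Standing assumptions: $q_{i,j},b_i:\mathbb R^d\to\mathbb R$ are bounded and Borel measurable; for every compact $K\subset\mathbb R^d$ there is $\gamma_K>0$ with $\gamma_K|\xi|^2\le\sum_{i,j}q_{i,j}(x)\xi_i\xi_j$ for $x\in K$, $\xi\in\mathbb R^d$; for each $x$, $N(x,\cdot)$ is a $\sigma$-finite Borel measure on $\mathbb R^d$, $x\mapsto N(x,B)$ is Borel for each Borel $B$, and $\sup_x\int\min\{1,|y|^2\}N(x,dy)<\infty$. For $D$ open and $u\in W^{2,p}_{\rm loc}(D)\cap C_b(\mathbb R^d)$ with $p>d$, $Au$ is defined a.e. in $D$ by these formulas. **Supersolution.** $u:\mathbb R^d\to\mathbb R$ is a supersolution of $(-A+c)f=0$ on $D$ if $u\in W^{2,p}_{\rm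 loc}(D)\cap C_b(\mathbb R^d)$ for some $p>d$ and $-Au(x)+c(x)u(x)\ge0$ for a.e. $x\in D$. **Notation.** A domain is an open connected set. $V\Subset D$ means $\bar V$ is compact and $\bar V\subset D$. *)

(* Defs.v *)
From HB Require Import structures.
From mathcomp Require Import all_boot all_order all_algebra.
From mathcomp Require Import all_classical all_reals all_analysis measurable_realfun.

Set Implicit Arguments.
Unset Strict Implicit.
Unset Printing Implicit Defensive.

Import Order.TTheory GRing.Theory Num.Theory.
Import numFieldNormedType.Exports.

Local Open Scope classical_set_scope.
Local Open Scope ring_scope.

(* R^d is 'rV[R]_d.  The library gives it the topology of the sup norm; its
   Borel sets and its Lebesgue measure are set up here. *)

Definition rV_display : measure_display.
Proof. by []. Qed.

Section borel_rV.
Variables (R : realType) (n : nat).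

Definition rV_borel : set (set 'rV[R]_n) := <<s @open 'rV[R]_n >>.

HB.instance Definition _ := @isMeasurable.Build rV_display 'rV[R]_n
  rV_borel (@sigma_algebra0 _ setT _) (@sigma_algebraC _ _)
  (@sigma_algebra_bigcup _ setT _).

End borel_rV.

Section measurability_rV.
Context (R : realType) (n : nat).

Lemma open_measurable_rV (A : set 'rV[R]_n) : open A -> measurable A.
Proof. by move=> oA; exact: sub_sigma_algebra. Qed.

Lemma continuous_measurable_rV (f : 'rV[R]_n -> R) :
  continuous f -> measurable_fun setT f.
Proof.
move=> cf; apply: (measurability _ (RGenOpens.measurableE R)) => _ [_ [a [b ->]] <-].
rewrite setTI; apply: open_measurable_rV.
by move/continuousP: cf; apply; exact: interval_open.
Qed.

Lemma continuous_measurable_rV_rV m (f : 'rV[R]_n -> 'rV[R]_m) :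
  continuous f -> measurable_fun setT f.
Proof.
move=> cf; apply: (measurability (@open 'rV[R]_m) erefl) => _ [A oA <-].
by rewrite setTI; apply: open_measurable_rV; move/continuousP: cf; exact.
Qed.

Lemma measurable_fun_rV d (T : measurableType d) (f : T -> 'rV[R]_n) :
  (forall i, measurable_fun setT (fun x => f x ord0 i)) -> measurable_fun setT f.
Proof.
move=> mf; apply: (measurability (@open 'rV[R]_n) erefl) => _ [A oA <-].
rewrite setTI.
pose box (p : 'rV[rat]_n * rat) : set 'rV[R]_n :=
  [set v | forall i, `|v ord0 i - ratr (p.1 ord0 i)| < ratr p.2].
have -> : A = \bigcup_(p in [set p | box p `<=` A]) box p.
  apply/seteqP; split => [v Av|v [p pA pv]]; last exact: pA.
  have /nbhs_ballP[e /= e0 eA] : nbhs v A by exact: open_nbhs_nbhs.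
  have [r] := @rat_in_itvoo R 0 (e / 2) (divr_gt0 e0 (ltr0Sn _ 1)).
  rewrite in_itv/= => /andP[r0 re].
  have q_ i : {q : rat | `|v ord0 i - ratr q| < ratr r}.
    have lt_v : v ord0 i < v ord0 i + ratr r by rewrite ltrDl.
    apply: cid; have [q] := rat_in_itvoo lt_v.
    rewrite in_itv/= => /andP[vq qv]; exists q.
    by rewrite ltr_distlC ltrBlDr qv/= (lt_trans vq)// ltrDl.
  exists (\row_i sval (q_ i), r) => /=; last first.
    by move=> i /=; rewrite mxE; exact: (svalP (q_ i)).
  move=> w /= bw; apply: eA; split => // i j; rewrite (ord1 i).
  rewrite /ball/= (splitr e); apply: (le_lt_trans (ler_distD (ratr (sval (q_ j))) _ _)).
  apply: ltrD; first by rewrite (lt_trans (svalP (q_ j))).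
  by rewrite distrC; have := bw j; rewrite mxE => /lt_trans; exact.
rewrite preimage_bigcup bigcup_mkcond.
apply: countable_bigcupT_measurable => // p; case: ifP => // _.
have -> : f @^-1` box p = \bigcap_(i in [set: 'I_n])
    (fun x => f x ord0 i) @^-1` [set t | `|t - ratr (p.1 ord0 i)| < ratr p.2].
  by apply/seteqP; split => [x h i _|x h i]; [exact: h | exact: (h i)].
apply: fin_bigcap_measurable; first exact: finite_finset.
move=> i _; rewrite -[X in measurable X]setTI; apply: (mf i) => //.
rewrite (_ : [set t | _] = ball (ratr (p.1 ord0 i) : R) (ratr p.2 : R)); first exact: measurable_ball.
by apply/seteqP; split => t /=; rewrite /ball/= distrC.
Qed.

End measurability_rV.

(* Lebesgue measure on R^n.+1 is the image of the product of the Lebesgue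
   measures on R and on R^n under (t, v) |-> (t, v_0, ..., v_{n-1}). *)
Section lebesgue_rV.
Variable R : realType.

Definition rV_cons n (p : R * 'rV[R]_n) : 'rV[R]_n.+1 :=
  \row_i oapp (p.2 ord0) p.1 (unlift ord0 i).

Definition rV_uncons n (v : 'rV[R]_n.+1) : R * 'rV[R]_n :=
  (v ord0 ord0, \row_i v ord0 (lift ord0 i)).

Lemma rV_consK n : cancel (@rV_cons n) (@rV_uncons n).
Proof.
move=> [t v]; rewrite /rV_uncons /rV_cons mxE unlift_none/=; congr pair.
by apply/rowP => i; rewrite !mxE liftK.
Qed.

Lemma rV_unconsK n : cancel (@rV_uncons n) (@rV_cons n).
Proof.
move=> v; apply/rowP => i; rewrite mxE /=.
by case: unliftP => [j|] ->; rewrite /= ?mxE.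
Qed.

Lemma measurable_rV_coord n i : measurable_fun setT (fun v : 'rV[R]_n => v ord0 i).
Proof. exact: continuous_measurable_rV (@coord_continuous _ _ _ _ _). Qed.

Lemma measurable_rV_cons n : measurable_fun setT (@rV_cons n).
Proof.
apply: measurable_fun_rV => i; rewrite /rV_cons.
under eq_fun do rewrite mxE.
case: (unlift ord0 i) => [j|] /=; last exact: measurable_fst.
by apply: (measurableT_comp (measurable_rV_coord j)); exact: measurable_snd.
Qed.

Lemma measurable_rV_uncons n : measurable_fun setT (@rV_uncons n).
Proof.
apply: measurable_fun_pair; first exact: measurable_rV_coord.
apply: measurable_fun_rV => i.
by under eq_fun do rewrite mxE; exact: measurable_rV_coord.
Qed.

Section step.
Variables (n : nat) (mu : {sigma_finite_measure set 'rV[R]_n -> \bar R}).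

Definition lebesgue_rV_step : set 'rV[R]_n.+1 -> \bar R :=
  pushforward (lebesgue_measure \x mu)%E (@rV_cons n).

Let step0 : lebesgue_rV_step set0 = 0%E.
Proof. by rewrite /lebesgue_rV_step /pushforward preimage_set0 measure0. Qed.

Let step_ge0 A : (0 <= lebesgue_rV_step A)%E.
Proof. by rewrite /lebesgue_rV_step /pushforward measure_ge0. Qed.

Let step_sigma_additive : semi_sigma_additive lebesgue_rV_step.
Proof.
move=> F mF tF mUF; rewrite /lebesgue_rV_step /pushforward preimage_bigcup.
have mpre A : measurable A -> measurable (@rV_cons n @^-1` A).
  by move=> mA; rewrite -[X in measurable X]setTI; exact: measurable_rV_cons.
apply: measure_semi_sigma_additive => [k||].
- exact: mpre.
- apply/trivIsetP => /= i j _ _ ij; rewrite -preimage_setI.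
  by move/trivIsetP : tF => /(_ _ _ _ _ ij) ->//; rewrite preimage_set0.
- by rewrite -preimage_bigcup; exact: mpre.
Qed.

HB.instance Definition _ := isMeasure.Build _ _ _ lebesgue_rV_step
  step0 step_ge0 step_sigma_additive.

Let step_sigma_finite : sigma_finite setT lebesgue_rV_step.
Proof.
have /sigma_finiteP[F [TF ndF Foo]] := sigma_finiteT (@lebesgue_measure R).
have /sigma_finiteP[G [TG ndG Goo]] := sigma_finiteT mu.
exists (fun k => @rV_uncons n @^-1` (F k `*` G k)).
  rewrite -preimage_bigcup (_ : \bigcup_i _ = setT) ?preimage_setT//.
  rewrite -setXTT TF TG predeqE => -[x y]; split.
    by move=> [l _ []/= ? ?]; split; exists l.
  move=> [/= [i _ Fx] [j _ Gy]]; exists (maxn i j) => //; split.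
    by move: x Fx; exact/subsetPset/ndF/leq_maxl.
  by move: y Gy; exact/subsetPset/ndG/leq_maxr.
move=> k; have [mF Fk] := Foo k; have [mG Gk] := Goo k; split.
  by rewrite -[X in measurable X]setTI; apply: measurable_rV_uncons => //; exact: measurableX.
rewrite /lebesgue_rV_step /pushforward.
rewrite (_ : _ @^-1` _ = F k `*` G k); last first.
  by rewrite predeqE => x; rewrite /preimage /mkset rV_consK.
by rewrite product_measure1E// lte_mul_pinfty// ge0_fin_numE.
Qed.

HB.instance Definition _ := Measure_isSigmaFinite.Build _ _ _ lebesgue_rV_step
  step_sigma_finite.

End step.

Fixpoint lebesgue_rV n : {sigma_finite_measure set 'rV[R]_n -> \bar R} :=
  if n is n'.+1 then lebesgue_rV_step (lebesgue_rV n')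
  else \d_ (0 : 'rV[R]_0).

Lemma lebesgue_rV_box n (I : 'I_n -> set R) : (forall i, measurable (I i)) ->
  lebesgue_rV n [set v | forall i, I i (v ord0 i)] =
  (\prod_(i < n) lebesgue_measure (I i))%E.
Proof.
elim: n I => [|n IHn] I mI.
  by rewrite big_ord0 /= diracE mem_set//; case.
pose B := [set v : 'rV[R]_n | forall i, I (lift ord0 i) (v ord0 i)].
rewrite big_ord_recl -(IHn (fun i => I (lift ord0 i)))// -/B.
have mB : measurable B.
  rewrite (_ : B = \bigcap_(i in [set: 'I_n])
      (fun v : 'rV[R]_n => v ord0 i) @^-1` I (lift ord0 i)).
    apply: fin_bigcap_measurable; first exact: finite_finset.
    by move=> i _; rewrite -[X in measurable X]setTI; exact: measurable_rV_coord.
  by apply/seteqP; split => [x h i _|x h i]; [exact: h | exact: (h i)].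
have E : @rV_cons n @^-1` [set v | forall i, I i (v ord0 i)] = I ord0 `*` B.
  apply/seteqP; split => [[t v]|[t v] [/= It Iv] i] /=; last first.
    by rewrite mxE; case: unliftP => [j|] ->.
  move=> h; split => [|i] /=.
    by have := h ord0; rewrite mxE unlift_none.
  by have := h (lift ord0 i); rewrite mxE liftK.
transitivity ((lebesgue_measure \x lebesgue_rV n)%E (I ord0 `*` B)).
  by rewrite -E.
exact: (@product_measure1E _ _ _ _ _ (@lebesgue_measure R) (lebesgue_rV n) _ _ (mI ord0) mB).
Qed.

End lebesgue_rV.

Section sobolev.
Variables (R : realType) (n : nat).
Implicit Types (D : set 'rV[R]_n) (f : 'rV[R]_n -> R).
Local Notation mu := (lebesgue_rV R n).

Definition unit_vec (i : 'I_n) : 'rV[R]_n := delta_mx ord0 i.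

Definition partial (i : 'I_n) f : 'rV[R]_n -> R := 'D_(unit_vec i) f.

Definition iter_partial (s : seq 'I_n) f : 'rV[R]_n -> R := foldr partial f s.

Definition smooth f : Prop := forall s : seq 'I_n,
  continuous (iter_partial s f) /\
  forall (i : 'I_n) (x : 'rV[R]_n), derivable (iter_partial s f) x (unit_vec i).

Definition test_function D f : Prop :=
  [/\ smooth f, compact (closure [set x | f x != 0]) &
      closure [set x | f x != 0] `<=` D].

Definition Lp_loc (p : R) D f : Prop :=
  measurable_fun D f /\
  forall K : set 'rV[R]_n, compact K -> K `<=` D ->
    ('N[mu]_p%:E [EFin \o f \_ K] < +oo)%E.

Definition weak_partial D (i : 'I_n) f g : Prop :=
  forall phi, test_function D phi ->
    \int[mu]_(x in D) (f x * partial i phi x) =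
    - \int[mu]_(x in D) (g x * phi x).

(* Weak derivatives are determined up to null sets: Du and D2u are versions
   of the weak gradient and of the weak Hessian of u. *)
Definition W2p_loc (p : R) D f (Du : 'I_n -> 'rV[R]_n -> R)
    (D2u : 'I_n -> 'I_n -> 'rV[R]_n -> R) : Prop :=
  [/\ Lp_loc p D f,
      forall i, Lp_loc p D (Du i) /\ weak_partial D i f (Du i) &
      forall i j, Lp_loc p D (D2u i j) /\ weak_partial D j (Du i) (D2u i j)].

End sobolev.

Section operator.
Variables (R : realType) (n : nat).
Local Notation mu := (lebesgue_rV R n).

(* square of the Euclidean norm; `|y| is the sup norm *)
Definition sqnorm (y : 'rV[R]_n) : R := \sum_(i < n) y ord0 i ^+ 2.

Variables (q : 'rV[R]_n -> 'M[R]_n) (b : 'rV[R]_n -> 'rV[R]_n).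
Variable N : R.-sigmafker 'rV[R]_n ~> 'rV[R]_n.

Definition operator_assumptions : Prop :=
  [/\ (forall i j, measurable_fun setT (fun x => q x i j)) /\
        (exists M : R, forall x i j, `|q x i j| <= M),
      (forall i, measurable_fun setT (fun x => b x ord0 i)) /\
        (exists M : R, forall x i, `|b x ord0 i| <= M),
      forall K : set 'rV[R]_n, compact K ->
        exists2 gamma : R, 0 < gamma & forall x (xi : 'rV[R]_n), K x ->
          gamma * sqnorm xi <=
          \sum_(i < n) \sum_(j < n) q x i j * xi ord0 i * xi ord0 j &
      exists M : R, forall x,
        (\int[N x]_y (Num.min 1 (sqnorm y))%:E <= M%:E)%E].

Section values.
Variables (u : 'rV[R]_n -> R) (Du : 'I_n -> 'rV[R]_n -> R).
Variables (D2u : 'I_n -> 'I_n -> 'rV[R]_n -> R).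

Definition opL (x : 'rV[R]_n) : R :=
  2^-1 * (\sum_(i < n) \sum_(j < n) q x i j * D2u i j x) +
  \sum_(i < n) b x ord0 i * Du i x.

Definition opS (x : 'rV[R]_n) : R :=
  \int[N x]_y (u (x + y) - u x -
    \sum_(i < n) y ord0 i * Du i x / (1 + sqnorm y)).

Definition opA (x : 'rV[R]_n) : R := opL x + opS x.

End values.

Definition supersolution (c : 'rV[R]_n -> R) (D : set 'rV[R]_n)
    (u : 'rV[R]_n -> R) : Prop :=
  [/\ continuous u, exists M : R, forall x, `|u x| <= M &
      exists p : R, exists Du : 'I_n -> 'rV[R]_n -> R,
      exists D2u : 'I_n -> 'I_n -> 'rV[R]_n -> R,
      [/\ n%:R < p, W2p_loc p D u Du D2u &
          {ae mu, forall x, D x -> 0 <= - opA u Du D2u x + c x * u x}]].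

End operator.

(* Main.v *)
Require Import Defs.
From HB Require Import structures.
From mathcomp Require Import all_boot all_order all_algebra.
From mathcomp Require Import all_classical all_reals all_analysis measurable_realfun.
From mathcomp Require Import ring lra.

(** The non-negative supersolutions on D form a cone S with two properties,
    and these imply the theorem.

    The first is closure under sums ([supercone_lin]). It is not formal: the
    integral in the operator is additive only where its integrand is integrable.
    This holds almost everywhere because a supersolution has a second-order
    expansion at almost every point of D ([two_sided_ae]).

    The second is the spreading of positivity ([spread_compact]): for A in D
    measurable of positive measure and K in D compact there are e, t > 0 such
    that every u in S with mu(A and u <= 1) < e satisfies u >= t on K.

    From the cone to the weight ([cone_weight]). Fix a small ball B0 in D. The
    convex hull of the functions u / c with u in S and u < c somewhere in B0 is
    bounded in measure: otherwise some member of S would be bounded at a point of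
    B0 and arbitrarily large on most of a set of positive measure, against
    spreading ([hull_bounded]). For a convex set of non-negative functions v that
    is bounded in measure, let h be the limit of 1 / (1 + v) along a sequence that
    minimises its integral; h is positive almost everywhere, and the first-order
    condition at the minimum bounds the integral of v h^2 by mu(D) for every v in
    the set ([numeraire]). Hence chi = h^2 satisfies: the integral of u chi over D is at
    most c mu(D) whenever u < c at some point of B0. Finally, if u is small
    somewhere in V, then by spreading from B0 to the closure of V it is
    comparably small somewhere in B0, and the theorem follows.

    Spreading is local growth followed by chaining. For growth ([growth]), let
    u in S be small at a point of the ball of radius r / 2 about x0, and consider
    u - psi - p.x, where psi is a Gaussian barrier that vanishes on the sphere of
    radius r and |p| <= eta / r. For every such p the minimum is attained inside
    the ball. The touching lemma ([touching]) bounds the volume of the set of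
    these slopes by the integral of (C / r^2 + |D^2 u|)^n over the set of contact
    points. At a contact point the equation, whose jump part is bounded below
    because u - psi - p.x is minimal there ([jump_lower]), forces u <= 1, places
    the point in the ball of radius r / 4, and bounds D^2 u by C / r^2
    ([contact_pde], [contact_bounds]). So the set where u <= 1 occupies a fixed
    fraction of the ball of radius r / 4. Read backwards: if u > 1 on most of
    that ball, then u >= m on the ball of radius r / 2. This starts at a density
    point of A ([seed]), doubles radii inside D ([propagate]), and extends to
    compact sets since D is connected.

    The touching lemma rests on mollification. For a mollified function the
    gradient maps the contact set onto the set of slopes, and a grid argument
    ([area_grid]) bounds the volume of that image. The n-th powers of the
    mollified Hessians are dominated, by Jensen's inequality, by an integrable
    function ([local_approx]), so the estimate passes to the limit. The same lemma
    with paraboloids of larger and larger opening gives the second-order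
    expansions ([second_order_local]). *)

Set Implicit Arguments.
Unset Strict Implicit.
Unset Printing Implicit Defensive.

Import Order.TTheory GRing.Theory Num.Theory.
Import numFieldNormedType.Exports.

Local Open Scope classical_set_scope.
Local Open Scope ring_scope.

(** * Almost everywhere convergence *)

Section summable.
Context d (T : measurableType d) (R : realType).
Variable mu : {measure set T -> \bar R}.

(** The series of the g n has a finite integral, hence a finite sum G almost
    everywhere. *)
Lemma summable_ae_dominated (D : set T) (g : nat -> T -> R) (M : R) :
  measurable D -> (forall n, measurable_fun D (g n)) ->
  (forall n x, D x -> 0 <= g n x) ->
  (forall n, (\int[mu]_(x in D) (g n x)%:E <= (M * 2^-1 ^+ n)%:E)%E) ->
  exists G : T -> R, [/\ mu.-integrable D (EFin \o G) &
    {ae mu, forall x, D x -> [/\ forall n, g n x <= G x,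
       cvgn (series (g ^~ x)) & g n x @[n --> \oo] --> 0]}].
Proof.
move=> mD mg g0 gM.
pose Gb x := (\sum_(0 <= n <oo) (g n x)%:E)%E.
have mgE n : measurable_fun D (EFin \o g n) by exact/measurable_EFinP.
have mGb : measurable_fun D Gb.
  apply: ge0_emeasurable_sum => [k x Dx _|k _]; last exact: mgE.
  by rewrite lee_fin g0.
have Gb0 x : D x -> (0 <= Gb x)%E.
  by move=> Dx; apply: nneseries_ge0 => n _ _; rewrite lee_fin g0.
have iGb : (\int[mu]_(x in D) Gb x <= (M * 2)%:E)%E.
  rewrite integral_nneseries//.
  apply: (@le_trans _ _ (\sum_(0 <= n <oo) (M * 2^-1 ^+ n)%:E)%E).
    apply: lee_nneseries => // n _ _.
    by apply: integral_ge0 => x Dx; rewrite lee_fin g0.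
  rewrite le_eqVlt; apply/orP; left; apply/eqP; apply: cvg_lim => //.
  rewrite (_ : (fun _ => _) = EFin \o series (geometric M (2^-1))); last first.
    by apply/funext => n /=; rewrite /series/= sumEFin.
  apply: cvg_EFin; first exact: nearW.
  rewrite (_ : M * 2 = M * (1 - 2^-1)^-1); last by congr (_ * _); field.
  by apply: cvg_geometric_series; rewrite ger0_norm ?invf_lt1// ?invr_ge0// ltr1n.
have intGb : mu.-integrable D Gb.
  apply/integrableP; split => //.
  rewrite (eq_integral Gb); first by rewrite (le_lt_trans iGb)// ltry.
  by move=> x; rewrite inE => Dx; rewrite gee0_abs// Gb0.
have aeG := integrable_ae mD intGb.
exists (fine \o Gb); split.
  have : mu.-integrable D (Gb) := intGb.
  move=> /integrableP[_ h]; apply/integrableP; split.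
    apply/measurable_EFinP; exact: measurableT_comp.
  apply: le_lt_trans h; apply: ge0_le_integral => //=.
  - apply/measurable_EFinP; apply: measurableT_comp => //; exact: measurableT_comp.
  - exact: measurableT_comp.
  - move=> x Dx; have := Gb0 x Dx; case: (Gb x) => //= *; by rewrite ?normr0 ?leey.
apply: filterS aeG => x /[swap] Dx /(_ Dx) fGb.
have leG n : (\sum_(0 <= k < n) (g k x)%:E <= Gb x)%E.
  apply: (@nneseries_lim_ge _ (fun k => (g k x)%:E)).
  by move=> k _; rewrite lee_fin g0.
have sG n : series (g ^~ x) n <= fine (Gb x).
  by rewrite -lee_fin fineK// /series/= -sumEFin.
have nds : nondecreasing_seq (series (g ^~ x)).
  apply/nondecreasing_seqP => n; rewrite /series/= big_nat_recr//=.
  by rewrite lerDl g0.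
have cs : cvgn (series (g ^~ x)).
  by apply: nondecreasing_is_cvgn => //; exists (fine (Gb x)) => _ [n _ <-].
split => //; last exact: cvg_series_cvg_0.
move=> n; apply: le_trans (sG n.+1); rewrite /series/= big_nat_recr//=.
by rewrite lerDr sumr_ge0// => k _; exact: g0.
Qed.

End summable.

Section real_limits.
Variable R : realType.

Lemma cvg_real_ge (u : nat -> R) (a l : R) :
  u n @[n --> \oo] --> l -> (forall n, a <= u n) -> a <= l.
Proof.
move=> c h; rewrite -(cvg_lim _ c)//; apply: limr_ge; [exact: cvgP c|exact: nearW].
Qed.

Lemma cvg_real_le (u : nat -> R) (a l : R) :
  u n @[n --> \oo] --> l -> (forall n, u n <= a) -> l <= a.
Proof.
move=> c h; rewrite -(cvg_lim _ c)//; apply: limr_le; [exact: cvgP c|exact: nearW].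
Qed.

End real_limits.

Section finite_measure.
Context d (T : measurableType d) (R : realType).
Variable mu : {measure set T -> \bar R}.
Variable D : set T.
Hypotheses (mD : measurable D) (fD : (mu D < +oo)%E).

Lemma measurable_inv_pos (f : T -> R) : measurable_fun D f ->
  (forall x, D x -> 0 < f x) -> measurable_fun D (fun x => (f x)^-1).
Proof.
move=> mf f0; apply: (@eq_measurable_fun _ _ _ _ D (fun x => f x `^ (-1))).
  by move=> x; rewrite inE => Dx; rewrite powR_inv1// ltW// f0.
apply: (measurableT_comp (f := fun t : R => t `^ (-1)) _ mf); exact: measurable_powR.
Qed.

Lemma bounded_integrable (f : T -> R) (M : R) : measurable_fun D f ->
  (forall x, D x -> `|f x| <= M) -> mu.-integrable D (EFin \o f).
Proof.
move=> mf fM; apply: measurable_bounded_integrable => //.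
exists M; split; first exact: num_real.
by move=> y My x Dx /=; rewrite (le_trans (fM x Dx))// ltW.
Qed.

Lemma bounded_cvg_Rintegral (f_ : nat -> T -> R) (f : T -> R) (M : R) :
  (forall n, measurable_fun D (f_ n)) -> measurable_fun D f ->
  (forall n x, D x -> `|f_ n x| <= M) ->
  {ae mu, forall x, D x -> f_ n x @[n --> \oo] --> f x} ->
  mu.-integrable D (EFin \o f) /\
  \int[mu]_(x in D) f_ n x @[n --> \oo] --> \int[mu]_(x in D) f x.
Proof.
move=> mf_ mf bf ff.
have icst : mu.-integrable D (cst M%:E).
  apply: (@bounded_integrable (cst M) `|M|); first exact: measurable_cst.
  by move=> x Dx /=.
have [|||||] := @dominated_convergence _ _ _ mu D mD
  (fun n x => (f_ n x)%:E) (EFin \o f) (cst M%:E).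
- by move=> n; exact/measurable_EFinP.
- exact/measurable_EFinP.
- apply: filterS ff => x h Dx; apply: cvg_EFin; first exact: nearW.
  exact: h.
- exact: icst.
- by apply: aeW => x n Dx; rewrite lee_fin bf.
move=> intf _ h; split => //.
have -> : (fun n => \int[mu]_(x in D) f_ n x) =
    fine \o (fun n => (\int[mu]_(x in D) (f_ n x)%:E)%E) by [].
apply: fine_cvg; rewrite /Rintegral fineK//.
exact: integrable_fin_num.
Qed.

End finite_measure.

(** * A weight for a convex set of functions bounded in measure *)

Section numeraire.
Context d (T : measurableType d) (R : realType).
Variable mu : {measure set T -> \bar R}.
Variable D : set T.
Hypotheses (mD : measurable D) (fD : (mu D < +oo)%E).
Variable K : set (T -> R).
Hypothesis Km : forall v, K v -> measurable_fun D v.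
Hypothesis K0 : forall v, K v -> forall x, D x -> 0 <= v x.
Hypothesis Kcvx : forall v w s, K v -> K w -> 0 < s < 1 ->
  K (fun x => (1 - s) * v x + s * w x).
Hypothesis Kne : K !=set0.
Hypothesis Kbd : forall e : R, 0 < e -> exists t : R, forall v, K v ->
  (mu (D `&` [set x | (t < v x)%R]) < e%:E)%E.

Let hh (v : T -> R) x := (1 + v x)^-1.
Let J v := \int[mu]_(x in D) hh v x.
Let I := inf [set J v | v in K].

Let hh01 v x : K v -> D x -> 0 < hh v x <= 1.
Proof.
move=> Kv Dx; have v0 := K0 Kv Dx; have p : 0 < 1 + v x by lra.
by rewrite /hh invr_gt0 p/= invf_le1//; lra.
Qed.

Let mhh v : K v -> measurable_fun D (hh v).
Proof.
move=> Kv; apply: measurable_inv_pos.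
  by apply: measurable_funD => //; exact: Km.
by move=> x Dx; have := K0 Kv Dx; lra.
Qed.

Let ihh v : K v -> mu.-integrable D (EFin \o hh v).
Proof.
move=> Kv; apply: (@bounded_integrable _ _ _ _ _ mD fD _ 1); first exact: mhh.
by move=> x Dx; have /andP[a b] := hh01 Kv Dx; rewrite ger0_norm// ltW.
Qed.

Let Ilb v : K v -> I <= J v.
Proof.
move=> Kv; apply: ge_inf; last by exists v.
exists 0 => _ [w Kw <-]; apply: Rintegral_ge0 => x Dx.
by have /andP[/ltW] := hh01 Kw Dx.
Qed.

(** The midpoint of v and w lies in K, and there 1 / (1 + .) falls short of the
    mean of its two values by (h - h')^2 / (2 (h + h')), where h + h' <= 2. *)
Let gap v w : K v -> K w ->
  \int[mu]_(x in D) (hh v x - hh w x) ^+ 2 <= 4 * ((J v + J w) / 2 - I).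
Proof.
move=> Kv Kw.
have s2 : (0 < 2^-1 :> R) && ((2^-1 : R) < 1) by apply/andP; split; lra.
have Km2 := Kcvx Kv Kw s2; set m := (X in K X) in Km2.
have isq : mu.-integrable D (EFin \o (fun x => (hh v x - hh w x) ^+ 2)).
  apply: (@bounded_integrable _ _ _ _ _ mD fD _ 1).
    by apply: measurable_funX; apply: measurable_funB; exact: mhh.
  move=> x Dx; have /andP[a b] := hh01 Kv Dx; have /andP[a' b'] := hh01 Kw Dx.
  by rewrite ger0_norm ?sqr_ge0//; nra.
have ptw x : D x -> (hh v x - hh w x) ^+ 2 <= 2 * (hh v x + hh w x) + (- 4) * hh m x.
  move=> Dx; have /andP[a b] := hh01 Kv Dx; have /andP[a' b'] := hh01 Kw Dx.
  have v0 := K0 Kv Dx; have w0 := K0 Kw Dx.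
  have -> : hh m x = 2 * (hh v x * hh w x) / (hh v x + hh w x).
    rewrite /hh /m; field; do ?[apply/andP; split]; apply: lt0r_neq0; lra.
  move: a b a' b'; set p := hh v x; set r := hh w x => a b a' b'.
  rewrite -subr_ge0.
  have -> : 2 * (p + r) + -4 * (2 * (p * r) / (p + r)) - (p - r) ^+ 2 =
     (p - r) ^+ 2 * (2 - (p + r)) / (p + r) by field; apply: lt0r_neq0; lra.
  by apply: divr_ge0; [apply: mulr_ge0; [exact: sqr_ge0|lra]|lra].
have iv := ihh Kv; have iw := ihh Kw; have im := ihh Km2.
have ivw : mu.-integrable D (EFin \o (fun x => hh v x + hh w x)).
  exact: (integrableD mD iv iw).
have i2 : mu.-integrable D (EFin \o (fun x => 2 * (hh v x + hh w x))).
  exact: (integrableZl mD 2 ivw).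
have i4 : mu.-integrable D (EFin \o (fun x => (-4) * hh m x)).
  exact: (integrableZl mD (-4) im).
apply: (@le_trans _ _ (\int[mu]_(x in D) (2 * (hh v x + hh w x) + (- 4) * hh m x))).
  by apply: le_Rintegral => //; exact: (integrableD mD i2 i4).
rewrite RintegralD// !RintegralZl// RintegralD//.
have := Ilb Km2; rewrite /J; lra.
Qed.

(** By gap, a minimising sequence for J converges in L2. The one chosen has
    J (vn n) within 8^-n of the infimum, so that it converges almost everywhere. *)
Lemma numeraire_minimiser : exists vn : nat -> T -> R, exists h : T -> R,
  [/\ forall n, K (vn n), measurable_fun D h,
      {ae mu, forall x, D x -> hh (vn n) x @[n --> \oo] --> h x} &
      J (vn n) @[n --> \oo] --> I].
Proof.
have hI : has_inf [set J v | v in K].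
  have [v Kv] := Kne; split; first by exists (J v), v.
  exists 0 => _ [w Kw <-]; apply: Rintegral_ge0 => x Dx.
  by have /andP[/ltW] := hh01 Kw Dx.
have ex n : {v | K v /\ J v < I + 8^-1 ^+ n}.
  apply: cid; have [|_ [v Kv <-] h] := @inf_adherent _ _ (8^-1 ^+ n) _ hI.
    by apply: exprn_gt0; lra.
  by exists v.
pose vn n := sval (ex n).
have Kvn n : K (vn n) by case: (svalP (ex n)).
have Jvn n : J (vn n) < I + 8^-1 ^+ n by case: (svalP (ex n)).
pose g n x := `|hh (vn n.+1) x - hh (vn n) x|.
have mg n : measurable_fun D (g n).
  by apply: measurableT_comp => //; apply: measurable_funB; exact: mhh.
have ig n : (\int[mu]_(x in D) (g n x)%:E <= ((fine (mu D) + 4) * 2^-1 ^+ n)%:E)%E.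
  have isq : mu.-integrable D (EFin \o (fun x => (hh (vn n.+1) x - hh (vn n) x) ^+ 2)).
    apply: (@bounded_integrable _ _ _ _ _ mD fD _ 1).
      by apply: measurable_funX; apply: measurable_funB; exact: mhh.
    move=> x Dx; have /andP[a b] := hh01 (Kvn n) Dx; have /andP[a' b'] := hh01 (Kvn n.+1) Dx.
    by rewrite ger0_norm ?sqr_ge0//; nra.
  have icst : mu.-integrable D (EFin \o cst (2^-1 ^+ n : R)).
    apply: (@bounded_integrable _ _ _ _ _ mD fD _ (2^-1 ^+ n)) => //.
    by move=> x _ /=; rewrite ger0_norm// exprn_ge0//; lra.
  have i2 : mu.-integrable D (EFin \o (fun x => 2 ^+ n * (hh (vn n.+1) x - hh (vn n) x) ^+ 2)).
    exact: (integrableZl mD (2 ^+ n) isq).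
  have iG : mu.-integrable D (EFin \o g n).
    apply: (@bounded_integrable _ _ _ _ _ mD fD _ 1) => //.
    move=> x Dx; have /andP[a b] := hh01 (Kvn n) Dx; have /andP[a' b'] := hh01 (Kvn n.+1) Dx.
    by rewrite /g normr_id ler_norml; apply/andP; split; lra.
  have -> : (\int[mu]_(x in D) (g n x)%:E)%E = (\int[mu]_(x in D) g n x)%:E.
    by rewrite /Rintegral fineK//; exact: integrable_fin_num.
  rewrite lee_fin.
  (* z <= 1 / m + m z^2 with m = 2^n turns the L2 bound into an L1 bound *)
  apply: (@le_trans _ _ (\int[mu]_(x in D) (2^-1 ^+ n +
      2 ^+ n * (hh (vn n.+1) x - hh (vn n) x) ^+ 2))).
    apply: le_Rintegral => //; first exact: (integrableD mD icst i2).
    move=> x Dx; rewrite /g; set y := hh _ x - _.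
    have p2 : 0 < (2 : R) ^+ n by rewrite exprn_gt0.
    rewrite -(real_normK (num_real y)) exprVn.
    have := normr_ge0 y; move: `|y| => z z0.
    set q := 2 ^+ n in p2 *; rewrite -subr_ge0.
    have -> : q^-1 + q * z ^+ 2 - z = q^-1 * (1 - q * z) ^+ 2 + z.
      by field; exact: lt0r_neq0.
    by rewrite addr_ge0// mulr_ge0 ?sqr_ge0// invr_ge0 ltW.
  rewrite RintegralD// RintegralZl// Rintegral_cst//.
  have := gap (Kvn n.+1) (Kvn n); set A := Rintegral _ _ _ => hA.
  have J1 := Jvn n.+1; have J2 := Jvn n.
  have e8 : 8^-1 ^+ n.+1 <= 8^-1 ^+ n :> R by rewrite exprSr ler_piMr ?exprn_ge0//; lra.
  have hA4 : A <= 4 * 8^-1 ^+ n by lra.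
  have : 2 ^+ n * A <= 2 ^+ n * (4 * 8^-1 ^+ n) by rewrite ler_wpM2l// exprn_ge0.
  rewrite mulrCA -exprMn (_ : 2 * 8^-1 = 4^-1); last by field.
  have : 4^-1 ^+ n <= 2^-1 ^+ n :> R by rewrite lerXn2r// ?nnegrE; lra.
  by rewrite mulrC; lra.
have g0 n x : D x -> 0 <= g n x by move=> _; exact: normr_ge0.
have [G [_ Gae]] := summable_ae_dominated mD mg g0 ig.
pose h x := limn_sup (fun n => hh (vn n) x).
exists vn, h; split => //.
- apply: measurable_fun_limn_sup; last by move=> n; exact: mhh.
  + by move=> x Dx; exists 1 => _ [n _ <-]; have /andP[] := hh01 (Kvn n) Dx.
  + by move=> x Dx; exists 0 => _ [n _ <-]; have /andP[/ltW] := hh01 (Kvn n) Dx.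
- apply: filterS Gae => x hx Dx; have [_ cs _] := hx Dx.
  have : cvgn (fun n => hh (vn n) x).
    have /normed_cvg : cvgn [normed series (fun n => hh (vn n.+1) x - hh (vn n) x)].
      exact: cs.
    move=> /cvg_ex[l hl]; apply/cvg_ex; exists (hh (vn 0%N) x + l); rewrite -cvg_shiftS.
    have -> : (fun n => hh (vn n.+1) x) =
      (fun n => hh (vn 0%N) x + series (fun n => hh (vn n.+1) x - hh (vn n) x) n.+1).
      by apply/funext => n; rewrite /series/= telescope_sumr//; ring.
    by apply: cvgD; [exact: cvg_cst|rewrite cvg_shiftS].
  by move=> c; rewrite /h (cvg_limn_supE c).
- apply: (@squeeze_cvgr _ _ _ _ (fun n => I) (fun n => I + 8^-1 ^+ n)).
  + by apply: nearW => n; rewrite Ilb//= ltW.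
  + exact: cvg_cst.
  + rewrite -[X in _ --> X]addr0; apply: cvgD; first exact: cvg_cst.
    by apply: cvg_expr; rewrite ger0_norm//; lra.
Qed.

(** Let h be the limit of 1 / (1 + vn) along the minimising sequence; h^2 is the
    weight. Boundedness of K in measure keeps h positive almost everywhere.
    Replacing vn by (1 - s) vn + s v cannot bring J below its infimum; in the
    limit n -> oo this bounds the integral of (1 + v) h^2 / ((1 - s) + s (1 + v) h)
    by mu(D) / (1 - s), and s -> 0 gives the claim. *)
Lemma numeraire : exists h : T -> R, [/\ measurable_fun D h,
  forall x, 0 < h x <= 1 &
  forall v, K v -> (\int[mu]_(x in D) (v x * h x)%:E <= mu D)%E].
Proof.
have [vn [h [Kvn mh hae Jc]]] := numeraire_minimiser.
have h01 : {ae mu, forall x, D x -> 0 <= h x <= 1}.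
  apply: filterS hae => x hx Dx; apply/andP; split.
    apply: (cvg_real_ge (hx Dx)) => n.
    by have /andP[/ltW] := hh01 (Kvn n) Dx.
  apply: (cvg_real_le (hx Dx)) => n.
  by have /andP[] := hh01 (Kvn n) Dx.
have hhb n x : D x -> `|hh (vn n) x| <= 1.
  by move=> Dx; have /andP[a b] := hh01 (Kvn n) Dx; rewrite ger0_norm// ltW.
have [ih hc] := bounded_cvg_Rintegral mD fD (fun n => mhh (Kvn n)) mh hhb hae.
have IE : I = \int[mu]_(x in D) h x by exact: (cvg_unique _ Jc hc).
(* where h vanishes vn tends to infinity, hence only on a null set *)
have mN : measurable (D `&` [set x | h x <= 0]).
  by rewrite (_ : [set x | h x <= 0] = h @^-1` `]-oo, 0]); [exact: mh|
     apply/seteqP; split => x /=; rewrite in_itv].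
have N0 : mu (D `&` [set x | h x <= 0]) = 0%E.
  set N := D `&` _ in mN *.
  have ND : N `<=` D by move=> x [].
  have fN : (mu N < +oo)%E by apply: le_lt_trans fD; apply: le_measure; rewrite ?inE.
  apply/eqP; rewrite eq_le measure_ge0 andbT; apply/lee_addgt0Pr => e e0; rewrite add0e.
  have [t0 ht0] := Kbd e0; pose t := Num.max t0 0.
  have tt0 : 0 <= t by rewrite le_max lexx orbT.
  have ht v : K v -> (mu (D `&` [set x | (t < v x)%R]) < e%:E)%E.
    move=> Kv; apply: le_lt_trans (ht0 v Kv); apply: le_measure; rewrite ?inE.
    - rewrite (_ : [set x | _] = v @^-1` `]t, +oo[); first by apply: (Km Kv).
      by apply/seteqP; split => x /=; rewrite in_itv/= andbT.
    - rewrite (_ : [set x | _] = v @^-1` `]t0, +oo[); first by apply: (Km Kv).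
      by apply/seteqP; split => x /=; rewrite in_itv/= andbT.
    - by move=> x [Dx /= tv]; split => //=; apply: le_lt_trans tv; rewrite le_max lexx.
  have haeN : {ae mu, forall x, N x -> hh (vn n) x @[n --> \oo] --> h x}.
    by apply: filterS hae => x hx /ND.
  have mhhN n : measurable_fun N (hh (vn n)) by apply: measurable_funS (mhh (Kvn n)).
  have [ihN hcN] := bounded_cvg_Rintegral mN fN mhhN (measurable_funS mD ND mh)
     (fun n x Nx => hhb n x (ND x Nx)) haeN.
  have le0 : \int[mu]_(x in N) h x <= 0.
    rewrite -oppr_ge0 -(mulN1r (Rintegral _ _ _)) -RintegralZl//.
    by apply: Rintegral_ge0 => x [_ /= hx]; rewrite mulN1r oppr_ge0.
  have lb n : (fine (mu N) - e) / (1 + t) <= \int[mu]_(x in N) hh (vn n) x.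
    pose B := N `&` [set x | vn n x <= t].
    have mB : measurable B.
      rewrite /B (_ : N `&` _ = N `&` (D `&` vn n @^-1` `]-oo, t])).
        by apply: measurableI => //; apply: (Km (Kvn n)).
      by apply/seteqP; split => x /=; rewrite in_itv/= => -[Nx h1]; split => //;
        [split=> //; exact: ND|case: h1].
    have BN : B `<=` N by move=> x [].
    have fB : (mu B < +oo)%E by apply: le_lt_trans fN; apply: le_measure; rewrite ?inE.
    have iN : mu.-integrable N (EFin \o hh (vn n)).
      by apply: (integrableS mD) => //; exact: ihh.
    have muNB : fine (mu N) - e <= fine (mu B).
      rewrite lerBlDr -lee_fin EFinD !fineK ?ge0_fin_numE//.
      apply: (@le_trans _ _ (mu B + mu (D `&` [set x | (t < vn n x)%R]))%E); last first.
        by rewrite leeD2l// ltW// ht.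
      apply: (@le_trans _ _ (mu (B `|` D `&` [set x | (t < vn n x)%R]))).
        apply: le_measure; rewrite ?inE//.
          apply: measurableU => //.
          rewrite (_ : [set x | _] = vn n @^-1` `]t, +oo[); first by apply: (Km (Kvn n)).
          by apply/seteqP; split => x /=; rewrite in_itv/= andbT.
        move=> x Nx; have [h1|h1] := leP (vn n x) t; first by left.
        by right; split => //; exact: ND.
      apply: measureU2 => //.
      rewrite (_ : [set x | _] = vn n @^-1` `]t, +oo[); first by apply: (Km (Kvn n)).
      by apply/seteqP; split => x /=; rewrite in_itv/= andbT.
    apply: (@le_trans _ _ (\int[mu]_(x in B) hh (vn n) x)); last first.
      rewrite -lee_fin /Rintegral !fineK; last 2 first.
      - exact: integrable_fin_num.
      - by apply: integrable_fin_num => //; apply: (integrableS mN).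
      apply: ge0_subset_integral => //.
        by apply/measurable_EFinP; exact: mhhN.
      by move=> x /ND Dx; have /andP[/ltW] := hh01 (Kvn n) Dx.
    apply: (@le_trans _ _ (\int[mu]_(x in B) (1 + t)^-1)).
      by rewrite Rintegral_cst// mulrC ler_wpM2l// invr_ge0; lra.
    apply: le_Rintegral => //.
    - apply: (@bounded_integrable _ _ _ _ _ mB fB _ ((1 + t)^-1)) => // x _.
      by rewrite ger0_norm// invr_ge0; lra.
    - by apply: (integrableS mN).
    - move=> x [/ND Dx /= vt]; have := K0 (Kvn n) Dx => v0.
      by rewrite lef_pV2 ?posrE; lra.
  have : (fine (mu N) - e) / (1 + t) <= 0.
    apply: le_trans le0; exact: (cvg_real_ge hcN).
  rewrite pmulr_lle0 ?invr_gt0; last lra.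
  by rewrite subr_le0 -lee_fin fineK// ge0_fin_numE.
have hpos : {ae mu, forall x, D x -> 0 < h x}.
  exists (D `&` [set x | h x <= 0]); split => // x /= /not_implyP[Dx].
  by move/negP; rewrite -leNgt.
(* h is known to lie in [0, 1] almost everywhere only; hp does so everywhere *)
pose hp x := Num.min 1 (Num.max 0 (h x)).
have hp0 x : 0 <= hp x by rewrite /hp le_min ler01 le_max lexx.
have hp1 x : hp x <= 1 by rewrite /hp ge_min lexx.
have mhp : measurable_fun D hp by apply: measurable_minr => //; exact: measurable_maxr.
have hhp : {ae mu, forall x, D x -> h x = hp x}.
  apply: filterS h01 => x h1 Dx; have /andP[a b] := h1 Dx.
  by rewrite /hp max_r// min_r.
exists (fun x => if 0 < hp x then hp x ^+ 2 else 1); split.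
- apply: measurable_fun_if => //.
  + exact: measurable_fun_ltr.
  + apply: measurable_funX; apply: measurable_funS mhp => //; exact: subIsetl.
- move=> x; case: ifPn => a; last by rewrite ltr01 lexx.
  by have := hp1 x; have := a; set z := hp x => z0 z1; apply/andP; split; nra.
move=> v Kv.
pose q s x := ((1 - s) + s * (1 + v x) * hp x)^-1.
have v0 x : D x -> 0 <= v x by exact: K0.
have mv := Km Kv.
have den s (w : R) x : D x -> 0 < s < 1 -> 0 <= w -> 1 - s <= (1 - s) + s * (1 + v x) * w.
  by move=> Dx /andP[s0 s1] w0; rewrite lerDl mulr_ge0// mulr_ge0 ?(ltW s0)//; have := v0 x Dx; lra.
have mden s (w : T -> R) : measurable_fun D w -> measurable_fun D (fun x => (1 - s) + s * (1 + v x) * w x).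
  move=> mw; apply: measurable_funD => //; apply: measurable_funM => //.
  by apply: measurable_funM => //; exact: measurable_funD.
have mq s : 0 < s < 1 -> measurable_fun D (q s).
  move=> s01; apply: measurable_inv_pos; first exact: mden.
  by move=> x Dx; have := @den s (hp x) x Dx s01 (hp0 x); move: s01 => /andP[]; lra.
have qb s x : 0 < s < 1 -> D x -> 0 < q s x <= (1 - s)^-1.
  move=> s01 Dx; have := @den s _ x Dx s01 (hp0 x); move: s01 => /andP[s0 s1] dd.
  by rewrite /q invr_gt0 lef_pV2 ?posrE ?dd ?andbT; lra.
(* J at (1 - s) vn + s v is at least I; let n tend to infinity *)
have opt s : 0 < s < 1 ->
    (\int[mu]_(x in D) ((1 + v x) * hp x ^+ 2 * q s x)%:E <= (fine (mu D) / (1 - s))%:E)%E.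
  move=> s01; have /andP[s0 s1] := s01.
  pose w n x := (1 - s) * vn n x + s * v x.
  have Kw n : K (w n) by exact: Kcvx.
  have hhw n x : D x -> hh (w n) x = hh (vn n) x / ((1 - s) + s * (1 + v x) * hh (vn n) x).
    move=> Dx; have := K0 (Kvn n) Dx; have := v0 x Dx; rewrite /hh /w => a b.
    have p1 : 0 < (1 - s) * (1 + vn n x) by rewrite mulr_gt0//; lra.
    have p2 : 0 < s * (1 + v x) by rewrite mulr_gt0//; lra.
    by field; do ?[apply/andP; split]; apply: lt0r_neq0; lra.
  have mhq : measurable_fun D (fun x => hp x * q s x).
    by apply: measurable_funM => //; exact: mq.
  have [ihq hq] : mu.-integrable D (EFin \o (fun x => hp x * q s x)) /\
      \int[mu]_(x in D) hh (w n) x @[n --> \oo] --> \int[mu]_(x in D) (hp x * q s x).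
    apply: (@bounded_cvg_Rintegral _ _ _ mu D mD fD _ _ 1).
    - by move=> n; exact: mhh.
    - exact: mhq.
    - by move=> n x Dx; have /andP[a b] := hh01 (Kw n) Dx; rewrite ger0_norm// ltW.
    - apply: filterS2 hae hhp => x hx hhpx Dx.
      rewrite (_ : (fun n => hh (w n) x) = fun n => hh (vn n) x / ((1 - s) + s * (1 + v x) * hh (vn n) x)); last first.
        by apply/funext => n; rewrite hhw.
      apply: cvgM; first by rewrite -hhpx//; exact: hx.
      apply: cvgV; first by rewrite gt_eqF//; have := @den s _ x Dx s01 (hp0 x); lra.
      apply: cvgD; first exact: cvg_cst.
      by apply: cvgM; [exact: cvg_cst|rewrite -hhpx//; exact: hx].
  have Iq : I <= \int[mu]_(x in D) (hp x * q s x).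
    by apply: (cvg_real_ge hq) => n; exact: Ilb.
  have ihp : mu.-integrable D (EFin \o hp).
    by apply: (@bounded_integrable _ _ _ _ _ mD fD _ 1) => // x _; rewrite ger0_norm.
  have Ihp : I = \int[mu]_(x in D) hp x.
    rewrite IE /Rintegral; congr fine; apply: ae_eq_integral => //.
    - by apply/measurable_EFinP.
    - by apply/measurable_EFinP.
    - by apply: filterS hhp => x hx Dx /=; rewrite hx.
  pose F x := (1 + v x) * hp x ^+ 2 * q s x.
  have mF : measurable_fun D F.
    apply: measurable_funM; last exact: mq.
    by apply: measurable_funM; [exact: measurable_funD|exact: measurable_funX].
  have F0 x : D x -> 0 <= F x.
    move=> Dx; have /andP[a _] := qb s x s01 Dx; have := v0 x Dx => b.
    by rewrite /F mulr_ge0 ?mulr_ge0 ?sqr_ge0//; lra.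
  have Fid x : D x -> s * F x = s * (hp x * q s x) + (hp x - hp x * q s x).
    move=> Dx; have := @den s _ x Dx s01 (hp0 x) => dd.
    by rewrite /F /q; field; apply: lt0r_neq0; lra.
  have iF : mu.-integrable D (EFin \o F).
    apply: (@bounded_integrable _ _ _ _ _ mD fD _ (s^-1 * (s * (1 - s)^-1 + 1))) => // x Dx.
    rewrite ger0_norm ?F0// ler_pdivlMl// Fid//.
    have /andP[a b] := qb s x s01 Dx; have := hp0 x; have := hp1 x => c e.
    have h1 : hp x * q s x <= (1 - s)^-1 by apply: le_trans b; nra.
    have h2 : s * (hp x * q s x) <= s * (1 - s)^-1 by rewrite ler_wpM2l// ltW.
    have h3 : 0 <= hp x * q s x by rewrite mulr_ge0// ltW.
    lra.
  have -> : (\int[mu]_(x in D) (F x)%:E)%E = (\int[mu]_(x in D) F x)%:E.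
    by rewrite /Rintegral fineK//; exact: integrable_fin_num.
  rewrite lee_fin -(ler_pM2l s0) -RintegralZl//.
  have isq : mu.-integrable D (EFin \o (fun x => s * (hp x * q s x))).
    exact: (integrableZl mD s ihq).
  rewrite (@eq_Rintegral _ _ _ mu D (fun x => s * (hp x * q s x) + (hp x - hp x * q s x))); last first.
    by move=> x; rewrite inE => Dx; exact: Fid.
  rewrite RintegralD//; last exact: (integrableB mD ihp ihq).
  rewrite RintegralB// RintegralZl// -Ihp.
  have : \int[mu]_(x in D) (hp x * q s x) <= fine (mu D) / (1 - s).
    have icst : mu.-integrable D (EFin \o cst ((1 - s)^-1 : R)).
      by apply: (@bounded_integrable _ _ _ _ _ mD fD _ `|(1 - s)^-1|).
    rewrite mulrC -Rintegral_cst//; apply: le_Rintegral => // x Dx /=.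
    by have /andP[a b] := qb s x s01 Dx; have := hp0 x; have := hp1 x => c e; apply: le_trans b; nra.
  by move=> h1; have := ler_wpM2l (ltW s0) h1; lra.
have [sg [s01 sgle sg0]] : exists sg : nat -> R, [/\ forall n, 0 < sg n < 1,
    forall n m, (n <= m)%N -> sg m <= sg n & sg n @[n --> \oo] --> 0].
  exists (fun n => n.+2%:R^-1); split.
  - by move=> n; rewrite invr_gt0 ltr0n/= invf_lt1// ltr1n.
  - by move=> n m nm; rewrite lef_pV2 ?posrE ?ltr0n// ler_nat.
  - have := @cvg_harmonic R; rewrite -(cvg_shiftn 1).
    by under eq_fun do rewrite addn1.
(* q s is not monotone in s, but r n is in n and lies below q *)
pose r n x := (1 + sg n * (1 + v x) * hp x)^-1.
have r0 x : D x -> 0 <= (1 + v x) * hp x by move=> Dx; rewrite mulr_ge0//; have := v0 x Dx; lra.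
have rq n m x : D x -> (n <= m)%N -> 0 <= r n x <= q (sg m) x.
  move=> Dx nm; have := r0 x Dx; set z := _ * hp x => z0.
  have le1 := sgle n m nm.
  have /andP[a b] := s01 m; have /andP[a' b'] := s01 n.
  have h1 : sg m * z <= sg n * z by rewrite ler_wpM2r.
  have h2 : 0 <= sg m * z by rewrite mulr_ge0// ltW.
  rewrite /r /q -!mulrA -/z invr_ge0 lef_pV2 ?posrE; last 2 first.
    lra.
    lra.
  by apply/andP; split; lra.
pose f n x := ((1 + v x) * hp x ^+ 2 * r n x)%:E.
have mf n : measurable_fun D (f n).
  apply/measurable_EFinP; apply: measurable_funM.
    by apply: measurable_funM; [exact: measurable_funD|exact: measurable_funX].
  apply: measurable_inv_pos.
    apply: measurable_funD => //; apply: measurable_funM => //.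
    by apply: measurable_funM => //; exact: measurable_funD.
  move=> x Dx; have := r0 x Dx; rewrite -mulrA; set z := _ * hp x => z0.
  by apply: ltr_pwDl => //; rewrite mulr_ge0// ltW//; have /andP[] := s01 n.
have k0 x : D x -> 0 <= (1 + v x) * hp x ^+ 2.
  by move=> Dx; rewrite mulr_ge0 ?sqr_ge0//; have := v0 x Dx; lra.
have f0 n x : D x -> (0 <= f n x)%E.
  by move=> Dx; rewrite lee_fin mulr_ge0 ?k0//; have /andP[] := rq n n x Dx (leqnn n).
have fle n : (\int[mu]_(x in D) f n x <= mu D)%E.
  have h1 m : (n <= m)%N -> (\int[mu]_(x in D) f n x <= (fine (mu D) / (1 - sg m))%:E)%E.
    move=> nm; apply: le_trans (opt _ (s01 m)); apply: ge0_le_integral => //.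
    - by move=> x Dx; exact: f0.
    - apply/measurable_EFinP; apply: measurable_funM; last exact: mq.
      by apply: measurable_funM; [exact: measurable_funD|exact: measurable_funX].
    - by move=> x Dx; rewrite lee_fin ler_wpM2l ?k0//; have /andP[] := rq n m x Dx nm.
  have fI : (\int[mu]_(x in D) f n x)%E \is a fin_num.
    rewrite ge0_fin_numE; first by apply: le_lt_trans (h1 n (leqnn n)) _; exact: ltry.
    by apply: integral_ge0 => x Dx; exact: f0.
  rewrite -(fineK fI) -(@fineK _ (mu D)) ?ge0_fin_numE// lee_fin.
  have c1 : fine (mu D) / (1 - sg (k + n)%N) @[k --> \oo] --> fine (mu D).
    rewrite -[X in _ --> X](divr1 (fine (mu D))).
    apply: cvgM; first exact: cvg_cst.
    apply: cvgV => //; rewrite -[X in _ --> X](subr0 1); apply: cvgB; first exact: cvg_cst.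
    by rewrite cvg_shiftn.
  apply: (cvg_real_ge c1) => k; rewrite -lee_fin fineK//; apply: h1; exact: leq_addl.
have nd x : D x -> {homo f ^~ x : n m / (n <= m)%N >-> (n <= m)%E}.
  move=> Dx n m nm; rewrite lee_fin ler_wpM2l ?k0// /r -!mulrA.
  have := r0 x Dx; set z := _ * hp x => z0.
  have le1 := sgle n m nm.
  have h1 : sg m * z <= sg n * z by rewrite ler_wpM2r.
  have h2 : 0 <= sg m * z by rewrite mulr_ge0// ltW//; have /andP[] := s01 m.
  by rewrite lef_pV2 ?posrE; lra.
have lim x : D x -> limn (f ^~ x) = ((1 + v x) * hp x ^+ 2)%:E.
  move=> Dx; apply: cvg_lim => //; apply: cvg_EFin; first exact: nearW.
  rewrite /= -[X in _ --> X]mulr1; apply: cvgM; first exact: cvg_cst.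
  rewrite -[X in _ --> X]invr1; apply: cvgV => //.
  rewrite -[X in _ --> X]addr0; apply: cvgD; first exact: cvg_cst.
  rewrite -[X in _ --> X](mul0r ((1 + v x) * hp x)).
  under eq_fun do rewrite -mulrA.
  by apply: cvgM; last exact: cvg_cst.
apply: (@le_trans _ _ (\int[mu]_(x in D) ((1 + v x) * hp x ^+ 2)%:E)%E).
  apply: ae_ge0_le_integral => //.
  - move=> x Dx; rewrite lee_fin mulr_ge0 ?v0//; case: ifP => // _; exact: sqr_ge0.
  - apply/measurable_EFinP; apply: measurable_funM => //; apply: measurable_fun_if => //.
      exact: measurable_fun_ltr.
    apply: measurable_funX; apply: measurable_funS mhp => //; exact: subIsetl.
  - apply/measurable_EFinP; apply: measurable_funM; [exact: measurable_funD|exact: measurable_funX].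
  - apply: filterS2 hpos hhp => x a b Dx; rewrite -b// a// lee_fin.
    by rewrite ler_wpM2r ?sqr_ge0//; lra.
rewrite (eq_integral (fun x => limn (f ^~ x))); last first.
  by move=> x; rewrite inE => Dx; rewrite lim.
rewrite monotone_convergence//.
by apply: lime_le; [apply: ereal_nondecreasing_is_cvgn => n m nm; apply: ge0_le_integral => //;
   [exact: f0|move=> x Dx; exact: nd]|exact: nearW].
Qed.

End numeraire.

(** * A weight for a cone of functions whose positivity spreads *)

Section measure_facts.
Context d (T : measurableType d) (R : realType).
Variable mu : {measure set T -> \bar R}.

Lemma measurable_set_ge (D : set T) (f : T -> R) (a : R) :
  measurable D -> measurable_fun D f -> measurable (D `&` [set x | a <= f x]).
Proof.
move=> mD mf; rewrite (_ : [set x | _] = f @^-1` `[a, +oo[); first exact: mf.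
by apply/seteqP; split => x /=; rewrite in_itv/= andbT.
Qed.

Lemma measurable_set_gt (D : set T) (f : T -> R) (a : R) :
  measurable D -> measurable_fun D f -> measurable (D `&` [set x | a < f x]).
Proof.
move=> mD mf; rewrite (_ : [set x | _] = f @^-1` `]a, +oo[); first exact: mf.
by apply/seteqP; split => x /=; rewrite in_itv/= andbT.
Qed.

Lemma measurable_set_le (D : set T) (f : T -> R) (a : R) :
  measurable D -> measurable_fun D f -> measurable (D `&` [set x | f x <= a]).
Proof.
move=> mD mf; rewrite (_ : [set x | _] = f @^-1` `]-oo, a]); first exact: mf.
by apply/seteqP; split => x /=; rewrite in_itv/=.
Qed.

Lemma le_measure_finite (A B : set T) : measurable A -> measurable B ->
  A `<=` B -> (mu B < +oo)%E -> (mu A < +oo)%E.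
Proof.
by move=> mA mB AB; apply: le_lt_trans; apply: le_measure; rewrite ?inE.
Qed.

(** Split the integral at the level k. *)
Lemma reverse_markov (B : set T) (f : T -> R) (M a k : R) :
  measurable B -> (mu B < +oo)%E -> measurable_fun B f ->
  0 <= M -> (forall x, B x -> 0 <= f x <= M) -> 0 <= k ->
  (a%:E <= \int[mu]_(x in B) (f x)%:E)%E ->
  a - k * fine (mu B) <= M * fine (mu (B `&` [set x | k <= f x])).
Proof.
move=> mB fB mf M0 f0M k0 aI.
have mBk := measurable_set_ge k mB mf; set Bk := _ `&` _ in mBk *.
have fBk : (mu Bk < +oo)%E by apply: le_measure_finite fB => // x [].
rewrite lerBlDr -lee_fin EFinD !EFinM !fineK ?ge0_fin_numE//.
apply: (le_trans aI).
apply: (@le_trans _ _ (\int[mu]_(x in B) (M%:E * (\1_Bk x)%:E + k%:E))%E).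
  apply: ge0_le_integral => //.
  - by move=> x Bx; rewrite lee_fin; have /andP[] := f0M x Bx.
  - exact/measurable_EFinP.
  - by apply: emeasurable_funD => //; apply: measurable_funeM; apply/measurable_EFinP.
  - move=> x Bx; have /andP[f0 fM] := f0M x Bx.
    rewrite -EFinM -EFinD lee_fin indicE; have [Bkx|nBkx] := pselect (Bk x).
      by rewrite mem_set// mulr1; lra.
    rewrite memNset// mulr0 add0r; rewrite leNgt; apply/negP => kf.
    by apply: nBkx; split => //=; exact: ltW.
rewrite ge0_integralD//; last 2 first.
- by move=> x _; rewrite mule_ge0 ?lee_fin.
- by apply: emeasurable_funM => //; apply/measurable_EFinP.
rewrite ge0_integralZl//; last first.
- by apply/measurable_EFinP; exact: measurable_indic.
rewrite integral_indic// integral_cst//; apply: leeD => //.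
by rewrite (_ : Bk `&` B = Bk)//; apply/setIidl => x [].
Qed.

Lemma limsup_measure_ge (D : set T) (F : nat -> set T) (k : \bar R) :
  measurable D -> (mu D < +oo)%E -> (forall n, measurable (F n)) ->
  (forall n, F n `<=` D) -> (forall n, (k <= mu (F n))%E) ->
  (k <= mu (lim_sup_set F))%E.
Proof.
move=> mD fD mF FD kF.
have fin : (mu (\bigcup_(k in [set k | (0 <= k)%N]) F k) < +oo)%E.
  apply: le_measure_finite fD => //; first exact: bigcup_measurable.
  by move=> x [n _ /FD].
have c := @lim_sup_set_cvg _ _ _ mu F mF fin.
have -> : mu (lim_sup_set F) = limn (fun n => mu (\bigcup_(k in [set k | (n <= k)%N]) F k)).
  by apply/esym/cvg_lim.
apply: lime_ge; first exact: cvgP c.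
apply: nearW => n; apply: (le_trans (kF n)); apply: le_measure; rewrite ?inE//.
  exact: bigcup_measurable.
by move=> x Fx; exists n => //=.
Qed.

(** The parts of A left uncovered decrease to the empty set within a set of
    finite measure. *)
Lemma tail_measure_small (F : nat -> set T) (A D : set T) (N : nat) (e : R) :
  measurable D -> (mu D < +oo)%E -> (forall n, measurable (F n)) ->
  measurable A -> A `<=` D -> A `<=` \bigcup_(k in [set k | (N <= k)%N]) F k ->
  0 < e ->
  exists M, (mu (A `\` \bigcup_(k in [set k | (N <= k < M)%N]) F k) < e%:E)%E.
Proof.
move=> mD fD mF mA AD AF e0.
pose E M := A `\` \bigcup_(k in [set k | (N <= k < M)%N]) F k.
have mE M : measurable (E M) by apply: measurableD => //; exact: bigcup_measurable.
have E0 : \bigcap_M E M = set0.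
  apply/seteqP; split => // x h; have [Ax _] := h 0%N I.
  have [k /= Nk Fk] := AF x Ax; have [_] := h k.+1 I; apply; exists k => //=.
  by rewrite Nk ltnSn.
have nE : nonincreasing_seq E.
  move=> n m nm; apply/subsetPset => x [Ax h]; split => // -[k /= /andP[Nk kn] Fk].
  by apply: h; exists k => //=; rewrite Nk (leq_trans kn).
have f0 : (mu (E 0%N) < +oo)%E by apply: le_measure_finite fD => // x [/AD].
have := nonincreasing_cvg_mu f0 mE (bigcapT_measurable mE) nE.
rewrite E0 measure0 => c.
have : nbhs (0%E : \bar R) [set x | (x < e%:E)%E].
  by apply: open_nbhs_nbhs; split; [exact: open_ereal_lt_ereal|rewrite /= lte_fin].
by move=> /c[M _ h]; exists M; exact: (h M (leqnn M)).
Qed.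

End measure_facts.

Section cone.
Context d (T : measurableType d) (R : realType).
Variable mu : {sigma_finite_measure set T -> \bar R}.
Variables (D B0 : set T) (S : set (T -> R)).
Hypotheses (mD : measurable D) (fD : (mu D < +oo)%E).
Hypotheses (mB0 : measurable B0) (B0D : B0 `<=` D) (B0pos : (0 < mu B0)%E).
Hypothesis Sm : forall u, S u -> measurable_fun setT u.
Hypothesis S0 : forall u, S u -> forall x, 0 <= u x.
Hypothesis Szero : S (fun=> 0).
Hypothesis SD : forall u v, S u -> S v -> S (fun x => u x + v x).
Hypothesis SZ : forall k u, 0 <= k -> S u -> S (fun x => k * u x).
Hypothesis spread : forall A, measurable A -> A `<=` D -> (0 < mu A)%E ->
  exists t e : R, [/\ 0 < t, 0 < e & forall u, S u ->
    (mu (A `&` [set x | (u x <= 1)%R]) < e%:E)%E -> forall x, B0 x -> t <= u x].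

(** This set contains the convex combinations of the normalised functions u / c,
    and it is stated with sums because the averaging argument of hull_select
    selects among the summands. *)
Definition hull (v : T -> R) := exists (n : nat) (u : nat -> T -> R) (c : nat -> R),
  [/\ forall i, (i < n)%N -> [/\ S (u i), 0 < c i & exists2 x, B0 x & u i x < c i],
      \sum_(0 <= i < n) c i <= 1 & v = fun y => \sum_(0 <= i < n) u i y].

Lemma S_sum (m n : nat) (u : nat -> T -> R) (P : pred nat) :
  (forall i, (m <= i < n)%N -> S (u i)) -> S (fun y => \sum_(m <= i < n | P i) u i y).
Proof.
move=> h.
have : forall i, i \in index_iota m n -> S (u i) by move=> i; rewrite mem_index_iota; exact: h.
elim: (index_iota m n) => [|a l IH] hl.
  by rewrite (_ : (fun _ => _) = fun=> 0)//; apply/funext => y; rewrite big_nil.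
have Sl : S (fun y => \sum_(i <- l | P i) u i y).
  by apply: IH => i il; apply: hl; rewrite in_cons il orbT.
rewrite (_ : (fun _ => _) = if P a then fun y => u a y + \sum_(i <- l | P i) u i y
    else fun y => \sum_(i <- l | P i) u i y); last first.
  by apply/funext => y; rewrite big_cons; case: ifP.
by case: ifP => // _; apply: SD => //; apply: hl; rewrite in_cons eqxx.
Qed.

Lemma hull_S v : hull v -> S v.
Proof. by move=> [n [u [c [h _ ->]]]]; apply: S_sum => i /h[]. Qed.

Lemma hull_convex v w s : hull v -> hull w -> 0 < s < 1 ->
  hull (fun x => (1 - s) * v x + s * w x).
Proof.
move=> [n [u [c [h c1 ->]]]] [n' [u' [c' [h' c1' ->]]]] /andP[s0 s1].
have s1' : 0 < 1 - s by lra.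
have scal k u0 c0 : 0 < k -> [/\ S u0, 0 < c0 & exists2 x, B0 x & u0 x < c0] ->
    [/\ S (fun x => k * u0 x), 0 < k * c0 & exists2 x, B0 x & k * u0 x < k * c0].
  move=> k0 [a b [x Bx e]]; split; [by apply: SZ => //; exact: ltW|exact: mulr_gt0|].
  by exists x => //; rewrite ltr_pM2l.
have cat (f g : nat -> R) : \sum_(0 <= i < n + n') (if (i < n)%N then f i else g (i - n)%N) =
    \sum_(0 <= i < n) f i + \sum_(0 <= i < n') g i.
  rewrite (@big_cat_nat _ _ _ n)//= ?leq_addr//; congr (_ + _).
    by apply: eq_big_nat => i /andP[_ ->].
  rewrite -{1}(add0n n) big_addn addKn; apply: eq_bigr => i _.
  by rewrite ltnNge leq_addl/= addnK.
exists (n + n')%N,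
  (fun i => if (i < n)%N then fun y => (1 - s) * u i y else fun y => s * u' (i - n)%N y),
  (fun i => if (i < n)%N then (1 - s) * c i else s * c' (i - n)%N); split.
- move=> i ini; case: ifPn => [hi|hi]; first by apply: scal => //; exact: h.
  by apply: scal => //; apply: h'; move: hi; rewrite -leqNgt => hi; rewrite ltn_subLR.
- rewrite (cat (fun i => (1 - s) * c i) (fun i => s * c' i)) -!mulr_sumr.
  by have := ler_wpM2l (ltW s1') c1; have := ler_wpM2l (ltW s0) c1'; lra.
- apply/funext => y; rewrite -[RHS]/(\sum_(0 <= i < n + n')
     (if (i < n)%N then fun y => (1 - s) * u i y else fun y => s * u' (i - n)%N y) y).
  rewrite !mulr_sumr -(cat (fun i => (1 - s) * u i y) (fun i => s * u' i y)).
  by apply: eq_bigr => i _; case: ifP.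
Qed.

Lemma hull_base u c x : S u -> 0 < c -> B0 x -> u x < c -> hull (fun y => c^-1 * u y).
Proof.
move=> Su c0 Bx uc; exists 1%N, (fun=> fun y => c^-1 * u y), (fun=> 1); split.
- move=> i _; split => //; first by apply: SZ => //; rewrite invr_ge0 ltW.
  by exists x => //; rewrite mulrC ltr_pdivrMr// mul1r.
- by rewrite big_nat1.
- by apply/funext => y; rewrite big_nat1.
Qed.

Let b := fine (mu B0).
Let fB0 : (mu B0 < +oo)%E. Proof. exact: le_measure_finite fD. Qed.
Let b0 : 0 < b. Proof. by apply: fine_gt0; rewrite B0pos fB0. Qed.

(** Each summand u_i is at most c_i / t0 on a subset G_i of B0 of measure at least
    e0. For z in B0 let w_z be the sum of the u_i with z in G_i. Then
    w_z(z) <= 1 / t0, while the integral over z of w_z(y) is at least e0 v(y). So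
    for y with v(y) > s many z have w_z(y) comparable to s, and by Tonelli's
    theorem many z have w_z comparable to s on a set of y of fixed measure. *)
Lemma hull_select (t0 e0 eta s : R) v : 0 < t0 -> 0 < e0 -> 0 < eta -> 0 < s ->
  (forall u c x, S u -> 0 < c -> B0 x -> u x < c ->
     (e0%:E <= mu (B0 `&` [set z | (u z <= c / t0)%R]))%E) ->
  hull v -> (eta%:E <= mu (D `&` [set y | (s < v y)%R]))%E ->
  exists H : set T, [/\ measurable H, H `<=` B0,
    ((e0 * eta / (4 * fine (mu D)))%:E <= mu H)%E &
    forall z, H z -> exists w, [/\ S w, w z <= t0^-1 &
      ((e0 * eta / (4 * b))%:E <=
         mu (D `&` [set y | (e0 / (2 * b) * s <= w y)%R]))%E]].
Proof.
move=> t00 e00 eta0 s0 base [n [u [c [h c1 vE]]]].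
pose v' := v; rewrite -/v'; set A := D `&` _ => etaA.
have Sv : S v' by rewrite /v' vE; apply: S_sum => i /h[].
have mA : measurable A by apply: measurable_set_gt => //; apply: measurable_funTS; exact: Sm.
pose U i := if (i < n)%N then u i else fun=> 0.
have SU i : S (U i) by rewrite /U; case: ifP => // /h[].
have v'E y : v' y = \sum_(0 <= i < n) U i y.
  by rewrite /v' vE; apply: eq_big_nat => i /andP[_ ilt]; rewrite /U ilt.
pose G i := B0 `&` [set z | U i z <= c i / t0].
have mG i : measurable (G i).
  by apply: measurable_set_le => //; apply: measurable_funTS; exact: Sm.
have eG i : (i < n)%N -> (e0%:E <= mu (G i))%E.
  move=> ilt; have [Si ci [x Bx ux]] := h i ilt.
  by rewrite /G /U ilt; exact: (base _ _ _ Si ci Bx ux).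
pose w z y := \sum_(0 <= i < n) \1_(G i) z * U i y.
have Sw z : S (w z).
  apply: (@S_sum 0 n (fun i y => \1_(G i) z * U i y) xpredT) => i _.
  exact: SZ.
have mw : measurable_fun setT (fun p : T * T => w p.1 p.2).
  apply: measurable_sum => i; apply: measurable_funM.
    exact: (measurableT_comp (measurable_indic (D := setT) (mG i)) measurable_fst).
  exact: (measurableT_comp (Sm (SU i)) measurable_snd).
have w0 z y : 0 <= w z y by apply: sumr_ge0 => i _; rewrite mulr_ge0//; exact: S0.
have wv z y : w z y <= v' y.
  rewrite v'E; apply: ler_sum => i _; rewrite indicE.
  by case: (_ \in _); rewrite ?mul1r ?mul0r//; exact: S0.
have mwy y : measurable_fun setT (w ^~ y) by exact: (measurable_fun_pair1 y mw).
have mwz z : measurable_fun setT (w z) by exact: Sm.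
have wint y : ((e0 * v' y)%:E <= \int[mu]_(z in B0) (w z y)%:E)%E.
  rewrite /w; under eq_integral do rewrite -sumEFin.
  have mi i : measurable_fun B0 (fun z => (\1_(G i) z * U i y)%:E).
    by apply/measurable_EFinP; apply: measurable_funM => //; exact: measurable_indic.
  rewrite ge0_integral_sum//; last by move=> i z _; rewrite lee_fin mulr_ge0//; exact: S0.
  rewrite v'E mulr_sumr -sumEFin; rewrite !big_nat; apply: lee_sum => i /andP[_ ilt].
  under eq_integral do rewrite mulrC EFinM.
  rewrite ge0_integralZl_EFin//; last first.
  - exact: S0.
  - by apply/measurable_EFinP; exact: measurable_indic.
  rewrite integral_indic// (_ : G i `&` B0 = G i); last by apply/setIidl => x [].
  by rewrite mulrC EFinM lee_wpmul2l// ?lee_fin ?eG//; exact: S0.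
pose k1 := e0 / (2 * b).
have k10 : 0 < k1 by rewrite divr_gt0// mulr_gt0//.
have slice y : s < v' y -> ((e0 / 2)%:E <= mu (B0 `&` [set z | (k1 * s <= w z y)%R]))%E.
  move=> sv; have vpos : 0 < v' y by exact: lt_trans sv.
  have := @reverse_markov _ _ _ mu B0 (w ^~ y) (v' y) (e0 * v' y) (k1 * v' y)
    mB0 fB0 (measurable_funTS (mwy y)) (ltW vpos).
  have h1 x : B0 x -> 0 <= w x y <= v' y by rewrite w0 wv.
  move=> /(_ h1 (ltW (mulr_gt0 k10 vpos)) (wint y)).
  have -> : e0 * v' y - k1 * v' y * fine (mu B0) = v' y * (e0 / 2).
    by rewrite -/b /k1; field; exact: lt0r_neq0.
  rewrite ler_pM2l// => h2.
  have mA1 : measurable (B0 `&` [set z | k1 * v' y <= w z y]).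
    by apply: measurable_set_ge => //; exact: measurable_funTS.
  have fA1 : (mu (B0 `&` [set z | (k1 * v' y <= w z y)%R]) < +oo)%E.
    by apply: le_measure_finite fB0 => // x [].
  apply: (@le_trans _ _ (mu (B0 `&` [set z | (k1 * v' y <= w z y)%R]))).
    by rewrite -(fineK (_ : mu _ \is a fin_num)) ?lee_fin// ge0_fin_numE.
  apply: le_measure; rewrite ?inE//.
    by apply: measurable_set_ge => //; exact: measurable_funTS.
  move=> z [Bz /= hz]; split => //=; apply: le_trans hz.
  by rewrite ler_pM2l// ltW.
pose P : set (T * T) := (B0 `*` A) `&` [set p | k1 * s <= w p.1 p.2].
have mP : measurable P.
  apply: measurable_set_ge; first exact: measurableX.
  exact: measurable_funTS.
pose f (p : T * T) : \bar R := (\1_P p)%:E.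
have mf : measurable_fun setT f by apply/measurable_EFinP; exact: measurable_indic.
have f0 p : (0 <= f p)%E by rewrite lee_fin.
have Fz z : B0 z -> (\int[mu]_y f (z, y))%E = mu (A `&` [set y | (k1 * s <= w z y)%R]).
  move=> Bz; rewrite -(setIT (A `&` _)) -integral_indic//; last first.
    by apply: measurable_set_ge => //; exact: measurable_funTS.
  apply: eq_integral => y _; rewrite /f !indicE; congr (_%:R%:E); congr nat_of_bool.
  by apply/idP/idP; rewrite !inE /P /=; [move=> [[]]|move=> []].
have Fz0 z : ~ B0 z -> (\int[mu]_y f (z, y))%E = 0%E.
  move=> nBz; rewrite integral0_eq// => y _; rewrite /f indicE memNset//.
  by move=> [[/= Bz]].
have Fy y : A y -> (\int[mu]_z f (z, y))%E = mu (B0 `&` [set z | (k1 * s <= w z y)%R]).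
  move=> Ay; rewrite -(setIT (B0 `&` _)) -integral_indic//; last first.
    by apply: measurable_set_ge => //; exact: measurable_funTS.
  apply: eq_integral => z _; rewrite /f !indicE; congr (_%:R%:E); congr nat_of_bool.
  by apply/idP/idP; rewrite !inE /P /=; [move=> [[]]|move=> []].
have ton : ((e0 / 2 * eta)%:E <= \int[mu]_z \int[mu]_y f (z, y))%E.
  rewrite fubini_tonelli//.
  apply: (@le_trans _ _ (\int[mu]_(y in A) (e0 / 2)%:E)%E).
    rewrite integral_cst// EFinM lee_wpmul2l// lee_fin; lra.
  apply: (@le_trans _ _ (\int[mu]_(y in A) \int[mu]_z f (z, y))%E).
    apply: ge0_le_integral => //.
    - by move=> y _; rewrite lee_fin; lra.
    - by apply: measurable_funTS; exact: (measurable_fun_fubini_tonelli_G (m1 := mu) f mf f0).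
    - by move=> y Ay; rewrite Fy//; apply: slice; case: Ay.
  apply: ge0_subset_integral => //.
  - exact: (measurable_fun_fubini_tonelli_G (m1 := mu) f mf f0).
  - by move=> y _; exact: integral_ge0.
pose F z := (\int[mu]_y f (z, y))%E.
have mF : measurable_fun setT F by exact: (measurable_fun_fubini_tonelli_F (m2 := mu) f mf f0).
have FB0 : (\int[mu]_z F z = \int[mu]_(z in B0) F z)%E.
  rewrite [RHS]integral_mkcond; apply: eq_integral => z _; rewrite patchE.
  by case: ifPn => //; rewrite notin_setE => /Fz0.
have AD : A `<=` D by move=> x [].
have Ff z : B0 z -> (F z <= mu D)%E.
  move=> Bz; rewrite /F Fz//; apply: le_measure; rewrite ?inE//.
    by apply: measurable_set_ge => //; exact: measurable_funTS.
  by move=> x [/AD].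
have Ffin z : B0 z -> F z \is a fin_num.
  move=> Bz; rewrite ge0_fin_numE; last by apply: integral_ge0.
  by apply: le_lt_trans (Ff z Bz) _.
have bD : b <= fine (mu D).
  by rewrite -lee_fin !fineK ?ge0_fin_numE//; apply: le_measure; rewrite ?inE.
have D0 : 0 < fine (mu D) by exact: lt_le_trans bD.
pose k2 := e0 * eta / (4 * b).
have k20 : 0 <= k2 by rewrite divr_ge0 ?mulr_ge0// ltW.
have mfF : measurable_fun B0 (fine \o F).
  by apply: measurableT_comp => //; exact: measurable_funTS.
have := @reverse_markov _ _ _ mu B0 (fine \o F) (fine (mu D)) (e0 / 2 * eta) k2
  mB0 fB0 mfF (ltW D0).
have h1 z : B0 z -> 0 <= (fine \o F) z <= fine (mu D).
  move=> Bz /=; rewrite fine_ge0 ?integral_ge0//=.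
  by rewrite -lee_fin !fineK ?Ffin ?Ff// ge0_fin_numE.
have h2 : ((e0 / 2 * eta)%:E <= \int[mu]_(x in B0) ((fine \o F) x)%:E)%E.
  apply: (le_trans ton); rewrite -/F FB0 le_eqVlt; apply/orP; left; apply/eqP.
  by apply: eq_integral => z; rewrite inE => Bz; rewrite /= fineK// Ffin.
move=> /(_ h1 k20 h2).
have -> : e0 / 2 * eta - k2 * fine (mu B0) = e0 * eta / 4.
  by rewrite -/b /k2; field; exact: lt0r_neq0.
set H := B0 `&` _ => hH.
have mH : measurable H by exact: measurable_set_ge.
have fH : (mu H < +oo)%E by apply: le_measure_finite fB0 => // x [].
exists H; split => //; first by move=> x [].
- rewrite -(fineK (_ : mu H \is a fin_num)) ?ge0_fin_numE// lee_fin.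
  by rewrite ler_pdivrMr ?mulr_gt0//; lra.
- move=> z [Bz /= kF]; exists (w z); split => //.
    apply: (@le_trans _ _ (\sum_(0 <= i < n) c i / t0)); last first.
      by rewrite -mulr_suml ler_piMl// invr_ge0 ltW.
    rewrite /w !big_nat; apply: ler_sum => i /andP[_ ilt]; rewrite indicE.
    case: (boolP (z \in G i)) => [|_]; last first.
      by rewrite mul0r divr_ge0 ?(ltW t00)// ltW//; have [] := h i ilt.
    by rewrite inE mul1r => -[].
  apply: (@le_trans _ _ (F z)); first by rewrite -(fineK (Ffin z Bz)) lee_fin.
  rewrite /F Fz//; apply: le_measure; rewrite ?inE.
  - by apply: measurable_set_ge => //; exact: measurable_funTS.
  - by apply: measurable_set_ge => //; exact: measurable_funTS.
  - by move=> y [/AD].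
Qed.

(** If members of the hull exceed 4^n on sets of measure at least eta, hull_select
    and a limsup give one point z and functions w_j in the cone with
    w_j(z) <= 1 / t0 and w_j of size 4^j on sets Q_j of fixed measure. A finite sum
    of the 2^-j w_j is then bounded at z and of size 2^N on most of the limsup of
    the Q_j, which for N large contradicts spreading from that limsup. *)
Lemma hull_bounded (eta : R) : 0 < eta -> exists t : R, forall v, hull v ->
  (mu (D `&` [set x | (t < v x)%R]) < eta%:E)%E.
Proof.
move=> eta0; apply: contrapT => /forallNP unb.
have {unb}ex n : {v | hull v /\ (eta%:E <= mu (D `&` [set x | (4 ^+ n < v x)%R]))%E}.
  apply: cid; have /existsNP[v /not_implyP[hv /negP]] := unb (4 ^+ n).
  by rewrite -leNgt => h; exists v.
have [t0 [e0 [t00 e00 base]]] := spread mB0 B0D B0pos.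
have base' u c x : S u -> 0 < c -> B0 x -> u x < c ->
    (e0%:E <= mu (B0 `&` [set z | (u z <= c / t0)%R]))%E.
  move=> Su c0 Bx uc; rewrite leNgt; apply/negP => small.
  have k0 : 0 < t0 / c by exact: divr_gt0.
  have := base _ (SZ (ltW k0) Su); rewrite (_ : [set z | _] = [set z | (u z <= c / t0)%R]).
    move=> /(_ small x Bx); apply/negP; rewrite -ltNge.
    by rewrite mulrAC ltr_pdivrMr// ltr_pM2l.
  by apply/seteqP; split => z /=; rewrite -ler_pdivlMl// invf_div mulr1.
have pos4 n : 0 < (4 : R) ^+ n by exact: exprn_gt0.
have selH n : {H : set T | [/\ measurable H, H `<=` B0,
    ((e0 * eta / (4 * fine (mu D)))%:E <= mu H)%E &
    forall z, H z -> exists w, [/\ S w, w z <= t0^-1 &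
      ((e0 * eta / (4 * b))%:E <=
         mu (D `&` [set y | (e0 / (2 * b) * 4 ^+ n <= w y)%R]))%E]]}.
  apply: cid; have [hv etav] := svalP (ex n).
  exact: (hull_select t00 e00 eta0 (pos4 n) base' hv etav).
pose H n := sval (selH n).
have D0 : 0 < fine (mu D).
  apply: (lt_le_trans b0); rewrite -lee_fin !fineK ?ge0_fin_numE//.
  by apply: le_measure; rewrite ?inE.
have [z zH] : lim_sup_set H !=set0.
  apply/set0P/eqP => H0.
  have : ((e0 * eta / (4 * fine (mu D)))%:E <= mu (lim_sup_set H))%E.
    apply: (limsup_measure_ge mD fD) => n; have [h1 h2 h3 _] := svalP (selH n) => //.
    by move=> x /h2 /B0D.
  rewrite H0 measure0 lee_fin leNgt divr_gt0 ?mulr_gt0//.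
have {}zH j : {k | (j <= k)%N /\ H k z}.
  by apply: cid; have [k /= jk Hk] := zH j I; exists k.
pose k1 := e0 / (2 * b).
have k10 : 0 < k1 by rewrite divr_gt0// mulr_gt0.
have selw j : {w | [/\ S w, w z <= t0^-1 &
    ((e0 * eta / (4 * b))%:E <= mu (D `&` [set y | (k1 * 4 ^+ j <= w y)%R]))%E]}.
  apply: cid; have [jk Hk] := svalP (zH j).
  have [_ _ _ /(_ z Hk)[w [Sw wz hw]]] := svalP (selH (sval (zH j))).
  exists w; split => //; apply: (le_trans hw); apply: le_measure; rewrite ?inE.
  - by apply: measurable_set_ge => //; apply: measurable_funTS; exact: Sm.
  - by apply: measurable_set_ge => //; apply: measurable_funTS; exact: Sm.
  - move=> y [Dy /= hy]; split => //=; apply: le_trans hy.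
    by rewrite ler_pM2l// ler_weXn2l// ler1n.
pose w j := sval (selw j).
have Sw j : S (w j) by have [] := svalP (selw j).
have wz j : w j z <= t0^-1 by have [] := svalP (selw j).
pose Q j := D `&` [set y | k1 * 4 ^+ j <= w j y].
have mQ j : measurable (Q j).
  by apply: measurable_set_ge => //; apply: measurable_funTS; exact: Sm.
have QD j : Q j `<=` D by move=> x [].
have Qge j : ((e0 * eta / (4 * b))%:E <= mu (Q j))%E by have [] := svalP (selw j).
pose A := lim_sup_set Q.
have mA : measurable A by apply: bigcapT_measurable => n; exact: bigcup_measurable.
have AD : A `<=` D by move=> x /(_ 0%N I)[k _ /QD].
have Apos : (0 < mu A)%E.
  apply: (@lt_le_trans _ _ (e0 * eta / (4 * b))%:E).
    by rewrite lte_fin divr_gt0 ?mulr_gt0.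
  exact: (limsup_measure_ge mD fD).
have [t1 [e1 [t10 e10 hA]]] := spread mA AD Apos.
have p3 : 0 < t0 * k1 * t1 by exact: mulr_gt0 (mulr_gt0 t00 k10) t10.
have [N hN] : exists N : nat, 4 / (t0 * k1 * t1) < 2 ^+ N.
  exists (Num.bound (4 / (t0 * k1 * t1))).
  apply: (lt_le_trans (archi_boundP _)); first exact: divr_ge0 (ltW p3).
  by rewrite -natrX ler_nat ltnW// ltn_expl.
have cov : A `<=` \bigcup_(k in [set k | (N <= k)%N]) Q k by move=> y /(_ N I).
have [M hM] := tail_measure_small mD fD mQ mA AD cov e10.
pose v y := \sum_(0 <= j < M | (N <= j)%N) 2^-1 ^+ j * w j y.
have Sv : S v.
  apply: (@S_sum 0 M (fun j y => 2^-1 ^+ j * w j y) (fun j => (N <= j)%N)) => j _.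
  by apply: SZ => //; rewrite exprn_ge0// invr_ge0.
have kp : 0 < 2 / (k1 * 2 ^+ N) by rewrite divr_gt0// mulr_gt0// exprn_gt0.
have small : (mu (A `&` [set x | (2 / (k1 * 2 ^+ N) * v x <= 1)%R]) < e1%:E)%E.
  apply: le_lt_trans hM; apply: le_measure; rewrite ?inE.
  - apply: measurable_set_le => //; apply: measurable_funTS; apply: Sm.
    by apply: SZ => //; exact: ltW.
  - by apply: measurableD => //; exact: bigcup_measurable.
  - move=> y [Ay /= vy]; split => // -[j /= /andP[Nj jM] [_ /= wj]].
    move: vy; apply/negP; rewrite -ltNge.
    have vge : k1 * 2 ^+ N <= v y.
      apply: (@le_trans _ _ (2^-1 ^+ j * w j y)).
        apply: (@le_trans _ _ (2^-1 ^+ j * (k1 * 4 ^+ j))); last first.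
          by rewrite ler_wpM2l// exprn_ge0// invr_ge0.
        rewrite mulrCA -exprMn (_ : 2^-1 * 4 = 2); last by field.
        by rewrite ler_pM2l// ler_weXn2l// ler1n.
      rewrite /v big_mkcond/= (bigD1_seq j)/= ?mem_index_iota ?iota_uniq//=.
      rewrite Nj lerDl sumr_ge0// => i _; case: ifP => // _.
      by rewrite mulr_ge0 ?S0// exprn_ge0// invr_ge0.
    apply: (@lt_le_trans _ _ (2 / (k1 * 2 ^+ N) * (k1 * 2 ^+ N))); last by rewrite ler_pM2l.
    by rewrite divfK ?ltr1n// gt_eqF// mulr_gt0// exprn_gt0.
have geo : \sum_(0 <= j < M) 2^-1 ^+ j <= 2 :> R.
  have -> : \sum_(0 <= j < M) 2^-1 ^+ j = 2 - 2 * 2^-1 ^+ M :> R.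
    elim: M {hM v Sv small} => [|M IH]; first by rewrite big_nil expr0; ring.
    by rewrite big_nat_recr//= IH exprS; field.
  by rewrite lerBlDr lerDl mulr_ge0// exprn_ge0// invr_ge0.
have Bz : B0 z by have [_ Hk] := svalP (zH 0%N); have [_ h _ _] := svalP (selH (sval (zH 0%N))); exact: h.
have := hA _ (SZ (ltW kp) Sv) small z Bz; apply/negP; rewrite -ltNge.
have vz : v z <= t0^-1 * 2.
  apply: (@le_trans _ _ (\sum_(0 <= j < M) 2^-1 ^+ j * t0^-1)).
    rewrite /v big_mkcond/=; apply: ler_sum => j _.
    have p2 : 0 <= (2^-1 : R) ^+ j by rewrite exprn_ge0// invr_ge0.
    by case: ifP => _; [rewrite ler_wpM2l|rewrite mulr_ge0// invr_ge0 ltW].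
  by rewrite -mulr_suml mulrC ler_pM2l// invr_gt0.
apply: (@le_lt_trans _ _ (2 / (k1 * 2 ^+ N) * (t0^-1 * 2))); first by rewrite ler_pM2l.
move: hN; rewrite ltr_pdivrMr// => hN.
have p2 : 0 < (2 : R) ^+ N by rewrite exprn_gt0.
rewrite -subr_gt0; set z2 := 2 ^+ N in hN p2 *.
have -> : t1 - 2 / (k1 * z2) * (t0^-1 * 2) = (z2 * (t0 * k1 * t1) - 4) / (k1 * z2 * t0).
  by field; do ?[apply/andP; split]; exact: lt0r_neq0.
by apply: divr_gt0; [rewrite subr_gt0|exact: mulr_gt0 (mulr_gt0 k10 p2) t00].
Qed.

(** If u < c at a point of B0, then u / c belongs to the hull. *)
Theorem cone_weight : exists chi : T -> R, [/\ measurable_fun D chi,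
  forall x, 0 < chi x <= 1 &
  forall u c x, S u -> 0 < c -> B0 x -> u x < c ->
    (\int[mu]_(y in D) (u y * chi y)%:E <= (c * fine (mu D))%:E)%E].
Proof.
have [|||||chi [mchi chi01 hchi]] := @numeraire _ _ _ mu D mD fD hull.
- by move=> v /hull_S /Sm h; exact: measurable_funTS.
- by move=> v /hull_S h x _; exact: S0.
- exact: hull_convex.
- exists (fun y => \sum_(0 <= i < 0) 0); exists 0%N, (fun=> fun=> 0), (fun=> 0); split => //.
  by rewrite big_nil.
- exact: hull_bounded.
exists chi; split => // u c x Su c0 Bx uc.
have := hchi _ (hull_base Su c0 Bx uc).
under eq_integral do rewrite -mulrA EFinM.
rewrite ge0_integralZl_EFin//.
- move=> h; have := lee_wpmul2l (_ : (0 <= c%:E)%E) h.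
  rewrite muleA -EFinM divff ?gt_eqF// mul1e EFinM fineK ?ge0_fin_numE//.
  by apply; rewrite lee_fin ltW.
- move=> y _; rewrite lee_fin; apply: mulr_ge0; first exact: S0.
  by have /andP[/ltW] := chi01 y.
- apply/measurable_EFinP; apply: measurable_funM => //.
  by apply: measurable_funTS; exact: Sm.
- by rewrite invr_ge0 ltW.
Qed.

End cone.

(** * Lebesgue measure on row vectors *)

Section real_continuity.
Variables (T : topologicalType) (R : realType).
Implicit Types f g : T -> R.

Lemma cont_cst (c : R) : continuous (fun _ : T => c).
Proof. by move=> x; exact: cvg_cst. Qed.

Lemma contD f g : continuous f -> continuous g -> continuous (fun x => f x + g x).
Proof. by move=> cf cg x; exact: (cvgD (cf x) (cg x)). Qed.

Lemma contB f g : continuous f -> continuous g -> continuous (fun x => f x - g x).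
Proof. by move=> cf cg x; exact: (cvgB (cf x) (cg x)). Qed.

Lemma contM f g : continuous f -> continuous g -> continuous (fun x => f x * g x).
Proof. by move=> cf cg x; exact: (cvgM (cf x) (cg x)). Qed.

Lemma contMax f g : continuous f -> continuous g -> continuous (fun x => Num.max (f x) (g x)).
Proof. by move=> cf cg x; exact: (continuous_max (cf x) (cg x)). Qed.

Lemma contMin f g : continuous f -> continuous g -> continuous (fun x => Num.min (f x) (g x)).
Proof. by move=> cf cg x; exact: (continuous_min (cf x) (cg x)). Qed.

Lemma cont_prod (I : Type) (s : seq I) (F : I -> T -> R) :
  (forall i, continuous (F i)) -> continuous (fun x => \prod_(i <- s) F i x).
Proof.
move=> cF; elim: s => [|i s IH].
  by under eq_fun do rewrite big_nil; exact: cont_cst.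
by under eq_fun do rewrite big_cons; exact: contM.
Qed.

Lemma cont_sum (I : Type) (s : seq I) (F : I -> T -> R) :
  (forall i, continuous (F i)) -> continuous (fun x => \sum_(i <- s) F i x).
Proof.
move=> cF; elim: s => [|i s IH].
  by under eq_fun do rewrite big_nil; exact: cont_cst.
by under eq_fun do rewrite big_cons; exact: contD.
Qed.

End real_continuity.

Lemma EFin_Rintegral d (T : measurableType d) (R : realType)
  (mu : {measure set T -> \bar R}) (D : set T) (f : T -> R) :
  measurable D -> mu.-integrable D (EFin \o f) ->
  (\int[mu]_(x in D) (f x)%:E = (\int[mu]_(x in D) f x)%:E)%E.
Proof. by move=> mD fi; rewrite /Rintegral fineK//; exact: integrable_fin_num. Qed.

Section rV_norm.
Variables (R : realType) (n : nat).
Implicit Types v : 'rV[R]_n.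

Lemma rV_coord_le v i : `|v ord0 i| <= `|v|.
Proof.
have /mapP[j Hj ->] : `|v ord0 i| \in [seq `|v x.1 x.2| | x : 'I_1 * 'I_n].
  by apply/mapP; exists (ord0, i) => //=; rewrite mem_enum.
by rewrite [leRHS]/Num.norm /= mx_normrE; apply/bigmax_geP; right => /=; exists j.
Qed.

Lemma rV_norm_le v (r : R) : 0 <= r -> (forall i, `|v ord0 i| <= r) -> `|v| <= r.
Proof.
move=> r0 h; rewrite [leLHS]/Num.norm /= mx_normrE; apply: bigmax_le => //= -[i j] _.
by rewrite (ord1 i); exact: h.
Qed.

Lemma continuous_rV_coord (i : 'I_n) : continuous (fun v : 'rV[R]_n => v ord0 i).
Proof. exact: coord_continuous. Qed.

End rV_norm.

Section boxes.
Variables (R : realType) (n : nat).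
Local Notation E := 'rV[R]_n.
Local Notation mu := (lebesgue_rV R n).

Definition ocbox (a b : 'I_n -> R) : set E := [set v | forall i, a i < v ord0 i <= b i].

Definition ocboxes : set (set E) := [set A | exists a b, A = ocbox a b].

Lemma measurable_coord_box (I : 'I_n -> set R) : (forall i, measurable (I i)) ->
  measurable [set v : E | forall i, I i (v ord0 i)].
Proof.
move=> mI; rewrite (_ : [set v | _] = \bigcap_(i in [set: 'I_n])
    (fun v : E => v ord0 i) @^-1` I i).
  apply: fin_bigcap_measurable; first exact: finite_finset.
  by move=> i _; rewrite -[X in measurable X]setTI; exact: measurable_rV_coord.
by apply/seteqP; split => [x h i _|x h i]; [exact: h | exact: (h i)].
Qed.

Lemma ocboxE a b : ocbox a b = [set v : E | forall i, `]a i, b i]%classic (v ord0 i)].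
Proof. by apply/seteqP; split => v h i; have := h i; rewrite /= in_itv. Qed.

Lemma measurable_ocbox a b : measurable (ocbox a b).
Proof. rewrite ocboxE; apply: (@measurable_coord_box (fun i => `]a i, b i]%classic)) => i.
exact: measurable_itv. Qed.

Lemma ocbox_measure a b : mu (ocbox a b) = (\prod_(i < n) (Num.max 0 (b i - a i)))%:E.
Proof.
rewrite ocboxE (@lebesgue_rV_box R n (fun i => `]a i, b i]%classic)); last first.
  by move=> i; exact: measurable_itv.
rewrite -prodEFin; apply: eq_bigr => i _; rewrite lebesgue_measure_itv/= lte_fin.
case: ltP => ab; first by rewrite max_r ?subr_ge0 ?(ltW ab)// EFinB.
by rewrite max_l// subr_le0.
Qed.

Lemma ocbox_finite a b : (mu (ocbox a b) < +oo)%E.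
Proof. by rewrite ocbox_measure ltry. Qed.

Lemma ocboxes_setI : setI_closed ocboxes.
Proof.
move=> _ _ [a [b ->]] [a' [b' ->]].
exists (fun i => Num.max (a i) (a' i)), (fun i => Num.min (b i) (b' i)).
apply/seteqP; split => v /=.
  by move=> [h h'] i; have /andP[? ?] := h i; have /andP[? ?] := h' i;
    rewrite gt_max le_min; apply/andP; split; apply/andP.
by move=> h; split => i; have := h i; rewrite gt_max le_min =>
  /andP[/andP[h1 h2] /andP[h3 h4]]; apply/andP.
Qed.

Lemma norm_lt_archi (v : E) : exists k : nat, `|v| < k%:R.
Proof. by exists (Num.bound `|v|); exact: archi_boundP. Qed.

Lemma measurable_rV_ocboxes : @measurable _ E = <<s ocboxes >>.
Proof.
apply/seteqP; split; last first.
  apply: smallest_sub; first exact: sigma_algebra_measurable.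
  by move=> _ [a [b ->]]; exact: measurable_ocbox.
have mid : measurable_fun setT (fun v : g_sigma_algebraType ocboxes => v : E).
  apply: measurable_fun_rV => i.
  apply: (measurability _ (RGenOInfty.measurableE R)) => _ [_ [x ->] <-].
  rewrite setTI (_ : _ @^-1` _ = \bigcup_k ocbox
    (fun j => if j == i then x else - k%:R) (fun=> k%:R)).
    by apply: bigcupT_measurable => k; apply: sub_sigma_algebra; exists
      (fun j => if j == i then x else - k%:R), (fun=> k%:R).
  apply/seteqP; split => [v|v [k _] h] /=; rewrite in_itv/= andbT; last first.
    by have := h i; rewrite eqxx => /andP[].
  move=> xv; have [k hk] := norm_lt_archi v; exists k => // j.
  have := rV_coord_le v j => /le_lt_trans/(_ hk); rewrite ltr_norml => /andP[h1 h2].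
  case: eqP => [e|_]; first by move: h2; rewrite e xv => /ltW.
  by rewrite h1 ltW.
by move=> A mA; have := mid measurableT A mA; rewrite setTI.
Qed.

Lemma translate_measurable (a : E) : measurable_fun setT (fun v : E => v + a).
Proof.
apply: continuous_measurable_rV_rV => x.
by apply: (@cvgD _ _ _ (nbhs x)); [exact: cvg_id|exact: cvg_cst].
Qed.

(** The half-open boxes are stable under intersection and generate the Borel sets,
    so it suffices to compare the two measures on boxes. *)
Lemma translation_invariant (a : E) A : measurable A ->
  mu ((fun v : E => v + a) @^-1` A) = mu A.
Proof.
move=> mA; apply/esym.
apply: (@measure_unique _ _ _ ocboxes (fun k => ocbox (fun=> - k%:R) (fun=> k%:R))
  _ _ _ _ mu (measure_function_pushforward__canonical__measure_function_Measure
    mu (translate_measurable a))) => //.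
- exact: measurable_rV_ocboxes.
- exact: ocboxes_setI.
- by move=> k; exists (fun=> - k%:R), (fun=> k%:R).
- apply/seteqP; split => // v _; have [k hk] := norm_lt_archi v; exists k => // j.
  have := rV_coord_le v j => /le_lt_trans/(_ hk); rewrite ltr_norml => /andP[h1 h2].
  by rewrite h1 ltW.
- move=> _ [b [c ->]]; rewrite /= /pushforward.
  rewrite (_ : _ @^-1` _ = ocbox (fun i => b i - a ord0 i) (fun i => c i - a ord0 i)).
    rewrite !ocbox_measure; congr (_%:E); apply: eq_bigr => i _; congr Num.max; ring.
  by apply/seteqP; split => v /= h i; have := h i; rewrite !mxE ltrBlDr lerBrDr.
- by move=> k; exact: ocbox_finite.
Qed.

Lemma ge0_integral_translate (a : E) (f : E -> \bar R) : measurable_fun setT f ->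
  (forall x, 0 <= f x)%E -> (\int[mu]_x f (x + a)%R = \int[mu]_x f x)%E.
Proof.
move=> mf f0.
have := @ge0_integral_pushforward _ _ E E _ (fun v : E => v + a) (translate_measurable a) mu
  setT f measurableT mf (fun y _ => f0 y).
rewrite preimage_setT => <-; apply: eq_measure_integral => //=.
  exact: translate_measurable.
by move=> _ A mA _; exact: translation_invariant.
Qed.

Lemma bounded_measure_finite (A : set E) (r : R) : measurable A ->
  (forall x, A x -> `|x| <= r) -> (mu A < +oo)%E.
Proof.
move=> mA Ar; apply: (@le_measure_finite _ _ _ mu _ (ocbox (fun=> - (`|r| + 1)) (fun=> `|r| + 1))) => //.
- exact: measurable_ocbox.
- move=> v /Ar vr i; have := le_trans (rV_coord_le v i) vr.
  rewrite ler_norml => /andP[h1 h2]; have := ler_norm r => h3; apply/andP; split; lra.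
- exact: ocbox_finite.
Qed.

End boxes.

(** * Density of continuous functions in L1 *)

Section L1_density.
Variables (R : realType) (n : nat).
Local Notation E := 'rV[R]_n.
Local Notation mu := (lebesgue_rV R n).
Variable Om : set E.
Hypotheses (mOm : measurable Om) (fOm : (mu Om < +oo)%E).

Definition L1_approx (f : E -> R) := forall e : R, 0 < e -> exists h : E -> R,
  [/\ continuous h, exists M : R, forall x, `|h x| <= M &
      (\int[mu]_(x in Om) `|f x - h x|%:E <= e%:E)%E].

Lemma L1_approxD f g : measurable_fun Om f -> measurable_fun Om g ->
  L1_approx f -> L1_approx g -> L1_approx (fun x => f x + g x).
Proof.
move=> mf mg af ag e e0; have e20 : 0 < e / 2 by exact: divr_gt0.
have [h [ch [M hM] ih]] := af _ e20; have [k [ck [M' kM] ik]] := ag _ e20.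
exists (fun x => h x + k x); split.
- exact: contD.
- by exists (M + M') => x; rewrite (le_trans (ler_normD _ _))// lerD.
- have mh := measurable_funTS (D := Om) (continuous_measurable_rV ch).
  have mk := measurable_funTS (D := Om) (continuous_measurable_rV ck).
  have mfh : measurable_fun Om (fun x => `|f x - h x|).
    by apply: measurableT_comp => //; exact: measurable_funB.
  have mgk : measurable_fun Om (fun x => `|g x - k x|).
    by apply: measurableT_comp => //; exact: measurable_funB.
  rewrite (splitr e) EFinD; apply: le_trans (leeD ih ik).
  rewrite -ge0_integralD//; last 2 first.
  - exact/measurable_EFinP.
  - exact/measurable_EFinP.
  apply: ge0_le_integral => //.
  - apply/measurable_EFinP; apply: measurableT_comp => //.
    by apply: measurable_funB; exact: measurable_funD.
  - by apply/measurable_EFinP; exact: measurable_funD.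
  - move=> x _; rewrite lee_fin (_ : _ - _ = (f x - h x) + (g x - k x)); last ring.
    exact: ler_normD.
Qed.

Lemma L1_approxZ c f : measurable_fun Om f -> L1_approx f -> L1_approx (fun x => c * f x).
Proof.
move=> mf af e e0; have c0 : 0 < `|c| + 1 by rewrite ltr_wpDl.
have [h [ch [M hM] ih]] := af _ (divr_gt0 e0 c0).
have mh := measurable_funTS (D := Om) (continuous_measurable_rV ch).
have mfh : measurable_fun Om (fun x => `|f x - h x|).
  by apply: measurableT_comp => //; exact: measurable_funB.
exists (fun x => c * h x); split.
- by apply: contM => //; exact: cont_cst.
- by exists (`|c| * M) => x; rewrite normrM ler_wpM2l.
- under eq_integral do rewrite -mulrBr normrM EFinM.
  rewrite ge0_integralZl_EFin//; last exact/measurable_EFinP.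
  apply: (le_trans (lee_wpmul2l _ ih)); first by rewrite lee_fin.
  by rewrite -EFinM lee_fin mulrCA ger_pMr// ler_pdivrMr// mul1r lerDl.
Qed.

(** L1_approx for an indicator function, with approximants kept in [0, 1] so that
    complements and unions can be formed on the approximants. *)
Definition set_approx (A : set E) := measurable A /\ forall e : R, 0 < e ->
  exists h : E -> R, [/\ continuous h, forall x, 0 <= h x <= 1 &
      (\int[mu]_(x in Om) `|\1_A x - h x|%:E <= e%:E)%E].

Lemma set_approxC A : set_approx A -> set_approx (~` A).
Proof.
move=> [mA aA]; split; first exact: measurableC.
move=> e e0; have [h [ch h01 ih]] := aA e e0.
exists (fun x => 1 - h x); split.
- by apply: contB => //; exact: cont_cst.
- by move=> x; have := h01 x; lra.
- apply: le_trans ih; rewrite le_eqVlt; apply/orP; left; apply/eqP.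
  apply: eq_integral => x _; congr (_%:E).
  rewrite distrC; congr (`| _ |); rewrite !indicE in_setC; case: (x \in A) => /=; ring.
Qed.

Lemma set_approxU A B : set_approx A -> set_approx B -> set_approx (A `|` B).
Proof.
move=> [mA aA] [mB aB]; split; first exact: measurableU.
move=> e e0; have e20 : 0 < e / 2 by exact: divr_gt0.
have [h [ch h01 ih]] := aA _ e20; have [k [ck k01 ik]] := aB _ e20.
have mh := measurable_funTS (D := Om) (continuous_measurable_rV ch).
have mk := measurable_funTS (D := Om) (continuous_measurable_rV ck).
exists (fun x => Num.max (h x) (k x)); split.
- exact: contMax.
- move=> x; have /andP[a b] := h01 x; have /andP[a' b'] := k01 x.
  by rewrite le_max a/= ge_max b b'.
- have mfh C (g : E -> R) : measurable C -> measurable_fun Om g ->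
      measurable_fun Om (fun x => `|\1_C x - g x|).
    by move=> mC mg; apply: measurableT_comp => //; apply: measurable_funB => //; exact: measurable_indic.
  rewrite (splitr e) EFinD; apply: le_trans (leeD ih ik).
  rewrite -ge0_integralD//; last 2 first.
  - by apply/measurable_EFinP; exact: mfh.
  - by apply/measurable_EFinP; exact: mfh.
  apply: ge0_le_integral => //.
  - apply/measurable_EFinP; apply: mfh; [exact: measurableU|exact: measurable_maxr].
  - by apply/measurable_EFinP; apply: measurable_funD; exact: mfh.
  - move=> x _; rewrite lee_fin !indicE in_setU.
    have /andP[a b] := h01 x; have /andP[a' b'] := k01 x.
    have := ler_norm (1 - h x); have := ler_norm (1 - k x); have := ler_norm (h x); have := ler_norm (k x).
    case: (x \in A); case: (x \in B); rewrite /= ?mulr1n ?mulr0n;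
      case: (leP (h x) (k x)) => hk;
      rewrite ?(ger0_norm (_ : 0 <= 1 - h x)) ?(ger0_norm (_ : 0 <= 1 - k x)) ?sub0r ?normrN
        ?(ger0_norm a) ?(ger0_norm a'); lra.
Qed.

Lemma set_approx_bigcup (F : nat -> set E) :
  (forall k, set_approx (F k)) -> set_approx (\bigcup_k F k).
Proof.
move=> aF; have mF k : measurable (F k) by case: (aF k).
have mU : measurable (\bigcup_k F k) by exact: bigcupT_measurable.
split => // e e0; have e20 : 0 < e / 2 by exact: divr_gt0.
pose A := Om `&` \bigcup_k F k.
have mA : measurable A by exact: measurableI.
have [||N hN] := @tail_measure_small _ _ _ mu F A Om 0%N (e / 2) mOm fOm mF mA _ _ e20.
- by move=> x [].
- by move=> x [_ [k _ Fk]]; exists k.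
pose G := \bigcup_(k in [set k | (0 <= k < N)%N]) F k.
have aG : set_approx G.
  rewrite /G; elim: N {hN G} => [|N IH].
    rewrite (_ : \bigcup_(k in _) _ = set0); last by apply/seteqP; split => // x [k].
    split => // e' e'0; exists (fun=> 0); split.
    - exact: cont_cst.
    - by move=> x; rewrite lexx ler01.
    - by under eq_integral do rewrite indic0 subr0 normr0; rewrite integral0 lee_fin ltW.
  rewrite (_ : \bigcup_(k in _) _ = \bigcup_(k in [set k | (0 <= k < N)%N]) F k `|` F N).
    by apply: set_approxU.
  apply/seteqP; split => x.
    move=> [k /= kN Fk]; have := kN; rewrite ltnS leq_eqVlt => /orP[/eqP <-|kN']; first by right.
    by left; exists k.
  by move=> [[k /= kN Fk]|FN]; [exists k => //=; exact: ltnW|exists N => //=].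
have [mG /(_ _ e20)[h [ch h01 ih]]] := aG.
exists h; split => //.
have mh := measurable_funTS (D := Om) (continuous_measurable_rV ch).
have mfh C : measurable C -> measurable_fun Om (fun x => `|\1_C x - h x|).
  by move=> mC; apply: measurableT_comp => //; apply: measurable_funB => //; exact: measurable_indic.
have mD : measurable (A `\` G) by exact: measurableD.
apply: (@le_trans _ _ (\int[mu]_(x in Om) ((\1_(A `\` G) x)%:E + `|\1_G x - h x|%:E))%E).
  apply: ge0_le_integral => //.
  - by apply/measurable_EFinP; exact: mfh.
  - by apply/measurable_EFinP; apply: measurable_funD; [exact: measurable_indic|exact: mfh].
  - move=> x Omx; rewrite lee_fin; have [Gx|nGx] := pselect (G x).
      have Ux : (\bigcup_k F k) x by have [k _ Fk] := Gx; exists k.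
      by rewrite !indicE (mem_set Gx) (mem_set Ux) memNset ?add0r// => -[].
    have [Ux|nUx] := pselect ((\bigcup_k F k) x).
      rewrite !indicE (memNset nGx) (mem_set Ux) mem_set//=.
      by have := h01 x => /andP[a b]; rewrite sub0r normrN !ger0_norm; lra.
    by rewrite !indicE (memNset nGx) (memNset nUx) lerDr.
rewrite ge0_integralD//; last 2 first.
- by apply/measurable_EFinP; exact: measurable_indic.
- by apply/measurable_EFinP; exact: mfh.
rewrite (splitr e) EFinD; apply: leeD => //.
rewrite integral_indic//; apply: le_trans (ltW hN).
apply: le_measure; rewrite ?inE//; exact: measurableI.
Qed.

Lemma set_approx_ocbox a b : set_approx (ocbox a b).
Proof.
split; first exact: measurable_ocbox.
move=> e e0.
pose tau (k : nat) (i : 'I_n) (t : R) :=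
  Num.min 1 (k%:R * Num.max 0 (t - a i)) * (1 - Num.min 1 (k%:R * Num.max 0 (t - b i))).
have tau01 k i t : 0 <= tau k i t <= 1.
  have h (u : R) : (0 : R) <= Num.min 1 (k%:R * Num.max 0 u) <= 1.
    by rewrite le_min ler01 mulr_ge0 ?ler0n ?le_max ?lexx//= ge_min lexx.
  have /andP[a1 a2] := h (t - a i); have /andP[b1 b2] := h (t - b i).
  by rewrite /tau; apply/andP; split; nra.
have cmin k (c : R) : continuous (fun t : R => Num.min 1 (k%:R * Num.max 0 (t - c)) : R).
  apply: contMin; first exact: cont_cst.
  apply: contM; first exact: cont_cst.
  apply: contMax; first exact: cont_cst.
  by apply: contB; [move=> t; exact: cvg_id|exact: cont_cst].
have ctau k i : continuous (tau k i).
  by apply: contM; [exact: cmin|apply: contB; [exact: cont_cst|exact: cmin]].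
pose h k (v : E) := \prod_(i < n) tau k i (v ord0 i).
have ch k : continuous (h k).
  apply: cont_prod => i v.
  exact: (continuous_comp (@coord_continuous _ _ _ ord0 i v) (ctau k i (v ord0 i))).
have h01 k v : 0 <= h k v <= 1.
  apply/andP; split; first by apply: prodr_ge0 => i _; have /andP[] := tau01 k i (v ord0 i).
  by apply: prodr_ile1 => i _; exact: tau01.
have big (u : R) : 0 < u -> exists K : nat, forall k, (K <= k)%N -> 1 <= k%:R * u.
  move=> u0; exists (Num.bound u^-1) => k Kk; rewrite -ler_pdivrMr// mul1r.
  apply: (le_trans (ltW (archi_boundP _))); first by rewrite invr_ge0 ltW.
  by rewrite ler_nat.
have min1 k u : u <= 0 -> Num.min 1 (k%:R * Num.max 0 u) = 0 :> R.
  by move=> u0; rewrite max_l// mulr0 min_r.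
have min2 k u : 0 < u -> 1 <= k%:R * u -> Num.min 1 (k%:R * Num.max 0 u) = 1 :> R.
  by move=> u0 ku; rewrite (max_r (ltW u0)) min_l.
have lim v : exists K : nat, forall k, (K <= k)%N -> h k v = \1_(ocbox a b) v.
  have [vin|vout] := pselect (ocbox a b v).
    have ex i : {K : nat | forall k, (K <= k)%N -> tau k i (v ord0 i) = 1}.
      apply: cid; have /andP[av vb] := vin i.
      have av' : 0 < v ord0 i - a i by rewrite subr_gt0.
      have [K hK] := big _ av'; exists K => k /hK kK.
      by rewrite /tau (min2 _ _ av' kK) min1 ?subr_le0// subr0 mul1r.
    exists (\max_(i < n) sval (ex i))%N => k Kk; rewrite indicE mem_set//= /h.
    apply: big1 => i _; apply: (svalP (ex i)).
    exact: leq_trans (leq_bigmax i) Kk.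
  have /existsNP[i /negP] := vout; rewrite negb_and -leNgt -ltNge => vi.
  suff [K hK] : exists K : nat, forall k, (K <= k)%N -> tau k i (v ord0 i) = 0.
    exists K => k /hK tk; rewrite indicE memNset//= /h.
    by rewrite (bigD1 i)//= tk mul0r.
  case/orP: vi => [va|bv].
    by exists 0%N => k _; rewrite /tau min1 ?subr_le0// mul0r.
  have bv' : 0 < v ord0 i - b i by rewrite subr_gt0.
  have [K hK] := big _ bv'; exists K => k /hK kK.
  by rewrite /tau (min2 _ _ bv' kK) subrr mulr0.
have mh k := measurable_funTS (D := Om) (continuous_measurable_rV (ch k)).
have mB := measurable_ocbox a b.
have [||||_ c] := @bounded_cvg_Rintegral _ _ _ mu Om mOm fOm
    (fun k x => `|\1_(ocbox a b) x - h k x|) (fun=> 0) 1.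
- by move=> k; apply: measurableT_comp => //; apply: measurable_funB.
- by [].
- move=> k x _; have := h01 k x => /andP[h0 h1]; rewrite normr_id indicE.
  by case: (x \in _) => /=; rewrite ler_norml; apply/andP; split; lra.
- apply: aeW => x _; apply: cvg_near_cst; have [K hK] := lim x.
  by exists K => // k /= /hK ->; rewrite subrr normr0.
move: c; rewrite Rintegral_cst// mul0r => /cvgr0_norm_lt/(_ _ e0)[K _ /(_ K (leqnn K))].
move=> hK; exists (h K); split => //.
rewrite EFin_Rintegral//; first by rewrite lee_fin; exact: le_trans (ler_norm _) (ltW hK).
apply: (@bounded_integrable _ _ _ _ _ mOm fOm _ 1).
  by apply: measurableT_comp => //; apply: measurable_funB.
move=> x _; have := h01 K x => /andP[h0 h1]; rewrite normr_id indicE.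
by case: (x \in _) => /=; rewrite ler_norml; apply/andP; split; lra.
Qed.

(** The sets with this property form a sigma-algebra that contains the boxes. *)
Lemma set_approx_measurable A : measurable A -> set_approx A.
Proof.
rewrite measurable_rV_ocboxes; apply: smallest_sub; last first.
  by move=> _ [a [b ->]]; exact: set_approx_ocbox.
split.
- rewrite -(setCK set0); apply: set_approxC; rewrite setC0.
  split => // e e0; exists (fun=> 1); split; [exact: cont_cst|by move=> x; rewrite ler01 lexx|].
  by under eq_integral do rewrite indicT subrr normr0; rewrite integral0 lee_fin ltW.
- by move=> A0 hA; rewrite setTD; exact: set_approxC.
- exact: set_approx_bigcup.
Qed.

Import HBSimple.

Lemma L1_approx_integrable f : mu.-integrable Om (EFin \o f) -> L1_approx f.
Proof.
move=> fi e e0; have e20 : 0 < e / 2 by exact: divr_gt0.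
have [g [gi gf gL]] := approximation_sfun_integrable mOm fi.
have [k hk] : exists k, (\int[mu]_(x in Om) `|(f x)%:E - (g k x)%:E| <= (e / 2)%:E)%E.
  have : nbhs (0%E : \bar R) [set x | (x < (e / 2)%:E)%E].
    by apply: open_nbhs_nbhs; split; [exact: open_ereal_lt_ereal|rewrite /= lte_fin].
  by move=> /gL[K _ h]; exists K; apply: ltW; exact: (h K (leqnn K)).
have mf : measurable_fun Om f by apply/measurable_EFinP; exact: measurable_int fi.
have ag : L1_approx (g k).
  have -> : (g k : E -> R) = fun x => \sum_(y <- finmap.enum_fset (fset_set (range (g k)))) y * \1_(g k @^-1` [set y]) x.
    by apply/funext => x; rewrite {1}fimfunE fsbig_finite.
  elim: (finmap.enum_fset _) => [|y s IH].
    move=> e' e'0; exists (fun=> 0); split; first exact: cont_cst.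
      by exists 0 => x; rewrite normr0.
    under eq_integral do rewrite big_nil subr0 normr0.
    by rewrite integral0 lee_fin ltW.
  under eq_fun do rewrite big_cons.
  have mi z : measurable (g k @^-1` [set z] : set E) by rewrite -[X in measurable X]setTI; exact: measurable_funP.
  apply: L1_approxD => //.
  - by apply: measurable_funM => //; exact: measurable_indic.
  - by apply: measurable_sum => z; apply: measurable_funM => //; exact: measurable_indic.
  - apply: L1_approxZ; first exact: measurable_indic.
    move=> e' e'0; have [_ /(_ e' e'0)[h [ch h01 ih]]] := set_approx_measurable (mi y).
    by exists h; split => //; exists 1 => x; have /andP[a b] := h01 x; rewrite ger0_norm.
have [h [ch [M hM] ih]] := ag _ e20.
exists h; split; [by []|by exists M|].
have mh := measurable_funTS (D := Om) (continuous_measurable_rV ch).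
rewrite (splitr e) EFinD; apply: le_trans (leeD hk ih).
have mg : measurable_fun Om (g k) by apply: measurable_funTS; exact: measurable_funP.
rewrite -ge0_integralD//; last 2 first.
- by apply: measurableT_comp => //; apply: emeasurable_funB; exact/measurable_EFinP.
- by apply/measurable_EFinP; apply: measurableT_comp => //; exact: measurable_funB.
apply: ge0_le_integral => //.
- by apply/measurable_EFinP; apply: measurableT_comp => //; exact: measurable_funB.
- apply: emeasurable_funD.
    by apply: measurableT_comp => //; apply: emeasurable_funB; exact/measurable_EFinP.
  by apply/measurable_EFinP; apply: measurableT_comp => //; exact: measurable_funB.
- move=> x _; rewrite -EFinB lee_fin (_ : _ - _ = (f x - g k x) + (g k x - h x)); last ring.
  exact: ler_normD.
Qed.

End L1_density.

(** * Mollification *)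

Section integrable_facts.
Context d (T : measurableType d) (R : realType).
Variable mu : {measure set T -> \bar R}.

Lemma integrable_mul_bounded (D : set T) (f g : T -> R) (M : R) :
  measurable D -> mu.-integrable D (EFin \o f) -> measurable_fun D g ->
  (forall x, D x -> `|g x| <= M) -> mu.-integrable D (EFin \o (fun x => f x * g x)).
Proof.
move=> mD fi mg gM.
have mf : measurable_fun D f by apply/measurable_EFinP; exact: measurable_int fi.
apply: (@le_integrable _ _ _ mu D mD _ (EFin \o (fun x => `|M| * f x))).
- by apply/measurable_EFinP; exact: measurable_funM.
- move=> x Dx /=; rewrite lee_fin !normrM normr_id mulrC ler_wpM2r//.
  by rewrite (le_trans (gM x Dx))// ler_norm.
- exact: (integrableZl mD `|M| fi).
Qed.

Lemma ge0_le_integralT (f g : T -> R) (D : set T) : measurable D ->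
  measurable_fun D f -> measurable_fun D g -> (forall x, D x -> 0 <= f x) ->
  (forall x, D x -> f x <= g x) ->
  (\int[mu]_(x in D) (f x)%:E <= \int[mu]_(x in D) (g x)%:E)%E.
Proof.
move=> mD mf mg f0 fg; apply: ge0_le_integral => //.
- exact/measurable_EFinP.
- exact/measurable_EFinP.
Qed.

End integrable_facts.

Section mollification.
Variables (R : realType) (n : nat).
Local Notation E := 'rV[R]_n.
Local Notation mu := (lebesgue_rV R n).

Record is_kernel (e : R) (rho : E -> R) : Prop := IsKernel {
  kernel_ge0 : forall z, 0 <= rho z ;
  kernel_sym : forall z, rho (- z) = rho z ;
  kernel_supp : forall z, e <= `|z| -> rho z = 0 ;
  kernel_lip : exists L, 0 <= L /\ forall x y, `|rho x - rho y| <= L * `|x - y| ;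
  kernel_bnd : exists M, forall z, rho z <= M ;
  kernel_int : (\int[mu]_z (rho z)%:E = 1)%E }.

Definition moll (rho f : E -> R) (x : E) : R := \int[mu]_z (f z * rho (x - z)).

Lemma lipschitz_continuous (f : E -> R) (L : R) :
  (forall x y, `|f x - f y| <= L * `|x - y|) -> continuous f.
Proof.
move=> fL x; apply/(@cvgrPdist_lt _ _ _ (nbhs x) _ f (f x)) => e e0.
have c0 : 0 < `|L| + 1 by rewrite ltr_wpDl.
apply: filterS (nbhsx_ballx x _ (divr_gt0 e0 c0)) => y.
rewrite -ball_normE /ball_/= => xy; apply: (le_lt_trans (fL x y)).
apply: (@le_lt_trans _ _ ((`|L| + 1) * `|x - y|)).
  by rewrite ler_wpM2r// (le_trans (ler_norm L))// lerDl.
by rewrite mulrC -ltr_pdivlMr.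
Qed.

Lemma contSub (x : E) : continuous (fun z : E => x - z).
Proof. by move=> z; apply: (@cvgB _ _ _ (nbhs z)); [exact: cvg_cst|exact: cvg_id]. Qed.

Section one_kernel.
Variables (e : R) (rho : E -> R).
Hypothesis hk : is_kernel e rho.

Lemma kernel_cont : continuous rho.
Proof. by have [L [_ hL]] := kernel_lip hk; exact: lipschitz_continuous hL. Qed.

Lemma kernel_shift_cont (x : E) : continuous (fun z : E => rho (x - z)).
Proof. by move=> z; exact: (continuous_comp (@contSub x z) (@kernel_cont (x - z))). Qed.

Lemma measurable_kernel_shift (x : E) : measurable_fun setT (fun z : E => rho (x - z)).
Proof. exact: continuous_measurable_rV (@kernel_shift_cont x). Qed.

Lemma measurable_kernel2 : measurable_fun setT (fun p : E * E => rho (p.1 - p.2)).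
Proof.
apply: (measurableT_comp (continuous_measurable_rV kernel_cont)).
apply: measurable_fun_rV => i.
rewrite (_ : (fun _ => _) = fun p : E * E => p.1 ord0 i - p.2 ord0 i); last first.
  by apply/funext => p; rewrite !mxE.
apply: measurable_funB.
  by apply: (measurableT_comp (@measurable_rV_coord R n i)); exact: measurable_fst.
by apply: (measurableT_comp (@measurable_rV_coord R n i)); exact: measurable_snd.
Qed.

Lemma kernel_int_l (z : E) : (\int[mu]_x (rho (x - z)%R)%:E = 1)%E.
Proof.
rewrite -(kernel_int hk).
rewrite -(@ge0_integral_translate R n (- z) (fun x => (rho x)%:E))//.
  by apply/measurable_EFinP; exact: continuous_measurable_rV kernel_cont.
by move=> x; rewrite lee_fin; exact: (kernel_ge0 hk).
Qed.

Lemma kernel_int_r (x : E) : (\int[mu]_z (rho (x - z)%R)%:E = 1)%E.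
Proof.
rewrite -(kernel_int_l x); apply: eq_integral => z _.
by rewrite -(kernel_sym hk) opprB.
Qed.

Lemma moll_integrable f (x : E) : mu.-integrable setT (EFin \o f) ->
  mu.-integrable setT (EFin \o (fun z : E => f z * rho (x - z))).
Proof.
move=> fi; have [M hM] := kernel_bnd hk.
apply: (@integrable_mul_bounded _ _ _ _ _ _ _ M) => //.
  exact: measurable_kernel_shift.
by move=> z _; rewrite ger0_norm//; exact: (kernel_ge0 hk).
Qed.

Lemma mollB (f g : E -> R) (x : E) : mu.-integrable setT (EFin \o f) -> mu.-integrable setT (EFin \o g) ->
  moll rho (fun z => f z - g z) x = moll rho f x - moll rho g x.
Proof.
move=> fi gi; rewrite /moll -RintegralB//; try exact: moll_integrable.
by apply: eq_Rintegral => z _; rewrite mulrBl.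
Qed.

Lemma moll_lip f : mu.-integrable setT (EFin \o f) ->
  exists L, 0 <= L /\ forall x y, `|moll rho f x - moll rho f y| <= L * `|x - y|.
Proof.
move=> fi; have [L [L0 hL]] := kernel_lip hk.
have nfi : mu.-integrable setT (EFin \o (fun z => `|f z|)) by exact: integrable_norm.
exists (L * \int[mu]_z `|f z|); split.
  by rewrite mulr_ge0//; exact: Rintegral_ge0.
move=> x y; rewrite /moll -RintegralB//; try exact: moll_integrable.
have di : mu.-integrable setT (EFin \o (fun z => f z * rho (x - z) - f z * rho (y - z))).
  by apply: (integrableB measurableT (moll_integrable x fi) (moll_integrable y fi)).
apply: (le_trans (le_normr_Rintegral measurableT di)).
rewrite mulrAC -RintegralZl//; apply: le_Rintegral => //.
- exact: integrable_norm.
- exact: (integrableZl measurableT _ nfi).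
- move=> z _; rewrite -mulrBr normrM mulrC ler_wpM2r//.
  by apply: (le_trans (hL _ _)); rewrite (_ : x - z - (y - z) = x - y)// opprB addrA subrK.
Qed.

Lemma moll_cont f : mu.-integrable setT (EFin \o f) -> continuous (moll rho f).
Proof. by move=> /moll_lip[L [_ h]]; exact: lipschitz_continuous h. Qed.

Lemma kernel_Rint (x : E) : \int[mu]_z rho (x - z) = 1.
Proof. by rewrite /Rintegral kernel_int_r. Qed.

Lemma kernel_integrable (x : E) : mu.-integrable setT (EFin \o (fun z : E => rho (x - z))).
Proof.
apply/integrableP; split; first by apply/measurable_EFinP; exact: measurable_kernel_shift.
under eq_integral do rewrite gee0_abs ?lee_fin ?(kernel_ge0 hk)//.
by rewrite kernel_int_r ltry.
Qed.

Lemma moll_near f (x : E) y (a : R) : mu.-integrable setT (EFin \o f) ->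
  (forall z, `|x - z| < e -> `|f z - y| <= a) -> `|moll rho f x - y| <= a.
Proof.
move=> fi fa.
have ci c : mu.-integrable setT (EFin \o (fun z => c * rho (x - z))).
  exact: (integrableZl measurableT _ (kernel_integrable x)).
have -> : moll rho f x - y = \int[mu]_z (f z * rho (x - z) - y * rho (x - z)).
  by rewrite RintegralB ?RintegralZl ?kernel_Rint ?mulr1//; try exact: moll_integrable;
    exact: kernel_integrable.
have di : mu.-integrable setT (EFin \o (fun z => f z * rho (x - z) - y * rho (x - z))).
  exact: (integrableB measurableT (moll_integrable x fi) (ci y)).
apply: (le_trans (le_normr_Rintegral measurableT di)).
rewrite -[leRHS]mulr1 -(kernel_Rint x) -RintegralZl//; last exact: kernel_integrable.
apply: le_Rintegral => //; first exact: integrable_norm.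
move=> z _; rewrite -mulrBl normrM (ger0_norm (kernel_ge0 hk _)).
have [xz|xz] := ltP `|x - z| e; first by rewrite ler_wpM2r ?(kernel_ge0 hk)// fa.
by rewrite (kernel_supp hk xz) !mulr0.
Qed.

Lemma moll_L1 f : mu.-integrable setT (EFin \o f) ->
  (\int[mu]_x `|moll rho f x|%:E <= \int[mu]_x `|f x|%:E)%E.
Proof.
move=> fi.
have mf : measurable_fun setT f by apply/measurable_EFinP; exact: measurable_int fi.
pose F (p : E * E) := (`|f p.2| * rho (p.1 - p.2))%:E : \bar R.
have mF : measurable_fun setT F.
  apply/measurable_EFinP; apply: measurable_funM; last exact: measurable_kernel2.
  by apply: measurableT_comp => //; apply: (measurableT_comp mf); exact: measurable_snd.
have F0 p : (0 <= F p)%E by rewrite lee_fin mulr_ge0//; exact: (kernel_ge0 hk).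
apply: (@le_trans _ _ (\int[mu]_x \int[mu]_z F (x, z))%E).
  apply: ge0_le_integral => //.
  - apply/measurable_EFinP; apply: measurableT_comp => //.
    exact: continuous_measurable_rV (moll_cont fi).
  - exact: (measurable_fun_fubini_tonelli_F (m2 := mu) F mF F0).
  - move=> x _; apply: (@le_trans _ _ (\int[mu]_z `|f z * rho (x - z)|)%:E).
      by rewrite lee_fin; apply: le_normr_Rintegral => //; exact: moll_integrable.
    rewrite -EFin_Rintegral//; last by apply: integrable_norm => //; exact: moll_integrable.
    rewrite le_eqVlt; apply/orP; left; apply/eqP; apply: eq_integral => z _.
    by rewrite /F/= normrM (ger0_norm (kernel_ge0 hk _)).
rewrite fubini_tonelli//.
rewrite le_eqVlt; apply/orP; left; apply/eqP; apply: eq_integral => z _.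
rewrite /F/=; under eq_integral do rewrite EFinM.
rewrite ge0_integralZl_EFin//.
- by rewrite kernel_int_l mule1.
- by move=> x _; rewrite lee_fin; exact: (kernel_ge0 hk).
- apply/measurable_EFinP; apply: continuous_measurable_rV => x.
  have cs : {for x, continuous (fun x : E => x - z)}.
    by apply: (@cvgB _ _ _ (nbhs x)); [exact: cvg_id|exact: cvg_cst].
  exact: (continuous_comp cs (@kernel_cont (x - z))).
Qed.

End one_kernel.

(** Mollification does not increase the L1 norm, so f can be replaced by a bounded
    continuous function, whose mollifications converge boundedly. *)
Lemma moll_cvg_L1 (rho_ : nat -> E -> R) (e_ : nat -> R) (f : E -> R) (r : R) :
  (forall k, is_kernel (e_ k) (rho_ k)) -> e_ k @[k --> \oo] --> 0 ->
  mu.-integrable setT (EFin \o f) -> 0 <= r -> (forall x, r < `|x| -> f x = 0) ->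
  forall a : R, 0 < a -> exists K, forall k, (K <= k)%N ->
   (\int[mu]_(x in [set x | (`|x| <= r)%R]) `|moll (rho_ k) f x - f x|%:E <= a%:E)%E.
Proof.
move=> kk e0 fi r0 fsupp a a0.
have a30 : 0 < a / 3 by exact: divr_gt0.
have mball s : measurable [set x : E | `|x| <= s].
  rewrite (_ : [set x | _] = (fun x : E => `|x|) @^-1` `]-oo, s]); last first.
    by apply/seteqP; split => x /=; rewrite in_itv.
  rewrite -[X in measurable X]setTI; apply: continuous_measurable_rV => //.
  by move=> x; exact: norm_continuous.
set B := [set x | _ <= r].
pose Om := [set x : E | `|x| <= r + 1].
have mOm : measurable Om by exact: mball.
have fOm : (mu Om < +oo)%E by apply: (@bounded_measure_finite _ _ _ (r + 1)).
have mf : measurable_fun setT f by apply/measurable_EFinP; exact: measurable_int fi.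
have BOm : B `<=` Om by move=> x; rewrite /B/Om/=; lra.
have fB : (mu B < +oo)%E by apply: (@bounded_measure_finite _ _ _ r) => //; exact: mball.
have [h [ch [M hM] ih]] := L1_approx_integrable mOm fOm (integrableS measurableT mOm (@subsetT _ Om) fi) a30.
have mh := continuous_measurable_rV ch.
pose g x := h x * \1_Om x.
have gM x : `|g x| <= `|M|.
  rewrite /g indicE normrM; have hx := le_trans (hM x) (ler_norm M).
  by case: (x \in Om); rewrite ?normr1 ?normr0 ?mulr1 ?mulr0.
have mg : measurable_fun setT g by apply: measurable_funM => //; exact: measurable_indic.
have gi : mu.-integrable setT (EFin \o g).
  have : mu.-integrable Om (EFin \o h) by apply: (@bounded_integrable _ _ _ _ _ mOm fOm h M) => //; exact: measurable_funTS.
  move=> hi; have -> : EFin \o g = (EFin \o h) \_ Om.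
    apply/funext => x; rewrite patchE /= /g indicE.
    by case: ifP => _; rewrite ?mulr1 ?mulr0.
  exact: (integrable_mkcond (EFin \o h) mOm).1.
have fgi : mu.-integrable setT (EFin \o (fun x => f x - g x)) by exact: (integrableB measurableT fi gi).
have fgL : (\int[mu]_x `|f x - g x|%:E <= (a / 3)%:E)%E.
  apply: le_trans ih; rewrite [leRHS]integral_mkcond le_eqVlt; apply/orP; left; apply/eqP.
  apply: eq_integral => x _; rewrite patchE /g indicE.
  have [xO|xO] := boolP (x \in Om); first by rewrite mulr1.
  rewrite mulr0 subr0 fsupp ?normr0//; move: xO; rewrite notin_setE /Om/= => /negP.
  by rewrite -ltNge; lra.
have mm k (u : E -> R) : mu.-integrable setT (EFin \o u) -> measurable_fun B (moll (rho_ k) u).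
  by move=> ui; apply: measurable_funTS; exact: continuous_measurable_rV (moll_cont (kk k) ui).
have [||||_ c] := @bounded_cvg_Rintegral _ _ _ mu B (mball r) fB
    (fun k x => `|moll (rho_ k) g x - g x|) (fun=> 0) (2 * `|M|).
- move=> k; apply: measurableT_comp => //; apply: measurable_funB; first exact: mm.
  exact: measurable_funTS.
- by [].
- move=> k x _; rewrite normr_id; have := @moll_near _ _ (kk k) g x 0 `|M| gi.
  move=> /(_ _)/wrap[z _|]; first by rewrite subr0.
  rewrite subr0 => h1; have := gM x; have := ler_normB (moll (rho_ k) g x) (g x); lra.
- apply: aeW => x Bx; apply/cvgrPdist_le => b b0.
  have gx : g x = h x by rewrite /g indicE mem_set ?mulr1//; exact: BOm.
  have /cvgrPdist_le/(_ b b0) := ch x.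
  rewrite -nbhs_ballE => -[s /= s0 hs].
  have := e0 => /cvgrPdist_lt/(_ (Num.min s 1)); rewrite lt_min s0 ltr01 => /(_ isT).
  apply: filterS => k; rewrite sub0r normrN lt_min => /andP[es e1].
  rewrite sub0r normrN normr_id; apply: (@moll_near _ _ (kk k)) => // z xz.
  have xz' := lt_le_trans xz (ler_norm _).
  have Oz : Om z.
    have := ler_normB x (x - z); rewrite opprB addrC subrK /Om/=.
    by move: Bx; rewrite /B/=; lra.
  rewrite gx /g indicE mem_set// mulr1 distrC; apply: hs.
  by rewrite -ball_normE /ball_/=; exact: lt_trans es.
move: c; rewrite Rintegral_cst; last exact: mball.
rewrite mul0r => /cvgr0_norm_lt/(_ _ a30)[K _ hK].
exists K => k Kk; have {hK} := hK k Kk; rewrite /= => hK.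
have gB : measurable_fun B g by exact: measurable_funTS.
have fmB : measurable_fun B f by exact: measurable_funTS.
have m1 : measurable_fun B (fun x => `|moll (rho_ k) (fun z => f z - g z) x|).
  by apply: measurableT_comp => //; exact: mm.
have m2 : measurable_fun B (fun x => `|moll (rho_ k) g x - g x|).
  by apply: measurableT_comp => //; apply: measurable_funB => //; exact: mm.
have m3 : measurable_fun B (fun x => `|f x - g x|).
  by apply: measurableT_comp => //; exact: measurable_funB.
have mB := mball r.
apply: (@le_trans _ _ (\int[mu]_(x in B) (`|moll (rho_ k) (fun z => f z - g z) x| +
   `|moll (rho_ k) g x - g x| + `|f x - g x|)%:E)%E).
  apply: ge0_le_integralT => //.
  - apply: measurableT_comp => //; apply: measurable_funB => //; exact: mm.
  - by do 2 apply: measurable_funD => //.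
  - move=> x _; rewrite (mollB (kk k))//.
    rewrite (_ : moll (rho_ k) f x - f x = (moll (rho_ k) f x - moll (rho_ k) g x) +
      (moll (rho_ k) g x - g x) - (f x - g x)); last by ring.
    by rewrite (le_trans (ler_normB _ _))// lerD2r; exact: ler_normD.
under eq_integral do rewrite !EFinD.
rewrite ge0_integralD//; last 3 first.
- by move=> x _; rewrite -EFinD lee_fin addr_ge0.
- by under eq_fun do rewrite -EFinD; apply/measurable_EFinP; exact: measurable_funD.
- exact/measurable_EFinP.
rewrite ge0_integralD//; last 2 first.
- exact/measurable_EFinP.
- exact/measurable_EFinP.
have sub (u : E -> R) : measurable_fun setT u -> (\int[mu]_(x in B) `|u x|%:E <= \int[mu]_x `|u x|%:E)%E.
  move=> mu_; apply: ge0_subset_integral => //.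
  by apply/measurable_EFinP; exact: measurableT_comp.
rewrite (_ : a = a / 3 + a / 3 + a / 3); last by field.
rewrite !EFinD; apply: leeD; [apply: leeD|].
- apply: le_trans fgL; apply: le_trans (moll_L1 (kk k) fgi); apply: sub.
  exact: continuous_measurable_rV (moll_cont (kk k) fgi).
- rewrite EFin_Rintegral//; first by rewrite lee_fin (le_trans (ler_norm _))// ltW.
  apply: (@bounded_integrable _ _ _ _ _ mB fB _ (2 * `|M|)) => // x _; rewrite normr_id.
  have := @moll_near _ _ (kk k) g x 0 `|M| gi.
  move=> /(_ _)/wrap[z _|]; first by rewrite subr0.
  rewrite subr0 => h1; have := gM x; have := ler_normB (moll (rho_ k) g x) (g x); lra.
- by apply: le_trans fgL; apply: sub; exact: measurable_funB.
Qed.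

End mollification.

(** * A smooth compactly supported kernel *)

Section derive_quadratic.
Variables (R : realType) (V : normedModType R).

Lemma is_derive_cvg (f : V -> R) (x v : V) (df : R) :
  h^-1 * (f (h *: v + x) - f x) @[h --> 0^'] --> df -> is_derive x v f df.
Proof.
move=> c; have c' : (fun h : R => h^-1 *: ((f \o shift x) (h *: v) - f x)) @ 0^' --> df by exact: c.
by apply: DeriveDef; [apply/cvg_ex; exists df|exact: (cvg_lim _ c')].
Qed.

Lemma is_derive_quad (f : V -> R) (x v : V) (df C : R) :
  (forall h, `|f (h *: v + x) - f x - h * df| <= C * h ^+ 2) -> is_derive x v f df.
Proof.
move=> hC; apply: is_derive_cvg.
apply/(@cvgrPdist_le _ _ _ (0^'%classic) _ (fun h : R => h^-1 * (f (h *: v + x) - f x))) => e e0.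
have c0 : 0 < `|C| + 1 by rewrite ltr_wpDl.
apply/nbhs_ballP; exists (e / (`|C| + 1)); first exact: divr_gt0.
move=> h; rewrite /ball/= sub0r normrN => he hn0.
have -> : df - h^-1 * (f (h *: v + x) - f x) = - (h^-1 * (f (h *: v + x) - f x - h * df)).
  by field.
rewrite normrN normrM normfV; have nh : 0 < `|h| by rewrite normr_gt0.
rewrite ler_pdivrMl//; apply: (le_trans (hC h)).
rewrite -real_normK ?num_real// expr2 mulrA mulrC ler_wpM2l//.
apply: (@le_trans _ _ ((`|C| + 1) * `|h|)).
  by rewrite ler_wpM2r// (le_trans (ler_norm C))// lerDl.
by rewrite mulrC -ler_pdivlMr// ltW.
Qed.

Lemma is_derive_zero (x v : V) : is_derive x v (fun=> 0 : R) 0.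
Proof. by apply: (@is_derive_quad _ _ _ _ 0) => h; rewrite mulr0 mul0r !subr0 normr0. Qed.

End derive_quadratic.

Section derivative_tower.
Variables (R : realType) (phi : nat -> R -> R).
Hypothesis phi_derive : forall m (t : R), is_derive t (1 : R) (phi m) (phi m.+1 t).

Lemma tower_cont m : continuous (phi m).
Proof.
move=> t; apply: differentiable_continuous; apply/derivable1_diffP.
exact: (@ex_derive _ _ _ _ _ _ _ (phi_derive m t)).
Qed.
Hypothesis phi_bounded : forall m, exists M, 0 <= M /\ forall t, `|phi m t| <= M.

Lemma tower_lip m : exists M, 0 <= M /\ forall s t, `|phi m t - phi m s| <= M * `|t - s|.
Proof.
have [M [M0 hM]] := phi_bounded m.+1; exists M; split => //.
have main s t : s < t -> `|phi m t - phi m s| <= M * `|t - s|.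
  move=> st; have [|c _ ->] := MVT st (fun x _ => phi_derive m x).
    by apply: continuous_subspaceT => x; exact: tower_cont.
  by rewrite normrM ler_wpM2r.
move=> s t; have [st|ts|->] := ltgtP s t; first exact: main.
- by rewrite distrC (distrC t); exact: main.
- by rewrite !subrr normr0 mulr0.
Qed.

Lemma tower_taylor m : exists M, 0 <= M /\ forall s h,
  `|phi m (s + h) - phi m s - phi m.+1 s * h| <= M * h ^+ 2.
Proof.
have [M [M0 hM]] := tower_lip m.+1; exists M; split => // s h.
have key x y : x < y -> exists2 c, `|c - s| <= Num.max `|x - s| `|y - s| & phi m y - phi m x = phi m.+1 c * (y - x).
  move=> xy; have [|c cxy ->] := MVT xy (fun x _ => phi_derive m x).
    by apply: continuous_subspaceT => z; exact: tower_cont.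
  exists c => //; move: cxy; rewrite in_itv/= => /andP[xc cy].
  rewrite le_max; apply/orP; have [cs|cs] := leP c s; [left|right].
    by rewrite !ler0_norm; lra.
  by rewrite !ger0_norm; lra.
have fin c : `|c - s| <= `|h| -> `|phi m.+1 c * h - phi m.+1 s * h| <= M * h ^+ 2.
  move=> ch; rewrite -mulrBl normrM -[h ^+ 2]real_normK ?num_real// expr2 mulrA ler_wpM2r//.
  by apply: (le_trans (hM _ _)); rewrite ler_wpM2l.
have [h0|h0|->] := ltgtP h 0.
- have [|c cs e] := key (s + h) s; first by lra.
  have -> : phi m (s + h) - phi m s = phi m.+1 c * h.
    by rewrite -opprB e; ring.
  by apply: fin; apply: (le_trans cs); rewrite subrr normr0 addrAC subrr add0r max_l.
- have [|c cs e] := key s (s + h); first by lra.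
  rewrite e (_ : s + h - s = h); last by ring.
  by apply: fin; apply: (le_trans cs); rewrite subrr normr0 addrAC subrr add0r max_r.
- by rewrite addr0 subrr mulr0 subr0 normr0 expr0n/= mulr0.
Qed.
End derivative_tower.

Section bump.
Variable R : realType.

(** The functions s^-k exp(-1/s), extended by 0: their span is closed under
    derivation. *)
Definition flat (k : nat) (s : R) : R := if 0 < s then s^-1 ^+ k * expR (- s^-1) else 0.

Lemma flat_ge0 k s : 0 <= flat k s.
Proof.
rewrite /flat; case: ifPn => // s0; rewrite mulr_ge0 ?expR_ge0// exprn_ge0// invr_ge0.
exact: ltW.
Qed.

Lemma flat_le0 k s : s <= 0 -> flat k s = 0.
Proof. by move=> s0; rewrite /flat ltNge s0. Qed.

(** The exponential of 1/s is at least each term of its series. *)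
Lemma flat_bound k s : flat k s <= (k.+2)`!%:R * s ^+ 2.
Proof.
have [s0|s0] := leP s 0.
  by rewrite flat_le0// mulr_ge0// sqr_ge0.
have i0 : 0 < s^-1 by rewrite invr_gt0.
have := expR_ge1Dxn k.+1 (ltW i0); rewrite /flat s0 expRN.
have f0 : 0 < (k.+2)`!%:R :> R by rewrite ltr0n fact_gt0.
move: f0; set F := _`!%:R => f0 h.
have p0 : 0 < s^-1 ^+ k.+2 / F by rewrite divr_gt0// exprn_gt0.
have h' : s^-1 ^+ k.+2 / F <= expR s^-1 by apply: le_trans h; rewrite lerDr.
apply: (@le_trans _ _ (s^-1 ^+ k * (s^-1 ^+ k.+2 / F)^-1)).
  by rewrite ler_wpM2l ?exprn_ge0 ?(ltW i0)// lef_pV2// posrE// expR_gt0.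
rewrite le_eqVlt; apply/orP; left; apply/eqP.
have sk : s^-1 ^+ k != 0 by rewrite expf_neq0// gt_eqF.
by rewrite !exprS; field; rewrite sk !gt_eqF.
Qed.

Lemma flat_derive k (s : R) : is_derive s (1 : R) (flat k) (flat k.+2 s - k%:R * flat k.+1 s).
Proof.
have [s0|s0|->] := ltgtP s 0.
- rewrite !flat_le0 ?(ltW s0)// mulr0 subr0.
  have z : is_derive s (1 : R) (fun=> 0 : R) (0 : R) by exact: is_derive_zero.
  apply: near_eq_is_derive z; near=> t; rewrite flat_le0// ltW//; near: t.
  by apply: open_nbhs_nbhs; split => //; exact: open_lt.
- have sn0 : s != 0 by rewrite gt_eqF.
  apply: (@near_eq_is_derive _ _ _ ((fun t : R => t^-1) ^+ k * (expR \o (fun t : R => - t^-1)))).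
    near=> t; have t0 : 0 < t by near: t; apply: open_nbhs_nbhs; split => //; exact: open_gt.
    by rewrite /flat t0 /=; congr (_ * _); rewrite exprfctE.
  have dV : is_derive s 1 (fun t : R => t^-1) (- s ^- 2 *: 1).
    exact: (is_deriveV sn0 (is_derive_id s 1)).
  have dN : is_derive s 1 (fun t : R => - t^-1) (- (- s ^- 2 *: 1)).
    exact: (is_deriveN dV).
  have dE := @is_derive1_comp R expR (fun t => - t^-1) s _ _ (is_derive_expR (- s^-1)) dN.
  have dX := is_deriveX k dV.
  have := is_deriveM dX dE => d.
  apply: (is_derive_eq d); rewrite /flat s0 /= !exprfctE /GRing.scale /= !mulr1 opprK.
  case: k {dX d} => [|k] /=.
    by rewrite !mul0r !expr0 !mulr0 subr0 addr0 mul1r mulrC exprVn.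
  rewrite !exprS; set x := expR _; set y := s^-1 ^+ k.
  by rewrite expr0; field.
- rewrite !flat_le0// mulr0 subr0; apply: (@is_derive_quad _ _ _ _ _ _ (k.+2)`!%:R) => h.
  rewrite (flat_le0 k (lexx 0)) mulr0 !subr0 addr0 ger0_norm ?flat_ge0//.
  by rewrite [_ *: _]mulr1; exact: flat_bound.
Unshelve. all: by end_near.
Qed.

Variable a : R.
Hypothesis a0 : 0 < a.

(** Sums of functions p(t) flat_k (1 - a t^2) with p a polynomial are closed under
    derivation; bump_D computes the derivative on the pairs (p, k). *)
Definition bump_term (pk : {poly R} * nat) (t : R) : R := pk.1.[t] * flat pk.2 (1 - a * t ^+ 2).

Definition bump_sum (l : seq ({poly R} * nat)) (t : R) : R := \sum_(pk <- l) bump_term pk t.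

Definition bump_D1 (pk : {poly R} * nat) : seq ({poly R} * nat) :=
  [:: (pk.1^`(), pk.2); (pk.1 * ((-2 * a)%:P * 'X), pk.2.+2);
      (pk.1 * ((2 * a * pk.2%:R)%:P * 'X), pk.2.+1)].

Definition bump_D (l : seq ({poly R} * nat)) := flatten [seq bump_D1 pk | pk <- l].

Lemma bump_term_derive pk (t : R) : is_derive t (1 : R) (bump_term pk) (bump_sum (bump_D1 pk) t).
Proof.
case: pk => p k.
have dq : is_derive t (1 : R) (fun u : R => 1 - a * u ^+ 2) (- 2 * a * t).
  apply: (@is_derive_quad _ _ _ _ _ _ a) => h.
  rewrite [h *: _]mulr1 (_ : _ - _ - _ = - (a * h ^+ 2)); last by ring.
  by rewrite normrN ger0_norm// mulr_ge0 ?sqr_ge0// ltW.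
have dF := @is_derive1_comp R (flat k) (fun u : R => 1 - a * u ^+ 2) t _ _
  (flat_derive k (1 - a * t ^+ 2)) dq.
have dp : is_derive t (1 : R) (horner p) p^`().[t] by exact: is_derive_poly.
have := is_deriveM dp dF => d; apply: (is_derive_eq d).
rewrite /bump_sum /bump_D1 !big_cons big_nil /bump_term /= /GRing.scale /=.
rewrite !(hornerM, hornerC, hornerX).
set F0 := flat k _; set F1 := flat k.+1 _; set F2 := flat k.+2 _.
ring.
Qed.

Lemma bump_sum_derive l (t : R) : is_derive t (1 : R) (bump_sum l) (bump_sum (bump_D l) t).
Proof.
elim: l => [|pk l IH].
  have -> : bump_sum [::] = fun=> 0 by apply/funext => u; rewrite /bump_sum big_nil.
  exact: is_derive_zero.
have -> : bump_sum (pk :: l) = bump_term pk + bump_sum l.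
  by apply/funext => u; rewrite /bump_sum big_cons.
have := is_deriveD (bump_term_derive pk t) IH => d; apply: (is_derive_eq d).
by rewrite /bump_sum -[bump_D (pk :: l)]/(bump_D1 pk ++ bump_D l) big_cat.
Qed.

Definition bump (m : nat) : R -> R := bump_sum (iter m bump_D [:: (1, 0%N)]).

Lemma bump_derive m (t : R) : is_derive t (1 : R) (bump m) (bump m.+1 t).
Proof. exact: bump_sum_derive. Qed.

Lemma bump0E t : bump 0 t = flat 0 (1 - a * t ^+ 2).
Proof. by rewrite /bump /bump_sum big_seq1 /bump_term hornerE mul1r. Qed.

Lemma bump_supp m t : 1 <= a * t ^+ 2 -> bump m t = 0.
Proof.
move=> at1; rewrite /bump /bump_sum big1// => -[p k] _.
by rewrite /bump_term flat_le0 ?mulr0// subr_le0.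
Qed.

Lemma bump_cont m : continuous (bump m).
Proof. exact: (tower_cont bump_derive). Qed.

Lemma bump_bounded m : exists M, 0 <= M /\ forall t, `|bump m t| <= M.
Proof.
pose b := a^-1 + 1.
have b0 : 0 < b by rewrite /b ltr_wpDl// invr_ge0 ltW.
have cb : {within `[- b, b], continuous (fun t => `|bump m t|)}.
  apply: continuous_subspaceT => t.
  exact: (continuous_comp (@bump_cont m t) (@norm_continuous _ _ _)).
have bb : - b <= b by lra.
have [c _ hc] := EVT_max bb cb.
exists `|bump m c|; split => // t.
have [tb|] := boolP (t \in `[- b, b]); first exact: hc.
move=> tb; rewrite bump_supp ?normr0//.
have tb' : b <= `|t|.
  rewrite leNgt; apply/negP => tlt; move/negP: tb; apply.
  by rewrite in_itv/=; move: tlt; rewrite ltr_norml => /andP[h1 h2]; rewrite !ltW.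
have : b ^+ 2 <= t ^+ 2 by rewrite -[leRHS]real_normK ?num_real// lerXn2r ?nnegrE// ltW.
move=> h; apply: (@le_trans _ _ (a * b ^+ 2)); last by rewrite ler_pM2l.
rewrite /b; have -> : a * (a^-1 + 1) ^+ 2 = a^-1 + 2 + a by field; rewrite gt_eqF.
have : 0 < a^-1 by rewrite invr_gt0.
move=> ia; rewrite -[leLHS]add0r -addrA; apply: lerD; first exact: ltW.
by apply: ler_wpDr; [exact: ltW|rewrite ler1n].
Qed.

End bump.

Section tower_product.
Variables (R : realType) (n : nat).
Local Notation E := 'rV[R]_n.
Local Notation mu := (lebesgue_rV R n).
Variable phi : nat -> R -> R.
Hypothesis phi_derive : forall m (t : R), is_derive t (1 : R) (phi m) (phi m.+1 t).
Hypothesis phi_bounded : forall m, exists M, 0 <= M /\ forall t, `|phi m t| <= M.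

(** If each phi m has derivative phi m.+1, the partial derivatives of a product
    over the coordinates are again such products, indexed by multi-indices m. *)
Definition pprod (m : 'I_n -> nat) (z : E) : R := \prod_(i < n) phi (m i) (z ord0 i).

Definition incr (i : 'I_n) (m : 'I_n -> nat) : 'I_n -> nat :=
  fun k => if k == i then (m k).+1 else m k.

Lemma incrC i j m : incr i (incr j m) = incr j (incr i m).
Proof. by apply/funext => k; rewrite /incr; case: (k == i); case: (k == j). Qed.

Lemma pprod_incr i m z : pprod (incr i m) z =
  phi (m i).+1 (z ord0 i) * \prod_(k < n | k != i) phi (m k) (z ord0 k).
Proof.
rewrite /pprod (bigD1 i)//= /incr eqxx; congr (_ * _).
by apply: eq_bigr => k /negPf ->.
Qed.

Lemma pprod_split i m z : pprod m z =
  phi (m i) (z ord0 i) * \prod_(k < n | k != i) phi (m k) (z ord0 k).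
Proof. by rewrite /pprod (bigD1 i). Qed.

Lemma pprod_cont m : continuous (pprod m).
Proof.
apply: cont_prod => i v.
exact: (continuous_comp (@coord_continuous _ _ _ ord0 i v) (@tower_cont R phi phi_derive (m i) (v ord0 i))).
Qed.

Lemma pprod_taylor m : exists C, 0 <= C /\ forall y h : E,
  `|pprod m (y + h) - pprod m y - \sum_(i < n) pprod (incr i m) y * h ord0 i| <= C * `|h| ^+ 2.
Proof.
have cB i : {M : R | 0 <= M /\ forall t, `|phi (m i) t| <= M} by apply: cid; exact: phi_bounded.
have cB' i : {M : R | 0 <= M /\ forall t, `|phi (m i).+1 t| <= M} by apply: cid; exact: phi_bounded.
have cL i : {M : R | 0 <= M /\ forall s t, `|phi (m i) t - phi (m i) s| <= M * `|t - s|}.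
  by apply: cid; exact: tower_lip.
have cT i : {M : R | 0 <= M /\ forall s h, `|phi (m i) (s + h) - phi (m i) s - phi (m i).+1 s * h| <= M * h ^+ 2}.
  by apply: cid; exact: tower_taylor.
pose P (s : seq 'I_n) (z : E) := \prod_(i <- s) phi (m i) (z ord0 i).
pose Dm (s : seq 'I_n) (y h : E) := \sum_(i <- s)
  \prod_(k <- s) (if k == i then phi (m k).+1 (y ord0 k) * h ord0 k else phi (m k) (y ord0 k)).
have step i s y h : i \notin s -> Dm (i :: s) y h =
    phi (m i).+1 (y ord0 i) * h ord0 i * P s y + phi (m i) (y ord0 i) * Dm s y h.
  move=> ins; rewrite /Dm big_cons big_cons eqxx; congr (_ * _ + _).
    rewrite /P big_seq [RHS]big_seq; apply: eq_bigr => k ks.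
    by case: eqP => // ki; move: ins; rewrite -ki ks.
  rewrite mulr_sumr big_seq [RHS]big_seq; apply: eq_bigr => k ks; rewrite big_cons.
  by case: eqP => // ki; move: ins; rewrite ki ks.
have : forall s, uniq s -> exists C1 C2 C3, [/\ 0 <= C1, 0 <= C2, 0 <= C3 &
    forall y h, [/\ `|P s y| <= C1, `|Dm s y h| <= C2 * `|h| &
      `|P s (y + h) - P s y - Dm s y h| <= C3 * `|h| ^+ 2]].
  elim=> [_|i s IH /= /andP[ins us]].
    exists 1, 0, 0; split => // y h; rewrite /P /Dm !big_nil normr1 normr0 subrr subr0 normr0 !mul0r.
    by split.
  have [C1 [C2 [C3 [C10 C20 C30 hC]]]] := IH us.
  have [B0 hB] := svalP (cB i); set B := sval (cB i) in B0 hB.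
  have [B'0 hB'] := svalP (cB' i); set B' := sval (cB' i) in B'0 hB'.
  have [L0 hL] := svalP (cL i); set L := sval (cL i) in L0 hL.
  have [T0 hT] := svalP (cT i); set T := sval (cT i) in T0 hT.
  exists (B * C1), (B' * C1 + B * C2), (B * C3 + T * C1 + L * C2).
  split; [by rewrite mulr_ge0|by rewrite addr_ge0// mulr_ge0|by rewrite !addr_ge0// mulr_ge0|].
  move=> y h; have [h1 h2 h3] := hC y h; have hi := rV_coord_le h i.
  have n0 : 0 <= `|h| by [].
  split.
  - by rewrite /P big_cons normrM ler_pM//; exact: h1.
  - rewrite step// mulrDl (le_trans (ler_normD _ _))// lerD//.
      rewrite !normrM -!mulrA ler_pM// ?mulr_ge0// mulrC ler_pM//; exact: h1.
    by rewrite normrM -mulrA ler_pM.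
  - rewrite step// /P !big_cons -!/(P _ _) mxE.
    set b := phi (m i) (y ord0 i + _); set a1 := phi (m i) (y ord0 i).
    set a2 := phi (m i).+1 _.
    have -> : b * P s (y + h) - a1 * P s y - (a2 * h ord0 i * P s y + a1 * Dm s y h) =
      b * (P s (y + h) - P s y - Dm s y h) + (b - a1 - a2 * h ord0 i) * P s y + (b - a1) * Dm s y h.
      ring.
    have e1 : `|b * (P s (y + h) - P s y - Dm s y h)| <= B * (C3 * `|h| ^+ 2).
      by rewrite normrM ler_pM//; exact: hB.
    have e2 : `|(b - a1 - a2 * h ord0 i) * P s y| <= T * `|h| ^+ 2 * C1.
      rewrite normrM ler_pM//; apply: (le_trans (hT _ _)); rewrite ler_wpM2l//.
      by rewrite -(real_normK (num_real (h ord0 i))) lerXn2r// nnegrE.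
    have e3 : `|(b - a1) * Dm s y h| <= L * `|h| * (C2 * `|h|).
      rewrite normrM ler_pM//; apply: (le_trans (hL _ _)).
      by rewrite addrAC subrr add0r ler_wpM2l.
    apply: (le_trans (ler_normD _ _)); apply: (le_trans (lerD (ler_normD _ _) (lexx _))).
    apply: (le_trans (lerD (lerD e1 e2) e3)).
    by rewrite le_eqVlt; apply/orP; left; apply/eqP; ring.
move=> /(_ (index_enum 'I_n) (index_enum_uniq _))[C1 [C2 [C3 [_ _ C30 hC]]]].
exists C3; split => // y h; have [_ _] := hC y h.
rewrite /P -!/(pprod _ _) (_ : Dm _ y h = \sum_(i < n) pprod (incr i m) y * h ord0 i)//.
rewrite /Dm; apply: eq_bigr => i _; rewrite pprod_incr (bigD1 i)//= eqxx [RHS]mulrAC; congr (_ * _).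
by apply: eq_bigr => k /negPf ->.
Qed.

Lemma pprod_bounded m : exists M, 0 <= M /\ forall z, `|pprod m z| <= M.
Proof.
have cB i : {M : R | 0 <= M /\ forall t, `|phi (m i) t| <= M} by apply: cid; exact: phi_bounded.
exists (\prod_(i < n) sval (cB i)); split.
  by apply: prodr_ge0 => i _; case: (svalP (cB i)).
move=> z; rewrite /pprod normr_prod; apply: ler_prod => i _; rewrite normr_ge0/=.
by case: (svalP (cB i)).
Qed.

Lemma pprod_lip m : exists L, 0 <= L /\ forall x y, `|pprod m x - pprod m y| <= L * `|x - y|.
Proof.
have cB i : {M : R | 0 <= M /\ forall z, `|pprod (incr i m) z| <= M}.
  by apply: cid; exact: pprod_bounded.
have [M [M0 hM]] := pprod_bounded m.
have [C [C0 hC]] := pprod_taylor m.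
pose S := \sum_(i < n) sval (cB i).
have S0 : 0 <= S by apply: sumr_ge0 => i _; case: (svalP (cB i)).
exists (2 * M + C + S); split; first by rewrite !addr_ge0// mulr_ge0.
move=> x y; have [d1|d1] := leP 1 `|x - y|.
  apply: (le_trans (ler_normB _ _)); apply: (@le_trans _ _ (2 * M * 1)).
    by have := hM x; have := hM y; lra.
  apply: ler_pM => //; first by rewrite mulr_ge0.
  by rewrite -addrA lerDl addr_ge0.
have := hC y (x - y); rewrite (addrC y) subrK; set Sg := \sum_(i < n) _ => h.
have hS : `|Sg| <= S * `|x - y|.
  rewrite /Sg (le_trans (ler_norm_sum _ _ _))// mulr_suml; apply: ler_sum => i _.
  by rewrite normrM ler_pM//; [case: (svalP (cB i))|exact: rV_coord_le].
have h2 : C * `|x - y| ^+ 2 <= C * `|x - y|.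
  by rewrite ler_wpM2l// expr2 ler_piMr// ltW.
rewrite (_ : pprod m x - pprod m y = (pprod m x - pprod m y - Sg) + Sg); last by ring.
apply: (le_trans (ler_normD _ _)); apply: (le_trans (lerD h hS)).
apply: (le_trans (lerD h2 (lexx (S * `|x - y|)))).
by rewrite -mulrDl ler_wpM2r// -addrA lerDr mulr_ge0.
Qed.

Lemma pprod_derive m (x : E) i : is_derive x (unit_vec R i) (pprod m) (pprod (incr i m) x).
Proof.
have [C [C0 hC]] := pprod_taylor m.
apply: (@is_derive_quad _ _ _ _ _ _ C) => h.
have nu : `|unit_vec R i| <= 1.
  apply: rV_norm_le => // j; rewrite /unit_vec mxE eqxx/=.
  by case: eqP => _; rewrite ?normr1 ?normr0.
have := hC x (h *: unit_vec R i); rewrite (addrC x).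
rewrite (bigD1 i)//= big1 ?addr0; last first.
  by move=> k ki; rewrite !mxE eqxx/= (negPf ki) !mulr0.
rewrite !mxE !eqxx mulr1 (mulrC _ h) => /le_trans; apply.
rewrite ler_wpM2l// -(real_normK (num_real h)) lerXn2r// ?nnegrE//.
by rewrite normrZ ler_piMr.
Qed.

End tower_product.

Section product_bump.
Variables (R : realType) (n : nat).
Local Notation E := 'rV[R]_n.
Variable a : R.
Hypothesis a0 : 0 < a.

Definition pbump (m : 'I_n -> nat) (z : E) : R := pprod (bump a) m z.

Lemma pbump_cont m : continuous (pbump m).
Proof. exact: (pprod_cont (bump_derive a0)). Qed.

Lemma pbump_taylor m : exists C, 0 <= C /\ forall y h : E,
  `|pbump m (y + h) - pbump m y - \sum_(i < n) pbump (incr i m) y * h ord0 i| <= C * `|h| ^+ 2.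
Proof. exact: (pprod_taylor (bump_derive a0) (bump_bounded a0)). Qed.

Lemma pbump_bounded m : exists M, 0 <= M /\ forall z, `|pbump m z| <= M.
Proof. exact: (pprod_bounded (bump_bounded a0)). Qed.

Lemma pbump_lip m : exists L, 0 <= L /\ forall x y, `|pbump m x - pbump m y| <= L * `|x - y|.
Proof. exact: (pprod_lip (bump_derive a0) (bump_bounded a0)). Qed.

Lemma pbump_derive m (x : E) i : is_derive x (unit_vec R i) (pbump m) (pbump (incr i m) x).
Proof. exact: (pprod_derive (bump_derive a0) (bump_bounded a0)). Qed.

Lemma pbump_supp m z : 1 <= a * `|z| ^+ 2 -> pbump m z = 0.
Proof.
move=> az; have [i hi] : exists i, `|z| = `|z ord0 i|.
  have z0 : z != 0 by apply: contraTneq az => ->; rewrite normr0 expr0n/= mulr0 ler10.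
  have z1 : mx_norm z != 0 by rewrite -[mx_norm z]/(`|z|) normr_eq0.
  by have [[k i] e] := mx_norm_neq0 z1; exists i; rewrite [LHS]e (ord1 k).
rewrite /pbump (pprod_split _ i) bump_supp ?mul0r//.
by move: az; rewrite hi real_normK// num_real.
Qed.

End product_bump.

Section mollifier.
Variables (R : realType) (n : nat).
Local Notation E := 'rV[R]_n.
Local Notation mu := (lebesgue_rV R n).
Variable e : R.
Hypothesis e0 : 0 < e.

Let a := e ^- 2.
Let a0 : 0 < a. Proof. by rewrite invr_gt0 exprn_gt0. Qed.

Let m0 : 'I_n -> nat := fun=> 0%N.

Lemma pbump0_ge0 z : 0 <= pbump a m0 z.
Proof. by apply: prodr_ge0 => i _; rewrite bump0E; exact: flat_ge0. Qed.

Lemma pbump0_sym z : pbump a m0 (- z) = pbump a m0 z.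
Proof. by apply: eq_bigr => i _; rewrite !bump0E mxE sqrrN. Qed.

Lemma pbump_far m (z : E) : e <= `|z| -> pbump a m z = 0.
Proof.
move=> ez; apply: pbump_supp; rewrite /a ler_pdivlMl ?exprn_gt0// mulr1.
by rewrite lerXn2r// nnegrE// ltW.
Qed.

Lemma pbump0_le z : pbump a m0 z <= expR (-1) ^+ n.
Proof.
rewrite -[X in _ ^+ X]card_ord -prodr_const; apply: ler_prod => i _.
rewrite bump0E flat_ge0/= /flat; case: ifPn => [h|_]; last exact: expR_ge0.
rewrite expr0 mul1r ler_expR lerN2 -[leLHS]invr1 lef_pV2 ?posrE//.
by rewrite gerBl mulr_ge0 ?sqr_ge0// ltW.
Qed.

Lemma pbump0_lower (z : E) : `|z| <= e / 2 -> expR (- (4 / 3)) ^+ n <= pbump a m0 z.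
Proof.
move=> ze; rewrite -[X in _ ^+ X]card_ord -prodr_const; apply: ler_prod => i _.
rewrite expR_ge0/= bump0E.
have h : a * z ord0 i ^+ 2 <= 1 / 4.
  rewrite -(real_normK (num_real (z ord0 i))).
  have : `|z ord0 i| ^+ 2 <= (e / 2) ^+ 2.
    by rewrite lerXn2r ?nnegrE ?divr_ge0 ?(ltW e0)// (le_trans (rV_coord_le z i)).
  rewrite -(ler_pM2l a0) => /le_trans; apply; rewrite /a le_eqVlt; apply/orP; left; apply/eqP.
  by field; rewrite gt_eqF.
set u := a * _ in h *; have u0 : 0 <= u by rewrite mulr_ge0 ?sqr_ge0// ltW.
have s0 : 0 < 1 - u by lra.
rewrite /flat s0 expr0 mul1r ler_expR lerN2 -[leRHS]invrK lef_pV2 ?posrE ?invr_gt0//; lra.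
Qed.

Let cube r : set E := ocbox (fun=> - r) (fun=> r).

Lemma pbump_integrable m : mu.-integrable setT (EFin \o pbump a m).
Proof.
have [M [M0 hM]] := pbump_bounded (n := n) a0 m.
have mc : measurable (cube e) by exact: measurable_ocbox.
have -> : EFin \o pbump a m = (EFin \o pbump a m) \_ (cube e).
  apply/funext => z; rewrite patchE; case: ifPn => //; rewrite notin_setE => nz /=.
  rewrite pbump_far// leNgt; apply/negP => ze; apply: nz => i.
  by have := le_lt_trans (rV_coord_le z i) ze; rewrite ltr_norml => /andP[-> /ltW].
apply: (integrable_mkcond _ mc).1.
apply: (@bounded_integrable _ _ _ _ _ mc (ocbox_finite _ _) _ M) => //.
by apply: measurable_funTS; apply: continuous_measurable_rV; exact: pbump_cont.
Qed.

Lemma ocbox_ge (b c : 'I_n -> R) (k : R) :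
  k <= \prod_(i < n) Num.max 0 (c i - b i) -> (k%:E <= mu (ocbox b c))%E.
Proof. by move=> h; rewrite ocbox_measure lee_fin. Qed.

Lemma ocbox_le (b c : 'I_n -> R) (k : R) :
  \prod_(i < n) Num.max 0 (c i - b i) <= k -> (mu (ocbox b c) <= k%:E)%E.
Proof. by move=> h; rewrite ocbox_measure lee_fin. Qed.

Definition mass : R := \int[mu]_z pbump a m0 z.

Lemma mass_gt0 : 0 < mass.
Proof.
have mc : measurable (cube (e / 2)) by exact: measurable_ocbox.
have c0 : 0 < expR (- (4 / 3)) ^+ n * e ^+ n :> R by rewrite mulr_gt0// exprn_gt0// expR_gt0.
rewrite -lte_fin /mass -EFin_Rintegral//; last exact: pbump_integrable.
apply: (@lt_le_trans _ _ (expR (- (4 / 3)) ^+ n * e ^+ n)%:E); first by rewrite lte_fin.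
apply: (@le_trans _ _ (\int[mu]_(z in cube (e / 2)) (expR (- (4 / 3)) ^+ n)%:E)%E).
  rewrite integral_cst// EFinM lee_wpmul2l ?lee_fin ?exprn_ge0 ?expR_ge0//.
  apply: ocbox_ge; rewrite -[X in e ^+ X]card_ord -prodr_const.
  apply: ler_prod => i _; rewrite (ltW e0)/= le_max; apply/orP; right; lra.
apply: (@le_trans _ _ (\int[mu]_(z in cube (e / 2)) (pbump a m0 z)%:E)%E).
  apply: ge0_le_integralT => //.
  - by apply: measurable_funTS; apply: continuous_measurable_rV; exact: pbump_cont.
  - move=> z cz; apply: pbump0_lower; apply: rV_norm_le; first by rewrite divr_ge0// ltW.
    by move=> i; have /andP[h1 h2] := cz i; rewrite ler_norml ltW.
apply: ge0_subset_integral => //.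
- by apply/measurable_EFinP; apply: continuous_measurable_rV; exact: pbump_cont.
- by move=> z _; rewrite lee_fin pbump0_ge0.
Qed.

Lemma mass_le : mass <= (expR (-1) * (2 * e)) ^+ n.
Proof.
have mc : measurable (cube e) by exact: measurable_ocbox.
rewrite -lee_fin /mass -EFin_Rintegral//; last exact: pbump_integrable.
apply: (@le_trans _ _ (\int[mu]_(z in cube e) (expR (-1) ^+ n)%:E)%E); last first.
  rewrite integral_cst// exprMn EFinM lee_wpmul2l ?lee_fin ?exprn_ge0 ?expR_ge0//.
  apply: ocbox_le; rewrite -[X in (2 * e) ^+ X]card_ord -prodr_const.
  apply: ler_prod => i _; rewrite (_ : Num.max 0 (e - - e) = 2 * e) ?lexx ?andbT ?mulr_ge0 ?ltW//.
  by rewrite opprK max_r ?addr_ge0 ?ltW//; ring.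
rewrite [leRHS]integral_mkcond; apply: ge0_le_integral => //.
- by move=> z _; rewrite lee_fin pbump0_ge0.
- by apply/measurable_EFinP; apply: continuous_measurable_rV; exact: pbump_cont.
- by apply/(measurable_restrictT _ mc); exact: measurable_cst.
- move=> z _; rewrite patchE; case: ifPn => [_|]; first by rewrite lee_fin pbump0_le.
  rewrite notin_setE => nz; rewrite pbump_far// leNgt; apply/negP => ze; apply: nz => i.
  by have := le_lt_trans (rV_coord_le z i) ze; rewrite ltr_norml => /andP[-> /ltW].
Qed.

(** The partial derivative with multi-index m of the normalised mollifier. *)
Definition rho (m : 'I_n -> nat) (z : E) : R := mass^-1 * pbump a m z.

Definition rho0 : E -> R := rho m0.

Lemma rho_cont m : continuous (rho m).
Proof. by apply: contM; [exact: cont_cst|exact: pbump_cont]. Qed.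

Lemma rho_far m (z : E) : e <= `|z| -> rho m z = 0.
Proof. by move=> h; rewrite /rho pbump_far// mulr0. Qed.

Lemma rho_bounded m : exists M, 0 <= M /\ forall z, `|rho m z| <= M.
Proof.
have [M [M0 hM]] := pbump_bounded (n := n) a0 m.
have i0 : 0 <= mass^-1 by rewrite invr_ge0 ltW// mass_gt0.
exists (mass^-1 * M); split; first by rewrite mulr_ge0.
by move=> z; rewrite /rho normrM ger0_norm// ler_wpM2l.
Qed.

Lemma rho_lip m : exists L, 0 <= L /\ forall x y, `|rho m x - rho m y| <= L * `|x - y|.
Proof.
have [M [M0 hM]] := pbump_lip (n := n) a0 m.
have i0 : 0 <= mass^-1 by rewrite invr_ge0 ltW// mass_gt0.
exists (mass^-1 * M); split; first by rewrite mulr_ge0.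
by move=> x y; rewrite /rho -mulrBr normrM ger0_norm// -mulrA ler_wpM2l.
Qed.

Lemma rho_taylor m : exists C, 0 <= C /\ forall y h : E,
  `|rho m (y + h) - rho m y - \sum_(i < n) rho (incr i m) y * h ord0 i| <= C * `|h| ^+ 2.
Proof.
have [M [M0 hM]] := pbump_taylor (n := n) a0 m.
have i0 : 0 <= mass^-1 by rewrite invr_ge0 ltW// mass_gt0.
exists (mass^-1 * M); split; first by rewrite mulr_ge0.
move=> y h; rewrite /rho; under eq_bigr do rewrite -mulrA.
by rewrite -mulr_sumr -!mulrBr normrM ger0_norm// -mulrA ler_wpM2l.
Qed.

Lemma rho_derive m (x : E) i : is_derive x (unit_vec R i) (rho m) (rho (incr i m) x).
Proof.
have := @is_deriveZ _ _ _ (pbump a m) mass^-1 x (unit_vec R i) _ (pbump_derive a0 m x i).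
by [].
Qed.

Lemma rho0_kernel : is_kernel e rho0.
Proof.
have i0 : 0 <= mass^-1 by rewrite invr_ge0 ltW// mass_gt0.
split.
- by move=> z; rewrite /rho0 /rho mulr_ge0// pbump0_ge0.
- by move=> z; rewrite /rho0 /rho pbump0_sym.
- exact: rho_far.
- exact: rho_lip.
- by have [M [_ hM]] := rho_bounded m0; exists M => z; apply: le_trans (hM z); exact: ler_norm.
- rewrite /rho0 /rho; under eq_integral do rewrite EFinM.
  rewrite ge0_integralZl_EFin//.
  + rewrite EFin_Rintegral//; last exact: pbump_integrable.
    by rewrite -EFinM mulVf// gt_eqF// mass_gt0.
  + by move=> z _; rewrite lee_fin pbump0_ge0.
  + by apply/measurable_EFinP; apply: continuous_measurable_rV; exact: pbump_cont.
Qed.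

(** The mollifier dominates a fixed multiple of the normalised indicator of a
    ball; this makes mollified indicators detect density points. *)
Lemma rho0_lower (z : E) : `|z| <= e / 2 -> (expR (- (1 / 3)) / (2 * e)) ^+ n <= rho0 z.
Proof.
move=> ze; have := pbump0_lower ze; have := mass_le; have := mass_gt0.
rewrite /rho0 /rho; set M := mass; set P := pbump _ _ _ => M0 hM hP.
rewrite [leRHS]mulrC ler_pdivlMr//; apply: le_trans hP.
apply: (@le_trans _ _ ((expR (- (1 / 3)) / (2 * e)) ^+ n * (expR (-1) * (2 * e)) ^+ n)).
  by rewrite ler_wpM2l// exprn_ge0// divr_ge0 ?expR_ge0// mulr_ge0// ltW.
have -> : expR (- (4 / 3)) = expR (- (1 / 3)) / (2 * e) * (expR (-1) * (2 * e)) :> R.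
  rewrite mulrACA mulVf ?mulr1; last by rewrite mulf_neq0// gt_eqF.
  by rewrite -expRD; congr expR; field.
by rewrite [leRHS]exprMn.
Qed.

Lemma rho_shift_derive m (x z : E) i :
  is_derive z (unit_vec R i) (fun z => rho m (z - x)) (rho (incr i m) (z - x)).
Proof.
have [d1 d2] := rho_derive m (z - x) i.
have E1 : (fun h : R => h^-1 *: (((fun z => rho m (z - x)) \o shift z) (h *: unit_vec R i) - rho m (z - x))) =
    (fun h : R => h^-1 *: ((rho m \o shift (z - x)) (h *: unit_vec R i) - rho m (z - x))).
  by apply/funext => h /=; rewrite addrA.
by apply: DeriveDef; [rewrite /derivable E1; exact: d1|rewrite /derive E1; exact: d2].
Qed.

Lemma iter_partial_rho (s : seq 'I_n) m (x : E) : exists m',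
  iter_partial s (fun z => rho m (z - x)) = fun z => rho m' (z - x).
Proof.
elim: s => [|i s [m' IH]]; first by exists m.
exists (incr i m'); rewrite /iter_partial /= -/(iter_partial s _) IH.
by apply/funext => z; exact: (@derive_val _ _ _ _ _ _ _ (rho_shift_derive m' x z i)).
Qed.

Lemma rho_shift_cont m (x : E) : continuous (fun z : E => rho m (z - x)).
Proof.
move=> z; have cs : {for z, continuous (fun z : E => z - x)}.
  by apply: (@cvgB _ _ _ (nbhs z)); [exact: cvg_id|exact: cvg_cst].
exact: (continuous_comp cs (@rho_cont m (z - x))).
Qed.

Lemma closed_cball (x : E) r : closed [set z : E | `|z - x| <= r].
Proof.
rewrite (_ : [set z | _] = (fun z : E => `|z - x|) @^-1` [set t : R | t <= r])//.
apply: closed_comp; last exact: closed_le.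
move=> z _; have cs : {for z, continuous (fun z : E => z - x)}.
  by apply: (@cvgB _ _ _ (nbhs z)); [exact: cvg_id|exact: cvg_cst].
exact: (continuous_comp cs (@norm_continuous _ _ _)).
Qed.

Lemma compact_cball (x : E) r : compact [set z : E | `|z - x| <= r].
Proof.
apply: bounded_closed_compact; last exact: closed_cball.
exists (r + `|x|); split; first exact: num_real.
move=> M hM z /= zr; apply: ltW; apply: le_lt_trans hM.
by have := ler_normD (z - x) x; rewrite subrK; lra.
Qed.

Lemma rho_test (D : set E) m (x : E) : [set z | `|z - x| <= e] `<=` D ->
  test_function D (fun z => rho m (z - x)).
Proof.
move=> xD.
have sub : closure [set z | rho m (z - x) != 0] `<=` [set z | `|z - x| <= e].
  rewrite [X in _ `<=` X](closure_id _).1; last exact: closed_cball.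
  apply: closureS => z /= nz; rewrite leNgt; apply/negP => ez.
  by move/eqP: nz; apply; apply: rho_far; exact: ltW.
split.
- move=> s; have [m' ->] := iter_partial_rho s m x; split; first exact: rho_shift_cont.
  by move=> i z; exact: (@ex_derive _ _ _ _ _ _ _ (rho_shift_derive m' x z i)).
- apply: (subclosed_compact _ (@compact_cball x e)) => //; exact: closed_closure.
- exact: subset_trans xD.
Qed.

(** For m = 0 the mollification of F, and in general, up to sign, its partial
    derivative with multi-index m. *)
Definition moments (m : 'I_n -> nat) (F : E -> R) (x : E) : R :=
  \int[mu]_z (F z * rho m (z - x)).

Lemma moments_integrable m F (x : E) : mu.-integrable setT (EFin \o F) ->
  mu.-integrable setT (EFin \o (fun z : E => F z * rho m (z - x))).
Proof.
move=> Fi; have [M [M0 hM]] := rho_bounded m.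
apply: (@integrable_mul_bounded _ _ _ _ _ _ _ M) => //.
exact: continuous_measurable_rV (@rho_shift_cont m x).
Qed.

Lemma moll_moments F (x : E) : moll rho0 F x = moments m0 F x.
Proof.
rewrite /moll /moments; apply: eq_Rintegral => z _.
by rewrite -(kernel_sym rho0_kernel) opprB.
Qed.

Lemma moments_lip m F : mu.-integrable setT (EFin \o F) ->
  exists L, 0 <= L /\ forall x y : E, `|moments m F x - moments m F y| <= L * `|x - y|.
Proof.
move=> fi; have [L [L0 hL]] := rho_lip m.
have nfi : mu.-integrable setT (EFin \o (fun z => `|F z|)) by exact: integrable_norm.
exists (L * \int[mu]_z `|F z|); split.
  by rewrite mulr_ge0//; exact: Rintegral_ge0.
move=> x y; rewrite /moments -RintegralB//; try exact: moments_integrable.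
have di : mu.-integrable setT (EFin \o (fun z : E => F z * rho m (z - x) - F z * rho m (z - y))).
  by apply: (integrableB measurableT (moments_integrable m x fi) (moments_integrable m y fi)).
apply: (le_trans (le_normr_Rintegral measurableT di)).
rewrite mulrAC -RintegralZl//; apply: le_Rintegral => //.
- exact: integrable_norm.
- exact: (integrableZl measurableT _ nfi).
- move=> z _; rewrite -mulrBr normrM mulrC ler_wpM2r//.
  apply: (le_trans (hL _ _)); have -> : z - x - (z - y) = y - x.
    by apply/rowP => j; rewrite !mxE; ring.
  by rewrite distrC.
Qed.

Lemma moments_taylor m F : mu.-integrable setT (EFin \o F) ->
  exists C, 0 <= C /\ forall x y : E, `|moments m F y - moments m F x +
     \sum_(i < n) moments (incr i m) F x * (y - x) ord0 i| <= C * `|y - x| ^+ 2.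
Proof.
move=> fi; have [C [C0 hC]] := rho_taylor m.
have nfi : mu.-integrable setT (EFin \o (fun z => `|F z|)) by exact: integrable_norm.
exists (C * \int[mu]_z `|F z|); split.
  by rewrite mulr_ge0//; exact: Rintegral_ge0.
move=> x y.
have i1 : mu.-integrable setT (EFin \o (fun z : E => F z * rho m (z - y) - F z * rho m (z - x))).
  by apply: (integrableB measurableT (moments_integrable m y fi) (moments_integrable m x fi)).
have i2 (i : 'I_n) : mu.-integrable setT (EFin \o (fun z : E => (y - x) ord0 i * (F z * rho (incr i m) (z - x)))).
  exact: (integrableZl measurableT _ (moments_integrable (incr i m) x fi)).
have i3 : mu.-integrable setT (EFin \o (fun z : E => \sum_(i < n) (y - x) ord0 i * (F z * rho (incr i m) (z - x)))).
  have := @integrable_sum _ _ _ mu setT measurableT _ (index_enum 'I_n) xpredT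
    (fun i z => ((y - x) ord0 i * (F z * rho (incr i m) (z - x)))%:E) (fun i _ => i2 i).
  by under eq_fun do rewrite sumEFin.
have -> : moments m F y - moments m F x + \sum_(i < n) moments (incr i m) F x * (y - x) ord0 i =
   \int[mu]_z (F z * (rho m (z - y) - rho m (z - x) +
      \sum_(i < n) rho (incr i m) (z - x) * (y - x) ord0 i)).
  transitivity (\int[mu]_z ((F z * rho m (z - y) - F z * rho m (z - x)) +
     \sum_(i < n) (y - x) ord0 i * (F z * rho (incr i m) (z - x)))); last first.
    apply: eq_Rintegral => z _; rewrite mulrDr mulrBr mulr_sumr; congr (_ + _).
    by apply: eq_bigr => i _; ring.
  rewrite RintegralD// RintegralB//; try exact: moments_integrable.
  congr (_ + _); rewrite /Rintegral.
  under eq_integral do rewrite -sumEFin.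
  rewrite integral_sum//.
  rewrite -sum_fine; last by move=> i _; exact: (integrable_fin_num measurableT (i2 i)).
  apply: eq_bigr => i _; rewrite -/(Rintegral _ _ _) RintegralZl 1?mulrC//.
  exact: moments_integrable.
set G := fun z => _.
have iG : mu.-integrable setT (EFin \o G).
  have := integrableD measurableT i1 i3; apply: eq_integrable => // z _ /=.
  rewrite -EFinD; congr (_%:E); rewrite /G mulrDr mulrBr mulr_sumr; congr (_ + _).
  by apply: eq_bigr => i _; ring.
apply: (le_trans (le_normr_Rintegral measurableT iG)).
rewrite mulrAC -RintegralZl//; apply: le_Rintegral => //.
- exact: integrable_norm.
- exact: (integrableZl measurableT _ nfi).
- move=> z _; rewrite /G normrM mulrC ler_wpM2r//.
  have := hC (z - x) (- (y - x)); rewrite normrN opprB addrA subrK.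
  rewrite (_ : \sum_(i < n) _ = - \sum_(i < n) rho (incr i m) (z - x) * (y - x) ord0 i) ?opprK//.
  by rewrite -sumrN; apply: eq_bigr => i _; rewrite !mxE; ring.
Qed.

(** Translates of the mollifier are test functions, and truncation to K is
    invisible on their supports. *)
Lemma weak_moments (D K : set E) (i : 'I_n) (f g : E -> R) m (x : E) :
  weak_partial D i f g -> [set z | `|z - x| <= e] `<=` K -> K `<=` D ->
  moments (incr i m) (f \_ K) x = - moments m (g \_ K) x.
Proof.
move=> fg xK KD.
have test : test_function D (fun z => rho m (z - x)) by apply: rho_test; exact: subset_trans KD.
have red (F : E -> R) m' : \int[mu]_(z in D) (F z * rho m' (z - x)) = moments m' (F \_ K) x.
  rewrite Rintegral_mkcond /moments; apply: eq_Rintegral => z _; rewrite !patchE.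
  have [zx|zx] := leP `|z - x| e.
    have Kz : K z by exact: xK.
    by rewrite (mem_set Kz) (mem_set (KD z Kz)).
  have r0 : rho m' (z - x) = 0 by apply: rho_far; exact: ltW.
  by rewrite r0 mulr0; case: ifP => _; rewrite ?mulr0.
have := fg _ test; rewrite red => <-.
rewrite -red; apply: eq_Rintegral => z _; congr (_ * _).
by rewrite /partial (@derive_val _ _ _ _ _ _ _ (rho_shift_derive m x z i)).
Qed.

End mollifier.

(** * Taylor expansions with quadratic remainders *)

Lemma addrKl (V : zmodType) (x y : V) : x + y - x = y.
Proof. by rewrite addrC addKr. Qed.

Section second_order.
Variables (R : realType) (n : nat).
Local Notation E := 'rV[R]_n.
Local Notation mu := (lebesgue_rV R n).

Definition dotp (p : 'I_n -> R) (h : E) : R := \sum_(i < n) p i * h ord0 i.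

Definition quadf (H : 'I_n -> 'I_n -> R) (h : E) : R :=
  \sum_(i < n) (\sum_(j < n) H i j * h ord0 j) * h ord0 i.

Lemma dotp_bound (p : 'I_n -> R) (h : E) (a : R) : (forall i, `|p i| <= a) ->
  `|dotp p h| <= n%:R * a * `|h|.
Proof.
move=> pa; apply: (le_trans (ler_norm_sum _ _ _)).
rewrite -mulrA mulr_natl -[X in _ *+ X]card_ord -sumr_const; apply: ler_sum => i _.
by rewrite normrM ler_pM// rV_coord_le.
Qed.

Lemma dotpZ p (t : R) (h : E) : dotp p (t *: h) = t * dotp p h.
Proof. by rewrite /dotp mulr_sumr; apply: eq_bigr => i _; rewrite mxE; ring. Qed.

Lemma dotpN p (h : E) : dotp p (- h) = - dotp p h.
Proof. by rewrite -scaleN1r dotpZ mulN1r. Qed.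

Lemma dotpD p (h k : E) : dotp p (h + k) = dotp p h + dotp p k.
Proof. by rewrite /dotp -big_split /=; apply: eq_bigr => i _; rewrite mxE; ring. Qed.

Lemma dotpB p (h k : E) : dotp p (h - k) = dotp p h - dotp p k.
Proof. by rewrite dotpD dotpN. Qed.

Lemma dotpBl p q (h : E) : dotp (fun i => p i - q i) h = dotp p h - dotp q h.
Proof. by rewrite /dotp -sumrB; apply: eq_bigr => i _; ring. Qed.

Lemma dotp_unit p i : dotp p (unit_vec R i) = p i.
Proof.
rewrite /dotp (bigD1 i)//= big1 ?addr0; last first.
  by move=> k ki; rewrite mxE eqxx/= (negPf ki) mulr0.
by rewrite mxE !eqxx mulr1.
Qed.

(** Expansions with explicit remainders are all that contact arguments use of the
    gradient g and the Hessian H of w, and they are stable under differences. *)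
Record C11 (C : R) (w : E -> R) (g : 'I_n -> E -> R) (H : 'I_n -> 'I_n -> E -> R) : Prop := MkC11 {
  C11_ge0 : 0 <= C ;
  C11_fst : forall x y : E, `|w y - w x - dotp (g ^~ x) (y - x)| <= C * `|y - x| ^+ 2 ;
  C11_snd : forall i (x y : E), `|g i y - g i x - dotp (fun j => H i j x) (y - x)| <= C * `|y - x| ^+ 2 ;
  C11_lip : forall i j (x y : E), `|H i j y - H i j x| <= C * `|y - x| }.

Lemma C11B C C' w w' g g' H H' : C11 C w g H -> C11 C' w' g' H' ->
  C11 (C + C') (fun x => w x - w' x) (fun i x => g i x - g' i x) (fun i j x => H i j x - H' i j x).
Proof.
move=> [C0 h1 h2 h3] [C0' h1' h2' h3']; split.
- exact: addr_ge0.
- move=> x y; rewrite dotpBl (_ : _ - _ = (w y - w x - dotp (g ^~ x) (y - x)) - (w' y - w' x - dotp (g' ^~ x) (y - x))); last by ring.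
  by rewrite mulrDl (le_trans (ler_normB _ _))// lerD.
- move=> i x y; rewrite dotpBl (_ : _ - _ = (g i y - g i x - dotp (fun j => H i j x) (y - x)) - (g' i y - g' i x - dotp (fun j => H' i j x) (y - x))); last by ring.
  by rewrite mulrDl (le_trans (ler_normB _ _))// lerD.
- move=> i j x y; rewrite (_ : _ - _ = (H i j y - H i j x) - (H' i j y - H' i j x)); last by ring.
  by rewrite mulrDl (le_trans (ler_normB _ _))// lerD.
Qed.

Lemma small_ge0 (A K r : R) : 0 < r -> (forall t, 0 < t < r -> - (K * t) <= A) -> 0 <= A.
Proof.
move=> r0 h; rewrite leNgt; apply/negP => A0.
have K0 : 0 < `|K| + 1 by rewrite ltr_wpDl.
pose t := Num.min (r / 2) (- A / 2 / (`|K| + 1)).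
have t0 : 0 < t by rewrite lt_min !divr_gt0// oppr_gt0.
have tr : t < r by rewrite gt_min; apply/orP; left; lra.
have := h t; rewrite t0 tr => /(_ isT) hA.
have : t * (`|K| + 1) <= - A / 2 by rewrite -ler_pdivlMr// ge_min lexx orbT.
have h1 : K * t <= `|K| * t by rewrite ler_wpM2r// ?(ltW t0)// ler_norm.
by move: h1 hA t0; rewrite mulrDr mulr1 (mulrC t); move: (K * t) (`|K| * t) => X Y; lra.
Qed.

(** Expand along the ray x + t xi and divide by t, then by t^2. *)
Lemma C11_contact C w g H (x : E) (p : 'I_n -> R) (r : R) : C11 C w g H -> 0 < r ->
  (forall y, `|y - x| < r -> w x + dotp p (y - x) <= w y) ->
  (forall i, g i x = p i) /\ forall xi : E, 0 <= quadf (fun i j => H i j x) xi.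
Proof.
move=> [C0 h1 h2 h3] r0 hw.
have rx (xi : E) : 0 < r / (`|xi| + 1) by rewrite divr_gt0// ltr_wpDl.
have rt (xi : E) t : 0 < t < r / (`|xi| + 1) -> `|(x + t *: xi) - x| < r.
  move=> /andP[t0 tr]; rewrite addrKl normrZ gtr0_norm//.
  have x1 : 0 < `|xi| + 1 by rewrite ltr_wpDl.
  apply: (@le_lt_trans _ _ (t * (`|xi| + 1))); last by rewrite -ltr_pdivlMr.
  by rewrite ler_wpM2l ?(ltW t0)// lerDl.
have gp xi : 0 <= dotp (g ^~ x) xi - dotp p xi.
  apply: (@small_ge0 _ (C * `|xi| ^+ 2) _ (rx xi)) => t /[dup] ht /rt /hw.
  have := h1 x (x + t *: xi); rewrite addrKl !dotpZ normrZ => e1 e2.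
  have /andP[t0 _] := ht; rewrite gtr0_norm// exprMn in e1.
  have e3 : w (x + t *: xi) - w x - t * dotp (g ^~ x) xi <= C * (t ^+ 2 * `|xi| ^+ 2).
    by apply: le_trans e1; exact: ler_norm.
  rewrite -(ler_pM2l t0) mulrN.
  rewrite (_ : t * (C * `|xi| ^+ 2 * t) = C * (t ^+ 2 * `|xi| ^+ 2)); last by ring.
  by rewrite mulrBr; lra.
have gE i : g i x = p i.
  have := gp (unit_vec R i); have := gp (- unit_vec R i).
  by rewrite !dotpN !dotp_unit => e1 e2; apply/eqP; rewrite eq_le; apply/andP; split; lra.
split => // xi.
have der t : is_derive t (1 : R) (fun t => w (x + t *: xi) - t * dotp p xi)
    (dotp (g ^~ (x + t *: xi)) xi - dotp p xi).
  apply: (@is_derive_quad _ _ _ _ _ _ (C * `|xi| ^+ 2)) => h.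
  have := h1 (x + t *: xi) (x + (h *: 1 + t) *: xi).
  rewrite (_ : x + (h *: 1 + t) *: xi - (x + t *: xi) = h *: xi); last first.
    by apply/rowP => j; rewrite !mxE /GRing.scale /=; ring.
  rewrite dotpZ normrZ exprMn real_normK ?num_real// => e.
  rewrite (_ : C * `|xi| ^+ 2 * h ^+ 2 = C * (h ^+ 2 * `|xi| ^+ 2)); last by ring.
  apply: le_trans e; rewrite le_eqVlt; apply/orP; left; apply/eqP; congr `|_|.
  by rewrite /GRing.scale /=; ring.
pose K := n%:R * (C * `|xi| ^+ 2) * `|xi|.
have K0 : 0 <= K by rewrite !mulr_ge0// sqr_ge0.
apply: (@small_ge0 _ K _ (rx xi)) => t ht; have /andP[t0 _] := ht.
have [c] : exists2 c, c \in `]0, t[ & (w (x + t *: xi) - t * dotp p xi) - (w (x + 0 *: xi) - 0 * dotp p xi) =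
    (dotp (g ^~ (x + c *: xi)) xi - dotp p xi) * (t - 0).
  apply: (MVT t0 (fun s _ => der s)).
  apply: continuous_subspaceT => s; apply: differentiable_continuous; apply/derivable1_diffP.
  exact: (@ex_derive _ _ _ _ _ _ _ (der s)).
rewrite in_itv/= subr0 scale0r addr0 mul0r subr0 => /andP[c0 ct] e.
have := hw _ (rt xi t ht); rewrite addrKl dotpZ => e2.
have {e e2} : 0 <= dotp (g ^~ (x + c *: xi)) xi - dotp p xi.
  by rewrite -(pmulr_lge0 _ t0) -e; lra.
rewrite -(_ : dotp (g ^~ x) xi = dotp p xi); last by apply: eq_bigr => i _; rewrite gE.
rewrite -dotpBl => e.
have eC : `|dotp (fun i => g i (x + c *: xi) - g i x - dotp (fun j => H i j x) (c *: xi)) xi| <= c ^+ 2 * K.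
  apply: (le_trans (@dotp_bound _ xi (C * (c ^+ 2 * `|xi| ^+ 2)) _)).
    move=> i; have := h2 i x (x + c *: xi); rewrite addrKl normrZ exprMn.
    by rewrite real_normK ?num_real.
  by rewrite le_eqVlt; apply/orP; left; apply/eqP; rewrite /K; ring.
move: eC; rewrite dotpBl (_ : dotp (fun i => dotp _ (c *: xi)) xi = c * quadf (fun i j => H i j x) xi); last first.
  rewrite /dotp /quadf mulr_sumr; apply: eq_bigr => i _; rewrite mulrA mulr_sumr; congr (_ * _).
  by apply: eq_bigr => j _; rewrite mxE; ring.
set q := quadf _ _; set z := dotp _ _ in e * => eC.
have : - (c ^+ 2 * K) <= c * q by move: eC; rewrite ler_norml => /andP[h4 h5]; lra.
rewrite expr2 -mulrA -mulrN ler_pM2l// => e4; apply: le_trans e4.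
by rewrite lerN2 mulrC ler_wpM2l// ltW.
Qed.

Lemma C11_moments (e : R) (F : E -> R) : 0 < e -> mu.-integrable setT (EFin \o F) ->
  exists C, C11 C (moments e (fun=> 0%N) F)
    (fun i x => - moments e (incr i (fun=> 0%N)) F x)
    (fun i j x => moments e (incr j (incr i (fun=> 0%N))) F x).
Proof.
move=> e0 Fi; set m0 := fun=> 0%N.
have [C0 [C00 hC0]] := moments_taylor e0 m0 Fi.
have c1 i : {C : R | 0 <= C /\ forall x y : E, `|moments e (incr i m0) F y - moments e (incr i m0) F x +
     \sum_(j < n) moments e (incr j (incr i m0)) F x * (y - x) ord0 j| <= C * `|y - x| ^+ 2}.
  by apply: cid; exact: moments_taylor.
have c2 i j : {L : R | 0 <= L /\ forall x y : E, `|moments e (incr j (incr i m0)) F x -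
    moments e (incr j (incr i m0)) F y| <= L * `|x - y|}.
  by apply: cid; exact: moments_lip.
pose S1 := \sum_(i < n) sval (c1 i).
pose S2 := \sum_(i < n) \sum_(j < n) sval (c2 i j).
have p1 i : 0 <= sval (c1 i) by case: (svalP (c1 i)).
have p2 i j : 0 <= sval (c2 i j) by case: (svalP (c2 i j)).
have S10 : 0 <= S1 by exact: sumr_ge0.
have S20 : 0 <= S2 by apply: sumr_ge0 => i _; exact: sumr_ge0.
have l1 i : sval (c1 i) <= S1 by rewrite /S1 (bigD1 i)//= lerDl sumr_ge0.
have l2 i j : sval (c2 i j) <= S2.
  rewrite /S2 (bigD1 i)//= (bigD1 j)//= -addrA lerDl addr_ge0// ?sumr_ge0// => k _; exact: sumr_ge0.
exists (C0 + S1 + S2); split.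
- by rewrite !addr_ge0.
- move=> x y; have := hC0 x y; rewrite (_ : \sum_(i < n) _ = - dotp (fun i => - moments e (incr i m0) F x) (y - x)).
    by move=> /le_trans; apply; rewrite ler_wpM2r ?sqr_ge0// -addrA lerDl addr_ge0.
  by rewrite /dotp -sumrN; apply: eq_bigr => i _; ring.
- move=> i x y; have [_ h] := svalP (c1 i); have := h x y.
  rewrite -/(dotp (fun j => moments e (incr j (incr i m0)) F x) (y - x)).
  set D := dotp _ _; set a := moments _ _ _ y; set b := moments _ _ _ x.
  have -> : - a - - b - D = - (a - b + D) by ring.
  rewrite normrN.
  move=> /le_trans; apply; rewrite ler_wpM2r ?sqr_ge0//.
  by have := l1 i; lra.
- move=> i j x y; have [_ h] := svalP (c2 i j); apply: (le_trans (h y x)).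
  by rewrite ler_wpM2r//; have := l2 i j; lra.
Qed.

End second_order.

(** * A discrete area formula *)

Section grid.
Variables (R : realType) (n : nat).
Local Notation E := 'rV[R]_n.
Local Notation mu := (lebesgue_rV R n).
Variable s : R.
Hypothesis s0 : 0 < s.

Definition cell (x : E) : {ffun 'I_n -> int} := [ffun i => Num.ceil (x ord0 i / s)].

Definition cell_center (m : {ffun 'I_n -> int}) : E := \row_i ((m i)%:~R * s - s / 2).

Lemma cellE m : [set x | cell x = m] = ocbox (fun i => ((m i)%:~R - 1) * s) (fun i => (m i)%:~R * s).
Proof.
apply/seteqP; split => x /=.
  move=> <- i; rewrite ffunE; have := ceil_itv (x ord0 i / s).
  by rewrite ltr_pdivlMr// ler_pdivrMr// intrD.
move=> h; apply/ffunP => i; rewrite ffunE; apply: ceil_def.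
by rewrite ltr_pdivlMr// ler_pdivrMr// intrD; exact: h.
Qed.

Lemma measurable_cell m : measurable [set x | cell x = m].
Proof. by rewrite cellE; exact: measurable_ocbox. Qed.

Lemma cell_measure m : ((s ^+ n)%:E <= mu [set x | cell x = m])%E.
Proof.
rewrite cellE; apply: ocbox_ge; rewrite -[X in s ^+ X]card_ord -prodr_const; apply: ler_prod => i _.
rewrite (ltW s0)/= le_max; apply/orP; right.
by rewrite mulrBl mul1r opprB addrC subrK.
Qed.

Lemma cell_centerP x : `|x - cell_center (cell x)| <= s / 2.
Proof.
apply: rV_norm_le; first by rewrite divr_ge0// ltW.
have /= := cellE (cell x); move/seteqP => [/(_ x erefl) h _] i.
by have /andP := h i; rewrite !mxE ler_norml => -[h1 h2]; apply/andP; split; lra.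
Qed.

Lemma cell_dist x y : cell x = cell y -> `|x - y| <= s.
Proof.
move=> xy; rewrite (splitr s) (_ : x - y = (x - cell_center (cell x)) - (y - cell_center (cell y))).
  by apply: (le_trans (ler_normB _ _)); apply: lerD; exact: cell_centerP.
by rewrite xy; apply/rowP => i; rewrite !mxE; ring.
Qed.

(** On a cell of side s the map g moves by at most about (a + rho) s / 2 from its
    value at the centre, so its image lies in a cube whose volume is at most
    (a + rho + 2 C s)^n times that of the cell. The cells that meet Z cover the
    preimages of the points of Y; summing over them gives the bound. *)
Lemma area_grid (g : 'I_n -> E -> R) (rho : E -> R) (a C : R) (Z Y : set E) :
  0 < C -> 0 <= a -> (forall x, 0 <= rho x) -> measurable_fun setT rho ->
  (forall x y, `|rho x - rho y| <= C * `|x - y|) ->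
  (forall i x y, `|g i y - g i x| <= (a + rho x) * `|y - x| + C * `|y - x| ^+ 2) ->
  (forall p : E, Y p -> exists2 x, Z x & forall i, p ord0 i = g i x) -> measurable Y ->
  exists U, [/\ measurable U, forall x : E, U x -> exists2 z, Z z & `|z - x| <= s &
    (mu Y <= \int[mu]_(x in U) ((a + rho x + 2 * C * s) ^+ n)%:E)%E].
Proof.
move=> C0 a0 rho0 mrho rhoL gL YZ mY.
pose hit m := exists2 x, Z x & cell x = m.
pose Q (k : nat) : set E := [set x | pickle_inv k = Some (cell x) /\ hit (cell x)].
have QE k : Q k = set0 \/ exists2 m, hit m & Q k = [set x | cell x = m].
  have [[m hm km]|nh] := pselect (exists2 m, hit m & pickle_inv k = Some m).
    right; exists m => //; apply/seteqP; split => x /=.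
      by move=> [e _]; move: e; rewrite km => -[].
    by move=> e; split; rewrite ?km e.
  by left; apply/seteqP; split => // x [e h]; apply: nh; exists (cell x).
have mQ k : measurable (Q k).
  by have [->|[m _ ->]] := QE k; [exact: measurable0|exact: measurable_cell].
pose rad m := (a + rho (cell_center m)) * (s / 2) + C * s ^+ 2 / 2.
pose B (k : nat) : set E := if `[< Q k !=set0 >] then
  (if pickle_inv k is Some m then ocbox (fun i => g i (cell_center m) - rad m) (fun i => g i (cell_center m) + rad m) else set0) else set0.
pose h x := ((a + rho x + 2 * C * s) ^+ n)%:E.
have h0 x : (0 <= h x)%E.
  by rewrite lee_fin exprn_ge0// !addr_ge0// !mulr_ge0// ltW.
have mh : measurable_fun setT h.
  apply/measurable_EFinP; apply: measurable_funX; apply: measurable_funD => //.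
  exact: measurable_funD.
have mB k : measurable (B k).
  rewrite /B; case: asboolP => // _; case: pickle_inv => // m; exact: measurable_ocbox.
have rad0 m : 0 <= rad m.
  by rewrite addr_ge0// ?mulr_ge0 ?addr_ge0 ?invr_ge0 ?sqr_ge0 ?(ltW C0) ?(ltW s0).
have muB k : (mu (B k) <= \int[mu]_(x in Q k) h x)%E.
  rewrite /B; case: asboolP => [|_]; last by rewrite measure0; exact: integral_ge0.
  move=> [x [ek hx]]; rewrite ek; set m := cell x in ek hx *.
  have QEm : Q k = [set x | cell x = m].
    apply/seteqP; split => y /=; first by case; rewrite ek => -[->].
    by move=> e; split; rewrite e ?ek.
  apply: (@le_trans _ _ (((2 * rad m / s) ^+ n)%:E * (s ^+ n)%:E)%E).
    apply: ocbox_le; rewrite -exprMn divfK ?gt_eqF//.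
    rewrite -[X in _ <= _ ^+ X]card_ord -prodr_const; apply: ler_prod => i _.
    have -> : g i (cell_center m) + rad m - (g i (cell_center m) - rad m) = 2 * rad m by ring.
    by rewrite max_r ?lexx ?andbT mulr_ge0.
  apply: (@le_trans _ _ (((2 * rad m / s) ^+ n)%:E * mu (Q k))%E).
    rewrite QEm; apply: lee_wpmul2l; last exact: cell_measure.
    by rewrite lee_fin exprn_ge0// divr_ge0 ?mulr_ge0// ltW.
  rewrite -integral_cst//; apply: ge0_le_integral => //.
  - by move=> y _; rewrite lee_fin exprn_ge0// divr_ge0 ?mulr_ge0// ltW.
  - exact: measurable_funTS.
  - move=> y; rewrite QEm => /= ym; rewrite lee_fin lerXn2r ?nnegrE//.
    + by rewrite divr_ge0 ?mulr_ge0// ltW.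
    + by rewrite !addr_ge0// !mulr_ge0// ltW.
    + rewrite ler_pdivrMr//.
      have := rhoL (cell_center m) y; rewrite distrC => /(le_trans (ler_norm _)) l1.
      have := cell_centerP y; rewrite ym => l2.
      have l3 : C * `|cell_center m - y| <= C * (s / 2) by rewrite ler_pM2l// distrC.
      rewrite /rad (_ : 2 * _ = (a + rho (cell_center m) + C * s) * s); last by field.
      rewrite ler_pM2r//; have : rho (cell_center m) <= rho y + C * (s / 2).
        by move: (rhoL (cell_center m) y); rewrite ler_norml => /andP[_ l4]; lra.
      have : 0 < C * s by rewrite mulr_gt0.
      by rewrite mulrA -(mulrA 2); move: (C * s) => cs; lra.
exists (\bigcup_k Q k); split.
- exact: bigcupT_measurable.
- move=> x [k _ [_ [z Zz e]]]; exists z => //; exact: cell_dist.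
rewrite ge0_integral_bigcup//.
- apply: (@le_trans _ _ (\sum_(0 <= k <oo) mu (B k))%E).
    apply: measure_sigma_subadditive => // p /YZ[x Zx gp].
    have Qx : Q (pickle (cell x)) x by split; [exact: pickleK_inv|exists x].
    exists (pickle (cell x)) => //; rewrite /B; case: asboolP => [_|]; last by case; exists x.
    rewrite pickleK_inv => i; rewrite gp.
    have := gL i (cell_center (cell x)) x; have := cell_centerP x.
    set d := `|_| => ds gd; set c := cell_center (cell x).
    have d0 : 0 <= d by exact: normr_ge0.
    have b1 : (a + rho c) * d <= (a + rho c) * (s / 2) by rewrite ler_wpM2l// addr_ge0.
    have b2 : C * d ^+ 2 < C * s ^+ 2 / 2.
      rewrite -mulrA ltr_pM2l//; apply: (@le_lt_trans _ _ ((s / 2) ^+ 2)).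
        by rewrite lerXn2r// nnegrE// divr_ge0// ltW.
      have : 0 < s ^+ 2 by exact: exprn_gt0.
      by rewrite exprMn; move: (s ^+ 2) => S S0; rewrite exprVn; lra.
    have := le_lt_trans gd (ler_ltD b1 b2); rewrite -/(rad (cell x)) ltr_norml => /andP[g1 g2].
    by apply/andP; split; [|apply: ltW]; lra.
  apply: lee_nneseries => // k _; exact: muB.
- exact: measurable_funTS.
- by move=> x _; exact: h0.
- apply/trivIsetP => i j _ _ ij; apply/seteqP; split => // x [[e1 _] [e2 _]].
  have := @pickle_invK {ffun 'I_n -> int} i; have := @pickle_invK {ffun 'I_n -> int} j.
  by rewrite e1 e2 /= => ej ei; move: ij; rewrite -ei -ej eqxx.
Qed.

End grid.

(** * Mollified weak derivatives *)

Section fast_mollification.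
Variables (R : realType) (n : nat).
Local Notation E := 'rV[R]_n.
Local Notation mu := (lebesgue_rV R n).
Local Notation rho0 := (@rho0 R n).

Lemma unif_modulus (f : E -> R) (K : set E) (a : R) : continuous f -> compact K -> 0 < a ->
  exists2 dl : R, 0 < dl & forall x y, K x -> `|x - y| < dl -> `|f x - f y| <= a.
Proof.
move=> cf /compact_near_coveringP cK a0.
have a20 : 0 < a / 2 by exact: divr_gt0.
have h0 x : K x -> \forall x' \near x & k \near \oo, forall y, `|x' - y| < (k.+1%:R : R)^-1 -> `|f x' - f y| <= a.
  move=> Kx; have /(@cvgrPdist_le _ _ _ (nbhs x) _ f (f x))/(_ _ a20) := cf x.
  rewrite -nbhs_ballE => -[r /= r0 hr].
  have r20 : 0 < r / 2 by exact: divr_gt0.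
  exists (ball x (r / 2), [set k | (k.+1%:R : R)^-1 < r / 2]) => /=.
    split; first exact: nbhsx_ballx.
    exact: near_infty_natSinv_lt (PosNum r20).
  move=> [x' k] [/= xx' dr] y xy.
  have b1 : ball x r x' by move: xx'; rewrite -!ball_normE /ball_/= => /lt_trans; apply; lra.
  have b2 : ball x r y.
    move: xx'; rewrite -!ball_normE /ball_/= => xx'.
    by have := ler_distD x' x y; have := lt_trans xy dr; lra.
  have := hr _ b1; have := hr _ b2 => /= h1 h2.
  rewrite (splitr a) (le_trans (ler_distD (f x) _ _))//; apply: lerD; last exact: h1.
  by rewrite distrC; exact: h2.
have [N _ hN] := cK nat \oo (fun k x => forall y, `|x - y| < (k.+1%:R : R)^-1 -> `|f x - f y| <= a) _ h0.
exists (N.+1%:R^-1); first by rewrite invr_gt0.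
by move=> x y Kx; apply: (hN N) => //=.
Qed.

Lemma closed_measurable_rV (A : set E) : closed A -> measurable A.
Proof.
by move=> cA; rewrite -[A]setCK; apply: measurableC; apply: open_measurable_rV; rewrite openC.
Qed.

Lemma compact_measurable_rV (A : set E) : compact A -> measurable A.
Proof. by move=> cA; apply: closed_measurable_rV; exact: compact_closed. Qed.

Lemma measurable_norm_le (r : R) : measurable [set x : E | `|x| <= r].
Proof.
apply: closed_measurable_rV; have := @closed_cball R n 0 r; congr closed.
by apply/seteqP; split => x /=; rewrite subr0.
Qed.

(** Along a sequence of scales for which the L1 errors are summable, mollifications
    converge almost everywhere with an integrable bound; finitely many functions
    can share the sequence. *)
Lemma fast_moll (I : finType) (F : I -> E -> R) (r : R) : 0 <= r ->
  (forall i, mu.-integrable setT (EFin \o F i)) -> (forall i x, r < `|x| -> F i x = 0) ->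
  exists e_ : nat -> R, (forall k, 0 < e_ k <= k.+1%:R^-1) /\
   forall i, exists G, mu.-integrable [set x | `|x| <= r] (EFin \o G) /\
     {ae mu, forall x, `|x| <= r -> (forall k, `|moll (rho0 (e_ k)) (F i) x - F i x| <= G x) /\
       moll (rho0 (e_ k)) (F i) x @[k --> \oo] --> F i x}.
Proof.
move=> r0 Fi Fs; pose e' (j : nat) : R := j.+1%:R^-1.
have e'0 j : 0 < e' j by rewrite invr_gt0.
have ker j : is_kernel (e' j) (rho0 (e' j)) by exact: rho0_kernel.
set B := [set x : E | `|x| <= r].
have mB : measurable B by exact: measurable_norm_le.
have ce : e' j @[j --> \oo] --> 0 by exact: cvg_harmonic.
have hK k i : {K | forall j, (K <= j)%N ->
    (\int[mu]_(x in B) `|moll (rho0 (e' j)) (F i) x - F i x|%:E <= (2^-1 ^+ k)%:E)%E}.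
  apply: cid; apply: (@moll_cvg_L1 R n (fun j => rho0 (e' j)) e' (F i) r) => //; exact: Fs.
pose J k := (\max_i (sval (hK k i)) + k)%N.
exists (e' \o J); split => [k|i].
  by rewrite /= e'0/= /e' lef_pV2 ?posrE// ler_nat ltnS leq_addl.
have mm j : measurable_fun setT (fun x => `|moll (rho0 (e' j)) (F i) x - F i x|).
  apply: measurableT_comp => //; apply: measurable_funB.
    exact: continuous_measurable_rV (moll_cont (ker j) (Fi i)).
  by apply/measurable_EFinP; exact: measurable_int (Fi i).
have [||| G [iG aeG]] := @summable_ae_dominated _ _ _ mu B
  (fun k x => `|moll (rho0 (e' (J k))) (F i) x - F i x|) 1 mB.
- by move=> k; apply: measurable_funTS; exact: mm.
- by [].
- move=> k; rewrite mul1r; apply: (svalP (hK k i)).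
  by rewrite /J; apply: leq_trans (leq_addr _ _); exact: (@leq_bigmax _ (fun i => sval (hK k i)) i).
exists G; split => //; apply: filterS aeG => x h Bx; have [h1 _ h2] := h Bx.
by split => //; apply/subr_cvg0; apply/norm_cvg0P.
Qed.

(** A convex power lies above its tangent at s. *)
Lemma bernoulli_tangent m (s t : R) : 0 <= s -> 0 <= t ->
  s ^+ m.+1 + m.+1%:R * s ^+ m * (t - s) <= t ^+ m.+1.
Proof.
move=> s0 t0; elim: m => [|m IH]; first by rewrite expr0 !expr1; lra.
rewrite (exprS t); apply: le_trans (ler_wpM2l t0 IH).
have h : 0 <= m.+1%:R * s ^+ m * (t - s) ^+ 2 by rewrite mulr_ge0 ?sqr_ge0// mulr_ge0// exprn_ge0.
rewrite -subr_ge0; apply: le_trans h _; rewrite le_eqVlt; apply/orP; left; apply/eqP.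
by rewrite -(natr1 m.+1) !exprS; ring.
Qed.

(** Jensen's inequality: average the tangent inequality at s = moll rho f x. *)
Lemma moll_pow e (rho : E -> R) (f : E -> R) m (x : E) : (0 < m)%N -> is_kernel e rho -> (forall z, 0 <= f z) ->
  mu.-integrable setT (EFin \o f) -> mu.-integrable setT (EFin \o (fun z => f z ^+ m)) ->
  moll rho f x ^+ m <= moll rho (fun z => f z ^+ m) x.
Proof.
case: m => // m' _ hk f0 fi fni.
set s := moll _ f x.
have s0 : 0 <= s by apply: Rintegral_ge0 => z _; rewrite mulr_ge0//; exact: (kernel_ge0 hk).
pose c := s ^+ m'.+1 - m'.+1%:R * s ^+ m' * s; pose b := m'.+1%:R * s ^+ m'.
have i1 : mu.-integrable setT (EFin \o (fun z => c * rho (x - z))).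
  exact: (integrableZl measurableT _ (kernel_integrable hk x)).
have i2 : mu.-integrable setT (EFin \o (fun z => b * (f z * rho (x - z)))).
  exact: (integrableZl measurableT _ (moll_integrable hk x fi)).
have -> : s ^+ m'.+1 = \int[mu]_z (c * rho (x - z) + b * (f z * rho (x - z))).
  rewrite RintegralD// RintegralZl; last 2 first.
  - by [].
  - exact: (kernel_integrable hk _).
  rewrite RintegralZl; last 2 first.
  - by [].
  - exact: (moll_integrable hk _ fi).
  by rewrite (kernel_Rint hk) -/(moll rho f x) -/s /c /b; ring.

apply: le_Rintegral => //.
- exact: (integrableD measurableT i1 i2).
- exact: (moll_integrable hk _ fni).
- move=> z _; rewrite mulrA -mulrDl ler_wpM2r//; first exact: (kernel_ge0 hk).
  by apply: le_trans (bernoulli_tangent m' s0 (f0 z)); rewrite /c /b; lra.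
Qed.

Lemma Rintegral_sum (D : set E) (I : finType) (f : I -> E -> R) : measurable D ->
  (forall i, mu.-integrable D (EFin \o f i)) ->
  \int[mu]_(x in D) (\sum_i f i x) = \sum_i \int[mu]_(x in D) f i x.
Proof.
move=> mD fi; rewrite /Rintegral; under eq_integral do rewrite -sumEFin.
rewrite integral_sum// -sum_fine// => i _; exact: (integrable_fin_num mD (fi i)).
Qed.

Lemma integrable_sumr (D : set E) (I : finType) (f : I -> E -> R) : measurable D ->
  (forall i, mu.-integrable D (EFin \o f i)) ->
  mu.-integrable D (EFin \o (fun x => \sum_i f i x)).
Proof.
move=> mD fi; have := @integrable_sum _ _ _ mu D mD _ (index_enum I) xpredT
    (fun i z => (f i z)%:E) (fun i _ => fi i).
by under eq_fun do rewrite sumEFin.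
Qed.

Lemma compact_norm_le (A : set E) : compact A -> exists2 r : R, 0 <= r & forall x, A x -> `|x| <= r.
Proof.
move=> /compact_bounded[M [_ hM]]; exists (`|M| + 1); first by rewrite addr_ge0.
by move=> x Ax; apply: (hM (`|M| + 1)) => //; have := ler_norm M; lra.
Qed.

Lemma integrable_patch (D : set E) (f : E -> R) : measurable D ->
  mu.-integrable D (EFin \o f) -> mu.-integrable setT (EFin \o (f \_ D)).
Proof.
move=> mD fi; have -> : EFin \o (f \_ D) = (EFin \o f) \_ D.
  by apply/funext => x; rewrite /= !patchE; case: ifP.
exact: (integrable_mkcond _ mD).1.
Qed.

End fast_mollification.

Section approximation.
Variables (R : realType) (n : nat).
Local Notation E := 'rV[R]_n.
Local Notation mu := (lebesgue_rV R n).

(** The entrywise sum is convenient as a matrix norm since it is visibly measurable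
    and integrable in the entries. *)
Definition hessn (H : 'I_n -> 'I_n -> R) : R := \sum_(p : 'I_n * 'I_n) `|H p.1 p.2|.

Lemma hessn_ge0 H : 0 <= hessn H.
Proof. by apply: sumr_ge0. Qed.

Variables (D K : set E) (u : E -> R) (Du : 'I_n -> E -> R) (D2u : 'I_n -> 'I_n -> E -> R).
Hypotheses (n_gt0 : (0 < n)%N) (KD : K `<=` D) (cK : compact K) (cu : continuous u).
Hypothesis iDu : forall i, mu.-integrable K (EFin \o Du i).
Hypothesis iD2 : forall i j, mu.-integrable K (EFin \o D2u i j).
Hypothesis ihn : mu.-integrable K (EFin \o (fun x => hessn (fun i j => D2u i j x) ^+ n)).
Hypothesis wDu : forall i, weak_partial D i u (Du i).
Hypothesis wD2 : forall i j, weak_partial D j (Du i) (D2u i j).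

Let h x := hessn (fun i j => D2u i j x).

Lemma power_integrable (a : R) : 0 <= a -> mu.-integrable K (EFin \o (fun x => (a + h x) ^+ n)).
Proof.
move=> a0; have mK := compact_measurable_rV cK.
have [r r0 Kr] := compact_norm_le cK.
have fK : (mu K < +oo)%E by exact: (@bounded_measure_finite _ _ _ r).
have i1 : mu.-integrable K (EFin \o (fun=> (2 * a) ^+ n)).
  by apply: (@bounded_integrable _ _ _ _ _ mK fK _ `|(2 * a) ^+ n|).
have i2 : mu.-integrable K (EFin \o (fun x => 2 ^+ n * h x ^+ n)).
  exact: (integrableZl mK _ ihn).
have mh : measurable_fun K h.
  apply/measurable_EFinP; apply: measurable_int; apply: (integrable_sumr mK) => -[i j].
  apply: integrable_norm; exact: iD2.
apply: (@le_integrable _ _ _ mu K mK _ (EFin \o (fun x => (2 * a) ^+ n + 2 ^+ n * h x ^+ n))).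
- by apply/measurable_EFinP; apply: measurable_funX; apply: measurable_funD.
- move=> x _ /=; rewrite lee_fin; have h0 : 0 <= h x by exact: hessn_ge0.
  have p0 : 0 <= (2 * a) ^+ n by rewrite exprn_ge0// mulr_ge0.
  have p1 : 0 <= (2 * h x) ^+ n by rewrite exprn_ge0// mulr_ge0.
  rewrite -exprMn !ger0_norm ?addr_ge0// ?exprn_ge0 ?addr_ge0//.
  have [ah|ah] := leP a (h x).
    by apply: ler_wpDl => //; rewrite lerXn2r ?nnegrE ?addr_ge0 ?mulr_ge0//; lra.
  by apply: ler_wpDr => //; rewrite lerXn2r ?nnegrE ?addr_ge0 ?mulr_ge0//; lra.
- exact: (integrableD mK i1 i2).
Qed.

(** Take for v k the mollification of u at small scales. On F its derivatives are
    mollifications of the weak derivatives, which converge almost everywhere, and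
    the symmetry of the Hessian of v k passes to D2u. For the domination put
    f = a + 1 + |D2u|: the n-th power of a + 1 + |H k| is at most
    (moll f)^n <= moll (f^n) by Jensen's inequality, and moll (f^n) is dominated
    when the scales decrease fast enough. *)
Lemma local_approx (F : set E) (e1 a : R) : 0 < e1 -> 0 <= a ->
  (forall x z : E, F x -> `|z - x| <= e1 -> K z) ->
  exists (v : nat -> E -> R) (g : nat -> 'I_n -> E -> R) (H : nat -> 'I_n -> 'I_n -> E -> R) (C : nat -> R)
    (Phi : E -> R),
  [/\ forall k, C11 (C k) (v k) (g k) (H k),
     forall b, 0 < b -> exists k0, forall k, (k0 <= k)%N -> forall x, F x -> `|v k x - u x| <= b,
     {ae mu, forall x, F x ->
       [/\ forall i, g k i x @[k --> \oo] --> Du i x,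
           forall i j, H k i j x @[k --> \oo] --> D2u i j x,
           forall i j, D2u i j x = D2u j i x &
           forall k, (a + 1 + hessn (fun i j => H k i j x)) ^+ n <= Phi x]} &
     mu.-integrable K (EFin \o Phi)].
Proof.
move=> e10 a0 FK; pose m0 : 'I_n -> nat := fun=> 0%N.
have mK := compact_measurable_rV cK.
have [r r0 Kr] := compact_norm_le cK.
have fK : (mu K < +oo)%E by exact: (@bounded_measure_finite _ _ _ r).
have [M _ uM] : exists2 M : R, 0 <= M & forall x, K x -> `|u x| <= M.
  have [K0|K0] := pselect (K !=set0); last by exists 0 => // x Kx; case: K0; exists x.
  have [|c _ hc] := @EVT_max_rV R n (fun x => `|u x|) K K0 cK.
    by apply: continuous_subspaceT => x; apply: continuous_comp; [exact: cu|exact: norm_continuous].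
  by exists `|u c| => // x Kx; apply: hc; rewrite inE.
have iu : mu.-integrable setT (EFin \o (u \_ K)).
  apply: integrable_patch => //; apply: (@bounded_integrable _ _ _ _ _ mK fK _ M) => //.
  by apply: measurable_funTS; exact: continuous_measurable_rV.
pose f x := a + 1 + h x.
have a10 : 0 <= a + 1 by rewrite addr_ge0.
have f0 x : 0 <= f x by rewrite addr_ge0// hessn_ge0.
have iphi : mu.-integrable K (EFin \o (fun x => f x ^+ n)) by exact: power_integrable.
have ih : mu.-integrable K (EFin \o h).
  by apply: (integrable_sumr mK) => -[i j]; apply: integrable_norm; exact: iD2.
have if1 : mu.-integrable K (EFin \o f).
  have := integrableD mK (@bounded_integrable _ _ _ _ _ mK fK (cst (a + 1)) (a + 1) _ _) ih.
  by apply => // x _; rewrite ger0_norm.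
(* None stands for f^n, which is mollified along the same scales *)
pose I : finType := option ('I_n + 'I_n * 'I_n).
pose Fm (i : I) : E -> R := match i with
  | None => (fun x => f x ^+ n) \_ K
  | Some (inl i) => Du i \_ K
  | Some (inr p) => D2u p.1 p.2 \_ K end.
have [||e_ [e_0 hF]] := @fast_moll R n I Fm r r0.
- by case=> [[i|[i j]]|]; apply: integrable_patch => //; rewrite /=; try exact: iDu; exact: iD2.
- have far (q : E -> R) x : r < `|x| -> (q \_ K) x = 0.
    move=> rx; rewrite patchE; case: ifPn => //; rewrite inE => /Kr; rewrite leNgt => /negP[].
    exact: rx.
  by case=> [[i|[i j]]|] x; exact: far.
have [k1 k1e] : exists k1 : nat, k1.+1%:R^-1 <= e1.
  have [N _ hN] := near_infty_natSinv_lt (PosNum e10); exists N; apply: ltW; exact: (hN N (leqnn N)).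
pose e k := e_ (k1 + k)%N.
have e0 k : 0 < e k by have /andP[] := e_0 (k1 + k)%N.
have ee1 k : e k <= e1.
  have /andP[_ h1] := e_0 (k1 + k)%N; apply: (le_trans h1); apply: le_trans k1e.
  by rewrite lef_pV2 ?posrE// ler_nat ltnS leq_addr.
have shift (s : nat -> R) (l : R) : s k @[k --> \oo] --> l -> s (k1 + k)%N @[k --> \oo] --> l.
  have -> : (fun k => s (k1 + k)%N) = (fun k => s (k + k1)%N) by apply/funext => k; rewrite addnC.
  by rewrite cvg_shiftn.
have sub k x : F x -> [set z | `|z - x| <= e k] `<=` K.
  by move=> Fx z /= zx; apply: FK Fx _; exact: le_trans (ee1 k).
pose v k := moments (e k) m0 (u \_ K).
pose g k i x := - moments (e k) (incr i m0) (u \_ K) x.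
pose H k i j x := moments (e k) (incr j (incr i m0)) (u \_ K) x.
have gE k i x : F x -> g k i x = moll (@rho0 R n (e k)) (Du i \_ K) x.
  move=> Fx; rewrite /g (weak_moments (e0 k) _ (wDu i) (sub k x Fx) KD) opprK.
  by rewrite (moll_moments (e0 k)).
have HE k i j x : F x -> H k i j x = moll (@rho0 R n (e k)) (D2u i j \_ K) x.
  move=> Fx; rewrite /H incrC (weak_moments (e0 k) _ (wDu i) (sub k x Fx) KD).
  rewrite (weak_moments (e0 k) _ (wD2 i j) (sub k x Fx) KD) opprK.
  by rewrite (moll_moments (e0 k)).
have lim (i : I) (q : E -> R) (x : E) : F x -> Fm i = q \_ K ->
    (`|x| <= r -> (moll (@rho0 R n (e_ k)) (Fm i) x @[k --> \oo] --> Fm i x)) ->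
    moll (@rho0 R n (e k)) (q \_ K) x @[k --> \oo] --> q x.
  move=> Fx Fq; have Kx : K x by apply: (sub 0%N x Fx); rewrite /= subrr normr0 ltW.
  move=> /(_ (Kr x Kx)) c; have := shift _ _ c; rewrite Fq patchE mem_set//.
have Csig k : {C | C11 C (v k) (g k) (H k)} by apply: cid; exact: C11_moments.
have [G [iG aeG]] := hF None.
have aeD i := hF (Some (inl i)).
have aeD2 p := hF (Some (inr p)).
exists v, g, H, (fun k => sval (Csig k)), (fun x => (f x ^+ n) + G x); split.
- by move=> k; exact: svalP (Csig k).
- move=> b b0; have [dl dl0 hdl] := unif_modulus cu cK b0.
  have [N _ hN] := near_infty_natSinv_lt (PosNum dl0); exists N => k Nk x Fx.
  rewrite /v -(moll_moments (e0 k)); apply: (@moll_near _ _ _ _ (rho0_kernel n (e0 k))) => // z xz.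
  have Kz : K z by apply: (sub k x Fx); rewrite /= distrC ltW.
  have Kx : K x by apply: (sub k x Fx); rewrite /= subrr normr0 ltW.
  rewrite patchE mem_set// distrC; apply: hdl => //; apply: (lt_le_trans xz).
  have /andP[_ h1] := e_0 (k1 + k)%N; apply: (le_trans h1); apply: ltW.
  by apply: (hN (k1 + k)%N) => /=; exact: leq_trans (leq_addl _ _).
- have ae1 : {ae mu, forall x, forall i, F x -> g k i x @[k --> \oo] --> Du i x}.
    apply: filter_forall => i; have [G' [_ aeG']] := aeD i.
    apply: filterS aeG' => x hx Fx; have := lim (Some (inl i)) (Du i) x Fx erefl (fun xr => (hx xr).2).
    by apply: cvg_trans; apply: near_eq_cvg; apply: nearW => k; rewrite gE.
  have ae2 : {ae mu, forall x, forall p : 'I_n * 'I_n, F x -> H k p.1 p.2 x @[k --> \oo] --> D2u p.1 p.2 x}.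
    apply: filter_forall => p; have [G' [_ aeG']] := aeD2 p.
    apply: filterS aeG' => x hx Fx; have := lim (Some (inr p)) (D2u p.1 p.2) x Fx erefl (fun xr => (hx xr).2).
    by apply: cvg_trans; apply: near_eq_cvg; apply: nearW => k; rewrite HE.
  apply: filterS3 ae1 ae2 aeG => x h1 h2 h3 Fx.
  have Kx : K x by apply: (sub 0%N x Fx); rewrite /= subrr normr0 ltW.
  have c2 i j : H k i j x @[k --> \oo] --> D2u i j x by exact: (h2 (i, j) Fx).
  split => //.
  + by move=> i; exact: h1.
  + move=> i j; apply: (cvg_unique _ (c2 i j)) => //.
    by have := c2 j i; apply: cvg_trans; apply: near_eq_cvg; apply: nearW => k; rewrite /H incrC.
  + move=> k; have hk := rho0_kernel n (e0 k); set rho := rho0 _ in hk.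
    have iK (q : E -> R) : mu.-integrable K (EFin \o q) -> mu.-integrable setT (EFin \o (fun z => (q \_ K) z * rho (x - z))).
      by move=> iq; apply: (moll_integrable hk); exact: integrable_patch.
    have iK' p : mu.-integrable setT (EFin \o (fun z => `|(D2u p.1 p.2 \_ K) z| * rho (x - z))).
      by apply: (moll_integrable hk); apply: integrable_norm => //; apply: integrable_patch => //; exact: iD2.
    have i1 : mu.-integrable setT (EFin \o (fun z => (a + 1) * rho (x - z))).
      exact: (integrableZl measurableT _ (kernel_integrable hk x)).
    have i2 := integrable_sumr measurableT iK'.
    have b1 : a + 1 + hessn (fun i j => H k i j x) <= moll rho (f \_ K) x.
      apply: (@le_trans _ _ (\int[mu]_z ((a + 1) * rho (x - z) +
          \sum_(p : 'I_n * 'I_n) `|(D2u p.1 p.2 \_ K) z| * rho (x - z)))).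
        rewrite RintegralD// RintegralZl; last 2 first.
        - by [].
        - exact: (kernel_integrable hk).
        rewrite (kernel_Rint hk) mulr1 lerD2l (Rintegral_sum measurableT iK').
        apply: ler_sum => p _; rewrite HE//.
        apply: (le_trans (le_normr_Rintegral measurableT (iK _ (iD2 p.1 p.2)))).
        rewrite le_eqVlt; apply/orP; left; apply/eqP; apply: eq_Rintegral => z _.
        by rewrite normrM (ger0_norm (kernel_ge0 hk _)).
      apply: le_Rintegral => //.
      - exact: (integrableD measurableT i1 i2).
      - exact: iK.
      - move=> z _; rewrite -mulr_suml -mulrDl.
        have [xz|xz] := ltP `|x - z| (e k); last by rewrite (kernel_supp hk xz) !mulr0.
        have Kz : K z by apply: (sub k x Fx); rewrite /= distrC ltW.
        rewrite ler_wpM2r ?(kernel_ge0 hk)// patchE mem_set// /f lerD2l.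
        by apply: ler_sum => p _; rewrite patchE mem_set.
    have nE : n = n.-1.+1 by rewrite prednK.
    apply: (@le_trans _ _ (moll rho (f \_ K) x ^+ n)).
      rewrite lerXn2r// ?nnegrE ?addr_ge0 ?hessn_ge0//; apply: le_trans b1.
      by rewrite addr_ge0 ?hessn_ge0.
    have fKn : (fun z => (f \_ K) z ^+ n) = (fun x => f x ^+ n) \_ K.
      apply/funext => z; rewrite !patchE; case: ifP => // _.
      by rewrite nE exprS mul0r.
    apply: (@le_trans _ _ (moll rho ((fun x => f x ^+ n) \_ K) x)).
      rewrite -fKn; apply: (moll_pow _ n_gt0 hk).
      - by move=> z; rewrite patchE; case: ifP.
      - exact: integrable_patch.
      - by rewrite fKn; exact: integrable_patch.
    have [h4 _] := h3 (Kr x Kx); have := h4 (k1 + k)%N; rewrite /= patchE mem_set//.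
    by rewrite ler_norml => /andP[_]; rewrite lerBlDl.
- have iGK : mu.-integrable K (EFin \o G).
    by apply: (integrableS _ mK _ iG) => //; exact: measurable_norm_le.
  exact: (integrableD mK iphi iGK).
Qed.

End approximation.

(** * Touching from below by affine perturbations *)

Section more_second_order.
Variables (R : realType) (n : nat).
Local Notation E := 'rV[R]_n.

Lemma quadf_bound (H : 'I_n -> 'I_n -> R) (h : E) (b : R) : (forall i j, `|H i j| <= b) ->
  `|quadf H h| <= n%:R * (n%:R * b * `|h|) * `|h|.
Proof. by move=> Hb; apply: dotp_bound => i; apply: dotp_bound. Qed.

Lemma quadfB (H G : 'I_n -> 'I_n -> R) (h : E) :
  quadf (fun i j => H i j - G i j) h = quadf H h - quadf G h.
Proof.
rewrite /quadf -sumrB; apply: eq_bigr => i _; rewrite -mulrBl -sumrB; congr (_ * _).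
by apply: eq_bigr => j _; rewrite mulrBl.
Qed.

Lemma hessn_row (H : 'I_n -> 'I_n -> R) i (h : E) : `|dotp (H i) h| <= hessn H * `|h|.
Proof.
apply: (le_trans (ler_norm_sum _ _ _)); rewrite /hessn mulr_suml.
rewrite (_ : \sum_(p : 'I_n * 'I_n) _ = \sum_i \sum_j `|H i j| * `|h|); last by rewrite pair_bigA.
rewrite [leRHS](bigD1 i)//=; apply: ler_wpDr; first by apply: sumr_ge0 => k _; exact: sumr_ge0.
by apply: ler_sum => j _; rewrite normrM ler_wpM2l// rV_coord_le.
Qed.

Lemma cvg_sumr (I : finType) (f : I -> nat -> R) (l : I -> R) :
  (forall i, f i k @[k --> \oo] --> l i) -> \sum_i f i k @[k --> \oo] --> \sum_i l i.
Proof. by move=> h; apply: cvg_big => //; exact: add_continuous. Qed.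

Lemma integral_sub_indic (mu : {measure set E -> \bar R}) (f : E -> R) (A D : set E) : A `<=` D ->
  (\int[mu]_(x in A) (f x)%:E = \int[mu]_(x in D) (f x * \1_A x)%:E)%E.
Proof.
move=> AD; rewrite -{1}(setIidr AD) integral_mkcondr; apply: eq_integral => x _.
by rewrite patchE indicE; case: ifP; rewrite ?mulr1 ?mulr0.
Qed.

Lemma C11_cont (C : R) (w : E -> R) g H : C11 C w g H -> continuous w.
Proof.
move=> [C0 h1 _ _] x; apply/(@cvgrPdist_le _ _ _ (nbhs x) _ w (w x)) => e e0.
pose A := n%:R * \sum_i `|g i x|.
have A0 : 0 <= A by rewrite mulr_ge0// sumr_ge0.
have b0 : 0 < A + C + 1 by rewrite ltr_wpDl// addr_ge0.
have r0 : 0 < Num.min 1 (e / (A + C + 1)) by rewrite lt_min ltr01 divr_gt0.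
apply: filterS (nbhsx_ballx x _ r0) => y.
rewrite -ball_normE /ball_/= lt_min distrC => /andP[y1 ye].
rewrite distrC; have := h1 x y.
have : `|dotp (g ^~ x) (y - x)| <= A * `|y - x|.
  by apply: dotp_bound => i; rewrite (bigD1 i)//= lerDl sumr_ge0.
set d := dotp _ _ => hd h; rewrite (_ : w y - w x = (w y - w x - d) + d); last by ring.
apply: (le_trans (ler_normD _ _)).
have : C * `|y - x| ^+ 2 <= C * `|y - x| by rewrite ler_wpM2l// expr2 ler_piMr// ltW.
move: ye; rewrite ltr_pdivlMr// => ye h3.
apply: (le_trans (lerD h hd)); apply: (le_trans (lerD h3 (lexx _))).
by apply: le_trans (ltW ye); rewrite !mulrDr mulr1 (mulrC C) (mulrC A); have := normr_ge0 (y - x); lra.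
Qed.

Lemma hessn_lip (C : R) w g (H : 'I_n -> 'I_n -> E -> R) (x y : E) : C11 C w g H ->
  `|hessn (fun i j => H i j x) - hessn (fun i j => H i j y)| <= (n * n)%:R * C * `|x - y|.
Proof.
move=> [C0 _ _ h3]; rewrite /hessn -sumrB; apply: (le_trans (ler_norm_sum _ _ _)).
rewrite -mulrA mulr_natl (_ : (n * n)%N = #|{: 'I_n * 'I_n}|); last by rewrite card_prod card_ord.
rewrite -sumr_const; apply: ler_sum => -[i j] _ /=.
by apply: (le_trans (ler_dist_dist _ _)); exact: h3.
Qed.

End more_second_order.

Section touching.
Variables (R : realType) (n : nat).
Local Notation E := 'rV[R]_n.
Local Notation mu := (lebesgue_rV R n).
Variables (D K : set E) (u : E -> R) (Du : 'I_n -> E -> R) (D2u : 'I_n -> 'I_n -> E -> R).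
Hypotheses (n_gt0 : (0 < n)%N) (KD : K `<=` D) (cK : compact K) (cu : continuous u).
Hypothesis iDu : forall i, mu.-integrable K (EFin \o Du i).
Hypothesis iD2 : forall i j, mu.-integrable K (EFin \o D2u i j).
Hypothesis ihn : mu.-integrable K (EFin \o (fun x => hessn (fun i j => D2u i j x) ^+ n)).
Hypothesis wDu : forall i, weak_partial D i u (Du i).
Hypothesis wD2 : forall i j, weak_partial D j (Du i) (D2u i j).

Variables (psi : E -> R) (gp : 'I_n -> E -> R) (Hp : 'I_n -> 'I_n -> E -> R).

(** Du and D2u are only versions of the weak derivatives of u, so this is a
    condition on u and on those versions: u - psi has contact of first and second
    order from below with an affine function at x. *)
Definition contact (eta : R) (F : set E) (x : E) : Prop :=
  [/\ forall i, `|Du i x - gp i x| <= eta,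
      forall y, F y -> u x - psi x + dotp (fun i => Du i x - gp i x) (y - x) <= u y - psi y,
      forall xi, 0 <= quadf (fun i j => D2u i j x - Hp i j x) xi &
      forall i j, D2u i j x = D2u j i x].

(** For a slope p with |p| <= eta the slack th makes v k - psi - p attain its
    minimum over F inside Om, for the mollifications v k of u and k large. So the
    gradient of v k - psi maps the contact set Z k onto the ball of slopes, and
    area_grid bounds the volume of that ball by an integral over a union U k of
    small cells that meet Z k. G is the limsup of the U k. The integrals pass to
    the limit by dominated convergence, and each point of G is a limit of contact
    points of v k - psi along which the contact inequalities survive. *)
Lemma touching (F Om : set E) (e1 a C eta th : R) :
  0 < e1 -> compact F -> F !=set0 -> (forall x z : E, F x -> `|z - x| <= e1 -> K z) ->
  Om `<=` F ->
  (forall x, Om x -> exists2 r : R, 0 < r & forall y, `|y - x| < r -> F y) ->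
  0 <= a -> C11 C psi gp Hp -> (forall i x y, `|gp i y - gp i x| <= a * `|y - x|) ->
  0 < th -> 0 <= eta ->
  (forall p : E, `|p| <= eta -> exists2 x1, F x1 & forall y, F y -> ~ Om y ->
     u x1 - psi x1 - dotp (p ord0) x1 + th <= u y - psi y - dotp (p ord0) y) ->
  exists G, [/\ measurable G, G `<=` F,
    (mu [set p : E | (`|p| <= eta)%R] <= \int[mu]_(x in G) ((a + hessn (fun i j => D2u i j x)) ^+ n)%:E)%E &
    {ae mu, forall x, G x -> contact eta F x}].
Proof.
move=> e10 cF F0 FK OmF Omo a0 Cpsi gpa th0 eta0 slack.
have cpsi := C11_cont Cpsi; have C0 := C11_ge0 Cpsi.
have e20 : 0 < e1 / 2 by exact: divr_gt0.
pose F2 : set E := [set x | exists2 z, F z & `|x - z| <= e1 / 2].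
have FF2 : F `<=` F2 by move=> x Fx; exists x => //; rewrite subrr normr0 ltW.
have F2K x z : F2 x -> `|z - x| <= e1 / 2 -> K z.
  move=> [z' Fz' xz'] zx; apply: (FK z' z Fz'); rewrite (splitr e1).
  by apply: le_trans (ler_distD x _ _) _; apply: lerD.
have F2sK : F2 `<=` K by move=> x F2x; apply: (F2K x x F2x); rewrite subrr normr0 ltW.
have [v [g [H [Cs [Phi [hC hv hae iPhi]]]]]] :=
  local_approx n_gt0 KD cK cu iDu iD2 ihn wDu wD2 e20 a0 F2K.
have mK := compact_measurable_rV cK.
have th30 : 0 < th / 3 by exact: divr_gt0.
have [k0 hk0] := hv _ th30.
pose rho k x := hessn (fun i j => H k i j x).
have rho0 k x : 0 <= rho k x by exact: hessn_ge0.
pose w k x := v k x - psi x.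
pose gw k i x := g k i x - gp i x.
pose Hw k i j x := H k i j x - Hp i j x.
have hCw k : C11 (Cs k + C) (w k) (gw k) (Hw k) by exact: C11B.
have Cs0 k : 0 <= Cs k by exact: C11_ge0 (hC k).
pose C' k : R := (n * n)%:R * Cs k + Cs k + C + 1.
have nC0 k : 0 <= (n * n)%:R * Cs k by rewrite mulr_ge0.
have C'0 k : 0 < C' k by rewrite /C' ltr_wpDl// !addr_ge0.
pose t (k : nat) : R := k.+1%:R^-1.
have t0 k : 0 < t k by rewrite invr_gt0.
have t1 k : t k <= 1 by rewrite invf_le1// ler1n.
(* the mesh is so fine that the remainders in area_grid are at most t k *)
pose s k : R := Num.min (e1 / 2) (t k / (2 * C' k + 1)).
have s0 k : 0 < s k.
  by rewrite lt_min e20 divr_gt0//; have := C'0 k; lra.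
have se k : s k <= e1 / 2 by rewrite ge_min lexx.
have sC k : s k * (2 * C' k + 1) <= t k.
  by rewrite -ler_pdivlMr ?ge_min ?lexx ?orbT//; have := C'0 k; lra.
have st k : s k <= t k.
  apply: le_trans (sC k); rewrite mulrDr mulr1 lerDr mulr_ge0 ?(ltW (s0 k))//.
  by rewrite mulr_ge0// ltW.
have sC2 k : 2 * C' k * s k <= t k by have := sC k; have := s0 k; rewrite mulrDr mulr1 mulrC; lra.
pose Z k : set E := [set z | Om z /\ exists p : E, `|p| <= eta /\
  forall y, F y -> w k z + dotp (p ord0) (y - z) <= w k y].
have Zg k z p : Om z -> (forall y, F y -> w k z + dotp p (y - z) <= w k y) ->
    (forall i, gw k i z = p i) /\ forall xi, 0 <= quadf (fun i j => Hw k i j z) xi.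
  move=> Oz hz; have [r r0 Fr] := Omo z Oz.
  by apply: (C11_contact (hCw k) r0) => y yz; apply: hz; exact: Fr.
have YZ k (p : E) : (k0 <= k)%N -> `|p| <= eta -> exists2 z, Z k z & forall i, p ord0 i = gw k i z.
  move=> k0k pe; pose W y := w k y - dotp (p ord0) y.
  have cW : continuous W.
    apply: contB; first by apply: contB => //; exact: C11_cont (hC k).
    by apply: cont_sum => i; apply: contM; [exact: cont_cst|exact: continuous_rV_coord].
  have [c] := EVT_min_rV F0 cF (continuous_subspaceT cW); rewrite inE => Fc hc.
  have [x1 Fx1 hx1] := slack p pe.
  have Oc : Om c.
    apply: contrapT => nO; have := hx1 c Fc nO; have := hc x1; rewrite inE => /(_ Fx1).
    have := hk0 k k0k x1 (FF2 _ Fx1); have := hk0 k k0k c (FF2 _ Fc).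
    rewrite /W /w !ler_norml => /andP[b1 b2] /andP[b3 b4] b5 b6; lra.
  have tc : forall y, F y -> w k c + dotp (p ord0) (y - c) <= w k y.
    by move=> y Fy; have := hc y; rewrite inE => /(_ Fy); rewrite /W dotpB; lra.
  exists c; first by split => //; exists p.
  by move=> i; have [-> _] := Zg k c _ Oc tc.
have gwL k i (x y : E) : `|gw k i y - gw k i x| <= (a + rho k x) * `|y - x| + C' k * `|y - x| ^+ 2.
  have [_ _ h2 _] := hC k.
  rewrite (_ : gw k i y - gw k i x = (g k i y - g k i x - dotp (fun j => H k i j x) (y - x)) +
    dotp (fun j => H k i j x) (y - x) - (gp i y - gp i x)); last by rewrite /gw; ring.
  apply: (le_trans (ler_normB _ _)); apply: (le_trans (lerD (ler_normD _ _) (gpa i x y))).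
  apply: (le_trans (lerD (lerD (h2 i x y) (hessn_row (fun i j => H k i j x) i (y - x))) (lexx _))).
  rewrite -/(rho k x) -addrA addrC -mulrDl (addrC (rho k x)) lerD2l ler_wpM2r ?sqr_ge0//.
  by rewrite /C'; have := nC0 k; lra.
have mY : measurable [set p : E | `|p| <= eta] by exact: measurable_norm_le.
have crho k : continuous (rho k).
  apply: (@lipschitz_continuous _ _ _ ((n * n)%:R * Cs k)) => x y; exact: hessn_lip (hC k).
have mrho k : measurable_fun setT (rho k) by exact: continuous_measurable_rV.
have hU k : {U : set E | [/\ measurable U, forall x : E, U x -> exists2 z, Z (k0 + k)%N z & `|z - x| <= s (k0 + k)%N &
    (mu [set p : E | (`|p| <= eta)%R] <= \int[mu]_(x in U) ((a + rho (k0 + k)%N x + t (k0 + k)%N) ^+ n)%:E)%E]}.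
  apply: cid; set j := (k0 + k)%N; have k0j : (k0 <= j)%N by exact: leq_addr.
  have [||U [mU hU1 hU2]] := @area_grid R n (s j) (s0 j) (gw j) (rho j) a (C' j) (Z j)
    [set p : E | `|p| <= eta] (C'0 j) a0 (rho0 j) (mrho j) _ (gwL j) _ mY.
  - move=> x y; apply: (le_trans (hessn_lip x y (hC j))); rewrite ler_wpM2r//.
    by rewrite /C'; have := Cs0 j; lra.
  - by move=> p /= pe; exact: YZ.
  exists U; split => //; apply: (le_trans hU2); apply: ge0_le_integralT => //.
  - apply: measurable_funTS; apply: measurable_funX; apply: measurable_funD => //.
    exact: measurable_funD.
  - apply: measurable_funTS; apply: measurable_funX; apply: measurable_funD => //.
    exact: measurable_funD.
  - move=> x _; rewrite exprn_ge0// addr_ge0 ?addr_ge0// mulr_ge0 ?(ltW (s0 j))//.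
    by rewrite mulr_ge0// ltW.
  - move=> x _; have ar : 0 <= a + rho j x by rewrite addr_ge0.
    have t0j := t0 j; have p0 : 0 <= 2 * C' j * s j by rewrite !mulr_ge0// ltW.
    by rewrite lerXn2r ?nnegrE ?addr_ge0 ?(ltW t0j)// lerD2l.
pose U k := sval (hU k).
have mU k : measurable (U k) by case: (svalP (hU k)).
have UZ k x : U k x -> exists2 z, Z (k0 + k)%N z & `|z - x| <= s (k0 + k)%N.
  by case: (svalP (hU k)) => _ h _; exact: h.
have UF2 k : U k `<=` F2.
  move=> x /UZ[z [Oz _] zx]; exists z; first exact: OmF.
  by rewrite distrC; apply: le_trans zx (se _).
pose V k := \bigcup_(j in [set j | (k <= j)%N]) U j.
have mV k : measurable (V k) by apply: bigcup_measurable => j _.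
have VF2 k : V k `<=` F2 by move=> x [j _ /UF2].
have Vdec k j : (k <= j)%N -> V j `<=` V k.
  by move=> kj x [i /= ji Ux]; exists i => //=; exact: leq_trans ji.
pose G := \bigcap_k V k.
have mG : measurable G by apply: bigcapT_measurable.
have GF2 : G `<=` F2 by move=> x /(_ 0%N I) /VF2.
pose h x := hessn (fun i j => D2u i j x).
have mh : measurable_fun K h.
  apply/measurable_EFinP; apply: measurable_int; apply: (integrable_sumr mK) => -[i j].
  by apply: integrable_norm; exact: iD2.
have aerho : {ae mu, forall x, F2 x -> rho k x @[k --> \oo] --> h x}.
  apply: filterS hae => x hx F2x; have [_ hH _ _] := hx F2x.
  by apply: cvg_sumr => -[i j] /=; apply: cvg_norm; exact: hH.
have GKE : G = K `&` G by apply/seteqP; split => [x Gx|x []//]; split => //; exact/F2sK/GF2.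
have area : (mu [set p : E | (`|p| <= eta)%R] <= \int[mu]_(x in G) ((a + h x) ^+ n)%:E)%E.
  pose f_ k x := ((a + rho (k0 + k)%N x + t (k0 + k)%N) ^+ n * \1_(V k) x)%:E.
  pose f x := ((a + h x) ^+ n * \1_G x)%:E.
  have mf_ k : measurable_fun K (f_ k).
    apply/measurable_EFinP; apply: measurable_funM; last exact: measurable_indic.
    apply: measurable_funTS; apply: measurable_funX; apply: measurable_funD => //.
    exact: measurable_funD.
  have mf : measurable_fun K f.
    apply/measurable_EFinP; apply: measurable_funM; last exact: measurable_indic.
    by apply: measurable_funX; exact: measurable_funD.
  have ct : t (k0 + k)%N @[k --> \oo] --> 0.
    have -> : (fun k => t (k0 + k)%N) = (fun k => t (k + k0)%N) by apply/funext => k; rewrite addnC.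
    by rewrite cvg_shiftn; exact: cvg_harmonic.
  have cf : {ae mu, forall x, K x -> f_ k x @[k --> \oo] --> f x}.
    apply: filterS aerho => x hx Kx; apply: cvg_EFin; first exact: nearW.
    have [Gx|nGx] := pselect (G x).
      rewrite indicE mem_set// mulr1.
      have -> : (fine \o f_ ^~ x) = fun k => (a + rho (k0 + k)%N x + t (k0 + k)%N) ^+ n.
        by apply/funext => k /=; rewrite indicE mem_set ?mulr1//; exact: Gx.
      have -> : (fun k => (a + rho (k0 + k)%N x + t (k0 + k)%N) ^+ n) =
         (fun q : R => q ^+ n) \o (fun k => a + rho (k0 + k)%N x + t (k0 + k)%N) by [].
      apply: continuous_cvg; first exact: exprn_continuous.
      rewrite -[a + h x]addr0; apply: cvgD => //; apply: cvgD; first exact: cvg_cst.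
      have -> : (fun k => rho (k0 + k)%N x) = (fun k => rho (k + k0)%N x) by apply/funext => k; rewrite addnC.
      have := hx (GF2 _ Gx); rewrite -(cvg_shiftn k0); exact.
    rewrite indicE memNset// mulr0.
    have [k1 nV] : exists k1, ~ V k1 x.
      by apply: contrapT => nV; apply: nGx => k _; apply: contrapT => nVk; apply: nV; exists k.
    apply: cvg_near_cst; exists k1 => // k /= k1k; rewrite indicE memNset ?mulr0//.
    by move=> Vk; apply: nV; exact: Vdec Vk.
  have dom : {ae mu, forall x k, K x -> (`|f_ k x| <= `|(EFin \o Phi) x|)%E}.
    apply: filterS hae => x hx k Kx; rewrite /f_ /= lee_fin indicE.
    have [Vx|nVx] := pselect (V k x); last by rewrite memNset// mulr0 normr0.
    rewrite mem_set// mulr1; have [_ _ _ hP] := hx (VF2 _ _ Vx).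
    apply: le_trans (ler_norm _); rewrite ger0_norm; last first.
      by rewrite exprn_ge0// !addr_ge0// ltW.
    apply: (le_trans _ (hP (k0 + k)%N)); have tj := t0 (k0 + k)%N; have tj1 := t1 (k0 + k)%N.
    rewrite lerXn2r ?nnegrE ?addr_ge0 ?(ltW tj)//; first exact: rho0.
    by rewrite -/(rho _ x); lra.
  have iPhi' : mu.-integrable K (fun x => `|(EFin \o Phi) x|)%E by exact: integrable_abse.
  have [_ _ cv] := dominated_convergence mK mf_ mf cf iPhi' dom.
  have -> : (\int[mu]_(x in G) ((a + h x) ^+ n)%:E = \int[mu]_(x in K) f x)%E.
    by apply: integral_sub_indic; exact: subset_trans F2sK.
  rewrite -(cvg_lim _ cv)//; apply: lime_ge; first by apply/cvg_ex; eexists; exact: cv.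
  apply: nearW => k /=; have [_ _ hk] := svalP (hU k); apply: (le_trans hk).
  have UK : U k `<=` K by apply: subset_trans F2sK; exact: UF2.
  rewrite -/(U k) (integral_sub_indic _ _ UK).
  apply: ge0_le_integral => //.
  - move=> x _; rewrite lee_fin mulr_ge0// exprn_ge0// !addr_ge0// ltW//.
  - apply/measurable_EFinP; apply: measurable_funM; last exact: measurable_indic.
    apply: measurable_funTS; apply: measurable_funX; apply: measurable_funD => //.
    exact: measurable_funD.
  - move=> x _; rewrite lee_fin ler_wpM2l//; first by rewrite exprn_ge0// !addr_ge0// ltW.
    rewrite !indicE ler_nat; case: (boolP (x \in U k)) => // /set_mem Ux.
    by rewrite mem_set//; exists k => /=.
have freq x N : G x -> exists j z, [/\ (N <= j)%N, Z j z & `|z - x| <= s j].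
  move=> Gx; have [j /= Nj Ux] := Gx N I; have [z Zz zx] := UZ _ _ Ux.
  by exists (k0 + j)%N, z; split => //; apply: leq_trans (leq_addl _ _).
have tinf (e : R) : 0 < e -> \forall j \near \oo, t j < e.
  by move=> e0; exact: near_infty_natSinv_lt (PosNum e0).
have GF : G `<=` F.
  move=> x Gx; have clF : closed F by exact: compact_closed.
  apply: clF => B /nbhs_ballP[e /= e0 eB]; have [N _ hN] := tinf e e0.
  have [j [z [Nj [Oz _] zx]]] := freq x N Gx; exists z; split; first exact: OmF.
  apply: eB; rewrite -ball_normE /ball_/= distrC; apply: (le_lt_trans zx).
  by apply: (le_lt_trans (st j)); exact: hN.
exists G; split => //; apply: filterS2 hae aerho => x hx hrho Gx.
have Fx := GF x Gx; have [hg hH hsym _] := hx (FF2 _ Fx).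
have {}hrho := hrho (FF2 _ Fx).
(* contact holds at some z near x for some w j, up to errors eps *)
have key (eps : R) : 0 < eps -> exists j z (p : E), [/\ `|p| <= eta,
    forall y, F y -> w j z + dotp (p ord0) (y - z) <= w j y,
    F z /\ `|z - x| <= eps,
    (forall y, F y -> `|v j y - u y| <= eps) /\ `|u z - psi z - (u x - psi x)| <= eps &
    [/\ forall i, `|Du i x - gp i x - p ord0 i| <= eps, forall xi, 0 <= quadf (fun i j' => Hw j i j' z) xi &
     forall i j', `|D2u i j' x - Hp i j' x - Hw j i j' z| <= eps]].
  move=> e0; have eps20 : 0 < eps / 2 by exact: divr_gt0.
  have [dl /= dl0 hdl] : exists2 dl : R, 0 < dl & forall z : E, `|x - z| < dl -> `|(u x - psi x) - (u z - psi z)| <= eps.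
    have cw : {for x, continuous (fun z => u z - psi z)} by exact: (contB cu cpsi).
    have /(@cvgrPdist_le _ _ _ (nbhs x) _ (fun z => u z - psi z))/(_ _ e0) := cw.
    rewrite -nbhs_ballE => -[r /= r0 hr]; exists r => // z xz; apply: hr.
    by rewrite -ball_normE.
  have A1 := tinf _ eps20; have A2 := tinf _ dl0.
  have A3 : \forall j \near \oo, forall y, F y -> `|v j y - u y| <= eps.
    by have [N hN] := hv _ e0; exists N => // j /= Nj y /FF2; exact: hN.
  have A4 : \forall j \near \oo, forall i, `|Du i x - g j i x| <= eps / 2.
    by apply: filter_forall => i; have /cvgrPdist_le/(_ _ eps20) := hg i.
  have A5 : \forall j \near \oo, (a + rho j x + 1) * t j < eps / 2.
    have c : (a + rho j x + 1) * t j @[j --> \oo] --> (a + h x + 1) * 0.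
      apply: cvgM; last exact: cvg_harmonic.
      by apply: cvgD; [apply: cvgD => //; exact: cvg_cst|exact: cvg_cst].
    rewrite mulr0 in c; have /cvgrPdist_lt/(_ _ eps20) := c.
    by apply: filterS => j; rewrite sub0r normrN; apply: le_lt_trans; exact: ler_norm.
  have A6 : \forall j \near \oo, forall p : 'I_n * 'I_n, `|D2u p.1 p.2 x - H j p.1 p.2 x| <= eps / 2.
    by apply: filter_forall => p; have /cvgrPdist_le/(_ _ eps20) := hH p.1 p.2.
  have [N _ hN] : \forall j \near \oo, [/\ t j < eps / 2 /\ t j < dl,
      (forall y, F y -> `|v j y - u y| <= eps),
      (forall i, `|Du i x - g j i x| <= eps / 2), (a + rho j x + 1) * t j < eps / 2 &
      forall p : 'I_n * 'I_n, `|D2u p.1 p.2 x - H j p.1 p.2 x| <= eps / 2].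
    by near=> j; split; [split; near: j|near: j|near: j|near: j|near: j].
  have [j [z [Nj [Oz [p [pe hp]]] zx]]] := freq x N Gx.
  have [[B1 B2] B3 B4 B5 B6] := hN j Nj.
  have [gz Hz] := Zg j z _ Oz hp.
  have zt : `|z - x| <= t j by exact: le_trans (st j).
  have zC : C' j * `|z - x| <= t j.
    apply: le_trans (sC2 j); have q1 := ltW (C'0 j); have q2 := ltW (s0 j).
    apply: (@le_trans _ _ (C' j * s j)); first by rewrite ler_wpM2l.
    by rewrite -mulrA ler_peMl ?ler1n// mulr_ge0.
  exists j, z, p; split => //.
  - by split; [exact: OmF|apply: (le_trans zt); lra].
  - split => //; rewrite distrC; apply: hdl; rewrite distrC; exact: le_lt_trans zt B2.
  split => //.
  - move=> i; rewrite -gz.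
    rewrite (_ : _ - _ - _ = (Du i x - g j i x) - (gw j i z - gw j i x)); last by rewrite /gw; ring.
    rewrite (splitr eps); apply: (le_trans (ler_normB _ _)); apply: lerD => //.
    apply: (le_trans (gwL j i x z)); apply: le_trans (ltW B5).
    rewrite [leRHS]mulrDl mul1r; apply: lerD; first by rewrite ler_wpM2l// addr_ge0.
    rewrite expr2 mulrA; apply: (@le_trans _ _ (t j * 1)); last by rewrite mulr1.
    by apply: ler_pM => //; [rewrite mulr_ge0// ltW|exact: le_trans zt _].
  - move=> i j'.
    rewrite (_ : _ - _ - _ = (D2u i j' x - H j i j' x) - (Hw j i j' z - Hw j i j' x)); last by rewrite /Hw; ring.
    rewrite (splitr eps); apply: (le_trans (ler_normB _ _)); apply: lerD; first exact: (B6 (i, j')).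
    apply: (le_trans (C11_lip (hCw j) i j' x z)); apply: le_trans (ltW B1); apply: le_trans zC.
    by rewrite ler_wpM2r// /C'; have := nC0 j; lra.
pose P i := Du i x - gp i x.
split => //.
- move=> i; rewrite -/(P i) -subr_ge0; apply: (@small_ge0 _ _ 1 1) => // eps /andP[e0 _].
  have [j [z [p [pe _ _ _ [hp _ _]]]]] := key _ e0.
  have := hp i; have := rV_coord_le p i => h1 h2.
  have := ler_normD (P i - p ord0 i) (p ord0 i); rewrite subrK.
  by move: h2; rewrite -/(P i); lra.
- move=> y Fy; rewrite -/P -subr_ge0.
  apply: (@small_ge0 _ _ (3 + n%:R * `|y - x| + n%:R * eta) 1) => // eps /andP[e0 _].
  have [j [z [p [pe hp [Fz zx] [hv' hu] [hP _ _]]]]] := key _ e0.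
  have h1 := hp y Fy; have := hv' z Fz; have := hv' y Fy; rewrite !ler_norml => /andP[h2 h3] /andP[h4 h5].
  move: hu; rewrite ler_norml => /andP[h6 h7].
  have h8 : `|dotp (fun i => P i - p ord0 i) (y - x)| <= n%:R * eps * `|y - x|.
    by apply: dotp_bound => i; exact: hP.
  have h9 : `|dotp (p ord0) (z - x)| <= n%:R * eta * eps.
    apply: (le_trans (@dotp_bound _ _ (p ord0) (z - x) eta _)).
      by move=> i; exact: le_trans (rV_coord_le p i) pe.
    by rewrite ler_wpM2l// mulr_ge0.
  have h10 : dotp (p ord0) (y - z) = dotp (p ord0) (y - x) - dotp (p ord0) (z - x).
    by rewrite !dotpB; ring.
  move: h8 h9; rewrite dotpBl !ler_norml => /andP[h8 h8'] /andP[h9 h9'].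
  move: h1; rewrite /w h10; move: h8 h8' h9 h9' h2 h3 h4 h5 h6 h7.
  rewrite !mulrDl (mulrAC _ eps) (mulrAC _ eta).
  move: (n%:R * `|y - x| * eps) (n%:R * eps * eta) => q1 q2.
  move: (dotp (p ord0) (y - x)) (dotp (p ord0) (z - x)) (dotp P (y - x)) => d1 d2 d3.
  lra.
- move=> xi; apply: (@small_ge0 _ _ (n%:R * (n%:R * `|xi|) * `|xi|) 1) => // eps /andP[e0 _].
  have [j [z [p [_ _ _ _ [_ hq hD]]]]] := key _ e0.
  have := @quadf_bound _ _ (fun i j' => D2u i j' x - Hp i j' x - Hw j i j' z) xi eps hD.
  rewrite quadfB; have := hq xi; rewrite ler_norml => h1 /andP[h2 _].
  rewrite (_ : n%:R * (n%:R * `|xi|) * `|xi| * eps = n%:R * (n%:R * eps * `|xi|) * `|xi|); last by ring.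
  by move: h1 h2; set q := n%:R * _ * _; lra.
Unshelve. all: by end_near.
Qed.

End touching.

(** * Second-order expansions almost everywhere *)

Section squared_norm.
Variables (R : realType) (n : nat).
Local Notation E := 'rV[R]_n.
Local Notation mu := (lebesgue_rV R n).

Lemma sqnorm_ge0 (y : E) : 0 <= sqnorm y.
Proof. by apply: sumr_ge0 => i _; exact: sqr_ge0. Qed.

Lemma sqnormD (y z : E) : sqnorm (y + z) = sqnorm y + 2 * dotp (y ord0) z + sqnorm z.
Proof.
rewrite /sqnorm /dotp mulr_sumr -!big_split /=; apply: eq_bigr => i _; rewrite mxE; ring.
Qed.

Lemma sqnormZ (t : R) (y : E) : sqnorm (t *: y) = t ^+ 2 * sqnorm y.
Proof. by rewrite /sqnorm mulr_sumr; apply: eq_bigr => i _; rewrite mxE exprMn. Qed.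

Lemma sqnorm_le (y : E) : sqnorm y <= n%:R * `|y| ^+ 2.
Proof.
rewrite mulr_natl -[X in _ *+ X]card_ord -sumr_const; apply: ler_sum => i _.
by rewrite -(real_normK (num_real (y ord0 i))) lerXn2r ?nnegrE// rV_coord_le.
Qed.

Lemma sqnorm_ge (y : E) : `|y| ^+ 2 <= sqnorm y.
Proof.
have : `|y| <= Num.sqrt (sqnorm y).
  apply: rV_norm_le; first exact: sqrtr_ge0.
  move=> i; rewrite -sqrtr_sqr ler_sqrt ?sqnorm_ge0//.
  by rewrite /sqnorm (bigD1 i)//= lerDl sumr_ge0// => j _; exact: sqr_ge0.
move=> h; rewrite -[leRHS]sqr_sqrtr ?sqnorm_ge0// lerXn2r// nnegrE//; exact: sqrtr_ge0.
Qed.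

Lemma sqnorm_cont : continuous (@sqnorm R n).
Proof. by apply: cont_sum => i; apply: contM; exact: continuous_rV_coord. Qed.

Lemma cball_measure_le (x : E) (r s : R) : 0 <= r -> r < s ->
  (mu [set z : E | (`|z - x| <= r)%R] <= ((2 * s) ^+ n)%:E)%E.
Proof.
move=> r0 rs; apply: (@le_trans _ _ (mu (ocbox (fun i => x ord0 i - s) (fun i => x ord0 i + s)))).
  apply: le_measure; rewrite ?inE.
  - exact: closed_measurable_rV (@closed_cball R n x r).
  - exact: measurable_ocbox.
  - move=> z /= zx i; have := le_trans (rV_coord_le (z - x) i) zx; rewrite !mxE ler_norml => /andP[h1 h2].
    by apply/andP; split; lra.
apply: ocbox_le; rewrite -[X in _ ^+ X]card_ord -prodr_const; apply: ler_prod => i _.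
by rewrite le_max lexx/= ge_max; apply/andP; split; lra.
Qed.

Lemma cball_measure_ge (x : E) (r : R) : 0 <= r ->
  (((2 * r) ^+ n)%:E <= mu [set z : E | (`|z - x| <= r)%R])%E.
Proof.
move=> r0; apply: (@le_trans _ _ (mu (ocbox (fun i => x ord0 i - r) (fun i => x ord0 i + r)))).
  apply: ocbox_ge; rewrite -[X in _ ^+ X]card_ord -prodr_const; apply: ler_prod => i _.
  by rewrite mulr_ge0//= le_max; apply/orP; right; lra.
apply: le_measure; rewrite ?inE.
- exact: measurable_ocbox.
- exact: closed_measurable_rV (@closed_cball R n x r).
- move=> z /= h; apply: rV_norm_le => // i; have /andP[h1 h2] := h i.
  by rewrite !mxE ler_norml; apply/andP; split; lra.
Qed.

Lemma C11_quadratic (k : R) (x0 : E) : 0 <= k ->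
  C11 (k * n%:R) (fun x => - (k / 2 * sqnorm (x - x0))) (fun i x => - (k * (x - x0) ord0 i))
    (fun i j _ => if i == j then - k else 0).
Proof.
move=> k0; split.
- by rewrite mulr_ge0.
- move=> x y; rewrite (_ : y - x0 = (x - x0) + (y - x)); last first.
    by apply/rowP => i; rewrite !mxE; ring.
  rewrite sqnormD (_ : dotp (fun i => - (k * (x - x0) ord0 i)) (y - x) = - (k * dotp ((x - x0) ord0) (y - x))); last first.
    by rewrite /dotp mulr_sumr -sumrN; apply: eq_bigr => i _; ring.
  set d := dotp _ _; set s1 := sqnorm (x - x0).
  rewrite (_ : _ - _ - _ = - (k / 2 * sqnorm (y - x))); last by field.
  rewrite normrN ger0_norm ?mulr_ge0 ?divr_ge0 ?sqnorm_ge0// -mulrA.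
  rewrite -mulrA ler_wpM2l//; have := sqnorm_le (y - x); have := sqnorm_ge0 (y - x).
  by move: (sqnorm _) (n%:R * _) => q1 q2; lra.
- move=> i x y; rewrite (_ : _ - _ = 0) ?normr0 ?mulr_ge0 ?sqr_ge0//.
  rewrite /dotp (bigD1 i)//= eqxx big1 ?addr0 ?mxE; last first.
    by move=> j ji; rewrite eq_sym (negPf ji) mul0r.
  by ring.
- by move=> i j x y; rewrite subrr normr0 !mulr_ge0.
Qed.

(** D is covered by countably many balls with rational data whose doubles lie
    in D. *)
Lemma ae_local (D : set E) (P : E -> Prop) : open D ->
  (forall (x0 : E) (r : R), 0 < r -> [set z | `|z - x0| <= 2 * r] `<=` D ->
     {ae mu, forall x, `|x - x0| <= r -> P x}) ->
  {ae mu, forall x, D x -> P x}.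
Proof.
move=> oD h; pose ctr (q : 'rV[rat]_n) : E := map_mx ratr q.
pose Q (k : nat) (x : E) : Prop := match pickle_inv k : option ('rV[rat]_n * nat) with
  | Some (q, m) => [set z | `|z - ctr q| <= 2 * m.+1%:R^-1] `<=` D -> `|x - ctr q| <= m.+1%:R^-1 -> P x
  | None => True end.
have : {ae mu, forall x k, Q k x}.
  apply: ae_foralln => k; rewrite /Q; case: pickle_inv => [[q m]|]; last exact: aeW.
  have [sD|nsD] := pselect ([set z | `|z - ctr q| <= 2 * (m.+1%:R : R)^-1] `<=` D); last by apply: aeW.
  have r0 : 0 < (m.+1%:R : R)^-1 by rewrite invr_gt0.
  by apply: filterS (h _ _ r0 sD) => x hx _.
apply: filterS => x hx Dx.
have /nbhs_ballP[e /= e0 eD] : nbhs x D by exact: open_nbhs_nbhs.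
have e30 : 0 < e / 3 by exact: divr_gt0.
have [m _ /(_ m (leqnn m)) /= me] := near_infty_natSinv_lt (PosNum e30).
have m0 : 0 < (m.+1%:R : R)^-1 by rewrite invr_gt0.
have q_ i : {q : rat | `|x ord0 i - ratr q| < (m.+1%:R : R)^-1}.
  have lt_v : x ord0 i < x ord0 i + (m.+1%:R : R)^-1 by rewrite ltrDl.
  apply: cid; have [q] := rat_in_itvoo lt_v.
  by rewrite in_itv/= => /andP[vq qv]; exists q; rewrite ltr_distlC ltrBlDr qv/= (lt_trans vq)// ltrDl.
pose q : 'rV[rat]_n := \row_i sval (q_ i).
have xq : `|x - ctr q| <= (m.+1%:R)^-1.
  by apply: rV_norm_le => [|i]; [exact: ltW|rewrite !mxE; apply: ltW; exact: (svalP (q_ i))].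
have := hx (pickle (q, m)); rewrite /Q pickleK_inv; apply => //.
move=> z /= zq; apply: eD; rewrite -ball_normE /ball_/=.
have h1 := ler_distD (ctr q) x z; move: zq; rewrite distrC => zq.
by move: me xq zq h1; move: (m.+1%:R^-1) => r me xq zq h1; lra.
Qed.

End squared_norm.

Section regular.
Variables (R : realType) (n : nat).
Local Notation E := 'rV[R]_n.
Local Notation mu := (lebesgue_rV R n).

(** The part of W2p_loc on which the contact arguments rely, with the fixed
    exponent n in place of a p > n that depends on the function; in this form the
    class is closed under linear combinations. *)
Record regular (D : set E) (u : E -> R) (Du : 'I_n -> E -> R) (D2u : 'I_n -> 'I_n -> E -> R) : Prop := MkRegular {
  reg_cont : continuous u ;
  reg_bnd : exists M, forall x, `|u x| <= M ;
  reg_int1 : forall K i, compact K -> K `<=` D -> mu.-integrable K (EFin \o Du i) ;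
  reg_int2 : forall K i j, compact K -> K `<=` D -> mu.-integrable K (EFin \o D2u i j) ;
  reg_int3 : forall K, compact K -> K `<=` D ->
    mu.-integrable K (EFin \o (fun x => hessn (fun i j => D2u i j x) ^+ n)) ;
  reg_weak1 : forall i, weak_partial D i u (Du i) ;
  reg_weak2 : forall i j, weak_partial D j (Du i) (D2u i j) }.

Hypothesis n_gt0 : (0 < n)%N.
Variables (D : set E) (u : E -> R) (Du : 'I_n -> E -> R) (D2u : 'I_n -> 'I_n -> E -> R).
Hypothesis ru : regular D u Du D2u.

(** Apply touching with psi = - k |x - x0|^2 / 2. For the slope k h, |h| <= r, the
    function u - psi - k h.x differs by a constant from u + k |x - x0 - h|^2 / 2,
    which is smaller at x0 + h than at distance sg from there. *)
Lemma paraboloid_contact (x0 : E) (r sg M : R) (k : R) : 0 < r -> 0 < sg -> sg <= r / 2 ->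
  (forall x, `|u x| <= M) -> 4 * M + 2 <= k * sg ^+ 2 -> 0 < k ->
  [set z | `|z - x0| <= 2 * r] `<=` D ->
  exists G, [/\ measurable G, G `<=` [set z | `|z - x0| <= r + sg],
    (((2 * (k * r)) ^+ n)%:E <= \int[mu]_(x in G) ((k + hessn (fun i j => D2u i j x)) ^+ n)%:E)%E &
    {ae mu, forall x, G x -> forall y, `|y - x0| <= r + sg ->
       - (k / 2 * sqnorm (y - x)) <= u y - u x - dotp (Du ^~ x) (y - x)}].
Proof.
move=> r0 sg0 sgr uM kM k0 KD.
set K := [set z | `|z - x0| <= 2 * r] in KD.
pose F := [set z : E | `|z - x0| <= r + sg].
pose Om := [set z : E | `|z - x0| < r + sg].
have cK : compact K by exact: compact_cball.
have cF : compact F by exact: compact_cball.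
have r40 : 0 < r / 4 by exact: divr_gt0.
have [|||||||G [mG GF muG aeG]] := @touching R n D K u Du D2u n_gt0 KD cK (reg_cont ru)
  (fun i => reg_int1 ru i cK KD) (fun i j => reg_int2 ru i j cK KD) (reg_int3 ru cK KD)
  (reg_weak1 ru) (reg_weak2 ru) _ _ _ F Om (r / 4) k _ (k * r) 1 r40 cF _ _ _ _ (ltW k0)
  (C11_quadratic x0 (ltW k0)) _ ltr01 _ _.
- by exists x0; rewrite /F /= subrr normr0 addr_ge0// ltW.
- move=> x z; rewrite /F /K /= => xF zx.
  by have := ler_distD x z x0; lra.
- by move=> x /ltW.
- move=> x; rewrite /Om /= => xO; exists (r + sg - `|x - x0|); first by rewrite subr_gt0.
  by move=> y yx; rewrite /F /=; have := ler_distD x y x0; lra.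
- move=> i x y; rewrite !mxE (_ : _ - _ = - (k * (y - x) ord0 i)); last by rewrite !mxE; ring.
  by rewrite normrN normrM gtr0_norm// ler_wpM2l ?(ltW k0)// rV_coord_le.
- by rewrite mulr_ge0// ltW.
- move=> p pe; pose h := k^-1 *: p; exists (x0 + h).
    rewrite /F /= addrKl /h normrZ gtr0_norm ?invr_gt0// ler_pdivrMl// (le_trans pe)// ler_pM2l//.
    by rewrite lerDl ltW.
  move=> y; rewrite /F /Om /= => yF /negP; rewrite -leNgt => yO.
  have ph : p = k *: h by rewrite /h scalerA mulfV ?scale1r// gt_eqF.
  have hr : `|h| <= r by rewrite /h normrZ gtr0_norm ?invr_gt0// ler_pdivrMl.
  have hy : sg ^+ 2 <= sqnorm (y - x0 - h).
    apply: le_trans (sqnorm_ge _); rewrite lerXn2r ?nnegrE ?(ltW sg0)//.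
    have := ler_normD (y - x0 - h) h; rewrite (subrK h (y - x0)).
    move=> h2; rewrite -(lerD2r `|h|); apply: le_trans h2; apply: le_trans yO.
    by rewrite addrC lerD2r.
  have e1 : sqnorm (y - x0) = sqnorm h + 2 * dotp (h ord0) (y - x0 - h) + sqnorm (y - x0 - h).
    by rewrite -sqnormD; congr sqnorm; apply/rowP => i; rewrite !mxE; ring.
  have dk z : dotp (p ord0) z = k * dotp (h ord0) z.
    by rewrite ph /dotp mulr_sumr; apply: eq_bigr => i _; rewrite mxE; ring.
  rewrite addrKl !opprK !dk.
  have e2 : dotp (h ord0) y = dotp (h ord0) (x0 + h) + dotp (h ord0) (y - x0 - h).
    by rewrite -dotpD; congr dotp; apply/rowP => i; rewrite !mxE; ring.
  rewrite e1 e2; move: kM (uM (x0 + h)) (uM y); rewrite !ler_norml => kM /andP[_ u1] /andP[u2 _].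
  have : k * sg ^+ 2 <= k * sqnorm (y - x0 - h) by rewrite ler_pM2l.
  move: (sqnorm _) (sqnorm _) (dotp _ _) (dotp _ _) (u _) (u _) u1 u2 => a1 a2 a3 a4 a5 a6 *; lra.
exists G; split => //.
  by apply: le_trans muG; have := @cball_measure_ge R n 0 (k * r); under eq_set do rewrite subr0; apply; rewrite mulr_ge0// ltW.
apply: filterS aeG => x hx Gx y yF; have [_ h _ _] := hx Gx; have {h} := h y yF.
rewrite (_ : y - x0 = (x - x0) + (y - x)); last by apply/rowP => i; rewrite !mxE; ring.
rewrite (sqnormD (x - x0) (y - x)) !opprK.
have -> : dotp (fun i => Du i x - - (k * (x - x0) ord0 i)) (y - x) =
    dotp (Du ^~ x) (y - x) + k * dotp ((x - x0) ord0) (y - x).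
  by rewrite /dotp mulr_sumr -big_split /=; apply: eq_bigr => i _; ring.
by move: (sqnorm _) (sqnorm _) (dotp _ _) (dotp _ _) (u _) (u _) => *; lra.
Qed.

(** For the opening k, paraboloid_contact reads
    (2 k r)^n <= the integral of (k + |D2u|)^n over G. Dividing by k^n and letting
    k tend to infinity, the union of the contact sets has measure at least
    (2 r)^n in a ball of radius r + sg; as sg tends to 0 they exhaust the ball of
    radius r up to a null set. *)
Lemma second_order_local (x0 : E) (r : R) : 0 < r -> [set z | `|z - x0| <= 2 * r] `<=` D ->
  {ae mu, forall x, `|x - x0| <= r -> exists a s : R, 0 < s /\ forall y, `|y| <= s ->
     - (a * sqnorm y) <= u (x + y) - u x - dotp (Du ^~ x) y}.
Proof.
move=> r0 KD; set K := [set z | `|z - x0| <= 2 * r] in KD.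
have cK : compact K by exact: compact_cball.
have mK := compact_measurable_rV cK.
have [M0 uM0] := reg_bnd ru; pose M := `|M0|.
have uM x : `|u x| <= M by exact: le_trans (uM0 x) (ler_norm _).
pose Q := [set z : E | `|z - x0| <= r].
have mQ : measurable Q by exact: closed_measurable_rV (@closed_cball R n x0 r).
pose sg m : R := r / m.+2%:R.
have sg0 m : 0 < sg m by exact: divr_gt0.
have sgr m : sg m <= r / 2 by rewrite /sg ler_pM2l// lef_pV2 ?posrE// ler_nat.
have kk m : {k0 : nat | forall k, (k0 <= k)%N -> 4 * M + 2 <= k.+1%:R * sg m ^+ 2}.
  apply: cid; have s20 : 0 < sg m ^+ 2 by exact: exprn_gt0.
  have q0 : 0 <= (4 * M + 2) / sg m ^+ 2.
    by rewrite divr_ge0 ?(ltW s20)// addr_ge0// mulr_ge0// normr_ge0.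
  exists (Num.bound ((4 * M + 2) / sg m ^+ 2)) => k hk.
  rewrite -ler_pdivrMr//; apply: (le_trans (ltW (archi_boundP q0))).
  by rewrite ler_nat; exact: leqW.
pose k0 m := sval (kk m).
have hG m k : {G : set E | [/\ measurable G, G `<=` [set z | `|z - x0| <= r + sg m],
    (((2 * ((k0 m + k).+1%:R * r)) ^+ n)%:E <= \int[mu]_(x in G) (((k0 m + k).+1%:R + hessn (fun i j => D2u i j x)) ^+ n)%:E)%E &
    {ae mu, forall x, G x -> forall y, `|y - x0| <= r + sg m ->
       - ((k0 m + k).+1%:R / 2 * sqnorm (y - x)) <= u y - u x - dotp (Du ^~ x) (y - x)}]}.
  apply: cid; apply: (@paraboloid_contact x0 r (sg m) M) => //.
  by apply: (svalP (kk m)); exact: leq_addr.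
pose G m k := sval (hG m k).
have mG m k : measurable (G m k) by case: (svalP (hG m k)).
pose Bd m := Q `\` \bigcup_k G m k.
have mBd m : measurable (Bd m) by apply: measurableD => //; exact: bigcupT_measurable.
pose F m := [set z : E | `|z - x0| <= r + sg m].
have mF m : measurable (F m) by exact: closed_measurable_rV (@closed_cball R n x0 (r + sg m)).
have FK m : F m `<=` K by move=> z; rewrite /F /K /=; have := sgr m; lra.
pose h x := hessn (fun i j => D2u i j x).
have mh : measurable_fun K h.
  apply/measurable_EFinP; apply: measurable_int; apply: (integrable_sumr mK) => -[i j].
  by apply: integrable_norm; exact: (reg_int2 ru i j cK KD).
have h0 x : 0 <= h x by exact: hessn_ge0.
have ih1 : mu.-integrable K (EFin \o (fun x => (1 + h x) ^+ n)).
  apply: (power_integrable cK (fun i j => reg_int2 ru i j cK KD) (reg_int3 ru cK KD) ler01).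
have muBd m : (mu (Bd m) <= ((2 * (r + 2 * sg m)) ^+ n - (2 * r) ^+ n)%:E)%E.
  pose S := F m `\` Bd m.
  have mS : measurable S by exact: measurableD.
  have SK : S `<=` K by move=> x [/FK].
  have BF : Bd m `<=` F m by move=> x [Qx _]; rewrite /F /=; move: Qx; rewrite /Q /=; have := sg0 m; lra.
  have muS : (((2 * r) ^+ n)%:E <= mu S)%E.
    pose f_ k x := ((1 + (k0 m + k).+1%:R^-1 * h x) ^+ n)%:E.
    have mhS : measurable_fun S h by exact: measurable_funS mh.
    have mf_ k : measurable_fun S (f_ k).
      apply/measurable_EFinP; apply: measurable_funX; apply: measurable_funD => //.
      exact: measurable_funM.
    have cf : {ae mu, forall x, S x -> f_ k x @[k --> \oo] --> (1%E : \bar R)}.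
      apply: aeW => x Sx; apply: cvg_EFin; first exact: nearW.
      have -> : fine \o f_ ^~ x = (fun q : R => q ^+ n) \o (fun k => 1 + (k0 m + k).+1%:R^-1 * h x) by [].
      rewrite -[X in _ --> X](expr1n R n).
      apply: continuous_cvg; first exact: exprn_continuous.
      rewrite -[X in _ --> X]addr0 -(mul0r (h x)); apply: cvgD; first exact: cvg_cst.
      apply: cvgM; last exact: cvg_cst.
      have -> : (fun k => (k0 m + k).+1%:R^-1) = (fun k => (k + k0 m).+1%:R^-1) :> (nat -> R).
        by apply/funext => k; rewrite addnC.
      by rewrite (cvg_shiftn (k0 m) (fun k => k.+1%:R^-1 : R)); exact: cvg_harmonic.
    pose dm := EFin \o (fun x => (1 + h x) ^+ n).
    have dom : {ae mu, forall x k, S x -> (`|f_ k x| <= dm x)%E}.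
      apply: aeW => x k Sx; rewrite /f_ /dm /= lee_fin.
      have i0 : 0 <= (k0 m + k).+1%:R^-1 :> R by rewrite invr_ge0.
      have p0 : 0 <= 1 + (k0 m + k).+1%:R^-1 * h x by rewrite addr_ge0// mulr_ge0.
      rewrite ger0_norm ?exprn_ge0// lerXn2r ?nnegrE ?(addr_ge0 ler01)// ?mulr_ge0//.
      by rewrite lerD2l ler_piMl// invf_le1// ler1n.
    have [_ _ cv] := dominated_convergence mS mf_ (measurable_cst 1%E) cf (integrableS mK mS SK ih1) dom.
    rewrite integral_cst// mul1e in cv.
    rewrite -(cvg_lim _ cv)//; apply: lime_ge; first by apply/cvg_ex; eexists; exact: cv.
    apply: nearW => k /=; have [_ GF muG _] := svalP (hG m k); rewrite -/(G m k) in GF muG.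
    set kR : R := (k0 m + k).+1%:R in muG.
    have kR0 : 0 < kR by rewrite ltr0n.
    have GS : G m k `<=` S.
      by move=> x Gx; split; [exact: GF|case=> _ []; exists k].
    have e1 : (\int[mu]_(x in G m k) ((kR + h x) ^+ n)%:E <= (kR ^+ n)%:E * \int[mu]_(x in S) f_ k x)%E.
      rewrite -ge0_integralZl_EFin//; last 2 first.
      - by move=> x _; rewrite lee_fin exprn_ge0// addr_ge0// mulr_ge0.
      - by rewrite exprn_ge0// ltW.
      apply: (@le_trans _ _ (\int[mu]_(x in S) ((kR + h x) ^+ n)%:E)%E).
        apply: ge0_subset_integral => //.
        - by apply/measurable_EFinP; apply: measurable_funX; apply: measurable_funD.
        - by move=> x _; rewrite lee_fin exprn_ge0// addr_ge0// ltW.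
      rewrite le_eqVlt; apply/orP; left; apply/eqP; apply: eq_integral => x _.
      rewrite /f_ -EFinM -exprMn; congr ((_ ^+ _)%:E).
      by rewrite -/kR; field; rewrite gt_eqF.
    have := le_trans muG e1; rewrite mulrCA exprMn EFinM.
    by rewrite lee_pmul2l// lte_fin exprn_gt0.
  have muF : mu (F m) = (mu (Bd m) + mu S)%E.
    rewrite -measureU//; last by apply/seteqP; split => // x [? []].
    by congr (mu _); rewrite /S setDUK.
  have b1 : (mu (F m) <= ((2 * (r + 2 * sg m)) ^+ n)%:E)%E.
    by apply: cball_measure_le; have := sg0 m; lra.
  rewrite EFinB leeBrDr//; apply: le_trans b1; rewrite muF; exact: leeD2l.
have neg : mu.-negligible (\bigcap_m Bd m).
  exists (\bigcap_m Bd m); split => //; first exact: bigcapT_measurable.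
  apply/eqP; rewrite eq_le measure_ge0 andbT.
  have cv : ((2 * (r + 2 * sg m)) ^+ n - (2 * r) ^+ n)%:E @[m --> \oo] --> (0%E : \bar R).
    apply: cvg_EFin; first exact: nearW.
    rewrite -(subrr ((2 * r) ^+ n)); apply: cvgB; last exact: cvg_cst.
    have -> : (fun m => (2 * (r + 2 * sg m)) ^+ n) = (fun q : R => (2 * (r + 2 * q)) ^+ n) \o sg by [].
    have cs : sg m @[m --> \oo] --> 0.
      rewrite -(mulr0 r); apply: cvgM; first exact: cvg_cst.
      have -> : (fun m => (m.+2%:R)^-1 : R) = (fun m => harmonic (m + 1)%N).
        by apply/funext => m; rewrite /harmonic addn1.
      by rewrite (cvg_shiftn 1 (harmonic : nat -> R)); exact: cvg_harmonic.
    apply: (@continuous_cvg _ _ _ \oo _ (fun m => 2 * (r + 2 * sg m)) (fun q : R => q ^+ n) (2 * r)).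
      exact: exprn_continuous.
    apply: cvgM; first exact: cvg_cst.
    rewrite -[X in _ --> X]addr0 -(mulr0 2); apply: cvgD; first exact: cvg_cst.
    by apply: cvgM; [exact: cvg_cst|exact: cs].
  rewrite -(cvg_lim _ cv)//; apply: lime_ge; first by apply/cvg_ex; eexists; exact: cv.
  apply: nearW => m; apply: le_trans (muBd m); apply: le_measure; rewrite ?inE//.
    exact: bigcapT_measurable.
  by move=> x; apply.
have ae1 : {ae mu, forall x m k, G m k x -> forall y, `|y - x0| <= r + sg m ->
       - ((k0 m + k).+1%:R / 2 * sqnorm (y - x)) <= u y - u x - dotp (Du ^~ x) (y - x)}.
  by apply: ae_foralln => m; apply: ae_foralln => k; case: (svalP (hG m k)).
have ae2 : {ae mu, forall x, ~ (\bigcap_m Bd m) x}.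
  by apply: negligibleS neg => x /=; rewrite notK.
apply: filterS2 ae1 ae2 => x h1 h2 xr.
have [m [k Gx]] : exists m k, G m k x.
  apply: contrapT => nG; apply: h2 => m _; split => // -[k _ Gx]; apply: nG; by exists m, k.
exists ((k0 m + k).+1%:R / 2), (sg m); split => // y ys.
have := h1 m k Gx (x + y); rewrite addrKl; apply.
by rewrite addrAC; apply: (le_trans (ler_normD _ _)); exact: lerD.
Qed.

Lemma second_order_ae : open D -> {ae mu, forall x, D x -> exists a s : R, 0 < s /\ forall y, `|y| <= s ->
     - (a * sqnorm y) <= u (x + y) - u x - dotp (Du ^~ x) y}.
Proof. by move=> oD; apply: ae_local => // x0 r r0 KD; exact: second_order_local. Qed.

End regular.

(** * The cone of non-negative supersolutions *)

Section regular_closure.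
Variables (R : realType) (n : nat).
Local Notation E := 'rV[R]_n.
Local Notation mu := (lebesgue_rV R n).
Variable D : set E.
Hypothesis oD : open D.

Let mD : measurable D. Proof. exact: open_measurable_rV. Qed.

Lemma integrable_test (K : set E) (F phi : E -> R) : compact K -> K `<=` D ->
  mu.-integrable K (EFin \o F) -> continuous phi -> (forall x, ~ K x -> phi x = 0) ->
  mu.-integrable D (EFin \o (fun x => F x * phi x)).
Proof.
move=> cK KD iF cphi phi0; have mK := compact_measurable_rV cK.
have [M hM] : exists M, forall x, K x -> `|phi x| <= M.
  have [K0|K0] := pselect (K !=set0); last by exists 0 => x Kx; case: K0; exists x.
  have [|c _ hc] := @EVT_max_rV R n (fun x => `|phi x|) K K0 cK.
    by apply: continuous_subspaceT => x; apply: continuous_comp; [exact: cphi|exact: norm_continuous].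
  by exists `|phi c| => x Kx; apply: hc; rewrite inE.
have iK : mu.-integrable K (EFin \o (fun x => F x * phi x)).
  apply: (@integrable_mul_bounded _ _ _ _ _ _ _ M) => //.
  by apply: measurable_funTS; exact: continuous_measurable_rV.
have := integrableS measurableT mD (@subsetT _ D) (integrable_patch mK iK).
apply: eq_integrable => // x _ /=; rewrite patchE; case: ifPn => //.
by rewrite notin_setE => /phi0 ->; rewrite mulr0.
Qed.

Lemma test_function_support (phi : E -> R) : test_function D phi ->
  exists K, [/\ compact K, K `<=` D & continuous phi /\ (forall x, ~ K x -> phi x = 0) /\
   forall i, continuous (partial i phi) /\ forall x, ~ K x -> partial i phi x = 0].
Proof.
move=> [sphi cK KD]; exists (closure [set x | phi x != 0]); split => //.
have out x : ~ closure [set x | phi x != 0] x -> phi x = 0.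
  by move=> nK; apply/eqP; apply: contrapT => p0; apply: nK; apply: subset_closure; exact/negP.
split; first by case: (sphi [::]).
split => // i; split; first by case: (sphi [:: i]).
move=> x nK; have z : is_derive x (unit_vec R i) (fun=> 0 : R) 0 by exact: is_derive_zero.
have h : is_derive x (unit_vec R i) phi 0.
  apply: (near_eq_is_derive _ z).
  have : nbhs x (~` closure [set x | phi x != 0]).
    by apply: open_nbhs_nbhs; split => //; rewrite openC; exact: closed_closure.
  by apply: filterS => y /out.
exact: (@derive_val _ _ _ _ _ _ _ h).
Qed.

Definition loc_int (f : E -> R) := forall K, compact K -> K `<=` D -> mu.-integrable K (EFin \o f).

Lemma weak_partial_lin (k : R) i (f f' g g' : E -> R) : loc_int f -> loc_int f' -> loc_int g -> loc_int g' ->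
  weak_partial D i f g -> weak_partial D i f' g' ->
  weak_partial D i (fun x => k * f x + f' x) (fun x => k * g x + g' x).
Proof.
move=> If If' Ig Ig' w w' phi tphi.
have [K [cK KD [cphi [phi0 /(_ i)[cd d0]]]]] := test_function_support tphi.
have lin (h h' psi : E -> R) : loc_int h -> loc_int h' -> continuous psi -> (forall x, ~ K x -> psi x = 0) ->
    \int[mu]_(x in D) ((k * h x + h' x) * psi x) =
    k * \int[mu]_(x in D) (h x * psi x) + \int[mu]_(x in D) (h' x * psi x).
  move=> Ih Ih' cpsi psi0.
  have i1 := integrable_test cK KD (Ih K cK KD) cpsi psi0.
  have i2 := integrable_test cK KD (Ih' K cK KD) cpsi psi0.
  rewrite -RintegralZl// -RintegralD//; last exact: (integrableZl mD _ i1).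
  by apply: eq_Rintegral => x _; ring.
rewrite !lin// (w phi tphi) (w' phi tphi); ring.
Qed.

Lemma loc_int_cont (f : E -> R) (M : R) : continuous f -> (forall x, `|f x| <= M) -> loc_int f.
Proof.
move=> cf fM K cK KD; have [r _ Kr] := compact_norm_le cK; have mK := compact_measurable_rV cK.
apply: (@bounded_integrable _ _ _ _ _ mK _ _ M) => //.
  exact: (@bounded_measure_finite _ _ _ r).
by apply: measurable_funTS; exact: continuous_measurable_rV.
Qed.

Lemma powD_le (a b : R) : 0 <= a -> 0 <= b -> (a + b) ^+ n <= 2 ^+ n * a ^+ n + 2 ^+ n * b ^+ n.
Proof.
move=> a0 b0; rewrite -!exprMn.
have p0 : 0 <= (2 * a) ^+ n by rewrite exprn_ge0// mulr_ge0.
have p1 : 0 <= (2 * b) ^+ n by rewrite exprn_ge0// mulr_ge0.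
have [ab|ab] := leP a b.
  by apply: ler_wpDl => //; rewrite lerXn2r ?nnegrE ?addr_ge0 ?mulr_ge0//; lra.
by apply: ler_wpDr => //; rewrite lerXn2r ?nnegrE ?addr_ge0 ?mulr_ge0//; lra.
Qed.

Lemma regular_lin (k : R) u Du D2u v Dv D2v : regular D u Du D2u -> regular D v Dv D2v ->
  regular D (fun x => k * u x + v x) (fun i x => k * Du i x + Dv i x)
    (fun i j x => k * D2u i j x + D2v i j x).
Proof.
move=> [cu [M uM] a1 a2 a3 a4 a5] [cv [M' vM] b1 b2 b3 b4 b5].
have i2 K i j : compact K -> K `<=` D -> mu.-integrable K (EFin \o (fun x => k * D2u i j x + D2v i j x)).
  move=> cK KD; have mK := compact_measurable_rV cK.
  exact: (integrableD mK (integrableZl mK k (a2 K i j cK KD)) (b2 K i j cK KD)).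
split.
- by apply: contD => //; apply: contM => //; exact: cont_cst.
- exists (`|k| * M + M') => x; apply: (le_trans (ler_normD _ _)); rewrite normrM.
  by apply: lerD => //; rewrite ler_wpM2l.
- move=> K i cK KD; have mK := compact_measurable_rV cK.
  exact: (integrableD mK (integrableZl mK k (a1 K i cK KD)) (b1 K i cK KD)).
- exact: i2.
- move=> K cK KD; have mK := compact_measurable_rV cK.
  have A3 := a3 K cK KD; have B3 := b3 K cK KD.
  pose w x := 2 ^+ n * `|k| ^+ n * hessn (fun i j => D2u i j x) ^+ n + 2 ^+ n * hessn (fun i j => D2v i j x) ^+ n.
  have iw : mu.-integrable K (EFin \o w).
    exact: (integrableD mK (integrableZl mK _ A3) (integrableZl mK _ B3)).
  apply: (@le_integrable _ _ _ mu K mK _ (EFin \o w)) iw.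
  + apply/measurable_EFinP; apply: measurable_funX; apply/measurable_EFinP; apply: measurable_int.
    by apply: (integrable_sumr mK) => -[i j]; apply: integrable_norm; exact: i2.
  + move=> x _ /=; rewrite lee_fin.
    have h0 := hessn_ge0 (fun i j => D2u i j x); have h0' := hessn_ge0 (fun i j => D2v i j x).
    have w0 : 0 <= w x by rewrite addr_ge0// !mulr_ge0// exprn_ge0.
    rewrite (ger0_norm w0) ger0_norm ?exprn_ge0 ?hessn_ge0//.
    apply: (@le_trans _ _ ((`|k| * hessn (fun i j => D2u i j x) + hessn (fun i j => D2v i j x)) ^+ n)).
      rewrite lerXn2r ?nnegrE ?hessn_ge0// ?addr_ge0 ?mulr_ge0//.
      rewrite /hessn mulr_sumr -big_split /=; apply: ler_sum => p _.
      by apply: (le_trans (ler_normD _ _)); rewrite normrM.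
    by apply: le_trans (powD_le _ _) _; rewrite ?mulr_ge0// exprMn mulrA.
- by move=> i; apply: weak_partial_lin => //; [exact: loc_int_cont uM|exact: loc_int_cont vM|move=> K; exact: a1|move=> K; exact: b1].
- by move=> i j; apply: weak_partial_lin => //; move=> K; [exact: a1|exact: b1|exact: a2|exact: b2].
Qed.

Lemma regular0 : (0 < n)%N -> regular D (fun=> 0) (fun _ _ => 0) (fun _ _ _ => 0).
Proof.
move=> n0; have z K : mu.-integrable K (EFin \o (fun=> 0)).
  by rewrite (_ : EFin \o _ = cst 0%E)//; exact: integrable0.
have wz i : weak_partial D i (fun=> 0) (fun=> 0).
  by move=> phi _; under eq_Rintegral do rewrite mul0r; under [in RHS]eq_Rintegral do rewrite mul0r; rewrite /Rintegral integral0 oppr0.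
split => //.
- exact: cont_cst.
- by exists 0 => x; rewrite normr0.
- move=> K cK KD; rewrite (_ : (fun x => _) = fun=> 0)//; apply/funext => x.
  by rewrite /hessn big1 ?expr0n ?(gtn_eqF n0)// => p _; rewrite normr0.
Qed.

(** The expansion from above is the expansion from below of - u. *)
Lemma two_sided_ae u Du D2u : (0 < n)%N -> regular D u Du D2u ->
  {ae mu, forall x, D x -> exists a s : R, 0 < s /\ forall y, `|y| <= s ->
     `|u (x + y) - u x - dotp (Du ^~ x) y| <= a * sqnorm y}.
Proof.
move=> n0 ru; have rN := regular_lin (-1) ru (regular0 n0).
apply: filterS2 (second_order_ae n0 ru oD) (second_order_ae n0 rN oD) => x h1 h2 Dx.
have [a [s [s0 ha]]] := h1 Dx; have [a' [s' [s0' ha']]] := h2 Dx.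
exists (Num.max a a'), (Num.min s s'); split; first by rewrite lt_min s0.
move=> y; rewrite le_min => /andP[ys ys'].
have := ha y ys; have := ha' y ys'; rewrite !addr0.
have -> : dotp (fun i => -1 * Du i x + 0) y = - dotp (Du ^~ x) y.
  by rewrite /dotp -sumrN; apply: eq_bigr => i _; ring.
have q0 := sqnorm_ge0 y.
have : a * sqnorm y <= Num.max a a' * sqnorm y by rewrite ler_wpM2r// le_max lexx.
have : a' * sqnorm y <= Num.max a a' * sqnorm y by rewrite ler_wpM2r// le_max lexx orbT.
rewrite ler_norml; move: (Num.max a a' * _) (a * _) (a' * _) (dotp _ _) (u _) (u _) => *.
by apply/andP; split; lra.
Qed.

End regular_closure.

Section jump_integrability.
Variables (R : realType) (n : nat).
Local Notation E := 'rV[R]_n.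

Definition jump (u : E -> R) (p : 'I_n -> R) (x y : E) : R :=
  u (x + y) - u x - \sum_(i < n) y ord0 i * p i / (1 + sqnorm y).

Lemma jumpE u p x y : jump u p x y = u (x + y) - u x - dotp p y / (1 + sqnorm y).
Proof.
by rewrite /jump /dotp mulr_suml; congr (_ - _); apply: eq_bigr => i _; rewrite (mulrC (p i)).
Qed.

Lemma one_sqnorm_gt0 (y : E) : 0 < 1 + sqnorm y.
Proof. by rewrite ltr_pwDl// sqnorm_ge0. Qed.

Lemma measurable_sqnorm : measurable_fun setT (@sqnorm R n).
Proof. exact: continuous_measurable_rV (@sqnorm_cont R n). Qed.

Lemma measurable_dotp (p : 'I_n -> R) : measurable_fun setT (dotp p : E -> R).
Proof.
apply: continuous_measurable_rV; apply: cont_sum => i.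
by apply: contM; [exact: cont_cst|exact: continuous_rV_coord].
Qed.

Lemma measurable_jump u p (x : E) : continuous u -> measurable_fun setT (jump u p x).
Proof.
move=> cu; rewrite (_ : jump u p x = fun y => u (x + y) - u x - dotp p y * (1 + sqnorm y)^-1); last first.
  by apply/funext => y; rewrite jumpE.
apply: measurable_funB; first apply: measurable_funB => //.
  apply: continuous_measurable_rV => y; apply: continuous_comp; last exact: cu.
  by apply: (@cvgD _ _ _ (nbhs y)); [exact: cvg_cst|exact: cvg_id].
apply: measurable_funM; first exact: measurable_dotp.
apply: measurable_inv_pos => //; last by move=> y _; exact: one_sqnorm_gt0.
by apply: measurable_funD => //; exact: measurable_sqnorm.
Qed.

Lemma dotp_tail (p : 'I_n -> R) (A : R) (y : E) : 0 <= A -> (forall i, `|p i| <= A) ->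
  `|dotp p y| <= n%:R * A * (1 + sqnorm y).
Proof.
move=> A0 pA; apply: (le_trans (dotp_bound y pA)); rewrite ler_wpM2l ?mulr_ge0//.
have := sqnorm_ge y; have := sqr_ge0 (`|y| - 1); rewrite sqrrB expr1n mulr1.
by have := normr_ge0 y; move: `|y| (sqnorm y) => r s; rewrite expr2 mulr2n; nra.
Qed.

(** Near y = 0 the integrand is O(|y|^2) by the expansion at x; elsewhere it is
    bounded. *)
Lemma jump_integrable (M : {measure set E -> \bar R}) u p (x : E) (B a s m : R) : continuous u ->
  (forall z, `|u z| <= B) -> 0 < s ->
  (forall y, `|y| <= s -> `|u (x + y) - u x - dotp p y| <= a * sqnorm y) ->
  (\int[M]_y (Num.min 1 (sqnorm y))%:E <= m%:E)%E ->
  M.-integrable setT (EFin \o jump u p x).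
Proof.
move=> cu uB s0 exp_ hm.
pose A := \sum_i `|p i|.
have A0 : 0 <= A by apply: sumr_ge0.
have pA i : `|p i| <= A by rewrite /A (bigD1 i)//= lerDl sumr_ge0.
pose mn (y : E) : R := Num.min 1 (sqnorm y).
have mn0 y : 0 <= mn y by rewrite le_min ler01 sqnorm_ge0.
have mmn : measurable_fun setT mn.
  exact: continuous_measurable_rV (contMin (@cont_cst _ _ 1) (@sqnorm_cont R n)).
have B0 : 0 <= B by exact: le_trans (uB x).
pose s2 := Num.min 1 (s ^+ 2).
have s20 : 0 < s2 by rewrite lt_min ltr01 exprn_gt0.
pose C1 := (`|a| + n%:R * A) * (1 + n%:R * s ^+ 2).
pose C2 := (2 * B + n%:R * A) / s2.
have nA0 : 0 <= n%:R * A by rewrite mulr_ge0.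
have C10 : 0 <= C1 by rewrite mulr_ge0 ?addr_ge0// mulr_ge0// sqr_ge0.
have C20 : 0 <= C2 by rewrite divr_ge0 ?(ltW s20)// addr_ge0// mulr_ge0.
have imn : M.-integrable setT (EFin \o (fun y => (C1 + C2) * mn y)).
  have : M.-integrable setT (EFin \o mn).
    apply/integrableP; split; first exact/measurable_EFinP.
    apply: le_lt_trans (ltry m); apply: le_trans hm.
    rewrite le_eqVlt; apply/orP; left; apply/eqP; apply: eq_integral => y _.
    by rewrite gee0_abs// lee_fin mn0.
  by move=> h; exact: (integrableZl measurableT (C1 + C2) h).
apply: le_integrable imn => //.
  by apply/measurable_EFinP; exact: measurable_jump.
move=> y _ /=; rewrite lee_fin [leRHS]ger0_norm ?mulr_ge0 ?addr_ge0//.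
have q0 := sqnorm_ge0 y; have q1 := one_sqnorm_gt0 y.
have dt := dotp_tail y A0 pA.
have [ys|ys] := leP `|y| s.
  have sq : sqnorm y <= n%:R * s ^+ 2.
    apply: (le_trans (sqnorm_le y)); rewrite ler_wpM2l// lerXn2r// nnegrE// ltW//.
  have sm : sqnorm y <= (1 + n%:R * s ^+ 2) * mn y.
    rewrite /mn; have [s1|s1] := leP 1 (sqnorm y); last by rewrite ler_peMl// lerDl mulr_ge0// sqr_ge0.
    by rewrite mulr1; apply: (le_trans sq); rewrite lerDr.
  have -> : jump u p x y = (u (x + y) - u x - dotp p y) + (dotp p y / (1 + sqnorm y)) * sqnorm y.
    by rewrite jumpE; field; rewrite gt_eqF.
  apply: (le_trans (ler_normD _ _)).
  have e1 : `|u (x + y) - u x - dotp p y| <= `|a| * sqnorm y.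
    by apply: (le_trans (exp_ y ys)); rewrite ler_wpM2r// ler_norm.
  have e2 : `|dotp p y / (1 + sqnorm y) * sqnorm y| <= n%:R * A * sqnorm y.
    rewrite normrM (ger0_norm q0) ler_wpM2r// normrM normfV (gtr0_norm q1).
    by rewrite ler_pdivrMr.
  apply: (le_trans (lerD e1 e2)); rewrite -mulrDl.
  apply: (@le_trans _ _ (C1 * mn y)); last by rewrite ler_wpM2r// lerDl.
  by rewrite /C1 -mulrA ler_wpM2l// addr_ge0.
have sm : s2 <= mn y.
  rewrite /s2 /mn le_min; apply/andP; split; first by rewrite ge_min lexx.
  rewrite ge_min; apply/orP; right; apply: le_trans (sqnorm_ge y).
  by rewrite lerXn2r// ?nnegrE// ltW.
rewrite jumpE; apply: (@le_trans _ _ (2 * B + n%:R * A)).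
  apply: (le_trans (ler_normB _ _)); apply: lerD.
    by apply: (le_trans (ler_normB _ _)); rewrite mulr_natl mulr2n; exact: lerD.
  by rewrite normrM normfV (gtr0_norm q1) ler_pdivrMr.
apply: (@le_trans _ _ (C2 * mn y)); last by rewrite ler_wpM2r// lerDr.
by rewrite /C2 mulrAC ler_pdivlMr// ler_wpM2l// addr_ge0// mulr_ge0.
Qed.

End jump_integrability.

Section supercone.
Variables (R : realType) (n : nat).
Local Notation E := 'rV[R]_n.
Local Notation mu := (lebesgue_rV R n).
Variables (q : E -> 'M[R]_n) (b : E -> E) (N : R.-sigmafker E ~> E).
Variables (D : set E) (c : E -> R).
Hypotheses (n_gt0 : (0 < n)%N) (oD : open D) (qbN : operator_assumptions q b N).

Definition supercone (u : E -> R) : Prop := (forall x, 0 <= u x) /\ exists Du D2u, regular D u Du D2u /\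
  {ae mu, forall x, D x -> 0 <= - opA q b N u Du D2u x + c x * u x}.

Lemma opL_lin k Du D2u Dv D2v x :
  opL q b (fun i x => k * Du i x + Dv i x) (fun i j x => k * D2u i j x + D2v i j x) x =
  k * opL q b Du D2u x + opL q b Dv D2v x.
Proof.
have s2 : \sum_(i < n) \sum_(j < n) q x i j * (k * D2u i j x + D2v i j x) =
    k * (\sum_(i < n) \sum_(j < n) q x i j * D2u i j x) + \sum_(i < n) \sum_(j < n) q x i j * D2v i j x.
  rewrite mulr_sumr -big_split /=; apply: eq_bigr => i _.
  by rewrite mulr_sumr -big_split /=; apply: eq_bigr => j _; ring.
have s1 : \sum_(i < n) b x ord0 i * (k * Du i x + Dv i x) =
    k * (\sum_(i < n) b x ord0 i * Du i x) + \sum_(i < n) b x ord0 i * Dv i x.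
  by rewrite mulr_sumr -big_split /=; apply: eq_bigr => i _; ring.
by rewrite /opL s1 s2; ring.
Qed.

Lemma regular_jump_integrable u Du D2u : regular D u Du D2u ->
  {ae mu, forall x, D x -> (N x).-integrable setT (EFin \o jump u (Du ^~ x) x)}.
Proof.
move=> ru; have [_ _ _ [m hm]] := qbN; have [B uB] := reg_bnd ru.
apply: filterS (two_sided_ae oD n_gt0 ru) => x hx Dx; have [a [s [s0 ha]]] := hx Dx.
exact: (jump_integrable (reg_cont ru) uB s0 ha (hm x)).
Qed.

(** The two jump integrals can be added because their integrands are integrable at
    almost every point, by the second-order expansions. *)
Lemma supercone_lin k u v : 0 <= k -> supercone u -> supercone v ->
  supercone (fun x => k * u x + v x).
Proof.
move=> k0 [u0 [Du [D2u [ru su]]]] [v0 [Dv [D2v [rv sv]]]]; split.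
  by move=> x; rewrite addr_ge0// mulr_ge0.
exists (fun i x => k * Du i x + Dv i x), (fun i j x => k * D2u i j x + D2v i j x).
split; first exact: regular_lin.
apply: filterS3 su sv (filterI (regular_jump_integrable ru) (regular_jump_integrable rv)).
move=> x hu hv [/= ju jv] Dx; have {}hu := hu Dx; have {}hv := hv Dx.
have {}ju := ju Dx; have {}jv := jv Dx.
have -> : opA q b N (fun x => k * u x + v x) (fun i x => k * Du i x + Dv i x)
    (fun i j x => k * D2u i j x + D2v i j x) x = k * opA q b N u Du D2u x + opA q b N v Dv D2v x.
  rewrite /opA opL_lin; have -> : opS N (fun x => k * u x + v x) (fun i x => k * Du i x + Dv i x) x =
      k * opS N u Du x + opS N v Dv x; last by ring.
  rewrite /opS -/(jump u (Du ^~ x) x) -/(jump v (Dv ^~ x) x).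
  transitivity (\int[N x]_y (k * jump u (Du ^~ x) x y + jump v (Dv ^~ x) x y)).
    apply: eq_Rintegral => y _; rewrite /jump.
    have -> : \sum_(i < n) y ord0 i * (k * Du i x + Dv i x) / (1 + sqnorm y) =
       k * (\sum_(i < n) y ord0 i * Du i x / (1 + sqnorm y)) + \sum_(i < n) y ord0 i * Dv i x / (1 + sqnorm y).
      by rewrite mulr_sumr -big_split /=; apply: eq_bigr => i _; ring.
    by ring.
  rewrite RintegralD//; last exact: (integrableZl measurableT _ ju).
  by rewrite RintegralZl.
have : 0 <= k * (- opA q b N u Du D2u x + c x * u x) by rewrite mulr_ge0.
by move: (opA _ _ _ _ _ _ _) (opA _ _ _ _ _ _ _) hv => A1 A2; lra.
Qed.

Lemma supercone0 : supercone (fun=> 0).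
Proof.
split => //; exists (fun _ _ => 0), (fun _ _ _ => 0); split; first exact: regular0.
apply: aeW => x _; rewrite /opA /opL /opS mulr0 addr0.
rewrite big1; last by move=> i _; rewrite big1// => j _; rewrite mulr0.
rewrite mulr0 big1; last by move=> i _; rewrite mulr0.
rewrite add0r (_ : Rintegral _ _ _ = 0) ?oppr0//.
rewrite (@eq_Rintegral _ _ _ _ _ (fun=> 0)); first by rewrite /Rintegral integral0.
by move=> y _; rewrite big1 ?subr0 ?addr0// => i _; rewrite mulr0 mul0r.
Qed.

Lemma Lp_loc_power (p : R) (f : E -> R) (K : set E) : 0 < p -> Lp_loc p D f -> compact K -> K `<=` D ->
  mu.-integrable K (EFin \o (fun x => 1 + `|f x| `^ p)).
Proof.
move=> p0 [mf hf] cK KD; have mK := compact_measurable_rV cK.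
have mfK : measurable_fun K f by apply: measurable_funS mf => //; exact: open_measurable_rV.
have mp : measurable_fun K (fun x => `|f x| `^ p).
  by apply: (measurableT_comp (measurable_powR p)); exact: measurableT_comp.
have ip : mu.-integrable K (EFin \o (fun x => `|f x| `^ p)).
  apply/integrableP; split; first exact/measurable_EFinP.
  have := poweR_lty p (hf K cK KD); rewrite poweR_Lnorm ?gt_eqF//.
  apply: le_lt_trans; rewrite [leLHS]integral_mkcond le_eqVlt; apply/orP; left; apply/eqP.
  apply: eq_integral => x _; rewrite /= !patchE; case: ifP => _ /=.
    by rewrite ger0_norm// powR_ge0.
  by rewrite normr0 powR0// gt_eqF.
have [r _ Kr] := compact_norm_le cK.
have i1 : mu.-integrable K (EFin \o (fun=> 1 : R)).
  apply: (@bounded_integrable _ _ _ _ _ mK _ _ 1) => //.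
    exact: (@bounded_measure_finite _ _ _ r).
  by move=> x _; rewrite normr1.
exact: (integrableD mK i1 ip).
Qed.

Lemma sum_pow_le (I : finType) (f : I -> R) (m : nat) : (0 < m)%N -> (forall i, 0 <= f i) ->
  (\sum_i f i) ^+ m <= #|I|%:R ^+ m * \sum_i f i ^+ m.
Proof.
move=> m0 f0; have [I0|/card_gt0P[i0 _]] := posnP #|I|.
  by rewrite big1 ?expr0n ?(gtn_eqF m0) ?mulr_ge0 ?exprn_ge0 ?sumr_ge0// => [i _|i _]; [rewrite exprn_ge0|have := fintype0 i I0].
have [j _ hj] := @Order.TotalTheory.arg_maxP _ _ _ i0 xpredT f isT.
have le1 : \sum_i f i <= #|I|%:R * f j.
  rewrite mulr_natl -sumr_const; apply: ler_sum => i _; exact: hj.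
apply: (@le_trans _ _ ((#|I|%:R * f j) ^+ m)); first by rewrite lerXn2r ?nnegrE ?mulr_ge0 ?sumr_ge0.
rewrite exprMn ler_wpM2l ?exprn_ge0//.
by rewrite (bigD1 j)//= lerDl sumr_ge0// => i _; rewrite exprn_ge0.
Qed.

(** On compact sets |f|^n <= 1 + |f|^p, as p > n. *)
Lemma W2p_regular (p : R) u Du D2u : n%:R < p -> continuous u -> (exists M, forall x, `|u x| <= M) ->
  W2p_loc p D u Du D2u -> regular D u Du D2u.
Proof.
move=> np cu bu [_ h1 h2].
have n1 : 1 <= n%:R :> R by rewrite ler1n.
have p0 : 0 < p by apply: lt_trans np; rewrite ltr0n.
have low (t s : R) : 0 <= t -> 0 < s -> s <= p -> t `^ s <= 1 + t `^ p.
  move=> t0 s0 sp; have [t1|t1] := leP 1 t.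
    by apply: ler_wpDl => //; exact: ler_powR.
  apply: ler_wpDr; first exact: powR_ge0.
  apply: (@le_trans _ _ (1 `^ s)); last by rewrite powR1.
  by apply: ge0_ler_powR; rewrite ?nnegrE// ltW.
have i1 f K : Lp_loc p D f -> compact K -> K `<=` D -> mu.-integrable K (EFin \o f).
  move=> Lf cK KD; have mK := compact_measurable_rV cK; have [mf _] := Lf.
  apply: le_integrable (Lp_loc_power p0 Lf cK KD) => //.
    by apply/measurable_EFinP; apply: measurable_funS mf => //; exact: open_measurable_rV.
  move=> x _ /=; rewrite lee_fin [leRHS]ger0_norm ?addr_ge0 ?powR_ge0//.
  by have := low `|f x| 1 (normr_ge0 _) ltr01 (le_trans n1 (ltW np)); rewrite powRr1.
split => //.
- by move=> K i cK KD; have [Lf _] := h1 i; exact: i1.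
- by move=> K i j cK KD; have [Lf _] := h2 i j; exact: i1.
- move=> K cK KD; have mK := compact_measurable_rV cK.
  pose w x := #|{: 'I_n * 'I_n}|%:R ^+ n * \sum_(r : 'I_n * 'I_n) (1 + `|D2u r.1 r.2 x| `^ p).
  have iw : mu.-integrable K (EFin \o w).
    have iS : mu.-integrable K (EFin \o (fun x => \sum_(r : 'I_n * 'I_n) (1 + `|D2u r.1 r.2 x| `^ p))).
      by apply: (integrable_sumr mK) => -[i j]; have [Lf _] := h2 i j; exact: Lp_loc_power.
    exact: (integrableZl mK _ iS).
  apply: (@le_integrable _ _ _ mu K mK _ (EFin \o w)) iw.
  + apply/measurable_EFinP; apply: measurable_funX; apply/measurable_EFinP; apply: measurable_int.
    by apply: (integrable_sumr mK) => -[i j]; apply: integrable_norm; have [Lf _] := h2 i j; exact: i1.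
  + move=> x _ /=; rewrite lee_fin ger0_norm ?exprn_ge0 ?hessn_ge0//; apply: le_trans (ler_norm _).
    apply: (le_trans (sum_pow_le n_gt0 _)) => //; rewrite /w ler_wpM2l ?exprn_ge0//.
    apply: ler_sum => r _; rewrite -powR_mulrn//; apply: low => //; last exact: ltW.
    by rewrite ltr0n.
- by move=> i; have [] := h1 i.
- by move=> i j; have [] := h2 i j.
Qed.

Lemma supersolution_supercone u : supersolution q b N c D u -> (forall x, 0 <= u x) -> supercone u.
Proof.
move=> [cu bu [p [Du [D2u [np W hs]]]]] u0; split => //; exists Du, D2u; split => //.
exact: W2p_regular W.
Qed.

End supercone.

(** * Positive semidefinite forms *)

Section psd_forms.
Variables (R : realType) (n : nat).
Local Notation E := 'rV[R]_n.
Implicit Types M : 'I_n -> 'I_n -> R.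

Lemma dotpDl (p q : 'I_n -> R) (h : E) : dotp (fun i => p i + q i) h = dotp p h + dotp q h.
Proof. by rewrite /dotp -big_split /=; apply: eq_bigr => i _; ring. Qed.

Lemma dotpZl (t : R) (p : 'I_n -> R) (h : E) : dotp (fun i => t * p i) h = t * dotp p h.
Proof. by rewrite /dotp mulr_sumr; apply: eq_bigr => i _; ring. Qed.

Lemma quadfE M (h : E) : quadf M h = dotp (fun i => dotp (M i) h) h.
Proof. by []. Qed.

Lemma dotp0 (p : 'I_n -> R) : dotp p (0 : E) = 0.
Proof. by rewrite /dotp big1// => i _; rewrite mxE mulr0. Qed.

Lemma quadf_unit M k (h : E) (t : R) : (forall i j, M i j = M j i) ->
  quadf M (h + t *: unit_vec R k) = quadf M h + 2 * t * dotp (M k) h + t ^+ 2 * M k k.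
Proof.
move=> Ms; rewrite quadfE; have -> : (fun i => dotp (M i) (h + t *: unit_vec R k)) = fun i => dotp (M i) h + t * M k i.
  by apply/funext => i; rewrite dotpD dotpZ dotp_unit Ms.
by rewrite dotpD dotpZ dotp_unit dotpDl dotpZl quadfE; ring.
Qed.

Lemma quadf_unit2 M i j (t : R) : (forall i j, M i j = M j i) ->
  quadf M (unit_vec R i + t *: unit_vec R j) = M i i + 2 * t * M j i + t ^+ 2 * M j j.
Proof.
move=> Ms; rewrite quadf_unit// dotp_unit -[unit_vec R i]add0r -[unit_vec R i]scale1r quadf_unit//.
by rewrite quadfE !dotp0; ring.
Qed.

Lemma psd_diag M k : (forall i j, M i j = M j i) -> (forall h : E, 0 <= quadf M h) -> 0 <= M k k.
Proof.
move=> Ms M0; have := M0 (0 + 1 *: unit_vec R k); rewrite quadf_unit//.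
by rewrite quadfE !dotp0 mulr0 !add0r expr1n mul1r.
Qed.

(** Evaluate the form on e_i + e_j and on e_i - e_j. *)
Lemma psd_entry M i j : (forall i j, M i j = M j i) -> (forall h : E, 0 <= quadf M h) ->
  `|M i j| <= \sum_k M k k.
Proof.
move=> Ms M0; have d0 k := psd_diag k Ms M0.
have ej t : 0 <= M i i + 2 * t * M i j + t ^+ 2 * M j j.
  by rewrite (Ms i j) -quadf_unit2.
have le_tr k : M k k <= \sum_k M k k by rewrite (bigD1 k)//= lerDl sumr_ge0.
have := ej 1; have := ej (- 1); rewrite sqrrN expr1n; have := le_tr i; have := le_tr j.
by rewrite ler_norml; move: (\sum_k _) (M i i) (M j j) (M i j) => *; apply/andP; split; lra.
Qed.

(** Successive Schur complements write M as a sum of rank-one forms v v^T, and for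
    each of them the inequality is the lower bound on Q at v. *)
Lemma trace_ge (Q : 'I_n -> 'I_n -> R) (gm : R) M :
  (forall xi : E, gm * sqnorm xi <= \sum_(i < n) \sum_(j < n) Q i j * xi ord0 i * xi ord0 j) ->
  (forall i j, M i j = M j i) -> (forall h : E, 0 <= quadf M h) ->
  gm * \sum_k M k k <= \sum_(i < n) \sum_(j < n) Q i j * M i j.
Proof.
move=> hQ; suff main : forall (s : seq 'I_n) M, (forall i j, M i j = M j i) -> (forall h : E, 0 <= quadf M h) ->
    (forall i j, i \notin s -> M i j = 0) -> gm * \sum_k M k k <= \sum_(i < n) \sum_(j < n) Q i j * M i j.
  by move=> Ms M0; apply: (main (enum 'I_n)) => // i j; rewrite mem_enum.
elim=> [|k s IH] {}M Ms M0 Mz.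
  rewrite big1 ?mulr0; last by move=> i _; rewrite Mz.
  by rewrite big1// => i _; rewrite big1// => j _; rewrite Mz ?mulr0.
have [k0|k0] := eqVneq (M k k) 0.
  have zk j : M k j = 0.
    have ek t : 0 <= M j j + 2 * t * M k j.
      by have := M0 (unit_vec R j + t *: unit_vec R k); rewrite quadf_unit2// k0 mulr0 addr0.
    apply: contrapT => /eqP Mk; have := ek (- (M j j + 1) / (2 * M k j)).
    rewrite (_ : 2 * _ * _ = - (M j j + 1)); last by field.
    by rewrite opprD addrA subrr sub0r oppr_ge0 ler10.
  apply: IH => // i j; have [->|ik] := eqVneq i k; first by rewrite zk.
  by move=> ins; apply: Mz; rewrite inE negb_or ik.
have d0 : 0 < M k k by rewrite lt_def k0 (psd_diag k Ms M0).
pose v : E := \row_i M i k.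
pose M' i j := M i j - M i k * M j k / M k k.
have vE i j : M i j = M' i j + (M k k)^-1 * (v ord0 i * v ord0 j) by rewrite /M' /v !mxE; ring.
have M's i j : M' i j = M' j i by rewrite /M' Ms; ring.
have M'0 (h : E) : 0 <= quadf M' h.
  have := M0 (h + (- dotp (M k) h / M k k) *: unit_vec R k); rewrite quadf_unit//.
  rewrite (_ : _ + _ + _ = quadf M h - dotp (M k) h ^+ 2 / M k k); last by field.
  rewrite /quadf (_ : \sum_i (\sum_j M' i j * h ord0 j) * h ord0 i =
    \sum_i (\sum_j M i j * h ord0 j) * h ord0 i - dotp (M k) h ^+ 2 / M k k)//.
  have -> : dotp (M k) h ^+ 2 / M k k = \sum_i (M k i * dotp (M k) h / M k k) * h ord0 i.
    by rewrite expr2 {1}/dotp mulr_suml mulr_suml; apply: eq_bigr => i _; ring.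
  rewrite -sumrB; apply: eq_bigr => i _; rewrite -mulrBl; congr (_ * _).
  rewrite /dotp mulr_sumr mulr_suml -sumrB; apply: eq_bigr => j _.
  by rewrite /M' (Ms i k) (Ms j k); ring.
have M'z i j : i \notin s -> M' i j = 0.
  have [->|ik] := eqVneq i k; first by rewrite /M' (Ms k j) mulrAC mulfV// mul1r subrr.
  move=> ins; have nin : i \notin k :: s by rewrite inE negb_or ik.
  by rewrite /M' !(Mz i)// !mul0r subr0.
have := IH M' M's M'0 M'z; have := hQ v.
have -> : \sum_k0 M k0 k0 = \sum_k0 M' k0 k0 + (M k k)^-1 * sqnorm v.
  by rewrite /sqnorm mulr_sumr -big_split /=; apply: eq_bigr => i _; rewrite vE expr2.
have -> : \sum_i \sum_j Q i j * M i j = \sum_i \sum_j Q i j * M' i j +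
   (M k k)^-1 * (\sum_i \sum_j Q i j * v ord0 i * v ord0 j).
  rewrite mulr_sumr -big_split /=; apply: eq_bigr => i _; rewrite mulr_sumr -big_split /=.
  by apply: eq_bigr => j _; rewrite vE; ring.
move=> h1 h2; rewrite mulrDr mulrCA; apply: lerD => //.
by rewrite ler_wpM2l// invr_ge0 ltW.
Qed.

End psd_forms.

(** * Gaussian barriers *)

Section gaussian.
Variables (R : realType) (A : R).
Hypothesis A0 : 0 < A.

(** Hermite polynomials, up to scaling. *)
Fixpoint gpoly (m : nat) : {poly R} :=
  if m is m'.+1 then (gpoly m')^`() - (2 * A)%:P * 'X * gpoly m' else 1.

Definition gauss (m : nat) (t : R) : R := (gpoly m).[t] * expR (- (A * t ^+ 2)).

Lemma gauss_derive m (t : R) : is_derive t (1 : R) (gauss m) (gauss m.+1 t).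
Proof.
have dq : is_derive t (1 : R) (fun u : R => - (A * u ^+ 2)) (- (2 * A * t)).
  apply: (@is_derive_quad _ _ _ _ _ _ A) => h.
  rewrite [h *: _]mulr1 (_ : _ - _ - _ = - (A * h ^+ 2)); last by ring.
  by rewrite normrN ger0_norm// mulr_ge0 ?sqr_ge0// ltW.
have dE := @is_derive1_comp R expR (fun u : R => - (A * u ^+ 2)) t _ _ (is_derive_expR _) dq.
have dp : is_derive t (1 : R) (horner (gpoly m)) (gpoly m)^`().[t] by exact: is_derive_poly.
have := is_deriveM dp dE => d; apply: (is_derive_eq d).
rewrite /gauss /= hornerD hornerN !hornerM hornerC hornerX.
by rewrite /GRing.scale /=; ring.
Qed.

Lemma gauss_bounded m : exists M, 0 <= M /\ forall t, `|gauss m t| <= M.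
Proof.
have mono i (t : R) : `|t| ^+ i <= (1 + i`!%:R / A ^+ i) * expR (A * t ^+ 2).
  have e1 : 1 <= expR (A * t ^+ 2) by rewrite -expR0 ler_expR mulr_ge0 ?sqr_ge0// ltW.
  have c0 : 0 <= i`!%:R / A ^+ i by rewrite divr_ge0// exprn_ge0// ltW.
  have [t1|t1] := leP `|t| 1.
    apply: (@le_trans _ _ 1); first by rewrite exprn_ile1.
    by apply: le_trans e1 _; rewrite ler_peMl ?expR_ge0// lerDl.
  apply: (@le_trans _ _ (i`!%:R / A ^+ i * expR (A * t ^+ 2))); last by rewrite ler_wpM2r ?expR_ge0// lerDr.
  have h : (A * t ^+ 2) ^+ i <= i`!%:R * expR (A * t ^+ 2).
    case: i {c0} => [|i]; first by rewrite expr0 fact0 mul1r.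
    have x0 : 0 <= A * t ^+ 2 by rewrite mulr_ge0 ?sqr_ge0// ltW.
    have f0 : 0 < (i.+1)`!%:R :> R by rewrite ltr0n fact_gt0.
    rewrite [leRHS]mulrC -ler_pdivrMr//.
    by have := expR_ge1Dxn i x0; apply: le_trans; rewrite lerDr.
  have Ai : 0 < A ^+ i by exact: exprn_gt0.
  rewrite mulrAC ler_pdivlMr//; apply: le_trans h.
  rewrite exprMn mulrC ler_wpM2l ?(ltW Ai)// -(real_normK (num_real t)) -exprM mulnC exprM.
  by rewrite expr2 ler_peMl ?exprn_ge0// exprn_ege1// ltW.
exists (\sum_(i < size (gpoly m)) `|(gpoly m)`_i| * (1 + i`!%:R / A ^+ i)).
split; first by apply: sumr_ge0 => i _; rewrite mulr_ge0// addr_ge0// divr_ge0// exprn_ge0// ltW.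
move=> t; rewrite /gauss normrM (gtr0_norm (expR_gt0 _)) expRN ler_pdivrMr ?expR_gt0//.
rewrite horner_coef (le_trans (ler_norm_sum _ _ _))// mulr_suml; apply: ler_sum => i _.
by rewrite normrM normrX -mulrA ler_wpM2l.
Qed.

Lemma gauss0E t : gauss 0 t = expR (- (A * t ^+ 2)).
Proof. by rewrite /gauss /= hornerE mul1r. Qed.

Lemma gauss1E t : gauss 1 t = - (2 * A * t) * expR (- (A * t ^+ 2)).
Proof. by rewrite /gauss /= derivC !hornerE; congr (_ * _); ring. Qed.

Lemma gauss2E t : gauss 2 t = (4 * A ^+ 2 * t ^+ 2 - 2 * A) * expR (- (A * t ^+ 2)).
Proof.
rewrite /gauss /= derivC mulr1 sub0r; congr (_ * _).
rewrite derivN derivM derivC derivX mul0r add0r mulr1.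
by rewrite hornerD !hornerN !hornerM hornerN !hornerM !hornerC hornerX; ring.
Qed.

Variable n : nat.
Local Notation E := 'rV[R]_n.
Let m0 : 'I_n -> nat := fun=> 0%N.

Lemma pgauss0E (z : E) : pprod gauss m0 z = expR (- (A * sqnorm z)).
Proof.
rewrite /pprod /sqnorm mulr_sumr -sumrN expR_sum.
by apply: eq_bigr => i _; rewrite gauss0E.
Qed.

Lemma pgauss1E i (z : E) : pprod gauss (incr i m0) z = - (2 * A * z ord0 i) * expR (- (A * sqnorm z)).
Proof.
rewrite pprod_incr gauss1E -pgauss0E (pprod_split _ i) gauss0E; ring.
Qed.

Lemma pgauss2E i j (z : E) : pprod gauss (incr j (incr i m0)) z =
  (4 * A ^+ 2 * z ord0 i * z ord0 j - (if i == j then 2 * A else 0)) * expR (- (A * sqnorm z)).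
Proof.
rewrite -pgauss0E pprod_incr (pprod_split _ j).
have [<-|ij] := eqVneq i j.
  rewrite /incr eqxx gauss2E gauss0E (_ : \prod_(k < n | k != i) _ = \prod_(k < n | k != i) gauss (m0 k) (z ord0 k)); last first.
    by apply: eq_bigr => k /negPf ->.
  by rewrite expr2; ring.
rewrite subr0 [in X in gauss X]/incr eq_sym (negPf ij) (bigD1 i)//= [X in _ = X * _]mulrC.
rewrite (bigD1 i (P := fun k => k != j))//= /incr eqxx gauss1E.
rewrite (_ : \prod_(k < n | _) gauss (if k == i then _ else _) _ = \prod_(k < n | (k != j) && (k != i)) gauss (m0 k) (z ord0 k)); last first.
  by apply: eq_bigr => k /andP[_ /negPf ->].
by rewrite gauss1E !gauss0E; ring.
Qed.

End gaussian.

Section barrier.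
Variables (R : realType) (n : nat).
Local Notation E := 'rV[R]_n.

Lemma sqnorm_norm_le (v : E) (r : R) : 0 <= r -> sqnorm v <= r ^+ 2 -> `|v| <= r.
Proof.
move=> r0 h; have := le_trans (sqnorm_ge v) h.
by rewrite ler_sqr ?nnegrE.
Qed.

Lemma C11_pprod (phi : nat -> R -> R) :
  (forall m (t : R), is_derive t (1 : R) (phi m) (phi m.+1 t)) ->
  (forall m, exists M, 0 <= M /\ forall t, `|phi m t| <= M) ->
  exists C, C11 C (pprod phi (fun=> 0%N) : E -> R) (fun i => pprod phi (incr i (fun=> 0%N)))
    (fun i j => pprod phi (incr j (incr i (fun=> 0%N)))).
Proof.
move=> dphi bphi; set m0 := fun=> 0%N.
have [C0 [C00 hC0]] := pprod_taylor dphi bphi (m0 : 'I_n -> nat).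
have c1 i : {C : R | 0 <= C /\ forall y h : E, `|pprod phi (incr i m0) (y + h) - pprod phi (incr i m0) y -
     \sum_(j < n) pprod phi (incr j (incr i m0)) y * h ord0 j| <= C * `|h| ^+ 2}.
  by apply: cid; exact: pprod_taylor.
have c2 i j : {L : R | 0 <= L /\ forall x y : E, `|pprod phi (incr j (incr i m0)) x -
    pprod phi (incr j (incr i m0)) y| <= L * `|x - y|}.
  by apply: cid; exact: pprod_lip.
pose S1 := \sum_(i < n) sval (c1 i).
pose S2 := \sum_(i < n) \sum_(j < n) sval (c2 i j).
have p1 i : 0 <= sval (c1 i) by case: (svalP (c1 i)).
have p2 i j : 0 <= sval (c2 i j) by case: (svalP (c2 i j)).
have S10 : 0 <= S1 by exact: sumr_ge0.
have S20 : 0 <= S2 by apply: sumr_ge0 => i _; exact: sumr_ge0.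
have l1 i : sval (c1 i) <= S1 by rewrite /S1 (bigD1 i)//= lerDl sumr_ge0.
have l2 i j : sval (c2 i j) <= S2.
  rewrite /S2 (bigD1 i)//= (bigD1 j)//= -addrA lerDl addr_ge0// ?sumr_ge0// => k _; exact: sumr_ge0.
exists (C0 + S1 + S2); split.
- by rewrite !addr_ge0.
- move=> x y; have := hC0 x (y - x); rewrite (addrC x) subrK => /le_trans; apply.
  by rewrite ler_wpM2r ?sqr_ge0// -addrA lerDl addr_ge0.
- move=> i x y; have [_ h] := svalP (c1 i); have := h x (y - x); rewrite (addrC x) subrK => /le_trans; apply.
  by rewrite ler_wpM2r ?sqr_ge0//; have := l1 i; lra.
- move=> i j x y; have [_ h] := svalP (c2 i j); apply: (le_trans (h y x)).
  by rewrite ler_wpM2r//; have := l2 i j; lra.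
Qed.

Lemma C11_scale (C s k : R) (x0 : E) w g H : 0 < s -> C11 C w g H ->
  exists C', C11 C' (fun x => w (s *: (x - x0)) - k) (fun i x => s * g i (s *: (x - x0)))
    (fun i j x => s ^+ 2 * H i j (s *: (x - x0))).
Proof.
move=> s0 [C0 h1 h2 h3]; exists (C * s ^+ 2 + C * s ^+ 3).
have e (x y : E) : s *: (y - x0) - s *: (x - x0) = s *: (y - x).
  by rewrite -scalerBr opprB addrA subrK.
have s20 : 0 <= C * s ^+ 2 by rewrite mulr_ge0// sqr_ge0.
have s30 : 0 <= C * s ^+ 3 by rewrite mulr_ge0// exprn_ge0// ltW.
split.
- exact: addr_ge0.
- move=> x y; have := h1 (s *: (x - x0)) (s *: (y - x0)); rewrite e dotpZ normrZ (gtr0_norm s0) exprMn.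
  rewrite dotpZl opprB addrA subrK => /le_trans; apply.
  by rewrite mulrA ler_wpM2r ?sqr_ge0// lerDl.
- move=> i x y; have := h2 i (s *: (x - x0)) (s *: (y - x0)); rewrite e dotpZ normrZ (gtr0_norm s0) exprMn => h.
  rewrite dotpZl -mulrBr (_ : _ - _ = s * (g i (s *: (y - x0)) - g i (s *: (x - x0)) - s * dotp (fun j => H i j (s *: (x - x0))) (y - x))); last by ring.
  rewrite normrM (gtr0_norm s0); apply: (@le_trans _ _ (s * (C * (s ^+ 2 * `|y - x| ^+ 2)))); first by rewrite ler_pM2l.
  rewrite (_ : s * _ = C * s ^+ 3 * `|y - x| ^+ 2); last by ring.
  by rewrite ler_wpM2r ?sqr_ge0// lerDr.
- move=> i j x y; have := h3 i j (s *: (x - x0)) (s *: (y - x0)); rewrite e normrZ (gtr0_norm s0) => h.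
  rewrite -mulrBr normrM (gtr0_norm (exprn_gt0 _ s0)).
  apply: (@le_trans _ _ (s ^+ 2 * (C * (s * `|y - x|)))); first by rewrite ler_pM2l// exprn_gt0.
  rewrite (_ : s ^+ 2 * _ = C * s ^+ 3 * `|y - x|); last by ring.
  by rewrite ler_wpM2r// lerDr.
Qed.

Definition gaussE (al : R) (x0 x : E) : R := expR (- (al * sqnorm (x - x0))).

Definition bar_grad (al : R) (x0 : E) (i : 'I_n) (x : E) : R :=
  - (2 * al * (x - x0) ord0 i) * gaussE al x0 x.

Definition bar_hess (al : R) (x0 : E) (i j : 'I_n) (x : E) : R :=
  (4 * al ^+ 2 * (x - x0) ord0 i * (x - x0) ord0 j - (if i == j then 2 * al else 0)) * gaussE al x0 x.

(** All barriers are rescalings of one Gaussian, so the Lipschitz constant of the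
    gradient scales like r^-2, uniformly in x0 and r. *)
Lemma barrier_C11 (A : R) : 0 < A -> exists C3, 0 <= C3 /\ forall (x0 : E) (r k : R), 0 < r ->
  (exists C, C11 C (fun x => gaussE (A / r ^+ 2) x0 x - k) (bar_grad (A / r ^+ 2) x0) (bar_hess (A / r ^+ 2) x0)) /\
  forall i x y, `|bar_grad (A / r ^+ 2) x0 i y - bar_grad (A / r ^+ 2) x0 i x| <= C3 / r ^+ 2 * `|y - x|.
Proof.
move=> A0; have dg := gauss_derive A0; have bg := gauss_bounded A0.
have c i : {L : R | 0 <= L /\ forall x y : E, `|pprod (gauss A) (incr i (fun=> 0%N)) x -
    pprod (gauss A) (incr i (fun=> 0%N)) y| <= L * `|x - y|}.
  by apply: cid; exact: pprod_lip.
have p0 i : 0 <= sval (c i) by case: (svalP (c i)).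
exists (\sum_(i < n) sval (c i)); split; first exact: sumr_ge0.
move=> x0 r k r0; have i0 : 0 < r^-1 by rewrite invr_gt0.
have rn0 : r != 0 by rewrite gt_eqF.
have vZ t (v : E) i : (t *: v) ord0 i = t * v ord0 i by rewrite mxE.
have e0 x : gaussE (A / r ^+ 2) x0 x = pprod (gauss A) (fun=> 0%N) (r^-1 *: (x - x0)).
  by rewrite pgauss0E sqnormZ /gaussE; congr expR; field.
have e1 i x : bar_grad (A / r ^+ 2) x0 i x = r^-1 * pprod (gauss A) (incr i (fun=> 0%N)) (r^-1 *: (x - x0)).
  rewrite pgauss1E /bar_grad e0 pgauss0E; set G := expR _; rewrite vZ.
  by move: ((x - x0) ord0 i) => zi; field.
have e2 i j x : bar_hess (A / r ^+ 2) x0 i j x = r^-1 ^+ 2 * pprod (gauss A) (incr j (incr i (fun=> 0%N))) (r^-1 *: (x - x0)).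
  rewrite pgauss2E /bar_hess e0 pgauss0E; set G := expR _; rewrite !vZ.
  move: ((x - x0) ord0 i) ((x - x0) ord0 j) => zi zj.
  by case: (i == j); field.
split.
  have [C hC] := C11_pprod dg bg; have [C' hC'] := C11_scale k x0 i0 hC; exists C'.
  have -> : (fun x => gaussE (A / r ^+ 2) x0 x - k) = (fun x => pprod (gauss A) (fun=> 0%N) (r^-1 *: (x - x0)) - k).
    by apply/funext => x; rewrite e0.
  have -> : bar_grad (A / r ^+ 2) x0 = (fun i x => r^-1 * pprod (gauss A) (incr i (fun=> 0%N)) (r^-1 *: (x - x0))).
    by apply/funext => i; apply/funext => x; rewrite e1.
  have -> : bar_hess (A / r ^+ 2) x0 = (fun i j x => r^-1 ^+ 2 * pprod (gauss A) (incr j (incr i (fun=> 0%N))) (r^-1 *: (x - x0))).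
    by apply/funext => i; apply/funext => j; apply/funext => x; rewrite e2.
  exact: hC'.
move=> i x y; rewrite !e1 -mulrBr normrM (gtr0_norm i0).
have [_ h] := svalP (c i); have := h (r^-1 *: (y - x0)) (r^-1 *: (x - x0)).
have -> : r^-1 *: (y - x0) - r^-1 *: (x - x0) = r^-1 *: (y - x).
  by rewrite -scalerBr opprB addrA subrK.
rewrite normrZ (gtr0_norm i0) => h'.
apply: (@le_trans _ _ (r^-1 * (sval (c i) * (r^-1 * `|y - x|)))); first by rewrite ler_pM2l.
rewrite (_ : r^-1 * _ = sval (c i) / r ^+ 2 * `|y - x|); last by rewrite -exprVn; ring.
rewrite ler_wpM2r// ler_wpM2r// ?invr_ge0 ?sqr_ge0//.
by rewrite (bigD1 i)//= lerDl sumr_ge0.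
Qed.

Lemma gaussE_gt0 al x0 x : 0 < gaussE al x0 x. Proof. exact: expR_gt0. Qed.

(** For |y| <= 1 the inequality exp t >= 1 + t replaces the increment of the
    Gaussian by that of its exponent; for |y| > 1 the first term is dropped. *)
Lemma bar_jump (al : R) (x0 x y : E) : 1 <= al -> `|x - x0| <= 1 ->
  - ((1 + 2 * n%:R) * al * gaussE al x0 x * Num.min 1 (sqnorm y)) <=
  gaussE al x0 (x + y) - gaussE al x0 x - dotp (bar_grad al x0 ^~ x) y / (1 + sqnorm y).
Proof.
move=> al1 z1; have al0 : 0 < al by lra.
set G := gaussE al x0 x; set z := x - x0; set s := sqnorm y; set d := dotp (z ord0) y.
have G0 : 0 < G by exact: gaussE_gt0.
have s0 : 0 <= s by exact: sqnorm_ge0.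
have s1 : 0 < 1 + s by rewrite ltr_pwDl.
have n0 : 0 <= n%:R :> R by [].
have dE : dotp (bar_grad al x0 ^~ x) y = - (2 * al * G * d).
  rewrite /d -/z /dotp mulr_sumr -sumrN; apply: eq_bigr => i _.
  by rewrite /bar_grad -/z -/G; ring.
have dy : `|d| <= n%:R * `|y|.
  rewrite -[n%:R]mulr1; apply: dotp_bound => i; exact: le_trans (rV_coord_le z i) z1.
have ys : `|y| ^+ 2 <= s by exact: sqnorm_ge.
rewrite dE mulNr opprK.
have aG : 0 < al * G by rewrite mulr_gt0.
have [sl|sg] := leP s 1.
  have y1 : `|y| <= 1 by apply: sqnorm_norm_le => //; rewrite expr1n.
  have dn : `|d| <= n%:R by apply: (le_trans dy); rewrite ler_piMr.
  have conv : G * (1 - al * (2 * d + s)) <= gaussE al x0 (x + y).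
    rewrite /gaussE (_ : x + y - x0 = z + y); last by rewrite addrAC.
    have -> : expR (- (al * sqnorm (z + y))) = G * expR (- (al * (2 * d + s))).
      by rewrite /G /gaussE -expRD sqnormD -/d -/s; congr expR; ring.
    by rewrite ler_wpM2l ?(ltW G0)// expR_ge1Dx.
  apply: (@le_trans _ _ (G * (1 - al * (2 * d + s)) - G + 2 * al * G * d / (1 + s))); last by rewrite lerD2r lerD2r.
  rewrite (_ : G * _ - G + _ = - (al * G * (s + 2 * d * (s / (1 + s))))); last by field; rewrite gt_eqF.
  rewrite lerN2 (_ : _ * s = al * G * ((1 + 2 * n%:R) * s)); last by ring.
  rewrite ler_pM2l// (_ : _ * s = s + 2 * (n%:R * s)); last by ring.
  rewrite lerD2l -mulrA ler_pM2l//.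
  have ss : s / (1 + s) <= s by rewrite ler_pdivrMr// ler_peMr// lerDl.
  have ss0 : 0 <= s / (1 + s) by rewrite divr_ge0// ltW.
  apply: (@le_trans _ _ (n%:R * (s / (1 + s)))); last by rewrite ler_wpM2l.
  by rewrite ler_wpM2r// (le_trans (ler_norm _)).
rewrite mulr1.
have y1 : `|y| <= 1 + s.
  by have := sqr_ge0 (`|y| - 1); rewrite sqrrB expr1n mulr1 mulr2n; move: (`|y| ^+ 2) (`|y|) ys s0 => r2 r1; lra.
have e1 : - (n%:R) <= d / (1 + s).
  rewrite ler_pdivlMr// mulNr lerNl; apply: le_trans (ler_wpM2l n0 y1); apply: le_trans dy.
  by rewrite -normrN; exact: ler_norm.
have e2 : - (2 * al * G * n%:R) <= 2 * al * G * d / (1 + s).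
  by rewrite -mulrN -[leRHS]mulrA ler_pM2l// mulr_gt0// mulr_gt0.
have e3 : G <= al * G by rewrite ler_peMl// ltW.
have e4 := gaussE_gt0 al x0 (x + y).
rewrite (_ : (1 + 2 * n%:R) * al * G = al * G + 2 * al * G * n%:R); last by ring.
by move: e2 e3 e4; move: (2 * al * G * n%:R) (2 * al * G * d / _) (al * G) (gaussE _ _ _) => *; lra.
Qed.

End barrier.

(** * Growth of supersolutions *)

Section contact_estimates.
Variables (R : realType) (n : nat).
Local Notation E := 'rV[R]_n.

Definition barrier (A r : R) (x0 x : E) : R := gaussE (A / r ^+ 2) x0 x - expR (- A).

(** Loss in jump_lower due to the affine perturbation of slope eta / r, in units of
    r^-2: the first term pays for the short jumps that leave the ball, the second
    for all other jumps. *)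
Definition kappa (m eta : R) : R := n%:R ^+ 2 * eta ^+ 2 / (3 * m) + 3 * (n%:R * eta).

Lemma kappa1_ge0 (m eta : R) : 0 < m -> 0 <= n%:R ^+ 2 * eta ^+ 2 / (3 * m).
Proof.
by move=> m0; apply: divr_ge0; [exact: mulr_ge0 (sqr_ge0 _) (sqr_ge0 _)|rewrite mulr_ge0// ltW].
Qed.

Lemma kappa_ge0 (m eta : R) : 0 < m -> 0 <= eta -> 0 <= kappa m eta.
Proof. by move=> m0 e0; apply: addr_ge0; [exact: kappa1_ge0|rewrite !mulr_ge0]. Qed.

Lemma sum_le_const (f : 'I_n -> R) (a : R) : (forall i, f i <= a) -> \sum_i f i <= n%:R * a.
Proof.
by move=> fa; rewrite mulr_natl -[X in _ *+ X]card_ord -sumr_const; apply: ler_sum => i _.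
Qed.

Lemma norm_tail (y : E) : `|y| <= 1 + sqnorm y.
Proof.
have := sqnorm_ge y; have := sqnorm_ge0 y; have := sqr_ge0 (`|y| - 1).
by rewrite sqrrB expr1n mulr1 mulr2n; move: (`|y| ^+ 2) (`|y|) (sqnorm y) => r2 r1 s; lra.
Qed.

Lemma barrier_out (A r : R) (x0 x : E) : 0 <= A -> 0 < r -> r ^+ 2 <= sqnorm (x - x0) -> barrier A r x0 x <= 0.
Proof.
move=> A0 r0 h; have r20 : 0 < r ^+ 2 by exact: exprn_gt0.
rewrite /barrier /gaussE subr_le0 ler_expR lerN2 mulrAC ler_pdivlMr//.
by rewrite ler_wpM2l.
Qed.

(** For jumps that stay in the ball the contact inequality bounds the increment of
    u - barrier from below by that of the affine function. For jumps that leave it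
    u - barrier is non-negative, which is a gain of 3 m / 4 over its value at x;
    completing the square, the gain absorbs the affine term of short jumps. *)
Lemma jump_lower (x0 x : E) (r A m eta : R) (u : E -> R) (P : 'I_n -> R) :
  0 < r -> r <= 1 -> 1 <= A -> 0 < m -> 0 <= eta -> sqnorm (x - x0) <= r ^+ 2 ->
  (forall z, 0 <= u z) -> (forall i, `|P i| <= eta / r) ->
  (forall y, sqnorm (y - x0) <= r ^+ 2 ->
     u x - barrier A r x0 x + dotp P (y - x) <= u y - barrier A r x0 y) ->
  u x - barrier A r x0 x <= - (3 / 4 * m) ->
  forall y, - (((1 + 2 * n%:R) * (A / r ^+ 2) * gaussE (A / r ^+ 2) x0 x + kappa m eta / r ^+ 2) * Num.min 1 (sqnorm y)) <=
    jump u (fun i => P i + bar_grad (A / r ^+ 2) x0 i x) x y.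
Proof.
move=> r0 r1 A1 m0 eta0 xr u0 Peta hc hm y.
set al := A / r ^+ 2; set G := gaussE al x0 x; set s := sqnorm y.
have r20 : 0 < r ^+ 2 by exact: exprn_gt0.
have r21 : r ^+ 2 <= 1 by rewrite exprn_ile1// ltW.
have rr2 : r ^+ 2 <= r by rewrite expr2 ler_piMr// ltW.
have al1 : 1 <= al by rewrite /al ler_pdivlMr// mul1r (le_trans r21).
have s0 : 0 <= s by exact: sqnorm_ge0.
have s1 : 0 < 1 + s by rewrite ltr_pwDl.
set mn := Num.min 1 s.
have mn0 : 0 <= mn by rewrite le_min ler01.
have xr1 : `|x - x0| <= r by apply: sqnorm_norm_le => //; exact: ltW.
have bj := @bar_jump R n al x0 x y al1 (le_trans xr1 r1); rewrite -/G -/s -/mn in bj.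
have er0 : 0 <= eta / r by rewrite divr_ge0// ltW.
have n0 : 0 <= n%:R :> R by [].
have ne0 : 0 <= n%:R * eta by rewrite mulr_ge0.
have k0 := kappa_ge0 m0 eta0.
have dP : `|dotp P y| <= n%:R * (eta / r) * `|y| by exact: dotp_bound.
suff first : - (kappa m eta / r ^+ 2 * mn) <= (u (x + y) - barrier A r x0 (x + y)) - (u x - barrier A r x0 x) - dotp P y / (1 + s).
  rewrite jumpE dotpDl -/s [leLHS](_ : _ = - ((1 + 2 * n%:R) * al * G * mn) - kappa m eta / r ^+ 2 * mn); last by ring.
  move: bj first; rewrite /barrier -/al -/G.
  rewrite [(dotp P y + _) / _]mulrDl; move: (_ * mn) (kappa _ _ / _ * mn) (dotp P y / _) (dotp _ y / _) (gaussE al x0 _) (u (x + y)) => *; lra.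
have kr : kappa m eta <= kappa m eta / r ^+ 2 by rewrite ler_pdivlMr// ler_piMr.
have ns : n%:R * eta <= kappa m eta.
  rewrite /kappa; have : 0 <= n%:R ^+ 2 * eta ^+ 2 / (3 * m) by exact: kappa1_ge0.
  by move: (_ / (3 * m)) ne0; move: (n%:R * eta) => t1 t2; lra.
have [inF|/ltW outF] := leP (sqnorm (x + y - x0)) (r ^+ 2).
  have := hc _ inF; rewrite addrKl => h.
  apply: (@le_trans _ _ (dotp P y - dotp P y / (1 + s))); last by move: h; rewrite -lerBrDl lerD2r.
  have -> : dotp P y - dotp P y / (1 + s) = dotp P y * (s / (1 + s)) by field; rewrite gt_eqF.
  have ss : s / (1 + s) <= mn.
    by rewrite le_min !ler_pdivrMr// mul1r lerDr ler01/= ler_peMr// lerDl.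
  have ss0 : 0 <= s / (1 + s) by rewrite divr_ge0// ltW.
  have yr : `|y| <= 2 * r.
    have := sqnorm_norm_le (ltW r0) inF => h2.
    have -> : y = (x + y - x0) - (x - x0) by apply/rowP => i; rewrite !mxE; ring.
    by apply: (le_trans (ler_normB _ _)); rewrite mulr_natl mulr2n; exact: lerD.
  have dP2 : `|dotp P y| <= 2 * (n%:R * eta).
    apply: (le_trans dP); rewrite (_ : 2 * _ = n%:R * (eta / r) * (2 * r)); last by field; rewrite gt_eqF.
    by rewrite ler_wpM2l// mulr_ge0.
  apply: (@le_trans _ _ (- (2 * (n%:R * eta) * mn))).
    rewrite lerN2 ler_wpM2r//; apply: le_trans kr; rewrite /kappa.
    have : 0 <= n%:R ^+ 2 * eta ^+ 2 / (3 * m) by exact: kappa1_ge0.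
    by move: (_ / (3 * m)) ne0; move: (n%:R * eta) => t1 t2; lra.
  rewrite lerNl -mulNr; apply: (@le_trans _ _ (`|dotp P y| * (s / (1 + s)))).
    by rewrite ler_wpM2r// -normrN ler_norm.
  by apply: ler_pM.
have w0 : 0 <= u (x + y) - barrier A r x0 (x + y).
  by rewrite subr_ge0; apply: le_trans (u0 _); apply: barrier_out => //; lra.
apply: (@le_trans _ _ (3 / 4 * m - dotp P y / (1 + s))); last by lra.
have dP3 : dotp P y / (1 + s) <= n%:R * (eta / r) * (`|y| / (1 + s)).
  rewrite [leRHS]mulrA ler_wpM2r ?invr_ge0 ?(ltW s1)//; exact: le_trans (ler_norm _) dP.
set t := n%:R * (eta / r) in dP3.
have t0 : 0 <= t by rewrite mulr_ge0.
have [sl|sg] := leP s 1.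
  have mnE : mn = s by rewrite /mn min_r.
  have e1 : `|y| / (1 + s) <= `|y| by rewrite ler_pdivrMr// ler_peMr// lerDl.
  (* completing the square in t |y| *)
  have e2 : t * `|y| <= 3 / 4 * m + t ^+ 2 / (3 * m) * `|y| ^+ 2.
    have m30 : 0 < 3 * m by rewrite mulr_gt0.
    rewrite -subr_ge0 (_ : _ - _ = (t * `|y| - 3 / 2 * m) ^+ 2 / (3 * m)); last by field; rewrite gt_eqF.
    by rewrite divr_ge0 ?sqr_ge0// ltW.
  have e3 : t ^+ 2 / (3 * m) * `|y| ^+ 2 <= kappa m eta / r ^+ 2 * s.
    apply: ler_pM; rewrite ?divr_ge0 ?sqr_ge0 ?sqnorm_ge ?mulr_ge0 ?(ltW m0)//.
    have -> : t ^+ 2 / (3 * m) = n%:R ^+ 2 * eta ^+ 2 / (3 * m) / r ^+ 2 by rewrite /t; field; rewrite !gt_eqF.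
    rewrite /kappa [leRHS]mulrDl.
    by rewrite lerDl divr_ge0 ?mulr_ge0// ltW.
  have e4 : t * (`|y| / (1 + s)) <= t * `|y| by rewrite ler_wpM2l.
  by rewrite mnE; lra.
have mnE : mn = 1 by rewrite /mn min_l// ltW.
have e1 : `|y| / (1 + s) <= 1 by rewrite ler_pdivrMr// mul1r norm_tail.
have e2 : t * (`|y| / (1 + s)) <= t by rewrite -[leRHS]mulr1 ler_wpM2l.
have e3 : t <= kappa m eta / r ^+ 2.
  rewrite /t mulrA; apply: (@le_trans _ _ (n%:R * eta / r ^+ 2)).
    by rewrite ler_wpM2l// lef_pV2.
  by rewrite ler_wpM2r// invr_ge0 ltW.
by rewrite mnE mulr1; lra.
Qed.

Lemma jump_int_lower (Nx : {measure set E -> \bar R}) (u : E -> R) p (x : E) (J MN : R) : 0 <= J ->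
  (\int[Nx]_y (Num.min 1 (sqnorm y))%:E <= MN%:E)%E ->
  Nx.-integrable setT (EFin \o jump u p x) ->
  (forall y, - (J * Num.min 1 (sqnorm y)) <= jump u p x y) ->
  - (J * MN) <= \int[Nx]_y jump u p x y.
Proof.
move=> J0 hN ij hj; pose mn (y : E) : R := Num.min 1 (sqnorm y).
have mn0 y : 0 <= mn y by rewrite le_min ler01 sqnorm_ge0.
have mmn : measurable_fun setT mn.
  exact: continuous_measurable_rV (contMin (@cont_cst _ _ 1) (@sqnorm_cont R n)).
have imn : Nx.-integrable setT (EFin \o mn).
  apply/integrableP; split; first exact/measurable_EFinP.
  apply: le_lt_trans (ltry MN); apply: le_trans hN.
  rewrite le_eqVlt; apply/orP; left; apply/eqP; apply: eq_integral => y _.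
  by rewrite gee0_abs// lee_fin mn0.
have Rmn : \int[Nx]_y mn y <= MN by rewrite -lee_fin -EFin_Rintegral.
have ineg : Nx.-integrable setT (EFin \o (fun y => - J * mn y)) by exact: (integrableZl measurableT (- J) imn).
apply: (@le_trans _ _ (\int[Nx]_y (- J * mn y))).
  by rewrite RintegralZl// mulNr lerN2 ler_wpM2l.
by apply: le_Rintegral => // y _; rewrite mulNr; exact: hj.
Qed.

(** Insert into the inequality for u at a contact point the lower bounds for the
    second-order term, by trace_ge for the part D2 - bar_hess and by ellipticity
    for the barrier, and for the jump term, by jump_lower. The terms with the
    Gaussian are of order (A / r^2)^2 |x - x0|^2 with a good sign and A / r^2 with a
    bad one; the affine perturbation contributes the right-hand side. *)
Lemma contact_pde (x0 x : E) (r A m eta : R) (u : E -> R) (Du : 'I_n -> R) (D2 : 'I_n -> 'I_n -> R)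
   (Q : 'I_n -> 'I_n -> R) (b : 'I_n -> R) (Nx : {measure set E -> \bar R}) (cx gm Qc B Mc MN : R) :
  0 < r -> r <= 1 -> 1 <= A -> 0 < m -> 0 <= eta -> sqnorm (x - x0) <= r ^+ 2 ->
  (forall z, 0 <= u z) -> (forall i, `|Du i - bar_grad (A / r ^+ 2) x0 i x| <= eta / r) ->
  (forall y, sqnorm (y - x0) <= r ^+ 2 ->
     u x - barrier A r x0 x + dotp (fun i => Du i - bar_grad (A / r ^+ 2) x0 i x) (y - x) <= u y - barrier A r x0 y) ->
  u x - barrier A r x0 x <= - (3 / 4 * m) ->
  (forall h : E, 0 <= quadf (fun i j => D2 i j - bar_hess (A / r ^+ 2) x0 i j x) h) ->
  (forall i j, D2 i j = D2 j i) ->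
  (forall xi : E, gm * sqnorm xi <= \sum_(i < n) \sum_(j < n) Q i j * xi ord0 i * xi ord0 j) ->
  (forall i j, `|Q i j| <= Qc) -> (forall i, `|b i| <= B) -> 0 <= cx -> cx <= Mc ->
  (\int[Nx]_y (Num.min 1 (sqnorm y))%:E <= MN%:E)%E -> 0 <= MN -> 0 <= B ->
  Nx.-integrable setT (EFin \o jump u Du x) ->
  2^-1 * (\sum_(i < n) \sum_(j < n) Q i j * D2 i j) + \sum_(i < n) b i * Du i + \int[Nx]_y jump u Du x y <= cx * u x ->
  gm / 2 * (\sum_k (D2 k k - bar_hess (A / r ^+ 2) x0 k k x)) +
    A / r ^+ 2 * gaussE (A / r ^+ 2) x0 x * (2 * (A / r ^+ 2) * gm * sqnorm (x - x0) -
      (n%:R * Qc + 2 * n%:R * B + (1 + 2 * n%:R) * MN + Mc)) <=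
    (kappa m eta * MN + n%:R * B * eta) / r ^+ 2.
Proof.
move=> r0 r1 A1 m0 eta0 xr u0 Peta hc hm psd sym ell Qb Bb c0 cM hN MN0 B0 ij pde.
set al := A / r ^+ 2 in Peta hc psd *; set G := gaussE al x0 x; set z := x - x0.
set P := fun i => Du i - bar_grad al x0 i x in hc.
have G0 : 0 < G by exact: gaussE_gt0.
have r20 : 0 < r ^+ 2 by exact: exprn_gt0.
have r21 : r ^+ 2 <= 1 by rewrite exprn_ile1// ltW.
have rr2 : r ^+ 2 <= r by rewrite expr2 ler_piMr// ltW.
have al1 : 1 <= al by rewrite /al ler_pdivlMr// mul1r (le_trans r21).
have al0 : 0 < al by lra.
have n0 : 0 <= n%:R :> R by [].
have aG : G <= al * G by rewrite ler_peMl// ltW.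
have zr : `|z| <= 1 by apply: le_trans r1; apply: sqnorm_norm_le => //; exact: ltW.
have DuE : (fun i => P i + bar_grad al x0 i x) = Du by apply/funext => i; rewrite /P subrK.
have k0 := kappa_ge0 m0 eta0.
have c12 : 0 <= 1 + 2 * n%:R :> R by rewrite addr_ge0// mulr_ge0.
have jl := jump_lower r0 r1 A1 m0 eta0 xr u0 Peta hc hm; rewrite -/al -/G DuE in jl.
have uG : u x <= al * G.
  apply: le_trans aG; have : 0 < expR (- A) by exact: expR_gt0.
  by move: hm m0; rewrite /barrier -/al -/G; lra.
clearbody al.
have ag0 : 0 <= al * G := mulr_ge0 (ltW al0) (ltW G0).
have al20 : 0 < 2 * al by rewrite mulr_gt0.
have J0 : 0 <= (1 + 2 * n%:R) * al * G + kappa m eta / r ^+ 2.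
  apply: addr_ge0; last by rewrite divr_ge0// ltW.
  by rewrite -mulrA; exact: mulr_ge0 c12 ag0.
have S1 := jump_int_lower J0 hN ij jl.
have tr := trace_ge ell (M := fun i j => D2 i j - bar_hess al x0 i j x) _ psd.
have {}tr := tr (fun i j => _); rewrite /= in tr.
have symM i j : D2 i j - bar_hess al x0 i j x = D2 j i - bar_hess al x0 j i x.
  by rewrite sym /bar_hess eq_sym; congr (_ - _ * _); ring.
have {}tr := tr symM.
have hH : G * (4 * al ^+ 2 * gm * sqnorm z - 2 * al * (n%:R * Qc)) <= \sum_(i < n) \sum_(j < n) Q i j * bar_hess al x0 i j x.
  have -> : \sum_(i < n) \sum_(j < n) Q i j * bar_hess al x0 i j x =
     G * (4 * al ^+ 2 * (\sum_(i < n) \sum_(j < n) Q i j * z ord0 i * z ord0 j) - 2 * al * \sum_(i < n) Q i i).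
    rewrite [4 * al ^+ 2 * _]mulr_sumr [2 * al * _]mulr_sumr -sumrB mulr_sumr; apply: eq_bigr => i _.
    rewrite mulr_sumr (bigD1 i)//= [\sum_(j < n) 4 * _ * _](bigD1 i)//= /bar_hess eqxx -/z -/G.
    rewrite (_ : \sum_(j < n | j != i) Q i j * _ = G * \sum_(j < n | j != i) 4 * al ^+ 2 * (Q i j * z ord0 i * z ord0 j)).
      by ring.
    by rewrite mulr_sumr; apply: eq_bigr => j ji; rewrite eq_sym (negPf ji); ring.
  rewrite ler_pM2l//; apply: lerB.
    have al4 : 0 <= 4 * al ^+ 2 by rewrite mulr_ge0// exprn_ge0// ltW.
    by rewrite -[leLHS]mulrA; apply: ler_wpM2l (ell z).
  apply: ler_wpM2l; first exact: ltW.
  apply: sum_le_const => i.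
  exact: le_trans (ler_norm _) (Qb i i).
have hQ : \sum_(i < n) \sum_(j < n) Q i j * D2 i j = \sum_(i < n) \sum_(j < n) Q i j * (D2 i j - bar_hess al x0 i j x) +
    \sum_(i < n) \sum_(j < n) Q i j * bar_hess al x0 i j x.
  by rewrite -big_split; apply: eq_bigr => i _; rewrite -big_split; apply: eq_bigr => j _ /=; ring.
have hb : - (n%:R * B * (eta / r + 2 * al * G)) <= \sum_(i < n) b i * Du i.
  rewrite lerNl -sumrN -mulrA; apply: sum_le_const => i.
  apply: (@le_trans _ _ (`|b i * Du i|)); first by rewrite -normrN ler_norm.
  rewrite normrM; apply: ler_pM => //.
  rewrite -DuE; apply: (le_trans (ler_normD _ _)); apply: lerD; first exact: Peta.
  rewrite /bar_grad normrM (gtr0_norm (gaussE_gt0 _ _ _)) -/G -/z normrN normrM (gtr0_norm al20).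
  rewrite ler_pM2r//; rewrite -[leRHS]mulr1; apply: ler_wpM2l; first exact: ltW.
  exact: le_trans (rV_coord_le z i) zr.
have hu : cx * u x <= Mc * (al * G) by apply: ler_pM.
have er : n%:R * B * (eta / r) <= n%:R * B * eta / r ^+ 2.
  rewrite -[leRHS]mulrA ler_wpM2l ?mulr_ge0//; rewrite ler_wpM2l// lef_pV2//.
move: pde tr hH S1 hb hu er; rewrite hQ -/G.
set T1 := \sum_(i < n) \sum_(j < n) _; set T2 := \sum_(i < n) \sum_(j < n) _; set T3 := \sum_(i < n) b i * _.
set T4 := \sum_(k < n) _; set S := Rintegral _ _ _; set U := cx * _; set s := sqnorm z => pde tr hH S1 hb hu er.
have {}tr : gm / 2 * T4 <= T1 / 2 by rewrite mulrAC ler_wpM2r// invr_ge0.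
have e1 : T1 / 2 <= U - T2 / 2 - T3 - S by move: pde; rewrite mulrDr; lra.
have e2 : G * (2 * al ^+ 2 * gm * s - al * (n%:R * Qc)) <= T2 / 2.
  by rewrite ler_pdivlMr//; apply: le_trans hH; rewrite le_eqVlt; apply/orP; left; apply/eqP; ring.
rewrite [leRHS]mulrDl (_ : kappa m eta * MN / r ^+ 2 = kappa m eta / r ^+ 2 * MN); last by ring.
rewrite (_ : al * G * (2 * al * gm * s - _) = G * (2 * al ^+ 2 * gm * s - al * (n%:R * Qc)) -
   (n%:R * B * (2 * al * G) + (1 + 2 * n%:R) * al * G * MN + Mc * (al * G))); last by ring.
rewrite [X in - X <= S]mulrDl in S1; rewrite [X in - X <= T3]mulrDr in hb.
move: S1 hb hu er e2 tr e1.
move: (kappa m eta / r ^+ 2 * MN) (n%:R * B * eta / r ^+ 2) (n%:R * B * (eta / r)) (Mc * (al * G))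
  (n%:R * B * (2 * al * G)) ((1 + 2 * n%:R) * al * G * MN) (G * (_ - _)).
clear pde hQ hH; move: (gm / 2 * T4) (T1 / 2) (T2 / 2) U T3 S => *; lra.
Qed.

End contact_estimates.

Section growth.
Variables (R : realType) (n : nat).
Local Notation E := 'rV[R]_n.
Local Notation mu := (lebesgue_rV R n).

Lemma sqnorm_shift_cont (x0 : E) : continuous (fun z : E => sqnorm (z - x0)).
Proof.
move=> z; have cs : {for z, continuous (fun z : E => z - x0)}.
  by apply: (@cvgB _ _ _ (nbhs z)); [exact: cvg_id|exact: cvg_cst].
exact: (continuous_comp cs (@sqnorm_cont R n _)).
Qed.

Lemma closed_sqnorm_ball (x0 : E) (a : R) : closed [set z : E | sqnorm (z - x0) <= a].
Proof.
rewrite (_ : [set z | _] = (fun z : E => sqnorm (z - x0)) @^-1` [set t : R | t <= a])//.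
by apply: closed_comp; [move=> z _; exact: sqnorm_shift_cont|exact: closed_le].
Qed.

(** If |x - x0| > r / 4, the choice of A makes the factor of the Gaussian at least
    1, and the left-hand side exceeds A exp(-A) / r^2 > C1 / r^2. Since the trace
    term is non-negative, the inequality also bounds the trace of D2 - bar_hess,
    hence its entries. *)
Lemma contact_bounds (x0 x : E) (r A gm C0 C1 : R) (D2 : 'I_n -> 'I_n -> R) :
  0 < r -> 1 <= A -> 0 < gm -> sqnorm (x - x0) <= r ^+ 2 ->
  0 <= C0 -> C0 + 1 <= gm * A / 8 -> C1 < A * expR (- A) ->
  (forall h : E, 0 <= quadf (fun i j => D2 i j - bar_hess (A / r ^+ 2) x0 i j x) h) ->
  (forall i j, D2 i j = D2 j i) ->
  gm / 2 * (\sum_k (D2 k k - bar_hess (A / r ^+ 2) x0 k k x)) +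
    A / r ^+ 2 * gaussE (A / r ^+ 2) x0 x * (2 * (A / r ^+ 2) * gm * sqnorm (x - x0) - C0) <= C1 / r ^+ 2 ->
  sqnorm (x - x0) <= (r / 4) ^+ 2 /\
  hessn D2 <= (n * n)%:R * (2 * (C1 + A * C0) / gm + 4 * A ^+ 2 + 2 * A) / r ^+ 2.
Proof.
move=> r0 A1 gm0 xr C00 hA hC1 psd sym h.
set al := A / r ^+ 2 in psd h; set G := gaussE al x0 x in h; set z := x - x0 in xr h *.
have r20 : 0 < r ^+ 2 by exact: exprn_gt0.
have A0 : 0 < A by lra.
have al0 : 0 < al by exact: divr_gt0.
have s0 : 0 <= sqnorm z by exact: sqnorm_ge0.
have G0 : 0 < G by exact: gaussE_gt0.
have G1 : G <= 1 by rewrite /G /gaussE -expR0 ler_expR oppr_le0 mulr_ge0// ltW.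
have GA : expR (- A) <= G.
  by rewrite /G /gaussE ler_expR lerN2 /al mulrAC ler_pdivrMr// ler_pM2l.
have symM i j : D2 i j - bar_hess al x0 i j x = D2 j i - bar_hess al x0 j i x.
  by rewrite sym /bar_hess eq_sym; congr (_ - _ * _); ring.
set tr := \sum_k _ in h.
have tr0 : 0 <= tr by apply: sumr_ge0 => k _; exact: (psd_diag k symM psd).
have alG : A * expR (- A) / r ^+ 2 <= al * G by rewrite /al mulrAC ler_pM2l.
have C1r : C1 / r ^+ 2 < A * expR (- A) / r ^+ 2 by rewrite ltr_pM2r ?invr_gt0.
have aG0 : 0 < al * G := mulr_gt0 al0 G0.
have gt0 : 0 <= gm / 2 * tr by apply: mulr_ge0 tr0; lra.
split.
  rewrite leNgt; apply/negP => hs.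
  have e1 : 1 <= 2 * al * gm * sqnorm z - C0.
    have : 2 * al * gm * (r / 4) ^+ 2 <= 2 * al * gm * sqnorm z.
      have p : 0 <= 2 * al * gm by apply: mulr_ge0 (ltW gm0); lra.
      by apply: ler_wpM2l p _ _ (ltW hs).
    rewrite (_ : 2 * al * gm * (r / 4) ^+ 2 = gm * A / 8); last by rewrite /al; field; rewrite gt_eqF.
    by move: (2 * al * gm * _) => t; lra.
  have : al * G * 1 <= al * G * (2 * al * gm * sqnorm z - C0) by apply: ler_wpM2l e1; exact: ltW.
  by move: h; move: (al * G * (_ - _)) => t; lra.
have trle : tr <= 2 * (C1 + A * C0) / gm / r ^+ 2.
  have e1 : al * G * (- C0) <= al * G * (2 * al * gm * sqnorm z - C0).
    apply: ler_wpM2l; first exact: ltW.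
    by rewrite lerDr; apply: mulr_ge0 s0; apply: mulr_ge0 (ltW gm0); lra.
  have e2 : al * G * C0 <= A * C0 / r ^+ 2.
    rewrite (_ : A * C0 / _ = al * 1 * C0); last by rewrite /al; ring.
    by apply: ler_wpM2r => //; rewrite ler_pM2l.
  have e3 : gm / 2 * tr <= (C1 + A * C0) / r ^+ 2.
    rewrite mulrDl; move: h e1; rewrite mulrN; move: (al * G * (_ - _)) (gm / 2 * tr) => *; lra.
  rewrite (_ : _ / r ^+ 2 = (C1 + A * C0) / r ^+ 2 * 2 / gm); last by field; rewrite !gt_eqF.
  by rewrite ler_pdivlMr//; lra.
have zi i : `|z ord0 i| <= r.
  by apply: le_trans (rV_coord_le z i) _; apply: sqnorm_norm_le => //; exact: ltW.
have hb i j : `|bar_hess al x0 i j x| <= (4 * A ^+ 2 + 2 * A) / r ^+ 2.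
  rewrite /bar_hess -/z -/G normrM (gtr0_norm G0); apply: le_trans (ler_piMr _ G1) _; first exact: normr_ge0.
  apply: (le_trans (ler_normB _ _)); rewrite [leRHS]mulrDl; apply: lerD.
    have a40 : 0 <= 4 * al ^+ 2 by rewrite mulr_ge0// exprn_ge0// ltW.
    rewrite 2!normrM (ger0_norm a40).
    rewrite (_ : 4 * A ^+ 2 / _ = 4 * al ^+ 2 * r * r); last by rewrite /al; field; rewrite gt_eqF.
    by apply: ler_pM (zi j) => //; [exact: mulr_ge0|apply: ler_wpM2l].
  case: ifP => _; last by rewrite normr0 divr_ge0 ?(ltW r20)// mulr_ge0// ltW.
  have al20 : 0 < 2 * al by lra.
  by rewrite (gtr0_norm al20) /al mulrA.
have hD i j : `|D2 i j| <= (2 * (C1 + A * C0) / gm + 4 * A ^+ 2 + 2 * A) / r ^+ 2.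
  rewrite -[D2 i j](subrK (bar_hess al x0 i j x)); apply: (le_trans (ler_normD _ _)).
  rewrite -addrA [leRHS]mulrDl; apply: lerD (hb i j).
  exact: le_trans (psd_entry i j symM psd) trle.
rewrite /hessn -mulrA mulr_natl (_ : (n * n)%N = #|{: 'I_n * 'I_n}|); last by rewrite card_prod card_ord.
by rewrite -sumr_const; apply: ler_sum => -[i j] _ /=.
Qed.

Variables (q : E -> 'M[R]_n) (b : E -> E) (N : R.-sigmafker E ~> E).
Variables (D : set E) (c : E -> R).
Hypotheses (n_gt0 : (0 < n)%N) (oD : open D) (qbN : operator_assumptions q b N).
Variables (gm Qc B Mc MN : R).
Hypotheses (gm0 : 0 < gm) (Qc0 : 0 <= Qc) (B0 : 0 <= B) (Mc0 : 0 <= Mc) (MN0 : 0 <= MN).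
Hypotheses (hQ : forall x i j, `|q x i j| <= Qc) (hB : forall x i, `|b x ord0 i| <= B).
Hypotheses (c0 : forall x, D x -> 0 <= c x) (cM : forall x, D x -> c x <= Mc).
Hypothesis hN : forall x, (\int[N x]_y (Num.min 1 (sqnorm y))%:E <= MN%:E)%E.

(** Since u - barrier is below - m at xb and non-negative outside the ball, and an
    affine function of slope eta / r varies by at most m / 4 on it, touching
    applies with slack m / 2. Almost every contact point satisfies the equation,
    hence lies in the quarter ball with u <= 1 and D2u of size C2 / r^2. *)
Lemma growth_step (A m eta C3 C2 : R) (x0 : E) (r : R) (u : E -> R) :
  let C0 := n%:R * Qc + 2 * n%:R * B + (1 + 2 * n%:R) * MN + Mc in
  let C1 := kappa n m eta * MN + n%:R * B * eta in
  1 <= A -> C0 + 1 <= gm * A / 8 -> 0 < m -> 2 * m = expR (- (A / 4)) - expR (- A) ->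
  0 < eta -> 2 * (n%:R * eta) <= m / 4 -> C1 < A * expR (- A) ->
  0 <= C3 -> (forall k, (exists C, C11 C (fun x => gaussE (A / r ^+ 2) x0 x - k) (bar_grad (A / r ^+ 2) x0) (bar_hess (A / r ^+ 2) x0)) /\
    forall i x y, `|bar_grad (A / r ^+ 2) x0 i y - bar_grad (A / r ^+ 2) x0 i x| <= C3 / r ^+ 2 * `|y - x|) ->
  C2 = (n * n)%:R * (2 * (C1 + A * C0) / gm + 4 * A ^+ 2 + 2 * A) ->
  0 < r -> r <= 1 -> [set z | `|z - x0| <= 2 * r] `<=` D ->
  (forall x (xi : E), `|x - x0| <= 2 * r ->
     gm * sqnorm xi <= \sum_(i < n) \sum_(j < n) q x i j * xi ord0 i * xi ord0 j) ->
  supercone q b N D c u ->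
  forall xb, sqnorm (xb - x0) <= (r / 2) ^+ 2 -> u xb < m ->
  (((2 * (eta / r)) ^+ n)%:E <= (((C3 + C2) / r ^+ 2) ^+ n)%:E *
     mu ([set x | (sqnorm (x - x0) <= (r / 4) ^+ 2)%R] `&` [set x | (u x <= 1)%R]))%E.
Proof.
move=> C0 C1 A1 hA m0 m2 eta0 nm hC1 C30 bar C2E r0 r1 KD ell [u0 [Du [D2u [ru pde]]]] xb xbr uxb.
set K := [set z | `|z - x0| <= 2 * r] in KD.
pose F := [set z : E | sqnorm (z - x0) <= r ^+ 2].
pose Om := [set z : E | sqnorm (z - x0) < r ^+ 2].
have A0 : 0 < A by lra.
have r20 : 0 < r ^+ 2 by exact: exprn_gt0.
have FB : F `<=` [set z | `|z - x0| <= r] by move=> z; exact: sqnorm_norm_le (ltW r0).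
have clF : closed F := @closed_sqnorm_ball x0 (r ^+ 2).
have cF : compact F by exact: subclosed_compact clF (@compact_cball R n x0 r) FB.
have oOm : open Om.
  rewrite (_ : Om = (fun z : E => sqnorm (z - x0)) @^-1` [set t : R | t < r ^+ 2])//.
  by apply: open_comp; [move=> z _; exact: sqnorm_shift_cont|exact: open_lt].
have cK : compact K by exact: compact_cball.
have FK : F `<=` K by move=> z /FB /=; rewrite /K /=; lra.
have xbF : F xb.
  rewrite /F /=; apply: (le_trans xbr); rewrite lerXn2r ?nnegrE ?divr_ge0 ?(ltW r0)//; lra.
have er0 : 0 <= eta / r by rewrite divr_ge0// ltW.
have n0 : 0 <= n%:R :> R by [].
have dpF (p : 'I_n -> R) x y : (forall i, `|p i| <= eta / r) -> F x -> F y -> `|dotp p (y - x)| <= m / 4.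
  move=> pe /FB /= Fx /FB /= Fy; apply: (le_trans (dotp_bound _ pe)); apply: le_trans nm.
  have -> : 2 * (n%:R * eta) = n%:R * (eta / r) * (2 * r) by field; rewrite gt_eqF.
  apply: ler_wpM2l; first exact: mulr_ge0.
  have -> : y - x = (y - x0) - (x - x0) by apply/rowP => i; rewrite !mxE; ring.
  by apply: (le_trans (ler_normB _ _)); rewrite mulr_natl mulr2n; exact: lerD.
have wxb : u xb - barrier A r x0 xb < - m.
  have : 2 * m <= barrier A r x0 xb.
    rewrite m2 /barrier lerD2r /gaussE ler_expR lerN2 mulrAC ler_pdivrMr//.
    rewrite (_ : A / 4 * r ^+ 2 = A * (r / 2) ^+ 2); first by rewrite ler_pM2l.
    by field.
  by lra.
have [[C hC] gl] := bar (expR (- A)).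
have a0 : 0 <= C3 / r ^+ 2 by rewrite divr_ge0// ltW.
have m20 : 0 < m / 2 by rewrite divr_gt0.
have [|||||G [mG GF muG aeG]] := @touching R n D K u Du D2u n_gt0 KD cK (reg_cont ru)
  (fun i => reg_int1 ru i cK KD) (fun i j => reg_int2 ru i j cK KD) (reg_int3 ru cK KD)
  (reg_weak1 ru) (reg_weak2 ru) _ _ _ F Om r (C3 / r ^+ 2) C (eta / r) (m / 2) r0 cF _ _ _ _ a0
  hC gl m20 er0 _.
- by exists xb.
- by move=> x z /FB /= xF zx; rewrite /K /=; have := ler_distD x z x0; lra.
- by move=> x /ltW.
- move=> x Omx; have := oOm _ Omx => /nbhs_ballP[e /= e0 eO]; exists e => // y yx; apply: ltW; apply: eO.
  by rewrite -ball_normE /= distrC.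
- move=> p pe; exists xb => // y yF /negP; rewrite -leNgt => yO.
  have pi i : `|p ord0 i| <= eta / r by exact: le_trans (rV_coord_le p i) pe.
  have := dpF (p ord0) xb y pi xbF yF; rewrite dotpB ler_norml => /andP[_ d1].
  have := barrier_out (ltW A0) r0 yO; rewrite /barrier => b1.
  move: wxb (u0 y) d1 b1; rewrite /barrier; move: (gaussE _ _ _ - _) (gaussE _ _ _ - _) (dotp _ _) (dotp _ _) => *; lra.
set S := [set x | _] `&` _.
have mS : measurable S.
  apply: measurableI; apply: closed_measurable_rV; first exact: closed_sqnorm_ball.
  rewrite (_ : [set x | _] = u @^-1` [set t : R | t <= 1])//.
  by apply: closed_comp; [move=> z _; exact: (reg_cont ru)|exact: closed_le].
have C10 : 0 <= C1.
  apply: addr_ge0; first by rewrite mulr_ge0// kappa_ge0// ltW.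
  by rewrite !mulr_ge0// ltW.
have C00 : 0 <= C0 by rewrite /C0 !addr_ge0// !mulr_ge0// addr_ge0// mulr_ge0.
have C20 : 0 <= C2.
  rewrite C2E mulr_ge0// !addr_ge0//.
  - by rewrite divr_ge0 ?(ltW gm0)// mulr_ge0// addr_ge0// mulr_ge0// ltW.
  - by rewrite mulr_ge0// sqr_ge0.
  - by rewrite mulr_ge0// ltW.
have key : {ae mu, forall x, G x -> S x /\ hessn (fun i j => D2u i j x) <= C2 / r ^+ 2}.
  apply: filterS3 aeG pde (regular_jump_integrable n_gt0 oD qbN ru) => x hx px jx Gx.
  have [k1 k2 k3 k4] := hx Gx; have Fx := GF _ Gx; have Dx := KD _ (FK _ Fx).
  have wx : u x - barrier A r x0 x <= - (3 / 4 * m).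
    have := k2 _ xbF; have := dpF _ x xb k1 Fx xbF; rewrite ler_norml => /andP[d1 _].
    move: wxb d1; rewrite /barrier; move: (dotp _ _) (gaussE _ _ _ - _) (gaussE _ _ _ - _) => *; lra.
  have ex (xi : E) : gm * sqnorm xi <= \sum_(i < n) \sum_(j < n) q x i j * xi ord0 i * xi ord0 j.
    by apply: ell; exact: FK Fx.
  have px' : 2^-1 * (\sum_(i < n) \sum_(j < n) q x i j * D2u i j x) + \sum_(i < n) b x ord0 i * Du i x +
      \int[N x]_y jump u (Du ^~ x) x y <= c x * u x.
    by have := px Dx; rewrite /opA /opL /opS -/(jump u (Du ^~ x) x); move: (Rintegral _ _ _) => t; lra.
  have cp := contact_pde r0 r1 A1 m0 (ltW eta0) Fx u0 k1 k2 wx k3 k4 ex (hQ x) (hB x) (c0 Dx) (cM Dx) (hN x) MN0 B0 (jx Dx) px'.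
  have [s1 s2] := contact_bounds r0 A1 gm0 Fx C00 hA hC1 k3 k4 cp.
  split; last by rewrite C2E.
  split => //=; have : barrier A r x0 x <= 1.
    rewrite /barrier; have : gaussE (A / r ^+ 2) x0 x <= 1.
      by rewrite /gaussE -expR0 ler_expR oppr_le0 mulr_ge0 ?sqnorm_ge0// divr_ge0// ltW.
    by move=> g1; rewrite lerBlDr (le_trans g1)// lerDl ltW// expR_gt0.
  by move: wx m0; lra.
apply: (@le_trans _ _ (mu [set p : E | (`|p| <= eta / r)%R])).
  by have := @cball_measure_ge R n 0 (eta / r) er0; under eq_set do rewrite subr0.
apply: (le_trans muG).
have mh : measurable_fun K (fun x => hessn (fun i j => D2u i j x)).
  apply/measurable_EFinP; apply: measurable_int; apply: (integrable_sumr (compact_measurable_rV cK)) => -[i j].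
  by apply: integrable_norm; exact: (reg_int2 ru i j cK KD).
have CC0 : 0 <= (C3 + C2) / r ^+ 2 by rewrite divr_ge0 ?addr_ge0// ltW.
apply: (@le_trans _ _ (\int[mu]_(x in G) ((((C3 + C2) / r ^+ 2) ^+ n)%:E * (\1_S x)%:E))%E).
  apply: ae_ge0_le_integral => //.
  - by move=> x _; rewrite lee_fin exprn_ge0// addr_ge0// hessn_ge0.
  - apply/measurable_EFinP; apply: measurable_funX; apply: measurable_funD => //.
    apply: measurable_funS mh => //; first exact: compact_measurable_rV.
    by move=> x /GF /FK.
  - by move=> x _; rewrite -EFinM lee_fin mulr_ge0// exprn_ge0.
  - by apply: emeasurable_funM => //; apply/measurable_EFinP; exact: measurable_indic.
  apply: filterS key => x hx Gx; have [Sx hh] := hx Gx.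
  rewrite indicE mem_set// mule1 lee_fin lerXn2r ?nnegrE ?addr_ge0 ?hessn_ge0//.
  by rewrite mulrDl lerD2l.
rewrite ge0_integralZl_EFin//; last 2 first.
- by apply/measurable_EFinP; exact: measurable_indic.
- exact: exprn_ge0.
apply: lee_wpmul2l; first by rewrite lee_fin exprn_ge0.
rewrite integral_indic//; apply: le_measure; rewrite ?inE//; first exact: measurableI.
Qed.

(** By growth_step a ball of slopes of volume (2 eta / r)^n is at most
    (C / r^2)^n times the measure of the set where u <= 1 in the quarter ball, so
    that this set has at least a fixed multiple of r^n as its measure. *)
Lemma growth : exists m dl : R, [/\ 0 < m, 0 < dl & forall (x0 : E) (r : R), 0 < r -> r <= 1 ->
  [set z | `|z - x0| <= 2 * r] `<=` D ->
  (forall x (xi : E), `|x - x0| <= 2 * r ->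
     gm * sqnorm xi <= \sum_(i < n) \sum_(j < n) q x i j * xi ord0 i * xi ord0 j) ->
  forall u, supercone q b N D c u ->
  (mu ([set x | (sqnorm (x - x0) <= (r / 4) ^+ 2)%R] `&` [set x | (u x <= 1)%R]) < (dl * r ^+ n)%:E)%E ->
  forall x, sqnorm (x - x0) <= (r / 2) ^+ 2 -> m <= u x].
Proof.
pose C0 : R := n%:R * Qc + 2 * n%:R * B + (1 + 2 * n%:R) * MN + Mc.
have n0 : 0 <= n%:R :> R by [].
have C00 : 0 <= C0 by rewrite /C0 !addr_ge0// !mulr_ge0// addr_ge0// mulr_ge0.
pose A : R := 1 + 8 * (C0 + 1) / gm.
have A1 : 1 <= A by rewrite lerDl divr_ge0 ?(ltW gm0)// mulr_ge0// addr_ge0.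
have A0 : 0 < A by lra.
have hA : C0 + 1 <= gm * A / 8.
  have -> : gm * A / 8 = gm / 8 + (C0 + 1) by rewrite /A; field; rewrite gt_eqF.
  by rewrite lerDr divr_ge0// ltW.
pose m : R := (expR (- (A / 4)) - expR (- A)) / 2.
have m0 : 0 < m by rewrite divr_gt0// subr_gt0 ltr_expR; lra.
have m2 : 2 * m = expR (- (A / 4)) - expR (- A) by rewrite /m; field.
pose Ae : R := A * expR (- A).
have Ae0 : 0 < Ae by rewrite mulr_gt0// expR_gt0.
pose L : R := (n%:R ^+ 2 / (3 * m) + 3 * n%:R) * MN + n%:R * B.
have L0 : 0 <= L.
  have l1 : 0 <= n%:R ^+ 2 / (3 * m) by rewrite divr_ge0 ?sqr_ge0// mulr_ge0// ltW.
  have l2 : 0 <= 3 * n%:R :> R by rewrite mulr_ge0.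
  exact: addr_ge0 (mulr_ge0 (addr_ge0 l1 l2) MN0) (mulr_ge0 n0 B0).
(* eta = 1 / den is at most m / (8 n) and makes C1 <= L eta smaller than Ae *)
pose den : R := 1 + 8 * n%:R / m + L / Ae.
have d1 : 0 <= 8 * n%:R / m by rewrite divr_ge0 ?(ltW m0)// mulr_ge0.
have d2 : 0 <= L / Ae by rewrite divr_ge0// ltW.
have den0 : 0 < den by rewrite /den; lra.
pose eta : R := den^-1.
have eta0 : 0 < eta by rewrite invr_gt0.
have eta1 : eta <= 1 by rewrite invf_le1// /den; lra.
have nm : 2 * (n%:R * eta) <= m / 4.
  have : n%:R * eta <= m / 8.
    rewrite ler_pdivrMr// (_ : m / 8 * den = m / 8 * (1 + L / Ae) + n%:R); last by rewrite /den; field; rewrite !gt_eqF.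
    by rewrite lerDr mulr_ge0// ?divr_ge0 ?(ltW m0)//; lra.
  by move: (n%:R * eta) => t; lra.
have hC1 : kappa n m eta * MN + n%:R * B * eta < A * expR (- A).
  apply: (@le_lt_trans _ _ (L * eta)).
    have m30 : 0 < 3 * m by rewrite mulr_gt0.
    have k1 : kappa n m eta <= (n%:R ^+ 2 / (3 * m) + 3 * n%:R) * eta.
      rewrite /kappa mulrA [leRHS]mulrDl lerD2r mulrAC; apply: ler_wpM2l.
        by rewrite divr_ge0 ?sqr_ge0// ltW.
      by rewrite expr2 ler_piMr// ltW.
    have := ler_wpM2r MN0 k1.
    rewrite (_ : L * eta = (n%:R ^+ 2 / (3 * m) + 3 * n%:R) * eta * MN + n%:R * B * eta) ?lerD2r//.
    by rewrite /L; ring.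
  rewrite ltr_pdivrMr// -/Ae (_ : Ae * den = Ae * (1 + 8 * n%:R / m) + L); last by rewrite /den; field; rewrite !gt_eqF.
  by rewrite ltrDr mulr_gt0//; lra.
have [C3 [C30 bar]] := @barrier_C11 R n A A0.
pose C1 : R := kappa n m eta * MN + n%:R * B * eta.
pose C2 : R := (n * n)%:R * (2 * (C1 + A * C0) / gm + 4 * A ^+ 2 + 2 * A).
have C10 : 0 <= C1.
  apply: addr_ge0; first by rewrite mulr_ge0// kappa_ge0// ltW.
  by rewrite !mulr_ge0// ltW.
have C20 : 0 <= C2.
  rewrite /C2 mulr_ge0// !addr_ge0//.
  - by rewrite divr_ge0 ?(ltW gm0)// mulr_ge0// addr_ge0// mulr_ge0// ltW.
  - by rewrite mulr_ge0// sqr_ge0.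
  - by rewrite mulr_ge0// ltW.
pose Kc : R := C3 + 1 + C2.
have Kc0 : 0 < Kc by rewrite /Kc; lra.
exists m, ((2 * eta / Kc) ^+ n); split => //; first by rewrite exprn_gt0// divr_gt0// mulr_gt0.
move=> x0 r r0 r1 KD ell u Su hu x xr; rewrite leNgt; apply/negP => uxm.
have r20 : 0 < r ^+ 2 by exact: exprn_gt0.
have C310 : 0 <= C3 + 1 by rewrite addr_ge0.
have bar' k : (exists C, C11 C (fun x => gaussE (A / r ^+ 2) x0 x - k) (bar_grad (A / r ^+ 2) x0) (bar_hess (A / r ^+ 2) x0)) /\
    forall i x y, `|bar_grad (A / r ^+ 2) x0 i y - bar_grad (A / r ^+ 2) x0 i x| <= (C3 + 1) / r ^+ 2 * `|y - x|.
  have [h1 h2] := bar x0 r k r0; split => // i y y'; apply: (le_trans (h2 i y y')).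
  by apply: ler_wpM2r => //; rewrite ler_wpM2r ?invr_ge0 ?(ltW r20)// lerDl.
have := growth_step A1 hA m0 m2 eta0 nm hC1 C310 bar' erefl r0 r1 KD ell Su xr uxm.
rewrite -/C0 -/C1 -/C2 -/Kc leNgt => /negP; apply.
have -> : (2 * (eta / r)) ^+ n = (Kc / r ^+ 2) ^+ n * ((2 * eta / Kc) ^+ n * r ^+ n).
  by rewrite -!exprMn; congr (_ ^+ _); field; rewrite !gt_eqF.
rewrite [X in (_ < X)%E]EFinM lte_pmul2l ?lte_fin//; first by rewrite exprn_gt0// divr_gt0.
Qed.

End growth.

(** * Spreading of lower bounds through a domain *)

Section density.
Variables (R : realType) (n : nat).
Local Notation E := 'rV[R]_n.
Local Notation mu := (lebesgue_rV R n).

(** Otherwise the mollified indicator of A would stay below 1 by a fixed amount on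
    all of A, at every small scale, against its convergence in L1. *)
Lemma density_point (A : set E) (rr a rmax : R) : measurable A -> 0 <= rr ->
  (forall x, A x -> `|x| <= rr) -> (0 < mu A)%E -> 0 < a -> 0 < rmax ->
  exists x r, [/\ A x, 0 < r, r <= rmax & (mu ([set z : E | (`|z - x| <= r)%R] `\` A) < (a * r ^+ n)%:E)%E].
Proof.
move=> mA rr0 Arr A0 a0 rm0; apply: contrapT => H.
have {}H x r : A x -> 0 < r -> r <= rmax -> ((a * r ^+ n)%:E <= mu ([set z : E | (`|z - x| <= r)%R] `\` A))%E.
  by move=> Ax r0 rm; rewrite leNgt; apply/negP => h; apply: H; exists x, r.
pose f := \1_A : E -> R.
have fA : (mu A < +oo)%E by exact: (bounded_measure_finite mA Arr).
have ind (B : set E) : measurable B -> (mu B < +oo)%E -> mu.-integrable setT (EFin \o (\1_B : E -> R)).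
  move=> mB fB; apply/integrableP; split; first exact/measurable_EFinP/measurable_indic.
  under eq_integral do rewrite gee0_abs ?lee_fin//.
  by rewrite integral_indic// setIT.
have fi : mu.-integrable setT (EFin \o f) by exact: ind.
have f01 z : 0 <= f z <= 1 by rewrite /f indicE; case: (z \in A); rewrite ?lexx ?ler01.
pose r_ k : R := rmax / k.+1%:R.
have r0 k : 0 < r_ k by exact: divr_gt0.
have rm k : r_ k <= rmax by rewrite ler_pdivrMr// ler_peMr ?(ltW rm0)// ler1n.
have e0 k : 0 < 2 * r_ k by rewrite mulr_gt0.
have ecv : 2 * r_ k @[k --> \oo] --> (0 : R).
  rewrite -[X in _ --> X](mulr0 (2 * rmax)).
  rewrite (_ : (fun k => 2 * r_ k) = (fun k => 2 * rmax * harmonic k)); first by apply: cvgM; [exact: cvg_cst|exact: cvg_harmonic].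
  by apply/funext => k; rewrite /r_ mulrA.
(* at scale 2 r the lower bound rho0_lower is (cc / r)^n *)
pose cc : R := expR (- (1 / 3)) / 4.
have cc0 : 0 < cc by rewrite divr_gt0// expR_gt0.
pose t := cc ^+ n * a.
have t0 : 0 < t by rewrite mulr_gt0// exprn_gt0.
have fs x : rr < `|x| -> f x = 0.
  by move=> h; rewrite /f indicE memNset// => /Arr; rewrite leNgt h.
have gap k x : A x -> t <= `|moll (rho0 (2 * r_ k)) f x - f x|.
  move=> Ax; set rho := rho0 _; have hk : is_kernel (2 * r_ k) rho by exact: rho0_kernel.
  set Bl := [set z : E | `|z - x| <= r_ k] `\` A.
  have mBl : measurable Bl by apply: measurableD => //; exact: closed_measurable_rV (@closed_cball R n x (r_ k)).
  have fBl : (mu Bl < +oo)%E.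
    apply: (@bounded_measure_finite _ _ Bl (r_ k + `|x|)) => // z [/= zx _].
    by have := ler_distD x z 0; rewrite !subr0; lra.
  have irho := kernel_integrable hk x.
  have iB : mu.-integrable setT (EFin \o (fun z => (cc / r_ k) ^+ n * \1_Bl z)).
    exact: (integrableZl measurableT ((cc / r_ k) ^+ n) (ind _ mBl fBl)).
  have ifr : mu.-integrable setT (EFin \o (fun z => f z * rho (x - z))).
    rewrite (_ : (fun z => _) = (fun z => rho (x - z) * f z)); last by apply/funext => z; rewrite mulrC.
    apply: (integrable_mul_bounded (M := 1) measurableT irho); first exact: measurable_indic.
    by move=> z _; have /andP[h1 h2] := f01 z; rewrite ger0_norm.
  have le1 : moll rho f x + (cc / r_ k) ^+ n * fine (mu Bl) <= 1.
    rewrite -(kernel_Rint hk x) /moll.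
    rewrite (_ : _ * fine _ = \int[mu]_z ((cc / r_ k) ^+ n * \1_Bl z)); last first.
      rewrite RintegralZl//; last exact: ind.
      by congr (_ * _); rewrite /Rintegral integral_indic// setIT.
    rewrite -RintegralD//; apply: le_Rintegral => //; first exact: (integrableD measurableT ifr iB).
    move=> z _; rewrite /f !indicE; have [zA|zA] := boolP (z \in A).
      by rewrite [z \in Bl]memNset ?mulr0 ?addr0 ?mul1r// => -[_ []]; exact: set_mem.
    rewrite mul0r add0r; have [zB|zB] := boolP (z \in Bl); last by rewrite mulr0; exact: (kernel_ge0 hk).
    have [/= zx _] := set_mem zB; rewrite mulr1.
    have := @rho0_lower R n _ (e0 k) (x - z); rewrite -/rho distrC.
    rewrite (_ : expR _ / _ = cc / r_ k); first by apply; rewrite mulrAC divff ?mul1r.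
    by rewrite /cc; field; rewrite gt_eqF.
  have hB : a * r_ k ^+ n <= fine (mu Bl).
    by rewrite -lee_fin fineK ?ge0_fin_numE//; exact: H.
  have hB2 : t <= (cc / r_ k) ^+ n * fine (mu Bl).
    have -> : t = (cc / r_ k) ^+ n * (a * r_ k ^+ n).
      by rewrite mulrCA -exprMn divfK ?gt_eqF// mulrC.
    by rewrite ler_wpM2l// exprn_ge0// divr_ge0// ltW.
  have fx : f x = 1 by rewrite /f indicE mem_set.
  by rewrite fx distrC; apply: le_trans (ler_norm _); lra.
have am0 : 0 < t * fine (mu A) / 2 by rewrite divr_gt0// mulr_gt0// fine_gt0// A0 fA.
have [K hK] := moll_cvg_L1 (fun k => rho0_kernel n (e0 k)) ecv fi rr0 fs am0.
have {hK} := hK K (leqnn K).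
rewrite leNgt => /negP; apply.
have mm : measurable_fun setT (fun x => `|moll (rho0 (2 * r_ K)) f x - f x|).
  apply: measurableT_comp => //; apply: measurable_funB; last exact: measurable_indic.
  exact: continuous_measurable_rV (moll_cont (rho0_kernel n (e0 K)) fi).
have mb : measurable [set x : E | `|x| <= rr] by exact: measurable_norm_le.
apply: (@lt_le_trans _ _ (\int[mu]_(x in [set x : E | (`|x| <= rr)%R]) (t%:E * (\1_A x)%:E))%E).
  rewrite ge0_integralZl_EFin//; last 2 first.
  - by apply/measurable_EFinP; exact: measurable_indic.
  - exact: ltW.
  rewrite integral_indic// (_ : A `&` _ = A); last by apply/setIidPl => x /Arr.
  rewrite [X in (_ < _ * X)%E](_ : _ = (fine (mu A))%:E); last by rewrite fineK// ge0_fin_numE.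
  rewrite -EFinM lte_fin.
  by move: am0; move: (t * fine (mu A)) => w; lra.
apply: ge0_le_integral => //.
- by move=> x _; rewrite -EFinM lee_fin mulr_ge0// ltW.
- by apply: emeasurable_funM => //; apply/measurable_EFinP; exact: measurable_indic.
- by apply/measurable_EFinP; exact: measurable_funTS mm.
move=> x _; rewrite indicE; have [xA|xA] := boolP (x \in A); last by rewrite mule0 lee_fin.
by rewrite mule1 lee_fin; apply: gap; exact: set_mem.
Qed.

End density.

Section spreading.
Variables (R : realType) (n : nat).
Local Notation E := 'rV[R]_n.
Local Notation mu := (lebesgue_rV R n).
Variables (q : E -> 'M[R]_n) (b : E -> E) (N : R.-sigmafker E ~> E).
Variables (D : set E) (c : E -> R).
Hypotheses (n_gt0 : (0 < n)%N) (oD : open D) (qbN : operator_assumptions q b N).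
Hypotheses (cn : connected D) (c0 : forall x, D x -> 0 <= c x) (cM : exists M : R, forall x, D x -> c x <= M).
Local Notation S := (supercone q b N D c).
Local Notation cball x r := [set z : E | `|z - x| <= r].

Lemma superconeZ k u : 0 <= k -> S u -> S (fun x => k * u x).
Proof.
move=> k0 Su; have := supercone_lin n_gt0 oD qbN k0 Su (supercone0 q b N D c n_gt0).
by congr (S _); apply/funext => x; rewrite addr0.
Qed.

Lemma supercone_cont u : S u -> continuous u.
Proof. by move=> [_ [Du [D2u [ru _]]]]; exact: reg_cont ru. Qed.

Lemma growth_compact (K : set E) : compact K -> K `<=` D -> exists m dl : R, [/\ 0 < m, 0 < dl &
  forall (x0 : E) (r : R), 0 < r -> r <= 1 -> cball x0 (2 * r) `<=` K -> forall u, S u ->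
  (mu ([set x | (sqnorm (x - x0) <= (r / 4) ^+ 2)%R] `&` [set x | (u x <= 1)%R]) < (dl * r ^+ n)%:E)%E ->
  forall x, sqnorm (x - x0) <= (r / 2) ^+ 2 -> m <= u x].
Proof.
move=> cK KD; have [[_ [Qc hQ]] [_ [B hB]] ell [MN hN]] := qbN; have [Mc hM] := cM.
have [gm gm0 hg] := ell _ cK.
have hQ' x i j : `|q x i j| <= `|Qc| by exact: le_trans (hQ x i j) (ler_norm _).
have hB' x i : `|b x ord0 i| <= `|B| by exact: le_trans (hB x i) (ler_norm _).
have hM' x : D x -> c x <= `|Mc| by move=> Dx; exact: le_trans (hM x Dx) (ler_norm _).
have hN' x : (\int[N x]_y (Num.min 1 (sqnorm y))%:E <= `|MN|%:E)%E.
  by apply: le_trans (hN x) _; rewrite lee_fin ler_norm.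
have [m [dl [m0 dl0 h]]] := growth n_gt0 oD qbN gm0 (normr_ge0 Qc) (normr_ge0 B) (normr_ge0 Mc) (normr_ge0 MN) hQ' hB' c0 hM' hN'.
exists m, dl; split => // x0 r r0 r1 rK; apply: h => //; first exact: subset_trans rK KD.
by move=> x xi xr; apply: hg; exact: rK.
Qed.

Lemma cball_sqnorm (x z : E) (r : R) : 0 <= r -> `|z - x| <= r / n.+1%:R -> sqnorm (z - x) <= r ^+ 2.
Proof.
move=> r0 h; apply: (le_trans (sqnorm_le _)).
have h2 : `|z - x| ^+ 2 <= (r / n.+1%:R) ^+ 2 by rewrite lerXn2r ?nnegrE ?divr_ge0.
apply: (@le_trans _ _ (n%:R * (r / n.+1%:R) ^+ 2)); first by rewrite ler_wpM2l.
have n1 : 0 < n.+1%:R ^+ 2 :> R by rewrite exprn_gt0.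
rewrite expr_div_n mulrA ler_pdivrMr// mulrC ler_wpM2l ?sqr_ge0//.
rewrite -natrX ler_nat; apply: (@leq_trans n.+1) => //.
by rewrite expnS leq_pmulr// expn_gt0.
Qed.

(** If u >= t on a quarter ball, then 2 u / t > 1 there and growth gives
    u >= m t / 2 on the half ball: the radius doubles. The number of doublings that
    lead from s to rho depends on s and rho only. *)
Lemma propagate (K : set E) (y : E) (rho s t : R) : compact K -> K `<=` D -> 0 < rho -> rho <= 1 ->
  cball y (2 * rho) `<=` K -> 0 < s -> 0 < t -> exists2 t', 0 < t' & forall u, S u ->
    (forall z, `|z - y| <= s -> t <= u z) -> forall z, `|z - y| <= rho / 4 / n.+1%:R -> t' <= u z.
Proof.
move=> cK KD rho0 rho1 yK s0 t0.
have [m [dl [m0 dl0 grow]]] := growth_compact cK KD.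
have dbl k : forall r, 0 < r -> 2 ^+ k * r <= rho -> exists2 t', 0 < t' & forall u, S u ->
    (forall z, sqnorm (z - y) <= (r / 4) ^+ 2 -> t <= u z) ->
    forall z, sqnorm (z - y) <= (2 ^+ k * r / 4) ^+ 2 -> t' <= u z.
  elim: k => [|k IH] r r0 kr.
    by exists t => // u Su hu z; rewrite expr0 mul1r; exact: hu.
  have k0 : 0 < 2 ^+ k :> R by rewrite exprn_gt0.
  have r'0 : 0 < 2 ^+ k * r by rewrite mulr_gt0.
  have kr' : 2 * (2 ^+ k * r) <= rho by move: kr; rewrite exprS mulrA.
  have [t1 t10 h1] := IH r r0 (ltac:(lra)).
  exists (m * t1 / 2); first by rewrite divr_gt0// mulr_gt0.
  move=> u Su hu z hz; have h1u := h1 u Su hu.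
  have a0 : 0 <= 2 / t1 by rewrite divr_ge0// ltW.
  have := @grow y (2 ^+ k * r) r'0 (ltac:(lra)) _ _ (superconeZ a0 Su) _ z.
  rewrite (_ : 2 ^+ k * r / 2 = 2 ^+ k.+1 * r / 4); last by rewrite exprS; field.
  move=> /(_ _ _ hz) h; rewrite ler_pdivrMr// -ler_pdivlMr//.
  rewrite (_ : u z * 2 / t1 = 2 / t1 * u z); last by ring.
  apply: h; first by apply: subset_trans yK => w /=; lra.
  rewrite (_ : _ `&` _ = set0) ?measure0 ?lte_fin ?mulr_gt0 ?exprn_gt0//.
  apply/seteqP; split => // w [/= /h1u w1 w2].
  have : 2 <= 2 / t1 * u w by rewrite mulrAC ler_pdivlMr// ler_pM2l.
  by lra.
pose k := Num.bound (rho / (4 * s)).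
have k0 : 0 < 2 ^+ k :> R by rewrite exprn_gt0.
have hk : rho / (4 * s) < 2 ^+ k by exact: upper_nthrootP.
have r0 : 0 < rho / 2 ^+ k by rewrite divr_gt0.
have kE : 2 ^+ k * (rho / 2 ^+ k) = rho by rewrite mulrC divfK// gt_eqF.
have [t' t'0 h] := dbl k _ r0 (ltac:(by rewrite kE)).
exists t' => // u Su hu z hz; apply: h Su _ _ _.
  move=> w hw; apply: hu; apply: le_trans (sqnorm_norm_le _ hw) _; first by rewrite divr_ge0// ltW.
  rewrite ler_pdivrMr// ler_pdivrMr// (_ : s * 4 * 2 ^+ k = 2 ^+ k * (4 * s)); last by ring.
  by rewrite -ler_pdivrMr ?mulr_gt0// ltW.
by rewrite kE; apply: cball_sqnorm => //; rewrite divr_ge0// ltW.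
Qed.

(** Near a density point of A, at a suitable scale r, the set A fills the quarter
    ball up to a measure below half of the threshold of growth. *)
Lemma seed (A : set E) : measurable A -> A `<=` D -> (0 < mu A)%E ->
  exists e x0 s t, [/\ 0 < e, 0 < s, 0 < t, D x0 & forall u, S u ->
    (mu (A `&` [set x | (u x <= 1)%R]) < e%:E)%E -> forall z, `|z - x0| <= s -> t <= u z].
Proof.
move=> mA AD A0.
have [x1 [rho [rho0 x1D A'0]]] : exists x1 rho, [/\ 0 < rho, cball x1 (2 * rho) `<=` D & (0 < mu (A `&` cball x1 rho))%E].
  apply: contrapT => H; move: A0; rewrite ltNge => /negP; apply.
  have ae : {ae mu, forall x, D x -> ~ A x}.
    apply: (ae_local oD) => x1 r r0 x1D.
    have z0 : mu (A `&` cball x1 r) = 0%E.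
      apply/eqP; rewrite eq_le measure_ge0 andbT leNgt; apply/negP => h; apply: H.
      by exists x1, r.
    exists (A `&` cball x1 r); split => //.
      by apply: measurableI => //; exact: closed_measurable_rV (@closed_cball R n x1 r).
    by move=> x /= /not_implyP[xr /contrapT Ax].
  case: ae => Z [mZ Z0 hZ]; rewrite -Z0; apply: le_measure; rewrite ?inE//.
  by move=> x Ax; apply: hZ => /(_ (AD _ Ax)).
set K := cball x1 (2 * rho) in x1D; set A' := A `&` _ in A'0.
have cK : compact K by exact: compact_cball.
have [m [dl [m0 dl0 grow]]] := growth_compact cK x1D.
have mA' : measurable A' by apply: measurableI => //; exact: closed_measurable_rV (@closed_cball R n x1 rho).
have A'r x : A' x -> `|x| <= rho + `|x1|.
  by move=> [_ /= xr]; have := ler_normD (x - x1) x1; rewrite subrK; lra.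
have rr0 : 0 <= rho + `|x1| by rewrite addr_ge0// ltW.
have a0 : 0 < dl / 2 * 4 ^+ n by rewrite mulr_gt0 ?exprn_gt0// divr_gt0.
have rm0 : 0 < Num.min 1 rho / 8 by rewrite divr_gt0// lt_min ltr01.
have [x [r [[Ax xr] r0 rm hr]]] := density_point mA' rr0 A'r A'0 a0 rm0.
have [r1 r2] : 8 * r <= 1 /\ 8 * r <= rho.
  by have := rm; rewrite ler_pdivlMr// le_min => /andP[]; lra.
exists (dl / 2 * (4 * r) ^+ n), x, (2 * r / n.+1%:R), m; split => //.
- by rewrite mulr_gt0 ?divr_gt0// exprn_gt0// mulr_gt0.
- by rewrite divr_gt0// mulr_gt0.
- exact: AD.
move=> u Su hu z hz; apply: (grow x (4 * r) _ _ _ u Su).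
- by rewrite mulr_gt0.
- by lra.
- move=> w /= wx; rewrite /K /=; move: xr => /= xr.
  by have := ler_distD x w x1; lra.
- have mu1 : measurable [set x | u x <= 1].
    rewrite -[X in measurable X]setTI (_ : [set x | _] = u @^-1` `]-oo, 1]); last first.
      by apply/seteqP; split => w /=; rewrite in_itv.
    exact: (continuous_measurable_rV (supercone_cont Su)).
  have mB : measurable (cball x r `\` A').
    by apply: measurableD => //; exact: closed_measurable_rV (@closed_cball R n x r).
  apply: (@le_lt_trans _ _ (mu ((cball x r `\` A') `|` (A `&` [set x | u x <= 1])))).
    apply: le_measure; rewrite ?inE.
    + apply: measurableI => //; apply: closed_measurable_rV.
      exact: closed_sqnorm_ball.
    + by apply: measurableU => //; exact: measurableI.
    move=> w [/= ws wu]; have [[wA _]|wA] := pselect (A' w); first by right.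
    left; split => //=; rewrite (_ : r = 4 * r / 4); last by field.
    by apply: sqnorm_norm_le => //; rewrite divr_ge0// mulr_ge0// ltW.
  apply: le_lt_trans (measureU2 _ _ _) _ => //; first exact: measurableI.
  rewrite (_ : dl * (4 * r) ^+ n = dl / 2 * 4 ^+ n * r ^+ n + dl / 2 * (4 * r) ^+ n).
    by rewrite EFinD; exact: lteD.
  by rewrite exprMn; field.
rewrite (_ : 4 * r / 2 = 2 * r); last by field.
by apply: cball_sqnorm => //; rewrite mulr_ge0// ltW.
Qed.

(** The points of D near which the admissible members have a common positive lower
    bound form an open set, and seed makes it non-empty. It is closed in D because
    the radius reached by propagate depends only on the distance to the complement
    of D. So it is all of D, and compactness makes the bound uniform. *)
Lemma spread_compact (A : set E) : measurable A -> A `<=` D -> (0 < mu A)%E ->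
  exists2 e, 0 < e & forall K, compact K -> K `<=` D -> exists2 t, 0 < t & forall u, S u ->
    (mu (A `&` [set x | (u x <= 1)%R]) < e%:E)%E -> forall x, K x -> t <= u x.
Proof.
move=> mA AD A0; have [e [x0 [s0 [t0 [e0 s00 t00 Dx0 h0]]]]] := seed mA AD A0.
exists e => //; pose P u := S u /\ (mu (A `&` [set x | (u x <= 1)%R]) < e%:E)%E.
pose W := [set x | D x /\ exists s t, [/\ 0 < s, 0 < t & forall u, P u -> forall z, `|z - x| <= s -> t <= u z]].
have oW : open W.
  rewrite openE => x [Dx [s [t [s1 t1 h]]]].
  have s20 : 0 < s / 2 by rewrite divr_gt0.
  have : \forall y \near x, D y /\ ball x (s / 2) y.
    by apply: filterI; [exact: open_nbhs_nbhs|exact: nbhsx_ballx].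
  apply: filterS => y [Dy]; rewrite -ball_normE /= => xy; split => //.
  exists (s / 2), t; split => // u Pu z zy; apply: h => //.
  by have := ler_distD y z x; rewrite (distrC y x); lra.
have WD : W = D.
  apply: cn.
  - by exists x0; split => //; exists s0, t0; split => // u [Su Pu]; exact: h0.
  - by exists W => //; apply/seteqP; split => [x Wx|x []//]; split => //; case: Wx.
  exists (closure W); first exact: closed_closure.
  apply/seteqP; split => [x Wx|x [Dx cWx]]; first by split; [case: Wx|exact: subset_closure].
  split => //.
  have /nbhs_ballP[d /= d0 dD] : nbhs x D by exact: open_nbhs_nbhs.
  pose rho := Num.min 1 (d / 8).
  have rho0 : 0 < rho by rewrite lt_min ltr01 divr_gt0.
  have rho1 : rho <= 1 by rewrite ge_min lexx.
  have rhod : rho <= d / 8 by rewrite ge_min lexx orbT.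
  pose K := cball x (4 * rho).
  have cK : compact K by exact: compact_cball.
  have KD : K `<=` D.
    by move=> z /= zx; apply: dD; rewrite -ball_normE /= distrC; apply: le_lt_trans zx _; lra.
  pose h := rho / 4 / n.+1%:R.
  have hh0 : 0 < h by rewrite !divr_gt0.
  have hrho : h <= rho.
    rewrite /h ler_pdivrMr// ler_pdivrMr// -mulrA ler_peMr ?(ltW rho0)//.
    by rewrite -natrM ler1n.
  have h20 : 0 < h / 2 by rewrite divr_gt0.
  have [y [[Dy [s [t [s1 t1 hW]]]] xy]] := cWx _ (nbhsx_ballx x _ h20).
  rewrite -ball_normE /= in xy.
  have yK : cball y (2 * rho) `<=` K.
    by move=> z /= zy; rewrite /K /=; have := ler_distD y z x; rewrite (distrC y x); lra.
  have [t' t'0 ht'] := propagate cK KD rho0 rho1 yK s1 t1.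
  exists (h / 2), t'; split => // u [Su Pu] z zx; apply: (ht' u Su); first by move=> w; exact: hW.
  by rewrite -/h; have := ler_distD x z y; lra.
move=> K cK KD; move/compact_near_coveringP : cK => cK.
have hloc x : K x -> \forall x' \near x & k \near \oo, forall u, P u -> (k.+1%:R : R)^-1 <= u x'.
  move=> /KD; rewrite -WD => -[Dx [s [t [s1 t1 h]]]].
  exists (ball x s, [set k | (k.+1%:R : R)^-1 < t]) => /=.
    split; first exact: nbhsx_ballx.
    exact: near_infty_natSinv_lt (PosNum t1).
  move=> [x' k] [/= xx' dr] u Pu; apply: le_trans (ltW dr) _; apply: h => //.
  by move: xx'; rewrite -ball_normE /= distrC => /ltW.
have [k _ hk] := cK nat \oo (fun k x => forall u, P u -> (k.+1%:R : R)^-1 <= u x) _ hloc.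
exists (k.+1%:R^-1); first by rewrite invr_gt0.
by move=> u Su Pu x Kx; apply: (hk k (leqnn k) x Kx).
Qed.

End spreading.

Unset Implicit Arguments.

Theorem theorem5p9 (R : realType) (d : nat) (d_gt0 : (0 < d)%N)
    (q : 'rV[R]_d -> 'M[R]_d) (b : 'rV[R]_d -> 'rV[R]_d)
    (N : R.-sigmafker 'rV[R]_d ~> 'rV[R]_d)
    (qbN : operator_assumptions q b N)
    (D : set 'rV[R]_d) (D_open : open D) (D_connected : connected D)
    (D_bounded : bounded_set D)
    (c : 'rV[R]_d -> R) (c_measurable : measurable_fun D c)
    (c_ge0 : forall x, D x -> 0 <= c x)
    (c_bounded : exists M : R, forall x, D x -> c x <= M) :
  exists chi : 'rV[R]_d -> R,
    [/\ measurable_fun D chi,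
        forall x, D x -> 0 < chi x,
        exists M : R, forall x, D x -> chi x <= M &
        forall V : set 'rV[R]_d,
          open V -> compact (closure V) -> closure V `<=` D ->
          exists2 C : R, 0 < C &
            forall u : 'rV[R]_d -> R,
              supersolution q b N c D u -> (forall x, 0 <= u x) ->
              (C%:E * \int[lebesgue_rV R d]_(x in V) (u x * chi x)%:E <=
               ereal_inf [set (u x)%:E | x in V])%E].
Proof.
have [[x0 Dx0]|D0] := pselect (exists x, D x); last first.
  exists (fun=> 1); split.
  - exact: measurable_cst.
  - by move=> x Dx; case: D0; exists x.
  - by exists 1.
  move=> V oV cV VD; exists 1 => // u _ _.
  have V0 x : V x -> False by move=> Vx; apply: D0; exists x; apply: VD; exact: subset_closure.
  apply: le_ereal_inf_tmp => y [x Vx _].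
  by case: (V0 x Vx).
have mD : measurable D by exact: open_measurable_rV.
have fD : (lebesgue_rV R d D < +oo)%E.
  have [M [_ hM]] := D_bounded; apply: (@bounded_measure_finite _ _ D (M + 1)) => // x Dx.
  by apply: (hM (M + 1)) => //; rewrite ltrDl.
have /nbhs_ballP[e /= e0 eD] : nbhs x0 D by exact: open_nbhs_nbhs.
pose B0 := [set z : 'rV[R]_d | `|z - x0| <= e / 2].
have e20 : 0 < e / 2 by rewrite divr_gt0.
have mB0 : measurable B0 by exact: closed_measurable_rV (@closed_cball R d x0 (e / 2)).
have B0D : B0 `<=` D.
  by move=> z /= zx; apply: eD; rewrite -ball_normE /= distrC; apply: le_lt_trans zx _; lra.
have B0pos : (0 < lebesgue_rV R d B0)%E.
  by apply: lt_le_trans (cball_measure_ge x0 (ltW e20)); rewrite lte_fin exprn_gt0// mulr_gt0.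
have cB0 : compact B0 by exact: compact_cball.
pose S := supercone q b N D c.
have SZ k u : 0 <= k -> S u -> S (fun x => k * u x) by exact: superconeZ.
have SD u v : S u -> S v -> S (fun x => u x + v x).
  move=> Su Sv; have := supercone_lin d_gt0 D_open qbN ler01 Su Sv.
  by congr (S _); apply/funext => x; rewrite mul1r.
have sp := spread_compact d_gt0 D_open qbN D_connected c_ge0 c_bounded.
have [||||chi [mchi chi01 hchi]] := @cone_weight _ _ _ (lebesgue_rV R d) D B0 S mD fD mB0 B0D B0pos _ _ _ SD SZ.
- by move=> u Su; exact: continuous_measurable_rV (supercone_cont Su).
- by move=> u [].
- exact: supercone0.
- move=> A mA AD A0; have [t t0 h] := sp A mA AD A0.
  by have [t' t'0 h'] := h B0 cB0 B0D; exists t', t; split.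
exists chi; split => //.
- by move=> x _; have /andP[] := chi01 x.
- by exists 1 => x _; have /andP[] := chi01 x.
move=> V oV cV VD; have [t t0 h] := sp B0 mB0 B0D B0pos.
have {h} [s s0 hs] := h _ cV VD; set M := fine (lebesgue_rV R d D).
have M0 : 0 <= M by exact: fine_ge0.
exists (s / (2 * (M + 1))); first by rewrite divr_gt0// mulr_gt0// ltr_wpDl.
move=> u su u0; have Su : S u := supersolution_supercone d_gt0 D_open su u0.
have cu := supercone_cont Su.
have VD' : V `<=` D by apply: subset_trans VD; exact: subset_closure.
have mV : measurable V by exact: open_measurable_rV.
have JD : (\int[lebesgue_rV R d]_(y in V) (u y * chi y)%:E <= \int[lebesgue_rV R d]_(y in D) (u y * chi y)%:E)%E.
  apply: ge0_subset_integral => //.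
    apply/measurable_EFinP; apply: measurable_funM => //.
    exact: measurable_funTS (continuous_measurable_rV cu).
  by move=> x _; have /andP[/ltW c0 _] := chi01 x; rewrite lee_fin mulr_ge0.
apply: le_ereal_inf_tmp => _ [x Vx <-].
have ux0 : 0 <= u x by exact: u0.
apply/lee_addgt0Pr => dl dl0.
pose k := (u x + dl) / s.
have k0 : 0 < k by rewrite divr_gt0// ltr_wpDl.
(* otherwise u / k > 1 on B0, and spreading gives u >= s k = u x + dl at x *)
have [y B0y uy] : exists2 y, B0 y & u y <= k.
  apply: contrapT => H.
  have Sv : S (fun z => k^-1 * u z) by apply: SZ => //; rewrite invr_ge0 ltW.
  have := hs _ Sv _ x (subset_closure Vx).
  rewrite (_ : B0 `&` _ = set0) ?measure0 ?lte_fin//.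
    move=> /(_ t0); rewrite ler_pdivlMl// /k divfK ?gt_eqF//; lra.
  apply/seteqP; split => // z [B0z /=]; rewrite ler_pdivrMl// mulr1 => uz; apply: H; by exists z.
have k20 : 0 < 2 * k by rewrite mulr_gt0.
have uy2 : u y < 2 * k by apply: le_lt_trans uy _; lra.
have J := le_trans JD (hchi u _ y Su k20 B0y uy2).
have C0 : 0 <= s / (2 * (M + 1)) by rewrite divr_ge0 ?(ltW s0)// mulr_ge0// addr_ge0.
apply: (@le_trans _ _ ((s / (2 * (M + 1)))%:E * (2 * k * M)%:E)%E).
  by apply: lee_wpmul2l => //; rewrite lee_fin.
rewrite -EFinM -EFinD lee_fin (_ : _ * (2 * k * M) = k * s * (M / (M + 1))); last first.
  by field; rewrite gt_eqF// ltr_wpDl.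
rewrite /k divfK ?gt_eqF// ler_piMr//; first by rewrite addr_ge0// ltW.
by rewrite ler_pdivrMr ?ltr_wpDl// mul1r lerDl.
Qed.
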